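(* Let $1\le l\le m$ be integers, and let $X,X_1,\dots,X_m$ be Banach function spaces on $\mathbb{R}^n$ with $\|\chi_B\|_X\le C\prod_{i=1}^m\|\chi_B\|_{X_i}$ for every ball $B$. Let $1\le p<\infty$, and assume $X'\in\mathbb{M}$ and $(X_i^p)'\in\mathbb{M}$ for $i=1,\dots,m$. Suppose that the multilinear Hardy–Littlewood maximal operator $\mathscr{M}$ is bounded from $X_1^p\times\cdots\times X_m^p$ to $X^p$, that $\vec b=(b_1,\dots,b_l)\in\mathrm{BMO}^l$, and that the iterated commutator $\mathcal{T}_{\vec b}$ (acting in the first $l$ variables) of an $m$-linear operator $\mathcal{T}$ satisfies the pointwise sparse domination hypothesis. Let $u=\prod_{i=1}^m u_i$ with $u_i^{1/p}\in\mathbb{W}^0_{X_i^p}$, $i=1,\dots,m$, and $u^{1/p}\in\mathbb{W}^0_{X^p}$. Then the following hold, with implicit constants independent of $\vec f$ and $\vec b$. (1) If $p=1$ and $X_i\in\mathbb{M}$ for $i=1,\dots,m$, then $$\|\mathcal{T}_{\vec b}(\vec f)\|_{M_X^u}\lesssim\|\vec b\|_{\mathrm{BMO}}\,\|M\|_{\mathfrak{B}_{X',u}}^{l+2}\,\|\mathscr{M}\|_{M_{X_1}^{u_1}\times\cdots\times M_{X_m}^{u_m}\to M_X^u}\prod_{i=1}^m\|M\|_{M_{X_i}^{u_i}\to M_{X_i}^{u_i}}\|f_i\|_{M_{X_i}^{u_i}}.$$ (2) If $p>1$ and $X_i'\in\mathbb{M}$ for $i=1,\dots,m$, then $$\left\||\mathcal{T}_{\vec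 b}(\vec f)|^p\right\|_{M_X^u}\lesssim\|\vec b\|_{\mathrm{BMO}}^p\,\|M\|_{\mathfrak{B}_{X',u}}^{pl+\max\{2,p\}}\,\|\mathscr{M}\|^p_{M_{X_1^p}^{u_1^{1/p}}\times\cdots\times M_{X_m^p}^{u_m^{1/p}}\to M_{X^p}^{u^{1/p}}}\prod_{i=1}^m\||f_i|^p\|_{M_{X_i}^{u_i}}.$$
   Context: Notation. $Q$ denotes cubes in $\mathbb{R}^n$, $\langle f\rangle_Q=\frac1{|Q|}\int_Q f$, $B(x,r)$ is the open ball, $\mathcal{M}(\mathbb{R}^n)$ is the space of Lebesgue measurable functions. $\|b\|_{\mathrm{BMO}}=\sup_Q\frac1{|Q|}\int_Q|b-\langle b\rangle_Q|$ and $\|\vec b\|_{\mathrm{BMO}}=\prod_i\|b_i\|_{\mathrm{BMO}}$. Sparse families. For a cube $Q_0$, $\mathcal{D}(Q_0)$ is the collection of dyadic subcubes of $Q_0$. A dyadic lattice $\mathscr{D}$ is a collection of cubes such that (i) $Q\in\mathscr{D}$ implies $\mathcal{D}(Q)\subset\mathscr{D}$; (ii) any $Q',Q''\in\mathscr{D}$ lie in $\mathcal{D}(Q)$ for some $Q\in\mathscr{D}$; (iii) every compact set is contained in some $Q\in\mathscr{D}$. A family $\mathcal{S}\subset\mathscr{D}$ is $\eta$-sparse ($0<\eta<1$) if $|\bigcup_{Q'\in\mathcal{S},Q'\subsetneq Q}Q'|\le(1-\eta)|Q|$ for all $Q\in\mathcal{S}$; ''sparse'' means $\eta$-sparse for a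 fixed $\eta\in(0,1)$ not depending on the functions. Iterated commutator and sparse domination hypothesis. For an $m$-linear operator $\mathcal{T}$ with kernel representation $\mathcal{T}(\vec f)(x)=\int_{\mathbb{R}^{nm}}K(x,\vec y)\prod_{s=1}^m f_s(y_s)\,d\vec y$, $$\mathcal{T}_{\vec b}(\vec f)(x)=\int_{\mathbb{R}^{nm}}\prod_{s=1}^l(b_s(x)-b_s(y_s))K(x,\vec y)\prod_{s=1}^m f_s(y_s)\,d\vec y;$$ in general $\mathcal{T}_{\vec b}=[b_1,\cdots[b_l,\mathcal{T}]_l\cdots]_1$ with $[b_s,\mathcal{T}]_s(\vec f)=b_s\mathcal{T}(\vec f)-\mathcal{T}(f_1,\dots,b_sf_s,\dots,f_m)$. Put $\mathcal{T}(b,f,Q,1)=|b-\langle b\rangle_Q|\langle|f|\rangle_Q$ (a function of $x$) and $\mathcal{T}(b,f,Q,2)=\langle|(b-\langle b\rangle_Q)f|\rangle_Q$. The pointwise sparse domination hypothesis: there is $C$ such that for all bounded compactly supported $f_1,\dots,f_m$ there exist $3^n$ sparse collections $\mathcal{S}_1,\dots,\mathcal{S}_{3^n}$ with, for a.e. $x$, $$|\mathcal{T}_{\vec b}(\vec f)(x)|\le C\sum_{j=1}^{3^n}\sum_{\vec\gamma\in\{1,2\}^l}\sum_{Q\in\mathcal{S}_j}\Big(\prod_{s=1}^l\mathcal{T}(b_s,f_s,Q,\gamma_s)\Big)\Big(\prod_{s=l+1}^m\langle|f_s|\rangle_Q\Big)\chi_Q(x).$$ Maximal operators. $Mf(x)=\sup_{Q\ni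 x}\langle|f|\rangle_Q$ is the Hardy–Littlewood maximal operator; $\mathscr{M}(\vec f)(x)=\sup\prod_{i=1}^m\frac1{|Q|}\int_Q|f_i|$, the supremum over balls $Q\ni x$ (using cubes instead changes $\mathscr{M}$ only by a constant factor). Function spaces. A Banach function space $X\subseteq\mathcal{M}(\mathbb{R}^n)$ is a normed space such that: $\|f\|_X=0\Leftrightarrow f=0$ a.e.; $|g|\le|f|$ a.e. implies $\|g\|_X\le\|f\|_X$; $0\le f_k\uparrow f$ a.e. implies $\|f_k\|_X\uparrow\|f\|_X$; $|E|<\infty$ implies $\chi_E\in X$; $|E|<\infty$ implies $\int_E|f|\le C_E\|f\|_X$ for all $f\in X$. Its associate space $X'$ has norm $\|f\|_{X'}=\sup\{|\int fg|:\|g\|_X\le1\}$. $X^p$ is the space with norm $\|f\|_{X^p}=\||f|^p\|_X^{1/p}$. $X\in\mathbb{M}$ means $M$ is bounded on $X$. For measurable $u:\mathbb{R}^n\times(0,\infty)\to(0,\infty)$, the Morrey-Banach space $M_X^u$ has norm $\|f\|_{M_X^u}=\sup_{x\in\mathbb{R}^n,r>0}\frac1{u(x,r)}\|f\chi_{B(x,r)}\|_X$. An $(X,u)$-block is a measurable $b$ supported in some $B(x_0,r)$ with $\|b\|_X\le1/u(x_0,r)$; $\mathfrak{B}_{X,u}$ is the set of $\sum_k\lambda_kb_k$ with $b_k$ $(X,u)$-blocks and $\sum|\lambda_k|<\infty$, with norm $\inf\sum|\lambda_k|$ over such representations (a.e.). $\|M\|_{\mathfrak{B}_{X',u}}$ is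 the operator norm of $M$ on $\mathfrak{B}_{X',u}$; $\|S\|_{A\to B}$ denotes operator norm. $u\in\mathbb{W}_X^0$ means $u:\mathbb{R}^n\times(0,\infty)\to(0,\infty)$ is measurable and there is $C>0$ such that for all $x,x_1,x_2\in\mathbb{R}^n$, $r,r_1,r_2>0$: (1) $\frac{\|\chi_{B(x_1,r_1)}\|_X}{u(x_1,r_1)}\le C\frac{\|\chi_{B(x_2,r_2)}\|_X}{u(x_2,r_2)}$ whenever $u(x_1,r_1)\le u(x_2,r_2)$; (2) $\sum_{j=0}^\infty\frac{\|\chi_{B(x,r)}\|_X}{\|\chi_{B(x,2^{j+1}r)}\|_X}u(x,2^{j+1}r)\le Cu(x,r)$.
   Formalization: The bounds are stated for f in the Morrey spaces such that T_b(f) is an a.e. limit of T_b(f^k), with f^k bounded, compactly supported and |f_i^k| ≤ |f_i|; for arbitrary f an abstract m-linear T is not controlled by the sparse domination hypothesis. *)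

(* Defs.v *)
From HB Require Import structures.
From mathcomp Require Import all_boot all_order all_algebra.
From mathcomp Require Import all_classical all_reals all_analysis.
From mathcomp Require Import measurable_realfun.

Set Implicit Arguments.
Unset Strict Implicit.
Unset Printing Implicit Defensive.
Import Order.TTheory GRing.Theory Num.Theory.
Import numFieldNormedType.Exports.

Local Open Scope classical_set_scope.
Local Open Scope ring_scope.

(* Lebesgue measure on R^n: the n-fold product of the Lebesgue measure on the *)
(* Borel sigma-algebra (generated by the coordinates), then Caratheodory's    *)
(* completion.                                                                *)

Definition borel_row (R : realType) (n : nat) : Type := 'rV[R]_n.

Section borel_row.
Context {R : realType}.

HB.instance Definition _ n := Pointed.on (borel_row R n).

Definition row_coord n (i : 'I_n) (x : borel_row R n) : measurableTypeR R :=
  (x : 'rV[R]_n) ord0 i.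

HB.instance Definition _ n := @isMeasurable.Build default_measure_display
  (borel_row R n) (g_sigma_preimage (@row_coord n))
  (@sigma_algebra0 _ _ _) (@sigma_algebraC _ _) (@sigma_algebra_bigcup _ _ _).

Definition row_cons n (z : borel_row R n * measurableTypeR R) :
    borel_row R n.+1 :=
  row_mx (z.2 : R)%:M (z.1 : 'rV[R]_n) : 'rV[R]_(1 + n).

Lemma measurable_row_coord n (i : 'I_n) :
  measurable_fun [set: borel_row R n] (row_coord i).
Proof.
move=> _ Y mY; rewrite setTI; apply: sub_sigma_algebra => /=.
rewrite -bigcup_seq/=; exists i => /=; first by rewrite mem_index_enum.
by exists Y => //; rewrite setTI.
Qed.

Lemma row_cons0 n z : row_coord ord0 (@row_cons n z) = z.2.
Proof.
transitivity (row_mx (z.2 : R)%:M (z.1 : 'rV[R]_n) ord0 (lshift n ord0)).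
  by congr (fun_of_matrix _ _ _); exact: val_inj.
by rewrite row_mxEl mxE eqxx mulr1n.
Qed.

Lemma row_consS n z (i : 'I_n) :
  row_coord (lift ord0 i) (@row_cons n z) = row_coord i z.1.
Proof.
transitivity (row_mx (z.2 : R)%:M (z.1 : 'rV[R]_n) ord0 (rshift 1 i)).
  by congr (fun_of_matrix _ _ _); exact: val_inj.
by rewrite row_mxEr.
Qed.

Lemma measurable_row_cons n : measurable_fun setT (@row_cons n).
Proof.
apply: (@measurability _ _ _ _ _ _
  (\big[setU/set0]_(i < n.+1)
     preimage_set_system setT (@row_coord n.+1 i) measurable)) => //.
move=> _ [A + <-]; rewrite -bigcup_seq/= => -[i _ [B mB <-]].
rewrite !setTI -comp_preimage.
case: (unliftP ord0 i) => [j|] ->.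
- have -> : row_coord (lift ord0 j) \o @row_cons n = row_coord j \o fst.
    by apply/funext => z /=; rewrite row_consS.
  rewrite -[X in measurable X]setTI; apply: measurableT_comp => //.
  exact: measurable_row_coord.
- have -> : row_coord ord0 \o @row_cons n = snd.
    by apply/funext => z /=; rewrite row_cons0.
  by rewrite -[X in measurable X]setTI; exact: measurable_snd.
Qed.

End borel_row.


Fixpoint borel_lebesgue (R : realType) (n : nat) :
    {measure set (borel_row R n) -> \bar R} :=
  if n is n'.+1 then
    measure_function_pushforward__canonical__measure_function_Measure
      (borel_lebesgue R n' \x @lebesgue_measure R)%E (@measurable_row_cons R n')
  else \d_ ((0 : 'rV[R]_0) : borel_row R 0).

Definition Rn (R : realType) (n : nat) : Type :=
  caratheodory_type (mu_ext (borel_lebesgue R n)).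
HB.instance Definition _ (R : realType) n := Measurable.on (Rn R n).

Definition leb (R : realType) (n : nat) : {measure set (Rn R n) -> \bar R} :=
  @completed_measure_extension _ _ _ (borel_lebesgue R n).

Lemma borel_lebesgue_box (R : realType) n (A : 'I_n -> set (measurableTypeR R)) :
  (forall i, measurable (A i)) ->
  measurable [set x : borel_row R n | forall i, A i (row_coord i x)] /\
  borel_lebesgue R n [set x | forall i, A i (row_coord i x)] =
  (\prod_(i < n) lebesgue_measure (A i))%E.
Proof.
move=> mA; split.
  rewrite (_ : mkset _ = \bigcap_(i in [set: 'I_n]) (@row_coord R n i @^-1` A i)).
    apply: fin_bigcap_measurable => // i _; rewrite -[X in measurable X]setTI.
    exact: measurable_row_coord.
  by apply/seteqP; split => [x Ax i _|x Ax i]; exact: Ax.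
elim: n A mA => [|n IH] A mA /=.
  by rewrite big_ord0 diracE mem_set// => -[].
rewrite /pushforward big_ord_recl muleC -IH//.
set B := [set x : borel_row R n | _].
have mB : measurable B.
  rewrite (_ : B = \bigcap_(i in [set: 'I_n]) (@row_coord R n i @^-1` A (lift ord0 i))).
    apply: fin_bigcap_measurable => // i _; rewrite -[X in measurable X]setTI.
    exact: measurable_row_coord.
  by apply/seteqP; split => [x Ax i _|x Ax i]; exact: Ax.
rewrite -product_measure1E//; congr (product_measure1 _ _ _).
apply/seteqP; split => [z /= Az|z /= [Bz Az] i].
  split=> [i /=|]; first by have := Az (lift ord0 i); rewrite row_consS.
  by have := Az ord0; rewrite row_cons0.
by case: (unliftP ord0 i) => [j|] ->; rewrite ?row_consS ?row_cons0//; exact: Bz.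
Qed.

Lemma leb_cube (R : realType) n (a : 'rV[R]_n) (h : R) : 0 < h ->
  leb R n [set x : 'rV[R]_n | forall i, a ord0 i <= x ord0 i < a ord0 i + h] =
  (h ^+ n)%:E.
Proof.
move=> h0.
pose A i : set (measurableTypeR R) := `[a ord0 i, a ord0 i + h[%classic.
have [mB BE] := @borel_lebesgue_box R n A (fun=> measurable_itv _).
rewrite (_ : mkset _ = [set x | forall i, A i (row_coord i x)]); last first.
  by apply/seteqP; split=> x /= + i => /(_ i); rewrite /A /= in_itv.
rewrite /leb /= /completed_measure_extension measurable_mu_extE// BE.
rewrite (eq_bigr (fun=> h%:E)) => [|i _]; last first.
  by rewrite lebesgue_measure_itv/= lte_fin ltrDl h0 -EFinB addrAC subrr add0r.
by rewrite prodEFin prodr_const card_ord.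
Qed.

Section spaces.
Context {R : realType} {n : nat}.
Local Notation E := (Rn R n).
Local Notation mu := (leb R n).
Local Open Scope ereal_scope.

Definition coord (x : E) (i : 'I_n) : R := (x : 'rV[R]_n) ord0 i.

(* Euclidean open balls; cubes are half-open with sides parallel to the axes, *)
(* coded by their lower corner and side length h, where 0 < h is required     *)
(* wherever cubes are quantified over.                                        *)
Definition eball (x : E) (r : R) : set E :=
  [set y | Num.sqrt (\sum_(i < n) (coord y i - coord x i) ^+ 2) < r]%R.

Definition cube : Type := ('rV[R]_n * R)%type.

Definition cset (Q : cube) : set E :=
  [set y | forall i, coord Q.1 i <= coord y i < coord Q.1 i + Q.2]%R.

Definition avg (A : set E) (f : E -> \bar R) : \bar R :=
  ((fine (mu A))^-1)%:E * \int[mu]_(y in A) f y.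

Definition ravg (Q : cube) (b : E -> R) : R := fine (avg (cset Q) (EFin \o b)).

Definition HLmax (f : E -> \bar R) (x : E) : \bar R :=
  ereal_sup [set avg (cset Q) (abse \o f) | Q in
    [set Q | (0 < Q.2)%R /\ cset Q x]].

Definition multimax m (f : 'I_m -> E -> \bar R) (x : E) : \bar R :=
  ereal_sup [set \prod_(i < m) avg (eball z.1 z.2) (abse \o f i) | z in
    [set z : E * R | (0 < z.2)%R /\ eball z.1 z.2 x]].

Definition locally_int (b : E -> R) : Prop :=
  measurable_fun setT b /\
  forall K : set E, compact (K : set 'rV[R]_n) ->
    \int[mu]_(x in K) `|(b x)%:E| < +oo.

Definition bmo_norm (b : E -> R) : \bar R :=
  ereal_sup [set avg (cset Q) (fun y => `|(b y - ravg Q b)%:E|) | Q in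
    [set Q | (0 < Q.2)%R]].

Definition BMO (b : E -> R) : Prop := locally_int b /\ bmo_norm b < +oo.

(* A space X of measurable functions is given by its norm, extended by +oo to *)
(* the measurable functions outside X. Functions are extended-real-valued, so *)
(* that maximal functions need no a priori finiteness; elements of a Banach   *)
(* function space are finite a.e. by the last axiom below.                    *)
Definition fnorm : Type := (E -> \bar R) -> \bar R.

Definition Lmeas (f : E -> \bar R) : Prop := measurable_fun [set: E] f.

Definition mem_space (X : fnorm) (f : E -> \bar R) : Prop :=
  Lmeas f /\ X f < +oo.

Definition chi (A : set E) (x : E) : \bar R := (\1_A x : R)%:E.

Record banach_function_space (X : fnorm) : Prop := BanachFunctionSpace {
  bfs_ge0 : forall f, Lmeas f -> 0 <= X f;
  bfs_scale : forall (c : R) f, Lmeas f ->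
    X (fun x => c%:E * f x) = `|c|%:E * X f;
  bfs_triangle : forall f g, Lmeas f -> Lmeas g ->
    X (fun x => f x + g x) <= X f + X g;
  bfs_eq0 : forall f, Lmeas f -> (X f = 0 <-> \forall x \ae mu, f x = 0);
  bfs_lattice : forall f g, Lmeas f -> Lmeas g ->
    (\forall x \ae mu, `|g x| <= `|f x|) -> X g <= X f;
  bfs_fatou : forall (F : nat -> E -> \bar R) f,
    (forall k, Lmeas (F k)) -> Lmeas f ->
    (\forall x \ae mu, (forall k, 0 <= F k x) /\
      nondecreasing_seq (F^~ x) /\ F k x @[k --> \oo] --> f x) ->
    nondecreasing_seq (X \o F) /\ X (F k) @[k --> \oo] --> X f;
  bfs_chi : forall A : set E, measurable A -> mu A < +oo -> X (chi A) < +oo;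
  bfs_int : forall A : set E, measurable A -> mu A < +oo ->
    exists C : R, forall f, mem_space X f ->
      \int[mu]_(x in A) `|f x| <= C%:E * X f }.

Definition assoc (X : fnorm) : fnorm := fun f =>
  ereal_sup [set `|\int[mu]_x (f x * g x)| | g in
    [set g | Lmeas g /\ X g <= 1]].

Definition fpow (X : fnorm) (p : R) : fnorm := fun f =>
  poweR (X (fun x => poweR `|f x| p)) p^-1.

Definition opnorm (X Y : fnorm) (S : (E -> \bar R) -> E -> \bar R) : \bar R :=
  ereal_sup [set Y (S f) | f in [set f | Lmeas f /\ X f <= 1]].

Definition mopnorm m (X : 'I_m -> fnorm) (Y : fnorm)
    (S : ('I_m -> E -> \bar R) -> E -> \bar R) : \bar R :=
  ereal_sup [set Y (S f) | f in
    [set f | forall i, Lmeas (f i) /\ X i (f i) <= 1]].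

Definition HLbounded (X : fnorm) : Prop :=
  exists C : R, forall f, mem_space X f -> X (HLmax f) <= C%:E * X f.

Definition multimax_bounded m (X : 'I_m -> fnorm) (Y : fnorm) : Prop :=
  exists C : R, forall f, (forall i, mem_space (X i) (f i)) ->
    Y (multimax f) <= C%:E * \prod_(i < m) X i (f i).

(* Weights u : R^n x (0,oo) -> (0,oo) are total functions whose values at     *)
(* r <= 0 are never used.                                                     *)
Definition morrey (X : fnorm) (u : E -> R -> R) : fnorm := fun f =>
  ereal_sup [set ((u z.1 z.2)^-1)%:E * X (fun y => f y * chi (eball z.1 z.2) y)
    | z in [set z : E * R | (0 < z.2)%R]].

Definition block (X : fnorm) (u : E -> R -> R) (b : E -> \bar R) : Prop :=
  exists (x0 : E) (r : R), [/\ (0 < r)%R, Lmeas b,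
    forall y, ~ eball x0 r y -> b y = 0 & X b <= ((u x0 r)^-1)%:E].

Definition block_repr (X : fnorm) (u : E -> R -> R) (f : E -> \bar R)
    (lam : nat -> R) (b : nat -> E -> \bar R) : Prop :=
  [/\ forall k, block X u (b k),
      \sum_(0 <= k <oo) `|lam k|%:E < +oo &
      \forall x \ae mu, f x \is a fin_num /\
        \sum_(0 <= k < N) (lam k)%:E * b k x @[N --> \oo] --> f x].

Definition block_norm (X : fnorm) (u : E -> R -> R) : fnorm := fun f =>
  ereal_inf [set s | exists lam b, block_repr X u f lam b /\
    s = \sum_(0 <= k <oo) `|lam k|%:E].

(* Joint measurability is Lebesgue measurability on R^(1+n), the radius being *)
(* the first coordinate.                                                      *)
Definition weight_measurable (u : E -> R -> R) : Prop :=
  measurable_fun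
    [set z : Rn R (1 + n) | 0 < (z : 'rV[R]_(1 + n)) ord0 ord0]%R
    (fun z : Rn R (1 + n) =>
       u (rsubmx (z : 'rV[R]_(1 + n))) ((z : 'rV[R]_(1 + n)) ord0 ord0)).

Definition chinorm (X : fnorm) (x : E) (r : R) : R := fine (X (chi (eball x r))).

Definition weight0 (X : fnorm) (u : E -> R -> R) : Prop :=
  [/\ forall x r, (0 < r)%R -> (0 < u x r)%R,
      weight_measurable u &
      exists C : R, [/\ (0 < C)%R,
        forall x1 x2 r1 r2, (0 < r1)%R -> (0 < r2)%R ->
          (u x1 r1 <= u x2 r2)%R ->
          (chinorm X x1 r1 / u x1 r1 <= C * (chinorm X x2 r2 / u x2 r2))%R &
        forall x r, (0 < r)%R ->
          \sum_(0 <= j <oo) (chinorm X x r / chinorm X x (2 ^+ j.+1 * r) *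
                              u x (2 ^+ j.+1 * r))%:E <= (C * u x r)%:E]].

Definition dyadic_sub (Q : cube) : set cube :=
  [set Q' | exists (k : nat) (j : 'I_n -> 'I_(2 ^ k)),
     Q'.2 = (Q.2 / 2 ^+ k)%R /\
     forall i, coord Q'.1 i = (coord Q.1 i + (j i)%:R * (Q.2 / 2 ^+ k))%R].

Definition dyadic_lattice (D : set cube) : Prop :=
  [/\ forall Q, D Q -> (0 < Q.2)%R,
      forall Q, D Q -> dyadic_sub Q `<=` D,
      forall Q' Q'', D Q' -> D Q'' ->
        exists Q, [/\ D Q, dyadic_sub Q Q' & dyadic_sub Q Q''] &
      forall K : set 'rV[R]_n, compact K -> exists Q, D Q /\ K `<=` cset Q].

Definition sparse (eta : R) (S : set cube) : Prop :=
  exists D, [/\ dyadic_lattice D, S `<=` D &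
    forall Q, S Q ->
      mu (\bigcup_(Q' in [set Q' | S Q' /\ cset Q' `<` cset Q]) cset Q') <=
      (1 - eta)%:E * mu (cset Q)].

Definition mop m : Type := ('I_m -> E -> R) -> E -> R.

Definition subst m (f : 'I_m -> E -> R) (i : 'I_m) (g : E -> R) :
    'I_m -> E -> R :=
  fun j => if j == i then g else f j.

(* An m-linear operator defined on the product of linear spaces dom 0, ...,   *)
(* dom (m-1) of measurable functions.                                         *)
Record multilinear_operator m (dom : 'I_m -> set (E -> R)) (T : mop m) :
    Prop := MultilinearOperator {
  mlin_dom_measurable : forall i f, dom i f -> measurable_fun setT f;
  mlin_dom0 : forall i, dom i (cst 0%R);
  mlin_dom_linear : forall i (c : R) f g, dom i f -> dom i g ->
    dom i (fun x => c * f x + g x)%R;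
  mlin_measurable : forall f, (forall i, dom i (f i)) ->
    measurable_fun setT (T f);
  mlin_linear : forall f i (c : R) g, (forall j, dom j (f j)) -> dom i g ->
    \forall x \ae mu, T (subst f i (fun y => c * f i y + g y)%R) x =
      (c * T f x + T (subst f i g) x)%R }.

Definition commutator m (s : 'I_m) (b : E -> R) (T : mop m) : mop m :=
  fun f x => (b x * T f x - T (subst f s (fun y => b y * f s y)) x)%R.

Section iterated_commutator.
Variables (m l : nat) (lm : (l <= m)%N) (b : 'I_l -> E -> R).
Variables (dom : 'I_m -> set (E -> R)) (T : mop m).

Definition iter_commutator : mop m :=
  foldr (fun s U => commutator (widen_ord lm s) (b s) U) T (enum 'I_l).

Definition iter_commutator_dom (f : 'I_m -> E -> R) : Prop :=
  (forall i, dom i (f i)) /\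
  (forall s, dom (widen_ord lm s) (fun y => b s y * f (widen_ord lm s) y)%R).

Definition bounded_csupp (f : E -> R) : Prop :=
  [/\ measurable_fun setT f, exists M : R, forall x, (`|f x| <= M)%R &
    exists K : set 'rV[R]_n, compact K /\ forall x, ~ K x -> f x = 0%R].

(* gamma = false stands for the index 1 and gamma = true for the index 2.     *)
Definition sparse_factor (c f : E -> R) (Q : cube) (gamma : bool) (x : E) :
    \bar R :=
  if gamma then avg (cset Q) (fun y => `|((c y - ravg Q c) * f y)%:E|)
  else `|(c x - ravg Q c)%:E| * avg (cset Q) (fun y => `|(f y)%:E|).

Definition sparse_bound (S : 'I_(3 ^ n) -> set cube) (f : 'I_m -> E -> R)
    (x : E) : \bar R :=
  \sum_(j < 3 ^ n) \sum_(gamma : {ffun 'I_l -> bool}) \esum_(Q in S j)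
    ((\prod_(s < l) sparse_factor (b s) (f (widen_ord lm s)) Q (gamma s) x) *
     (\prod_(s < m | (l <= s)%N) avg (cset Q) (fun y => `|(f s y)%:E|)) *
     chi (cset Q) x).

Definition sparse_domination (C eta : R) : Prop :=
  forall f, (forall i, bounded_csupp (f i)) ->
    iter_commutator_dom f /\
    exists S : 'I_(3 ^ n) -> set cube, (forall j, sparse eta (S j)) /\
      \forall x \ae mu, `|(iter_commutator f x)%:E| <= C%:E * sparse_bound S f x.

(* Sparse domination only controls T_b on bounded compactly supported         *)
(* functions, hence on tuples where T_b is determined by such functions: T_b f *)
(* is an a.e. limit of T_b f_k with |f_k| <= |f|. This contains the bounded   *)
(* compactly supported tuples themselves (constant sequence) and all tuples   *)
(* where T_b is given by absolutely convergent kernel integrals (truncation). *)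
Definition approximable (f : 'I_m -> E -> R) : Prop :=
  exists F : nat -> 'I_m -> E -> R,
    [/\ forall k i, bounded_csupp (F k i),
        forall k i, \forall x \ae mu, (`|F k i x| <= `|f i x|)%R &
        \forall x \ae mu,
          (iter_commutator (F k) x)%:E @[k --> \oo] -->
          (iter_commutator f x)%:E].

End iterated_commutator.

End spaces.

Arguments fnorm : clear implicits.
Arguments mop : clear implicits.

(* Main.v *)
(** Dualizing the sparse bound against a nonnegative function [G] gives
      int |T_b f| G <= C prod ||b_s||_BMO int MM(M f_1, ..., M f_m) M^(l+2) G,
    where [M] and [MM] are the linear and the multilinear maximal operator. Indeed,
    on each cube the powers of the oscillations of the [b_s] cost iterated maximal
    functions of [G] (a stopping-time argument), the averages of the [f_i] are
    controlled by [MM(M f_1, ..., M f_m)], and the cubes of a sparse family have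
    disjoint subsets of comparable measure. For [p = 1], let [G = g chi_B / u(B)] with
    [g] in the unit ball of the associate space [X']. It is a block, hence
    [||M^(l+2) G|| <= ||M||^(l+2)] in the block space, and pairing with the Morrey norm of
    [MM(M f_1, ..., M f_m)] and the Lorentz-Luxemburg theorem give the claim. For
    [p > 1], the Rubio de Francia weight [w = sum_k (2 ||M||)^-k M^k G] is an A_1 weight,
    and the dual inequality for all [G] implies the weighted inequality
      int |T_b f|^p w <= C int MM(M f_1, ..., M f_m)^p w,
    because the maximal operator with respect to the measure [w] is bounded on the dual
    Lebesgue space. The factors [M f_i] are absorbed by the boundedness of [M] on the
    Morrey space over [X_i^p], which follows from the Fefferman-Stein inequality and
    [M] being bounded on [X_i']. Degenerate cases ([||b_s|| = 0] or [f_i = 0]) are separated so that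
    no product [0 * oo] occurs. *)

Require Import Defs.
From HB Require Import structures.
From mathcomp Require Import all_boot all_order all_algebra.
From mathcomp Require Import all_classical all_reals all_analysis.
From mathcomp Require Import measurable_realfun.
From mathcomp Require Import ring lra.

Set Implicit Arguments.
Unset Strict Implicit.
Unset Printing Implicit Defensive.
Import Order.TTheory GRing.Theory Num.Theory.
Import numFieldNormedType.Exports.
Local Open Scope classical_set_scope.
Local Open Scope ring_scope.
Local Open Scope ereal_scope.

Local Notation coord := Defs.coord.

(** * Integrals over cubes and balls *)

(** Three obstacles shape the argument. Differentiation: the stopping-time step needs [f <= lam]
    a.e. outside the stopping cubes; this is derived from the approximation of measurable sets by
    unions of dyadic cells, and [g <= HLmax g] is used only in mean over cubes. Duality: the
    separating functional behind Lorentz-Luxemburg comes from a projection in L^2 on a set of finite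
    measure, so it is a bounded function and not an abstract element of a dual space. Infinite
    values: norms and operator norms live in [\bar R], so each bound is first proved with real
    constants, and is transferred only once every factor is known to be positive and finite. The
    number [l + 2] of iterates arises as follows: the oscillations are bounded by the power [l + 1]
    of one function [onum >= 1], each power costs one [HLmax], and the sparse summation costs one
    more. For [p > 1] the weight is seeded by the very block that tests the Morrey norm, so the
    Morrey norm is needed only through pairings with iterates of [HLmax] on that block. *)

Lemma measurable_mulR d (T : measurableType d) (R : realType) (f g : T -> R) :
  measurable_fun setT f -> measurable_fun setT g ->
  measurable_fun setT (fun x => f x * g x)%R.
Proof. exact: measurable_funM. Qed.

Section extended_products.
Context {R : realType}.

Lemma lee_prode (I : Type) (r : seq I) (P : pred I) (f g : I -> \bar R) :
  (forall i, P i -> 0 <= f i) -> (forall i, P i -> f i <= g i) ->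
  \prod_(i <- r | P i) f i <= \prod_(i <- r | P i) g i.
Proof.
move=> f0 fg; elim: r => [|a r IH]; first by rewrite !big_nil.
rewrite !big_cons; case: ifP => // Pa; apply: lee_pmul => //; first exact: f0.
  exact: prode_ge0.
exact: fg.
Qed.

Lemma prode_gt0 (I : Type) (r : seq I) (P : pred I) (f : I -> \bar R) :
  (forall i, P i -> 0 < f i) -> 0 < \prod_(i <- r | P i) f i.
Proof.
by move=> f0; elim/big_ind : _ => // x y; exact: mule_gt0.
Qed.

End extended_products.

Section nonnegative_integrals.
Context d (T : measurableType d) (R : realType) (mu : {measure set T -> \bar R}).
Implicit Types (f g : T -> \bar R) (D : set T).

Lemma le_int D f g : measurable D -> measurable_fun setT f ->
    measurable_fun setT g -> (forall x, D x -> 0 <= f x) ->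
    (forall x, D x -> f x <= g x) ->
  \int[mu]_(x in D) f x <= \int[mu]_(x in D) g x.
Proof.
move=> mD mf mg f0 fg; apply: ge0_le_integral => //; exact: measurable_funTS.
Qed.

Lemma le_int_sub D D' f : measurable D -> measurable D' ->
    measurable_fun setT f -> (forall x, 0 <= f x) -> D `<=` D' ->
  \int[mu]_(x in D) f x <= \int[mu]_(x in D') f x.
Proof.
by move=> mD mD' mf f0 DD'; apply: ge0_subset_integral => //; exact: measurable_funTS.
Qed.

Lemma int_chi D f : measurable D ->
  \int[mu]_(x in D) f x = \int[mu]_x (f x * (\1_D x : R)%:E).
Proof.
move=> mD; rewrite integral_mkcond; apply: eq_integral => x _.
by rewrite patchE indicE; case: (x \in D); rewrite ?mule1 ?mule0.
Qed.

Lemma measurable_fun_limn_einf (F : nat -> T -> \bar R) :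
  (forall k, measurable_fun setT (F k)) ->
  measurable_fun setT (fun x => limn_einf (F^~ x)).
Proof.
move=> mF; rewrite /limn_einf; apply: measurableT_comp => //.
by apply: measurable_fun_limn_esup => k; exact: measurableT_comp.
Qed.

(** Every passage to the limit in an integral bound goes through this form of Fatou's lemma. The
    limit is assumed measurable by itself, because it agrees with the lower limit only a.e. on
    [D]. *)
Lemma fatou_le D f (F : nat -> T -> \bar R) (B : \bar R) : measurable D ->
    measurable_fun setT f -> (forall k, measurable_fun setT (F k)) ->
    (forall x, 0 <= f x) -> (forall k x, 0 <= F k x) ->
    (\forall x \ae mu, D x -> F k x @[k --> \oo] --> f x) ->
    (forall k, \int[mu]_(x in D) F k x <= B) ->
  \int[mu]_(x in D) f x <= B.
Proof.
move=> mD mf mF f0 F0 Ff FB.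
have lF0 x : 0 <= limn_einf (F^~ x).
  rewrite (limn_einf_lim (F^~ x)); apply: lime_ge; first exact: is_cvg_einfs.
  by apply: nearW => k; apply: le_ereal_inf_tmp => _ [i _ <-].
apply: (@le_trans _ _ (\int[mu]_(x in D) limn_einf (F^~ x))).
  apply: ae_ge0_le_integral => //.
  - exact: measurable_funTS.
  - by apply: measurable_funTS; exact: measurable_fun_limn_einf.
  apply: filterS Ff => x Fx /Fx {}Fx; rewrite is_cvg_limn_einfE.
    by rewrite (cvg_lim _ Fx).
  by apply/cvg_ex; exists (f x).
apply: le_trans (fatou mu mD _ _) _ => [k|k x _|]; [exact: measurable_funTS|exact: F0|].
rewrite (limn_einf_lim (fun k => \int[mu]_(x in D) F k x)); apply: lime_le; first exact: is_cvg_einfs.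
apply: nearW => k; apply: le_trans (FB k); apply: ereal_inf_lbound.
by exists k => /=.
Qed.

(** Inverting an injection of [S] into the naturals enumerates [S] by the image [B], which need not
    be an initial segment; [esum_series] pads with zeros outside [B]. The empty set stands apart
    because [e] must take values in [I]. *)
Lemma esum_enum (I : choiceType) (S : set I) : countable S ->
  S = set0 \/ exists (e : nat -> I) (B : set nat), set_bij B S e.
Proof.
move=> /countable_injP[g gS].
have [->|/set0P[i0 Si0]] := eqVneq S set0; [by left|right].
have xg i : S i -> xget i0 [set j | S j /\ g j = g i] = i.
  move=> Si; case: xgetP => [j -> [Sj gji]|/(_ i)/= []//].
  by apply: gS => //; rewrite inE.
exists (fun k => xget i0 [set i | S i /\ g i = k]), (g @` S); split.
- by move=> _ [i Si <-]; rewrite /= xg.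
- by move=> _ _ /set_mem[i Si <-] /set_mem[j Sj <-]; rewrite !xg// => ->.
- by move=> i Si; exists (g i); [exists i|rewrite xg].
Qed.

Lemma countable_bigcup_measurable (I : choiceType) (S : set I) (F : I -> set T) :
  countable S -> (forall i, S i -> measurable (F i)) ->
  measurable (\bigcup_(i in S) F i).
Proof.
move=> /esum_enum[->|[e [B [eBS _ SeB]]]] mF; first by rewrite bigcup_set0.
have <- : e @` B = S by apply/seteqP; split => [_ [k Bk <-]|//]; exact: eBS.
rewrite bigcup_image; apply: bigcup_measurable => k Bk; apply: mF; exact: eBS.
Qed.

Lemma esum_int_le (I : choiceType) (S : set I) (F : I -> set T) D f :
    measurable D -> (forall i, S i -> measurable (F i)) ->
    measurable_fun setT f -> (forall x, 0 <= f x) -> trivIset S F ->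
    (forall i, S i -> F i `<=` D) ->
  \esum_(i in S) \int[mu]_(x in F i) f x <= \int[mu]_(x in D) f x.
Proof.
move=> mD mF mf f0 tS FD.
apply: ge_ereal_sup => _ [A [fA AS] <-].
pose G i := if i \in S then F i else set0.
have mG i : measurable (G i) by rewrite /G; case: ifPn => // /set_mem /mF.
rewrite fsbig_finite//= big_seq.
rewrite (eq_bigr (fun i => \int[mu]_(x in G i) f x)) => [|i]; last first.
  by rewrite in_fset_set// => /set_mem /AS Si; rewrite /G mem_set.
rewrite -big_seq.
rewrite -ge0_integral_bigsetU//.
- apply: le_int_sub => //; first exact: bigsetU_measurable.
  rewrite -bigcup_seq => x [i /= iA]; rewrite /G.
  by case: ifPn => // /set_mem Si; exact: FD.
- move=> i j _ _; rewrite /G; case: ifPn => [/set_mem Si|_]; last by rewrite set0I => -[].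
  case: ifPn => [/set_mem Sj|_]; last by rewrite setI0 => -[].
  exact: tS.
- exact: measurable_funTS.
Qed.

Lemma esum_series (I : choiceType) (S : set I) (e : nat -> I) (B : set nat)
    (a : I -> \bar R) : set_bij B S e -> (forall i, 0 <= a i) ->
  \esum_(i in S) a i = \sum_(0 <= k <oo) if k \in B then a (e k) else 0.
Proof.
move=> eB a0; rewrite (reindex_esum _ _ _ _ eB) esum_mkcond -nneseries_esumT//.
by move=> k; case: ifP.
Qed.

Lemma measurable_esum (I : choiceType) (S : set I) (f : I -> T -> \bar R) :
    countable S -> (forall i, measurable_fun setT (f i)) ->
    (forall i x, 0 <= f i x) ->
  measurable_fun setT (fun x => \esum_(i in S) f i x).
Proof.
move=> /esum_enum[->|[e [B eB]]] mf f0.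
  by under eq_fun do rewrite esum_set0; exact: measurable_cst.
under eq_fun do rewrite (esum_series eB)//.
apply: ge0_emeasurable_sum => [k x _|k _].
  by case: (k \in B).
by case: (k \in B).
Qed.

Lemma int_esum (I : choiceType) (S : set I) (f : I -> T -> \bar R) D :
    countable S -> measurable D -> (forall i, measurable_fun setT (f i)) ->
    (forall i x, 0 <= f i x) ->
  \int[mu]_(x in D) (\esum_(i in S) f i x) =
  \esum_(i in S) \int[mu]_(x in D) f i x.
Proof.
move=> /esum_enum[->|[e [B eB]]] mD mf f0.
  by rewrite esum_set0 integral0_eq// => x _; exact: esum_set0.
rewrite (esum_series eB) => [|i]; last exact: integral_ge0.
under eq_integral do rewrite (esum_series eB)//.
rewrite integral_nneseries//.
- apply: eq_eseriesr => k _; case: ifP => // _.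
  exact: integral0.
- by move=> k; case: (k \in B); [exact: measurable_funTS|exact: measurable_cst].
- by move=> k x _; case: ifP.
Qed.

Lemma int_bigcup_le (I : choiceType) (S : set I) (F : I -> set T) f :
    countable S -> (forall i, measurable (F i)) ->
    measurable_fun setT f -> (forall x, 0 <= f x) ->
  \int[mu]_(x in \bigcup_(i in S) F i) f x <=
  \esum_(i in S) \int[mu]_(x in F i) f x.
Proof.
move=> cS mF mf f0.
have mU : measurable (\bigcup_(i in S) F i).
  exact: countable_bigcup_measurable.
rewrite int_chi//; under eq_esum do rewrite int_chi//.
have mfi i : measurable_fun setT (fun x => f x * (\1_(F i) x)%:E).
  by apply: emeasurable_funM => //; apply/measurable_EFinP; exact: measurable_indic.
have fi0 i x : 0 <= f x * (\1_(F i) x)%:E by rewrite mule_ge0// lee_fin.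
rewrite -int_esum//; apply: le_int => //.
- by apply: emeasurable_funM => //; apply/measurable_EFinP; exact: measurable_indic.
- exact: measurable_esum.
- by move=> x _; rewrite mule_ge0// lee_fin.
move=> x _; rewrite indicE; case: (boolP (x \in _)) => [/set_mem[i Si Fix]|_]; last first.
  by rewrite mule0; apply: esum_ge0.
apply: esum_ge; exists [set i]; first by split=> // _ ->.
by rewrite fsbig_set1 indicE mem_set.
Qed.

End nonnegative_integrals.

Lemma measurable_dist d (T : measurableType d) (R : realType) n
    (f : 'I_n -> T -> R) (c : 'I_n -> R) : (forall i, measurable_fun setT (f i)) ->
  measurable_fun setT (fun y => Num.sqrt (\sum_(i < n) (f i y - c i) ^+ 2)).
Proof.
move=> mf; apply: measurableT_comp.
  exact: (continuous_measurable_fun (@sqrt_continuous R)).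
apply: measurable_sum => i; apply: measurable_funX.
by apply: measurable_funB => //.
Qed.

Section geometry.
Context {R : realType} {n : nat}.
Local Notation E := (Rn R n).
Local Notation mu := (leb R n).

Lemma borel_rowE (A : set (borel_row R n)) : measurable A ->
  measurable (A : set E) /\ mu A = borel_lebesgue R n A.
Proof.
move=> mA; split; first exact: caratheodory_measurable_mu_ext.
exact: measurable_mu_extE.
Qed.

Lemma leb_box (A : 'I_n -> set (measurableTypeR R)) :
  (forall i, measurable (A i)) ->
  measurable [set x : E | forall i, A i (coord x i)] /\
  mu [set x : E | forall i, A i (coord x i)] = \prod_(i < n) lebesgue_measure (A i).
Proof.
by move=> /borel_lebesgue_box[mA <-]; have [? ?] := borel_rowE mA.
Qed.

Lemma measurable_coord (i : 'I_n) :
  measurable_fun [set: E] ((fun x => coord x i) : E -> measurableTypeR R).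
Proof.
move=> _ Y mY; rewrite setTI.
have := @measurable_row_coord R n i measurableT Y mY; rewrite setTI.
by move/borel_rowE => -[].
Qed.

Lemma measurable_coordR (i : 'I_n) :
  measurable_fun [set: E] ((fun x => coord x i) : E -> R).
Proof. exact: measurable_coord. Qed.

Lemma csetE (Q : @cube R n) : cset Q =
  [set x : E | forall i, `[coord Q.1 i, (coord Q.1 i + Q.2)%R[%classic (coord x i)].
Proof. by apply/seteqP; split=> x /= + i => /(_ i); rewrite in_itv. Qed.

Lemma measurable_cset (Q : @cube R n) : measurable (cset Q).
Proof. by rewrite csetE; apply: (leb_box (fun=> measurable_itv _)).1. Qed.

Lemma leb_cset (Q : @cube R n) : (0 < Q.2)%R -> mu (cset Q) = (Q.2 ^+ n)%:E.
Proof. by case: Q => a h; exact: leb_cube. Qed.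

Definition box (x : E) (r : R) : set E :=
  [set y | forall i, `|coord y i - coord x i| < r]%R.

Lemma measurable_eball (x : E) (r : R) : measurable (eball x r).
Proof.
have mf := @measurable_dist _ E R n (fun i y => coord y i) (coord x) measurable_coordR.
have := mf measurableT _ (measurable_itv `]-oo, r[); rewrite setTI.
congr measurable; apply/seteqP; split => y /=; rewrite in_itv //.
Qed.

Lemma eball_box (x : E) (r : R) : eball x r `<=` box x r.
Proof.
move=> y /= yr i; rewrite -sqrtr_sqr; apply: le_lt_trans yr.
rewrite ler_wsqrtr// (bigD1 i)//= lerDl; apply: sumr_ge0 => j _.
exact: sqr_ge0.
Qed.

(** The sum of [n] squares is below [n r^2], hence below [(n r)^2]; the factor [n] instead of its
    square root is enough. In dimension zero the box is the whole one-point space, while the ball of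
    radius [0 * r] is empty. *)
Lemma box_eball (x : E) (r : R) : (0 < n)%N -> box x r `<=` eball x (n%:R * r).
Proof.
move=> n0 y yr; have r0 : (0 < r)%R.
  by apply: le_lt_trans (yr (Ordinal n0)).
have nr0 : (0 < n%:R * r)%R by rewrite mulr_gt0// ltr0n.
rewrite /eball/= -(gtr0_norm nr0) -sqrtr_sqr ltr_sqrt ?exprn_gt0//.
apply: (@lt_le_trans _ _ (\sum_(i < n) r ^+ 2)%R).
  apply: ltr_sum => [|i _].
    by apply/hasP; exists (Ordinal n0); rewrite ?mem_index_enum.
  rewrite -real_normK ?num_real// ltr_pXn2r// ?nnegrE ?(ltW r0)//; exact: yr.
rewrite sumr_const card_ord exprMn -[leLHS]mulr_natl ler_pM2r ?exprn_gt0//.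
by rewrite expr2 ler_peMl// ler1n.
Qed.

Definition ccube (x : E) (r : R) : @cube R n := (\row_i (coord x i - r), 2 * r)%R.

Lemma ccubeP (x : E) r y : cset (ccube x r) y <->
  forall i, (coord x i - r <= coord y i < coord x i + r)%R.
Proof.
have e i : coord (ccube x r).1 i = (coord x i - r)%R by rewrite {1}/coord mxE.
split=> + i => /(_ i); rewrite e /=; move: (coord x i) (coord y i) => a b.
  by move=> /andP[? ?]; apply/andP; split; lra.
by move=> /andP[? ?]; apply/andP; split; lra.
Qed.

Lemma box_ccube (x : E) r : box x r `<=` cset (ccube x r).
Proof.
by move=> y yr; apply/ccubeP => i; have := yr i; rewrite ltr_distl => /andP[/ltW ->].
Qed.

Lemma ccube_box (x : E) r s : (r < s)%R -> cset (ccube x r) `<=` box x s.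
Proof.
move=> rs y /ccubeP + i => /(_ i) /andP[a b]; rewrite ltr_distl.
by apply/andP; split; lra.
Qed.

Lemma cset_nonempty (Q : @cube R n) : (0 < Q.2)%R -> cset Q Q.1.
Proof. by move=> h0 i; rewrite lexx ltrDl. Qed.

Lemma leb_eball_fin (x : E) r : (0 < r)%R -> mu (eball x r) < +oo.
Proof.
move=> r0; apply: (@le_lt_trans _ _ (mu (cset (ccube x r)))).
  apply: le_measure; rewrite ?inE; [exact: measurable_eball|exact: measurable_cset|].
  by apply: subset_trans (@box_ccube _ _); exact: eball_box.
by rewrite leb_cset ?ltry//= mulr_gt0.
Qed.

Lemma leb_eball_le (x : E) r : (0 < r)%R -> mu (eball x r) <= ((2 * r) ^+ n)%:E.
Proof.
move=> r0; rewrite -(@leb_cset (ccube x r)) /= ?mulr_gt0//.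
apply: le_measure; rewrite ?inE; [exact: measurable_eball|exact: measurable_cset|].
by apply: subset_trans (@box_ccube _ _); exact: eball_box.
Qed.

Lemma leb_eball_ge (x : E) r : (0 < n)%N -> (0 < r)%R ->
  ((r / n%:R) ^+ n)%:E <= mu (eball x r).
Proof.
move=> n0 r0; have h0 : (0 < r / n%:R)%R by rewrite divr_gt0 ?ltr0n.
have := @leb_cset (ccube x (r / n%:R / 2)).
rewrite /= [X in (X ^+ n)%R]mulrC divfK ?pnatr_eq0// => <-//.
apply: le_measure; rewrite ?inE; [exact: measurable_cset|exact: measurable_eball|].
have -> : eball x r = eball x (n%:R * (r / n%:R)).
  by congr eball; rewrite mulrC divfK// pnatr_eq0 -lt0n.
apply: subset_trans (@box_eball _ _ n0).
by apply: ccube_box; rewrite ltr_pdivrMr// ltr_pMr// ltr1n.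
by rewrite mulr_gt0// divr_gt0.
Qed.

Lemma leb_eball_gt0 (x : E) r : (0 < n)%N -> (0 < r)%R -> 0 < mu (eball x r).
Proof.
move=> n0 r0; apply: lt_le_trans (leb_eball_ge _ n0 r0).
by rewrite lte_fin exprn_gt0// divr_gt0// ltr0n.
Qed.

Lemma measurable_chi (A : set E) : measurable A -> Lmeas (chi A).
Proof. by move=> mA; apply/measurable_EFinP; exact: measurable_indic. Qed.

Lemma chi_ge0 (A : set E) x : 0 <= chi A x.
Proof. by rewrite /chi lee_fin. Qed.

Lemma chi1 (A : set E) x : A x -> chi A x = 1.
Proof. by move=> Ax; rewrite /chi indicE mem_set. Qed.

Lemma chi0 (A : set E) x : ~ A x -> chi A x = 0.
Proof. by move=> Ax; rewrite /chi indicE memNset. Qed.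

End geometry.

Section lebesgue_measurable.
Context {R : realType} {n : nat}.
Local Notation E := (Rn R n).
Implicit Types f g : E -> \bar R.

Lemma LmeasM f g : Lmeas f -> Lmeas g -> Lmeas (fun x => f x * g x).
Proof. exact: emeasurable_funM. Qed.

Lemma LmeasD f g : Lmeas f -> Lmeas g -> Lmeas (fun x => f x + g x).
Proof. exact: emeasurable_funD. Qed.

Lemma LmeasZ c f : Lmeas f -> Lmeas (fun x => c * f x).
Proof. by move=> mf; apply: LmeasM => //; exact: measurable_cst. Qed.

Lemma Lmeas_cst (c : \bar R) : Lmeas (fun _ : E => c).
Proof. exact: measurable_cst. Qed.

Lemma Lmeas_fin (b : E -> R) : measurable_fun setT b -> Lmeas (EFin \o b).
Proof. by move=> mb; apply/measurable_EFinP. Qed.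

Lemma Lmeas_poweR f p : Lmeas f -> Lmeas (fun x => f x `^ p).
Proof. by move=> mf; exact: (measurableT_comp (measurable_poweR p)). Qed.

Lemma Lmeas_chi f (A : set E) : measurable A -> Lmeas f -> Lmeas (fun x => f x * chi A x).
Proof. by move=> mA mf; apply: LmeasM => //; exact: measurable_chi. Qed.

Lemma Lmeas_prod (I : Type) (r : seq I) (P : pred I) (F : I -> E -> \bar R) :
  (forall i, Lmeas (F i)) -> Lmeas (fun x => \prod_(i <- r | P i) F i x).
Proof.
move=> mF; elim: r => [|a r IH].
  rewrite (_ : (fun _ => _) = fun=> 1); first exact: Lmeas_cst.
  by apply/funext => x; rewrite big_nil.
rewrite (_ : (fun _ => _) = fun x => (if P a then F a x else 1) *
    \prod_(i <- r | P i) F i x); last first.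
  by apply/funext => x; rewrite big_cons; case: ifP; rewrite ?mul1e.
by apply: LmeasM => //; case: (P a) => //; exact: Lmeas_cst.
Qed.

Lemma Lmeas_sum (I : Type) (r : seq I) (P : pred I) (F : I -> E -> \bar R) :
  (forall i, Lmeas (F i)) -> Lmeas (fun x => \sum_(i <- r | P i) F i x).
Proof.
move=> mF; elim: r => [|a r IH].
  rewrite (_ : (fun _ => _) = fun=> 0); first exact: Lmeas_cst.
  by apply/funext => x; rewrite big_nil.
rewrite (_ : (fun _ => _) = fun x => (if P a then F a x else 0) +
    \sum_(i <- r | P i) F i x); last first.
  by apply/funext => x; rewrite big_cons; case: ifP; rewrite ?add0e.
by apply: LmeasD => //; case: (P a) => //; exact: Lmeas_cst.
Qed.

Lemma Lmeas_series (F : nat -> E -> \bar R) : (forall k, Lmeas (F k)) ->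
  (forall k x, 0 <= F k x) -> Lmeas (fun x => \sum_(0 <= k <oo) F k x).
Proof.
move=> mF F0; apply: ge0_emeasurable_sum => [k x _ _|k _]; first exact: F0.
exact: mF.
Qed.

End lebesgue_measurable.

Section averages.
Context {R : realType} {n : nat}.
Local Notation E := (Rn R n).
Local Notation mu := (leb R n).
Implicit Types (f g : E -> \bar R) (A B : set E).

Lemma Lmeas_abse f : Lmeas f -> Lmeas (abse \o f).
Proof. by move=> mf; exact: measurableT_comp. Qed.

Lemma avg_ge0 A f : (forall x, 0 <= f x) -> 0 <= avg A f.
Proof.
move=> f0; rewrite /avg mule_ge0 ?integral_ge0// lee_fin invr_ge0.
Qed.

Lemma int_ae_le A f g : measurable A -> Lmeas f -> Lmeas g ->
  (forall x, 0 <= f x) -> (forall x, 0 <= g x) ->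
  (\forall x \ae mu, A x -> f x <= g x) ->
  \int[mu]_(x in A) f x <= \int[mu]_(x in A) g x.
Proof.
move=> mA mf mg f0 g0 fg.
by apply: ae_ge0_le_integral => //; exact: measurable_funTS.
Qed.

Lemma int_sub A B f : measurable A -> measurable B -> Lmeas f ->
  (forall x, 0 <= f x) -> A `<=` B ->
  \int[mu]_(x in A) f x <= \int[mu]_(x in B) f x.
Proof. exact: le_int_sub. Qed.

Lemma ae_ex A (P : E -> Prop) : measurable A -> 0 < mu A -> (\forall x \ae mu, P x) ->
  exists2 x, A x & P x.
Proof.
move=> mA A0 aeP; apply: contrapT => nP; move: A0; apply/negP; rewrite -leNgt.
have : \int[mu]_(x in A) 1 <= \int[mu]_(x in A) 0.
  apply: (int_ae_le mA (Lmeas_cst _) (Lmeas_cst _) (fun=> lee01) (fun=> lexx _)).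
  by apply: filterS aeP => x Px Ax; exfalso; apply: nP; exists x.
by rewrite integral0 integral_cst// mul1e.
Qed.

Lemma int_le A f g : measurable A -> Lmeas f -> Lmeas g -> (forall x, 0 <= f x) ->
  (forall x, A x -> f x <= g x) ->
  \int[mu]_(x in A) f x <= \int[mu]_(x in A) g x.
Proof.
move=> mA mf mg f0 fg.
exact: (le_int _ mA mf mg (fun x _ => f0 x) fg).
Qed.

Lemma intD A f g : measurable A -> Lmeas f -> (forall x, 0 <= f x) ->
  Lmeas g -> (forall x, 0 <= g x) ->
  \int[mu]_(x in A) (f x + g x) = \int[mu]_(x in A) f x + \int[mu]_(x in A) g x.
Proof.
move=> mA mf f0 mg g0.
exact: (ge0_integralD mu mA (fun x _ => f0 x) (measurable_funTS mf)
  (fun x _ => g0 x) (measurable_funTS mg)).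
Qed.

Lemma intZ A f c : measurable A -> Lmeas f -> (forall x, 0 <= f x) -> 0 <= c ->
  \int[mu]_(x in A) (c * f x) = c * \int[mu]_(x in A) f x.
Proof.
move=> mA mf f0 c0.
exact: (ge0_integralZl mu mA (measurable_funTS mf) (fun x _ => f0 x) c0).
Qed.

Lemma int_lincomb A f g c d : measurable A -> Lmeas f -> (forall x, 0 <= f x) ->
  Lmeas g -> (forall x, 0 <= g x) -> 0 <= c -> 0 <= d ->
  \int[mu]_(x in A) (c * f x + d * g x) =
  c * \int[mu]_(x in A) f x + d * \int[mu]_(x in A) g x.
Proof.
move=> mA mf f0 mg g0 c0 d0; rewrite -(intZ mA mf f0 c0) -(intZ mA mg g0 d0).
apply: (intD mA).
- exact: LmeasZ.
- by move=> x; exact: mule_ge0.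
- exact: LmeasZ.
- by move=> x; exact: mule_ge0.
Qed.

Lemma int_sum (I : Type) (r : seq I) A (F : I -> E -> \bar R) : measurable A ->
  (forall i, Lmeas (F i)) -> (forall i x, 0 <= F i x) ->
  \int[mu]_(x in A) (\sum_(i <- r) F i x) = \sum_(i <- r) \int[mu]_(x in A) F i x.
Proof.
move=> mA mF F0.
exact: (ge0_integral_sum mu mA (fun i => measurable_funTS (mF i)) (fun i x _ => F0 i x)).
Qed.

Lemma intU A B f : measurable A -> measurable B -> Lmeas f -> (forall x, 0 <= f x) ->
  A `&` B = set0 ->
  \int[mu]_(x in A `|` B) f x = \int[mu]_(x in A) f x + \int[mu]_(x in B) f x.
Proof.
move=> mA mB mf f0 AB.
apply: (ge0_integral_setU mu mA mB (measurable_funTS mf) (fun x _ => f0 x)).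
by apply/disj_setPS; rewrite AB.
Qed.

Lemma int_chiE A f : measurable A ->
  \int[mu]_(x in A) f x = \int[mu]_x (f x * chi A x).
Proof. exact: int_chi. Qed.

Lemma avg_le A f g : measurable A -> Lmeas f -> Lmeas g ->
  (forall x, 0 <= f x) -> (forall x, 0 <= g x) ->
  (\forall x \ae mu, A x -> f x <= g x) -> avg A f <= avg A g.
Proof.
move=> mA mf mg f0 g0 fg; apply: lee_wpmul2l.
  by rewrite lee_fin invr_ge0 fine_ge0.
exact: int_ae_le.
Qed.

Lemma int_avg A f : measurable A -> 0 < mu A -> mu A < +oo ->
  \int[mu]_(x in A) f x = mu A * avg A f.
Proof.
move=> mA A0 Aoo; have Af : mu A \is a fin_num by rewrite ge0_fin_numE// ltW.
rewrite /avg -[X in X * (_ * _)](fineK Af) muleA -EFinM divff ?mul1e//.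
by rewrite gt_eqF// fine_gt0// A0.
Qed.

Lemma leb_cset_gt0 (Q : @cube R n) : (0 < Q.2)%R -> 0 < mu (cset Q).
Proof. by move=> h0; rewrite leb_cset// lte_fin exprn_gt0. Qed.

Lemma leb_cset_fin (Q : @cube R n) : (0 < Q.2)%R -> mu (cset Q) < +oo.
Proof. by move=> h0; rewrite leb_cset// ltry. Qed.

Lemma avg_cset (Q : @cube R n) f : (0 < Q.2)%R ->
  avg (cset Q) f = ((Q.2 ^+ n)^-1)%:E * \int[mu]_(x in cset Q) f x.
Proof. by move=> h0; rewrite /avg leb_cset. Qed.

Lemma int_cset (Q : @cube R n) f : (0 < Q.2)%R ->
  \int[mu]_(x in cset Q) f x = (Q.2 ^+ n)%:E * avg (cset Q) f.
Proof.
move=> h0; rewrite -leb_cset// int_avg//; first exact: measurable_cset.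
  exact: leb_cset_gt0.
exact: leb_cset_fin.
Qed.

Lemma avgZ A f (c : R) : measurable A -> Lmeas f -> (forall x, 0 <= f x) ->
  (0 <= c)%R -> avg A (fun x => c%:E * f x) = c%:E * avg A f.
Proof.
move=> mA mf f0 c0; rewrite /avg ge0_integralZl//; last exact: measurable_funTS.
by rewrite muleCA.
Qed.

Lemma avgD A f g : measurable A -> Lmeas f -> (forall x, 0 <= f x) ->
  Lmeas g -> (forall x, 0 <= g x) ->
  avg A (fun x => f x + g x) = avg A f + avg A g.
Proof.
move=> mA mf f0 mg g0; rewrite /avg ge0_integralD//; try exact: measurable_funTS.
by rewrite ge0_muleDr// integral_ge0.
Qed.

Lemma avg_cst A (c : R) : measurable A -> 0 < mu A -> mu A < +oo ->
  avg A (fun=> c%:E) = c%:E.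
Proof.
move=> mA A0 Aoo; have Af : mu A \is a fin_num by rewrite ge0_fin_numE// ltW.
rewrite /avg integral_cst// -[X in _ * (_ * X)](fineK Af) -!EFinM mulrCA mulVf ?mulr1//.
by rewrite gt_eqF// fine_gt0// A0.
Qed.

Lemma ae_zero_int A f : measurable A -> Lmeas f -> (forall x, 0 <= f x) ->
  \int[mu]_(x in A) f x = 0 -> \forall x \ae mu, A x -> f x = 0.
Proof.
move=> mA mf f0 i0.
have := ae_eq_integral_abs mu mA (@measurable_funTS _ _ _ _ A f mf).
move=> [+ _]; apply; rewrite -[RHS]i0; apply: eq_integral => x _.
by rewrite gee0_abs.
Qed.

Lemma cset_sub_eball (Q : @cube R n) x : (0 < n)%N -> (0 < Q.2)%R -> cset Q x ->
  cset Q `<=` eball x (n%:R * Q.2).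
Proof.
move=> n0 h0 Qx y Qy; apply: box_eball => // i.
by have /andP[? ?] := Qx i; have /andP[? ?] := Qy i; rewrite ltr_distl; apply/andP; split; lra.
Qed.

End averages.

Section rational_cubes.
Context {R : realType} {n : nat}.
Local Notation E := (Rn R n).
Local Notation mu := (leb R n).

Definition ratcube : Type := ({ffun 'I_n -> rat} * rat)%type.

Definition rcube (q : ratcube) : @cube R n := (\row_i ratr (q.1 i), ratr q.2).

Lemma coord_rcube q i : coord (rcube q).1 i = ratr (q.1 i).
Proof. by rewrite /coord mxE. Qed.

Lemma rcube_approx (Q : @cube R n) (e : R) : (0 < Q.2)%R -> (0 < e)%R ->
  exists q : ratcube, [/\ (0 < (rcube q).2)%R, cset Q `<=` cset (rcube q) &
    ((rcube q).2 < Q.2 + e)%R].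
Proof.
move=> h0 e0.
have [|r] := @rat_in_itvoo R (Q.2 + e / 2) (Q.2 + e); first by lra.
rewrite in_itv/= => /andP[r1 r2].
have /choice[a ha] : forall i : 'I_n, exists q : rat,
    (coord Q.1 i - e / 2 < ratr q < coord Q.1 i)%R.
  move=> i; have [|q] := @rat_in_itvoo R (coord Q.1 i - e / 2) (coord Q.1 i); first by lra.
  by rewrite in_itv/= => ?; exists q.
exists ([ffun i => a i], r); split => //=; first by lra.
move=> x Qx i; have := Qx i; have := ha i; rewrite coord_rcube ffunE /=.
move: (ratr (a i)) (coord Q.1 i) (coord x i) => u v w /andP[? ?] /andP[? ?].
by apply/andP; split; lra.
Qed.

Lemma rcube_box (x : E) (e : R) : (0 < e)%R ->
  exists q : ratcube, [/\ (0 < (rcube q).2)%R, cset (rcube q) x &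
    cset (rcube q) `<=` box x e].
Proof.
move=> e0.
have e20 : (0 < e / 2)%R by rewrite divr_gt0.
have [|q [q0 Qq qe]] := @rcube_approx (ccube x (e / 4)) (e / 2) _ e20.
  by rewrite /= mulr_gt0// divr_gt0.
have qx : cset (rcube q) x.
  by apply: Qq; apply: box_ccube => i; rewrite subrr normr0 divr_gt0.
exists q; split => // y qy i; have := qx i; have := qy i; rewrite ltr_distl.
move: qe => /=; move: (coord _ i) (coord _ i) (coord _ i) (ratr _) => a b c d.
by move=> ? /andP[? ?] /andP[? ?]; apply/andP; split; lra.
Qed.

(** An open set is the union of the countably many rational cubes inside it. Openness is expressed
    by sup-norm boxes so that it can be checked coordinatewise. *)
Lemma open_box_measurable (A : set E) :
  (forall x, A x -> exists2 e, (0 < e)%R & box x e `<=` A) -> measurable A.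
Proof.
move=> oA.
rewrite (_ : A = \bigcup_(q in [set q : ratcube | cset (rcube q) `<=` A]) cset (rcube q)).
  apply: countable_bigcup_measurable => [|q _]; [exact: countableP|exact: measurable_cset].
apply/seteqP; split => [x /[dup] Ax /oA[e e0 eA]|x [q /= qA /qA//]].
have [q [q0 qx qe]] := rcube_box x e0.
by exists q => //=; exact: subset_trans eA.
Qed.

Lemma eball_open (z : E) r x : eball z r x ->
  exists2 e, (0 < e)%R & box x e `<=` eball z r.
Proof.
move=> zrx; have r0 : (0 < r)%R by apply: le_lt_trans zrx; rewrite sqrtr_ge0.
have zr y : eball z r y <-> (\sum_(i < n) (coord y i - coord z i) ^+ 2 < r ^+ 2)%R.
  by rewrite /eball/= -{1}(gtr0_norm r0) -sqrtr_sqr ltr_sqrt ?exprn_gt0.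
move/zr : zrx => zrx.
(* Moving each coordinate by less than [e <= 1] changes the squared distance by at most [e (c - 1)];
   with [e <= s / c] this stays below the available slack [s]. *)
pose c := (\sum_(i < n) (2 * `|coord x i - coord z i| + 1) + 1)%R.
have c0 : (0 < c)%R by rewrite ltr_pwDr// sumr_ge0// => i _; rewrite addr_ge0// mulr_ge0.
pose s := (r ^+ 2 - \sum_(i < n) (coord x i - coord z i) ^+ 2)%R.
have s0 : (0 < s)%R by rewrite subr_gt0.
exists (Num.min 1 (s / c))%R; first by rewrite lt_min ltr01 divr_gt0.
move=> y yx; apply/zr.
apply: (@le_lt_trans _ _ (\sum_(i < n) (coord x i - coord z i) ^+ 2 +
   \sum_(i < n) (Num.min 1 (s / c)) * (2 * `|coord x i - coord z i| + 1))%R).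
  rewrite -big_split /=; apply: ler_sum => i _; have := yx i.
  have : (Num.min 1 (s / c) <= 1)%R by rewrite ge_min lexx.
  move: (Num.min _ _) => m; rewrite ltr_distl => m1 /andP[].
  move: (coord x i) (coord y i) (coord z i) => a b w h1 h2.
  have [aw|aw] := leP 0%R (a - w)%R.
    rewrite ger0_norm//; nra.
  rewrite ltr0_norm//; nra.
rewrite -mulr_sumr -ltrBrDl -/s.
apply: (@le_lt_trans _ _ (s / c * (c - 1))%R).
  rewrite /c addrK ler_wpM2r// ?ge_min ?lexx ?orbT//.
  by apply: sumr_ge0 => i _; rewrite addr_ge0// mulr_ge0.
by rewrite -mulrA gtr_pMr// mulrC ltr_pdivrMr// mul1r; lra.
Qed.

End rational_cubes.

(** * Maximal operators *)

Section maximal_operators.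
Context {R : realType} {n : nat}.
Local Notation E := (Rn R n).
Local Notation mu := (leb R n).
Implicit Types (f g : E -> \bar R) (A B : set E).

(** Used with [h] the side of a cube and [e] the excess of a rational cube around it: letting the
    excess tend to zero removes the error in the volume. *)
Lemma exprn_right_le (a b h : R) (k : nat) :
  (forall e, (0 < e)%R -> (a <= b * (h + e) ^+ k)%R) -> (a <= b * h ^+ k)%R.
Proof.
move=> ab; have : (fun e => b * (h + e) ^+ k)%R @ 0^'+ --> (b * (h + 0) ^+ k)%R.
  apply: cvg_at_right_filter.
  apply: cvgM; first exact: cvg_cst.
  have : {for (0 : R)%R, continuous (fun e : R => (h + e) ^+ k)%R}.
    apply: (@continuous_comp _ _ _ (fun e => h + e)%R (fun y => y ^+ k)%R).
      by apply: cvgD; [exact: cvg_cst|exact: cvg_id].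
    exact: exprn_continuous.
  by [].
rewrite addr0 => /cvgr_to_ge; apply.
near=> e; apply: ab; near: e; exact: nbhs_right_gt.
Unshelve. all: by end_near. Qed.

Lemma avg_HLmax f (Q : @cube R n) x : (0 < Q.2)%R -> cset Q x ->
  avg (cset Q) (abse \o f) <= HLmax f x.
Proof. by move=> h0 Qx; apply: ereal_sup_ubound; exists Q. Qed.

Lemma avg_abs_ge0 A f : 0 <= avg A (abse \o f).
Proof. by apply: avg_ge0 => x /=. Qed.

Lemma avg_abs_le A f g : measurable A -> Lmeas f -> Lmeas g ->
  (\forall y \ae mu, `|f y| <= `|g y|) -> avg A (abse \o f) <= avg A (abse \o g).
Proof.
move=> mA mf mg fg; apply: avg_le => //=; [exact: Lmeas_abse|exact: Lmeas_abse|].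
by apply: filterS fg => y + _.
Qed.

Lemma HLmax_ge0 f x : 0 <= HLmax f x.
Proof.
apply: (@le_trans _ _ (avg (cset (ccube x 1)) (abse \o f))); first exact: avg_abs_ge0.
apply: avg_HLmax; rewrite ?mulr_gt0//=.
by apply: box_ccube => i; rewrite subrr normr0.
Qed.

(* Every cube is approximated from outside by cubes with rational data, so the
   supremum in [HLmax] can be taken over a countable family. *)
Definition ravgc f (q : ratcube) (x : E) : \bar R :=
  if ((0 < (rcube q : @cube R n).2)%R)
  then avg (cset (rcube q)) (abse \o f) * chi (cset (rcube q)) x else 0.

Lemma ravgc_ge0 f q x : 0 <= ravgc f q x.
Proof.
by rewrite /ravgc; case: (_ < _)%R => //; rewrite mule_ge0 ?chi_ge0// avg_abs_ge0.
Qed.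

Lemma HLmaxE f x : Lmeas f -> HLmax f x = ereal_sup [set ravgc f q x | q in setT].
Proof.
move=> mf; apply/eqP; rewrite eq_le; apply/andP; split; last first.
  apply: ge_ereal_sup => _ [q _ <-]; rewrite /ravgc; case: ifP => [q0|_]; last exact: HLmax_ge0.
  case: (pselect (cset (rcube q) x)) => qx.
    by rewrite chi1// mule1; exact: avg_HLmax.
  by rewrite chi0// mule0; exact: HLmax_ge0.
apply: ge_ereal_sup => _ [Q [h0 Qx] <-].
set s := ereal_sup _.
have sq e : (0 < e)%R -> \int[mu]_(y in cset Q) `|f y| <= s * ((Q.2 + e) ^+ n)%:E.
  move=> e0; have [q [q0 Qq qe]] := rcube_approx h0 e0.
  apply: (@le_trans _ _ (\int[mu]_(y in cset (rcube q)) `|f y|)).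
    exact: (int_sub (measurable_cset Q) (measurable_cset _) (Lmeas_abse mf)
      (fun y => abse_ge0 (f y)) Qq).
  rewrite int_cset// muleC; apply: lee_pmul => //.
  - exact: avg_abs_ge0.
  - by rewrite lee_fin exprn_ge0// ltW.
  - apply: ereal_sup_ubound; exists q => //.
    by rewrite /ravgc q0 chi1 ?mule1//; exact: Qq.
  - by rewrite lee_fin lerXn2r ?nnegrE ?(ltW q0) ?(ltW qe)// addr_ge0 ?ltW.
have s0 : 0 <= s.
  by apply: le_trans (ravgc_ge0 f ([ffun=> 0%R], 0%R) x) _; apply: ereal_sup_ubound; exists ([ffun=> 0%R], 0%R).
rewrite avg_cset// -lee_pdivlMl// ?invrK; last by rewrite invr_gt0 exprn_gt0.
have i0 : 0 <= \int[mu]_(y in cset Q) `|f y| by exact: integral_ge0.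
have [soo|sfin] := eqVneq s +oo.
  by rewrite soo gt0_muley ?leey// lte_fin exprn_gt0.
have {}sfin : s \is a fin_num by rewrite ge0_fin_numE// lt_neqAle sfin leey.
have ifin : \int[mu]_(y in cset Q) `|f y| \is a fin_num.
  rewrite ge0_fin_numE//; apply: le_lt_trans (sq 1%R _) _ => //.
  by rewrite -(fineK sfin) -EFinM ltry.
move: sq; rewrite /comp -(fineK sfin) -(fineK ifin) => sq.
rewrite -EFinM lee_fin mulrC; apply: exprn_right_le => e /sq.
by rewrite -EFinM lee_fin.
Qed.

Lemma measurable_ravgc f q : Lmeas (ravgc f q).
Proof.
rewrite /ravgc; case: (_ < _)%R; last exact: Lmeas_cst.
exact/LmeasZ/measurable_chi/measurable_cset.
Qed.

Lemma measurable_ereal_sup (I : countType) d (T : measurableType d)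
    (h : I -> T -> \bar R) : (forall i, measurable_fun setT (h i)) ->
  measurable_fun setT (fun x => ereal_sup [set h i x | i in setT]).
Proof.
move=> mh; apply: (measurability _ (ErealGenOInfty.measurableE R)) => //.
move=> _ [_ [r ->] <-]; rewrite setTI.
rewrite (_ : _ @^-1` _ = \bigcup_(i in setT) (h i @^-1` `]r%:E, +oo[)).
  apply: countable_bigcup_measurable => [|i _]; first exact: countableP.
  by rewrite -[X in measurable X]setTI; apply: mh => //; exact: emeasurable_itv.
apply/seteqP; split => x /=; rewrite in_itv/= andbT.
  by move/ereal_sup_gt => [_ [i _ <-] ri]; exists i => //=; rewrite in_itv/= andbT.
move=> [i _ /=]; rewrite in_itv/= andbT => /lt_le_trans; apply.
by apply: ereal_sup_ubound; exists i.
Qed.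

Lemma measurable_HLmax f : Lmeas f -> Lmeas (HLmax f).
Proof.
move=> mf; rewrite /Lmeas (_ : HLmax f = fun x => ereal_sup [set ravgc f q x | q in setT]).
  by apply: measurable_ereal_sup => q; exact: measurable_ravgc.
by apply/funext => x; exact: HLmaxE.
Qed.

Lemma HLmax_le f g x : Lmeas f -> Lmeas g ->
  (\forall y \ae mu, `|f y| <= `|g y|) -> HLmax f x <= HLmax g x.
Proof.
move=> mf mg fg; apply: ge_ereal_sup => _ [Q [h0 Qx] <-].
apply: le_trans (avg_HLmax _ h0 Qx); apply: avg_abs_le => //.
exact: measurable_cset.
Qed.

Lemma HLmaxZ f (c : R) x : Lmeas f -> HLmax (fun y => c%:E * f y) x = `|c|%:E * HLmax f x.
Proof.
move=> mf.
have H (d : R) (g : E -> \bar R) : Lmeas g ->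
    HLmax (fun y => d%:E * g y) x <= `|d|%:E * HLmax g x.
  move=> mg; apply: ge_ereal_sup => _ [Q [h0 Qx] <-].
  rewrite (_ : abse \o _ = fun y => `|d|%:E * (abse \o g) y); last first.
    by apply/funext => y /=; rewrite abseM.
  rewrite avgZ//=; [|exact: measurable_cset|exact: Lmeas_abse].
  by apply: lee_wpmul2l; [rewrite lee_fin|exact: avg_HLmax].
have [->|c0] := eqVneq c 0%R.
  rewrite normr0 mul0e; apply/eqP; rewrite eq_le HLmax_ge0 andbT.
  apply: le_trans (H _ _ mf) _; by rewrite normr0 mul0e.
apply/eqP; rewrite eq_le H//=.
have mcf : Lmeas (fun y => c%:E * f y) by exact: emeasurable_funM.
have := H c^-1%R _ mcf.
rewrite (_ : (fun y => _ * (_ * _)) = f); last first.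
  by apply/funext => y; rewrite muleA -EFinM mulVf// mul1e.
by rewrite normfV lee_pdivlMl// normr_gt0.
Qed.

Lemma HLmax_series (f : nat -> E -> \bar R) x : (forall k, Lmeas (f k)) ->
    (forall k y, 0 <= f k y) ->
  HLmax (fun y => \sum_(0 <= k <oo) f k y) x <= \sum_(0 <= k <oo) HLmax (f k) x.
Proof.
move=> mf f0; apply: ge_ereal_sup => _ [Q [h0 Qx] <-].
rewrite /avg (_ : \int[mu]_(y in _) _ =
   \int[mu]_(y in cset Q) \sum_(0 <= k <oo) f k y); last first.
  by apply: eq_integral => y _; rewrite /= gee0_abs// nneseries_ge0.
rewrite integral_nneseries//; last 2 first.
- exact: measurable_cset.
- by move=> k; apply: measurable_funTS; exact: mf.
rewrite -nneseriesZl; last by move=> k _; exact: integral_ge0.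
apply: lee_nneseries => [k _ _|k _].
  by rewrite mule_ge0 ?integral_ge0// lee_fin invr_ge0 fine_ge0.
apply: le_trans (avg_HLmax _ h0 Qx); rewrite /avg le_eqVlt; apply/orP; left; apply/eqP.
by congr (_ * _); apply: eq_integral => y _; rewrite /= gee0_abs.
Qed.

Lemma int_cset_avg0 f (Q : @cube R n) : (0 < Q.2)%R -> Lmeas f ->
  avg (cset Q) (abse \o f) = 0 -> \forall x \ae mu, cset Q x -> f x = 0.
Proof.
move=> h0 mf a0.
have := @ae_zero_int R n (cset Q) (abse \o f) (measurable_cset _) (Lmeas_abse mf).
rewrite int_cset// a0 mule0 => /(_ (fun x => abse_ge0 (f x)) erefl).
by apply: filterS => x H /H /= /eqP; rewrite abse_eq0 => /eqP.
Qed.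

Definition qcube (k : nat) : @cube R n := ccube 0%R k.+1%:R.

Lemma qcube_gt0 k : (0 < (qcube k).2)%R.
Proof. by rewrite /= mulr_gt0. Qed.

Lemma in_qcube x : exists k0 : nat, forall k, (k0 <= k)%N -> cset (qcube k) x.
Proof.
have S0 : (0 <= \sum_(i < n) `|coord x i|)%R by exact: sumr_ge0.
have := archi_boundP S0; set k0 := Num.bound _ => k0P.
exists k0 => k k0k; apply: box_ccube => i.
rewrite /coord mxE subr0; apply: (@le_lt_trans _ _ (\sum_(i < n) `|coord x i|)%R).
  by rewrite (bigD1 i)//= lerDl sumr_ge0.
by apply: lt_trans k0P _; rewrite ltr_nat.
Qed.

Lemma ae_qcube (P : E -> Prop) :
  (forall k, \forall x \ae mu, cset (qcube k) x -> P x) -> \forall x \ae mu, P x.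
Proof.
move=> H; have := @ae_foralln _ _ _ mu (fun k x => cset (qcube k) x -> P x) H.
by apply: filterS => x HP; have [k0 /(_ k0 (leqnn _)) Qx] := in_qcube x; exact: HP Qx.
Qed.

Lemma HLmax_eq0 f x : Lmeas f -> HLmax f x = 0 -> \forall y \ae mu, f y = 0.
Proof.
move=> mf Mf0; apply: ae_qcube => k.
have [k0 k0x] := in_qcube x.
have h0 := qcube_gt0 (maxn k k0).
have Qx : cset (qcube (maxn k k0)) x by apply: k0x; rewrite leq_maxr.
have : avg (cset (qcube (maxn k k0))) (abse \o f) = 0.
  by apply/eqP; rewrite eq_le avg_abs_ge0 ?andbT// -Mf0; exact: avg_HLmax.
move/(int_cset_avg0 h0 mf); apply: filterS => y + Qy; apply.
apply/ccubeP => i; move/ccubeP : Qy => /(_ i).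
have : (k.+1%:R <= (maxn k k0).+1%:R :> R)%R by rewrite ler_nat ltnS leq_maxl.
move: (_.+1%:R)%R (_.+1%:R)%R (coord _ _) (coord _ _) => a b u v ab /andP[? ?].
by apply/andP; split; lra.
Qed.

Lemma HLmax_gt0 f x : Lmeas f -> ~ (\forall y \ae mu, f y = 0) -> 0 < HLmax f x.
Proof.
move=> mf f0; rewrite lt_neqAle HLmax_ge0 andbT; apply/eqP => /esym /HLmax_eq0.
by move=> /(_ mf).
Qed.

Section multimax.
Context {m : nat}.
Implicit Types F G : 'I_m -> E -> \bar R.

Lemma avg_multimax F z r x : (0 < r)%R -> eball z r x ->
  \prod_(i < m) avg (eball z r) (abse \o F i) <= multimax F x.
Proof. by move=> r0 zx; apply: ereal_sup_ubound; exists (z, r). Qed.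

Lemma prod_avg_ge0 (A : set E) F :
  0 <= \prod_(i < m) avg A (abse \o F i).
Proof. by apply: prode_ge0 => i _; exact: avg_abs_ge0. Qed.

Lemma eball_center (x : E) r : (0 < r)%R -> eball x r x.
Proof.
by move=> r0; rewrite /eball/= big1 ?sqrtr0// => i _; rewrite subrr expr0n.
Qed.

Lemma multimax_ge0 F x : 0 <= multimax F x.
Proof.
apply: le_trans (avg_multimax F ltr01 (eball_center x ltr01)).
exact: prod_avg_ge0.
Qed.

(** Lower semicontinuity: the superlevel sets are open, since a ball that competes at [x] also
    competes at all points near [x]. *)
Lemma measurable_multimax F : Lmeas (multimax F).
Proof.
apply: (measurability _ (ErealGenOInfty.measurableE R)) => //.
move=> _ [_ [r ->] <-]; rewrite setTI; apply: open_box_measurable => x /=.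
rewrite in_itv/= andbT => /ereal_sup_gt[_ [[z s] /= [s0 zx] <-] rF].
have [e e0 ezs] := eball_open zx.
exists e => // y /ezs zy; rewrite /= in_itv/= andbT.
by apply: lt_le_trans rF _; exact: avg_multimax.
Qed.

Lemma multimax_le F G x : (forall i, Lmeas (F i)) -> (forall i, Lmeas (G i)) ->
  (forall i, \forall y \ae mu, `|F i y| <= `|G i y|) -> multimax F x <= multimax G x.
Proof.
move=> mF mG FG; apply: ge_ereal_sup => _ [[z r] /= [r0 zx] <-].
apply: le_trans (avg_multimax _ r0 zx).
apply: lee_prode => [i _|i _]; first exact: avg_abs_ge0.
by apply: avg_abs_le => //; exact: measurable_eball.
Qed.

Lemma multimaxZ F (c : 'I_m -> R) x : (forall i, Lmeas (F i)) ->
    (forall i, (0 <= c i)%R) ->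
  multimax (fun i y => (c i)%:E * F i y) x <= \prod_(i < m) (c i)%:E * multimax F x.
Proof.
move=> mF c0; apply: ge_ereal_sup => _ [[z r] /= [r0 zx] <-].
apply: (@le_trans _ _ (\prod_(i < m) ((c i)%:E * avg (eball z r) (abse \o F i)))).
  apply: lee_prode => [i _|i _]; first exact: avg_abs_ge0.
  rewrite -avgZ//=; [|exact: measurable_eball|exact: Lmeas_abse].
  rewrite le_eqVlt; apply/orP; left; apply/eqP; congr avg.
  by apply/funext => y /=; rewrite abseM /= ger0_norm.
rewrite big_split /=; apply: lee_wpmul2l; last exact: avg_multimax.
by apply: prode_ge0 => i _; rewrite lee_fin.
Qed.

(** A cube containing [x] lies in the ball about [x] of radius [n] times its side, whose volume is
    at most [(2 n)^n] times that of the cube; each of the [m] averages pays this ratio once. *)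
Lemma cube_multimax F (Q : @cube R n) x : (0 < n)%N -> (0 < Q.2)%R -> cset Q x ->
  (forall i, Lmeas (F i)) ->
  \prod_(i < m) avg (cset Q) (abse \o F i) <=
  (((2 * n%:R) ^+ n) ^+ m)%:E * multimax F x.
Proof.
move=> n0 h0 Qx mF; set r := (n%:R * Q.2)%R.
have r0 : (0 < r)%R by rewrite mulr_gt0 ?ltr0n.
have -> : (((2 * n%:R) ^+ n) ^+ m)%:E = \prod_(i < m) ((2 * n%:R) ^+ n)%:E :> \bar R.
  by rewrite prodEFin prodr_const card_ord.
apply: (@le_trans _ _ (\prod_(i < m) (((2 * n%:R) ^+ n)%:E *
    avg (eball x r) (abse \o F i)))).
  apply: lee_prode => [i _|i _]; first exact: avg_abs_ge0.
  rewrite avg_cset// lee_pdivrMl ?exprn_gt0//.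
  apply: (@le_trans _ _ (\int[mu]_(y in eball x r) `|F i y|)).
    apply: (int_sub (measurable_cset Q) (measurable_eball x r) (Lmeas_abse (mF i))).
      by move=> y; exact: abse_ge0.
    exact: cset_sub_eball.
  rewrite int_avg; [|exact: measurable_eball|exact: leb_eball_gt0|exact: leb_eball_fin].
  rewrite [leRHS]muleA; apply: lee_wpmul2r; first exact: avg_abs_ge0.
  apply: le_trans (leb_eball_le _ r0) _.
  by rewrite -EFinM -exprMn /r le_eqVlt; apply/orP; left; apply/eqP; congr ((_ ^+ _)%:E)%R; ring.
rewrite big_split /=; apply: lee_wpmul2l; last exact: avg_multimax (eball_center _ r0).
by apply: prode_ge0 => i _; rewrite lee_fin exprn_ge0// mulr_ge0.
Qed.

(** On a large enough centred cube all [m] averages are positive at once. This positivity later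
    shows that operator norms are nonzero, so that no [0 * oo] arises. *)
Lemma multimax_gt0 F x : (0 < n)%N -> (forall i, Lmeas (F i)) ->
  (forall i, ~ (\forall y \ae mu, F i y = 0)) -> 0 < multimax F x.
Proof.
move=> n0 mF F0.
have /choice[k kP] : forall i : 'I_m, exists k, forall j, (k <= j)%N ->
    0 < avg (cset (qcube j)) (abse \o F i).
  move=> i; apply: contrapT => H; apply: (F0 i); apply: ae_qcube => k.
  have : exists2 j, (k <= j)%N & avg (cset (qcube j)) (abse \o F i) = 0.
    apply: contrapT => H2; apply: H; exists k => j kj.
    rewrite lt_neqAle avg_abs_ge0// andbT; apply/eqP => a0; apply: H2.
    by exists j.
  move=> [j kj /(int_cset_avg0 (qcube_gt0 _) (mF i))]; apply: filterS => y + Qy; apply.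
  apply/ccubeP => l; move/ccubeP : Qy => /(_ l).
  have : (k.+1%:R <= j.+1%:R :> R)%R by rewrite ler_nat.
  move: (_.+1%:R)%R (_.+1%:R)%R (coord _ _) (coord _ _) => a b u v ab /andP[? ?].
  by apply/andP; split; lra.
have [k0 k0x] := in_qcube x.
pose K := maxn k0 (\max_(i < m) k i).
have Qx : cset (qcube K) x by apply: k0x; rewrite leq_maxl.
have c0 : (0 < ((2 * n%:R) ^+ n) ^+ m :> R)%R by rewrite !exprn_gt0// mulr_gt0// ltr0n.
have := cube_multimax n0 (qcube_gt0 K) Qx mF.
rewrite -lee_pdivrMl// => /(lt_le_trans _); apply.
rewrite mule_gt0// ?lte_fin ?invr_gt0//; apply: prode_gt0 => i _; apply: kP.
by rewrite leq_max (leq_bigmax i) orbT.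
Qed.

End multimax.

End maximal_operators.

(** * Stopping cubes and mean oscillation *)

Section dyadic_subcubes.
Context {R : realType} {n : nat}.
Local Notation E := (Rn R n).
Local Notation mu := (leb R n).
Variable P : @cube R n.
Hypothesis P0 : (0 < P.2)%R.

(** A generation together with an integer position. Positions are unbounded naturals, which keeps
    the index type countable and non-dependent; the cube lies in [P] exactly for the positions
    [idx k x] of points [x] of [P]. *)
Definition didx : Type := (nat * {ffun 'I_n -> nat})%type.

Definition dcube (q : didx) : @cube R n :=
  (\row_i (coord P.1 i + (q.2 i)%:R * (P.2 / 2 ^+ q.1)), P.2 / 2 ^+ q.1)%R.

Definition idx (k : nat) (x : E) : {ffun 'I_n -> nat} :=
  [ffun i => Num.truncn ((coord x i - coord P.1 i) / P.2 * 2 ^+ k)].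

Lemma dcube_gt0 q : (0 < (dcube q).2)%R.
Proof. by rewrite /= divr_gt0// exprn_gt0. Qed.

Lemma coord_dcube q i :
  coord (dcube q).1 i = (coord P.1 i + (q.2 i)%:R * (P.2 / 2 ^+ q.1))%R.
Proof. by rewrite {1}/coord mxE. Qed.

Lemma coord_dcubeS k v i : (coord (dcube (k, v)).1 i + (dcube (k, v)).2 =
  coord P.1 i + (v i).+1%:R * (P.2 / 2 ^+ k))%R.
Proof. by rewrite coord_dcube /= -[(v i).+1]addn1 natrD mulrDl mul1r addrA. Qed.

Lemma leb_setU_le (A B : set E) a b : measurable A -> measurable B ->
  mu A <= a -> mu B <= b -> mu (A `|` B) <= a + b.
Proof.
move=> mA mB Aa Bb; apply: le_trans (leeD Aa Bb).
exact: (@measureU2 _ _ _ mu A B mA mB).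
Qed.

Lemma pos_in_cube x i : cset P x -> (0 <= (coord x i - coord P.1 i) / P.2 < 1)%R.
Proof.
move=> /(_ i) /andP[? ?]; rewrite divr_ge0 ?subr_ge0 ?(ltW P0)//=.
by rewrite ltr_pdivrMr// mul1r ltrBlDl.
Qed.

Lemma dcubeP k v x : cset P x -> (cset (dcube (k, v)) x <-> v = idx k x).
Proof.
move=> Px; have p2 : (0 < 2 ^+ k :> R)%R by rewrite exprn_gt0.
have e w i : (coord (dcube (k, w)).1 i <= coord x i < coord (dcube (k, w)).1 i + (dcube (k, w)).2)%R =
    ((w i)%:R <= (coord x i - coord P.1 i) / P.2 * 2 ^+ k < (w i).+1%:R)%R.
  rewrite coord_dcubeS coord_dcube /= -lerBrDl -ltrBlDl.
  have -> : ((coord x i - coord P.1 i) / P.2 * 2 ^+ k =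
      (coord x i - coord P.1 i) / (P.2 / 2 ^+ k))%R by rewrite invf_div mulrA mulrAC.
  by rewrite ler_pdivlMr ?ltr_pdivrMr ?divr_gt0.
split=> [vx|-> i].
  apply/ffunP => i; rewrite ffunE; symmetry; apply: truncn_def.
  by rewrite -e; exact: vx.
rewrite e ffunE; apply: truncn_itv; rewrite mulr_ge0 ?exprn_ge0//.
by have /andP[] := pos_in_cube i Px.
Qed.

Lemma idx_lt k x i : cset P x -> (idx k x i < 2 ^ k)%N.
Proof.
move=> Px; have /andP[t0 t1] := pos_in_cube i Px.
have p2 : (0 < 2 ^+ k :> R)%R by rewrite exprn_gt0.
rewrite ffunE -(ltr_nat R) natrX.
apply: (@le_lt_trans _ _ ((coord x i - coord P.1 i) / P.2 * 2 ^+ k)%R).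
  by rewrite truncn_le; apply: mulr_ge0; rewrite ?exprn_ge0.
by rewrite gtr_pMl.
Qed.

Lemma dcube_sub k x : cset P x -> cset (dcube (k, idx k x)) `<=` cset P.
Proof.
move=> Px y + i => /(_ i); have := idx_lt k i Px; rewrite coord_dcubeS coord_dcube /=.
move: (idx k x i) => v vk /andP[y1 y2].
have p2 : (0 < 2 ^+ k :> R)%R by rewrite exprn_gt0.
have h0 : (0 < P.2 / 2 ^+ k)%R by rewrite divr_gt0.
apply/andP; split; first by apply: le_trans y1; rewrite lerDl mulr_ge0// ltW.
apply: lt_le_trans y2 _; rewrite lerD2l.
by rewrite mulrA ler_pdivrMr// mulrC ler_pM2l// -natrX ler_nat.
Qed.

Lemma idx_in k x : cset P x -> cset (dcube (k, idx k x)) x.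
Proof. by move=> Px; apply/dcubeP. Qed.

Lemma idx_coarse j k x y : (j <= k)%N -> cset P x -> cset P y ->
  idx k x = idx k y -> idx j x = idx j y.
Proof.
move=> jk Px Py xy; apply/ffunP => i.
have H z : cset P z -> idx j z i = (idx k z i %/ 2 ^ (k - j))%N.
  move=> Pz; rewrite !ffunE; have /andP[t0 t1] := pos_in_cube i Pz.
  move: (_ / _)%R t0 => t t0; apply: truncn_def.
  have p2 : (0 < 2 ^+ (k - j) :> R)%R by rewrite exprn_gt0.
  have tk : (t * 2 ^+ k = t * 2 ^+ j * 2 ^+ (k - j) :> R)%R.
    by rewrite -mulrA -exprD subnKC.
  have := @truncn_itv R (t * 2 ^+ k); rewrite mulr_ge0 ?exprn_ge0// => /(_ isT).
  move: (Num.truncn _) => N; rewrite tk; move: (t * 2 ^+ j)%R => s /andP[N1 N2].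
  apply/andP; split.
    rewrite -(ler_pM2r p2); apply: le_trans N1.
    by rewrite -natrX -natrM ler_nat leq_trunc_div.
  rewrite -(ltr_pM2r p2); apply: lt_le_trans N2 _.
  by rewrite -natrX -natrM ler_nat ltn_ceil// expn_gt0.
by rewrite !H// xy.
Qed.

Lemma idx0 x : cset P x -> idx 0 x = [ffun=> 0%N].
Proof.
move=> Px; apply/ffunP => i; have := idx_lt 0 i Px; rewrite expn0 ltnS leqn0 => /eqP ->.
by rewrite ffunE.
Qed.

Lemma dcube0 x : cset P x -> dcube (0%N, idx 0 x) = P.
Proof.
move=> Px; rewrite idx0// /dcube/= expr0 divr1 [RHS]surjective_pairing; congr pair.
by apply/rowP => i; rewrite mxE ffunE mul0r addr0.
Qed.

Definition dunion (k : nat) (D : set {ffun 'I_n -> nat}) : set E :=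
  [set x | D (idx k x)].

Lemma measurable_dunion k D : measurable (cset P `&` dunion k D).
Proof.
rewrite (_ : _ `&` _ = \bigcup_(v in D) (cset P `&` cset (dcube (k, v)))).
  apply: countable_bigcup_measurable => [|v _]; first exact: countableP.
  by apply: measurableI; exact: measurable_cset.
apply/seteqP; split => [x [Px Dx]|x [v Dv [Px xv]]].
  by exists (idx k x) => //; split => //; exact: idx_in.
by split => //; move/dcubeP : xv; rewrite /dunion/= => <-.
Qed.

Definition symdiff (A B : set E) := (A `\` B) `|` (B `\` A).

(* Approximation by unions of dyadic subcubes of one generation; it plays the role
   of the Lebesgue differentiation theorem. *)
Definition dapprox (A : set E) : Prop := measurable (cset P `&` A) /\
  forall e : R, (0 < e)%R -> exists k D,
    mu (cset P `&` symdiff A (dunion k D)) <= e%:E.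

Lemma symdiff_setI A B (C : set E) : C `&` symdiff A B =
  ((C `&` A) `\` (C `&` B)) `|` ((C `&` B) `\` (C `&` A)).
Proof.
apply/seteqP; split => [x [Cx [[Ax Bx]|[Bx Ax]]]|x [[[Cx Ax] Bx]|[[Cx Bx] Ax]]].
- by left; split => // -[].
- by right; split => // -[].
- by split => //; left; split => // ?; apply: Bx.
- by split => //; right; split => // ?; apply: Ax.
Qed.

Lemma measurable_symdiff A k D : measurable (cset P `&` A) ->
  measurable (cset P `&` symdiff A (dunion k D)).
Proof.
move=> mA; rewrite symdiff_setI.
by apply: measurableU; apply: measurableD => //; exact: measurable_dunion.
Qed.

Lemma dapprox_eq A B : cset P `&` A = cset P `&` B -> dapprox A -> dapprox B.
Proof.
move=> AB [mA Ae]; split=> [|e e0]; first by rewrite -AB.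
have [k [D kD]] := Ae e e0; exists k, D.
by rewrite symdiff_setI -AB -symdiff_setI.
Qed.

Lemma dapprox_dunion k D : dapprox (dunion k D).
Proof.
split=> [|e e0]; first exact: measurable_dunion.
exists k, D; rewrite symdiff_setI setDv setU0 measure0 lee_fin; exact: ltW.
Qed.

Lemma dapproxC A : dapprox A -> dapprox (~` A).
Proof.
move=> [mA Ae]; split=> [|e e0].
  rewrite -setDE (_ : _ `\` _ = cset P `\` (cset P `&` A)).
    by apply: measurableD => //; exact: measurable_cset.
  by rewrite setDIr setDv set0U.
have [k [D kD]] := Ae e e0; exists k, (~` D).
suff -> : symdiff (~` A) (dunion k (~` D)) = symdiff A (dunion k D) by [].
apply/seteqP; split => [x [[Ax Bx]|[Bx Ax]]|x [[Ax Bx]|[Bx Ax]]].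
- by right; split => //; exact: contrapT.
- by left; split => //; exact: contrapT.
- by right; split => //.
- by left; split => //.
Qed.

Lemma dunion_refine k K D : (k <= K)%N -> exists D', forall x, cset P x ->
  (dunion K D' x <-> dunion k D x).
Proof.
move=> kK; exists [set v | exists x, [/\ cset P x, v = idx K x & dunion k D x]] => x Px.
split=> [[y [Py xy Dy]]|Dx]; last by exists x.
by rewrite /dunion/= (idx_coarse kK Px Py xy).
Qed.

Lemma dapproxU A B : dapprox A -> dapprox B -> dapprox (A `|` B).
Proof.
move=> [mA Ae] [mB Be]; split=> [|e e0].
  by rewrite setIUr; exact: measurableU.
have e20 : (0 < e / 2)%R by rewrite divr_gt0.
have [k1 [D1 kD1]] := Ae _ e20; have [k2 [D2 kD2]] := Be _ e20.
have [D1' D1P] := dunion_refine D1 (leq_maxl k1 k2).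
have [D2' D2P] := dunion_refine D2 (leq_maxr k1 k2).
exists (maxn k1 k2), (D1' `|` D2').
apply: (@le_trans _ _ (mu ((cset P `&` symdiff A (dunion k1 D1)) `|`
    (cset P `&` symdiff B (dunion k2 D2))))).
  apply: le_measure; rewrite ?inE.
  - by apply: measurable_symdiff; rewrite setIUr; exact: measurableU.
  - by apply: measurableU; exact: measurable_symdiff.
  move=> x [Px]; have := D1P x Px; have := D2P x Px; rewrite /symdiff /dunion /=.
  move=> D2x D1x; case; last first.
    move=> [[/D1x d1|/D2x d2] /not_orP[nA nB]]; [left|right]; split => //; right; split => //.
  move=> [[Ax|Bx] /not_orP[n1 n2]]; [left|right]; split => //; left; split => //.
    by move=> /D1x.
  by move=> /D2x.
rewrite [X in _ <= X%:E](splitr e) EFinD.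
by apply: leb_setU_le => //; exact: measurable_symdiff.
Qed.

Lemma leb_sub_cset A : measurable A -> A `<=` cset P -> mu A \is a fin_num.
Proof.
move=> mA AP; rewrite ge0_fin_numE//; apply: le_lt_trans (leb_cset_fin P0).
by apply: le_measure; rewrite ?inE//; exact: measurable_cset.
Qed.

(** Inside [P], which has finite measure, finite unions exhaust the countable union up to [e / 2] by
    continuity from below, and finite unions are approximated already. *)
Lemma dapprox_bigcup (A : nat -> set E) : (forall i, dapprox (A i)) ->
  dapprox (\bigcup_i A i).
Proof.
move=> Ai; have mA : measurable (cset P `&` \bigcup_i A i).
  by rewrite setI_bigcupr; apply: bigcup_measurable => i _; exact: (Ai i).1.
split=> // e e0.
have e20 : (0 < e / 2)%R by rewrite divr_gt0.
pose F m := \big[setU/set0]_(i < m) A i.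
have aF m : dapprox (F m).
  rewrite /F; elim: m => [|m IH]; last by rewrite big_ord_recr; exact: dapproxU.
  rewrite big_ord0; apply: dapprox_eq (dapprox_dunion 0 set0).
  by congr setI; apply/seteqP; split.
have ndF : nondecreasing_seq (fun m => cset P `&` F m).
  move=> a b ab; apply/subsetPset; apply: setIS.
  rewrite /F -!bigcup_mkord => x [i /= ia Aix]; exists i => //=.
  exact: leq_trans ab.
have UF : \bigcup_m (cset P `&` F m) = cset P `&` \bigcup_i A i.
  rewrite -setI_bigcupr; congr setI; apply/seteqP; split => x.
    by move=> [m _]; rewrite /F -bigcup_mkord => -[i _ ?]; exists i.
  by move=> [i _ Aix]; exists i.+1 => //; rewrite /F -bigcup_mkord; exists i => /=.
have := @nondecreasing_cvg_mu _ E R mu (fun m => cset P `&` F m) (fun m => (aF m).1).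
rewrite UF => /(_ mA ndF) cv.
have [m Fm] : exists m, mu (cset P `&` \bigcup_i A i) - (e / 2)%:E <= mu (cset P `&` F m).
  apply: contrapT => H.
  have : mu (cset P `&` \bigcup_i A i) <= mu (cset P `&` \bigcup_i A i) - (e / 2)%:E.
    rewrite -{1}(cvg_lim _ cv)//; apply: lime_le; first by apply/cvg_ex; eexists; exact: cv.
    apply: nearW => k; rewrite leNgt; apply/negP => ?; apply: H; exists k; exact: ltW.
  rewrite leNgt => /negP; apply; rewrite lteBlDr// lteDl//.
  by apply: leb_sub_cset => // x [].
have [k [D kD]] := (aF m).2 _ e20; exists k, D.
apply: (@le_trans _ _ (mu (((cset P `&` \bigcup_i A i) `\` (cset P `&` F m)) `|`
    (cset P `&` symdiff (F m) (dunion k D))))).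
  apply: le_measure; rewrite ?inE.
  - exact: measurable_symdiff.
  - apply: measurableU; last by apply: measurable_symdiff; exact: (aF m).1.
    by apply: measurableD => //; exact: (aF m).1.
  move=> x [Px [[Ax Ux]|[Ux Ax]]].
    have [Fx|Fx] := pselect (F m x); first by right; split => //; left.
    by left; split => // -[].
  right; split => //; right; split => // Fx; apply: Ax.
  by move: Fx; rewrite /F -bigcup_mkord => -[i _ ?]; exists i.
rewrite [X in _ <= X%:E](splitr e) EFinD.
apply: leb_setU_le => //.
- by apply: measurableD => //; exact: (aF m).1.
- by apply: measurable_symdiff; exact: (aF m).1.
rewrite measureD//; last 2 first.
- exact: (aF m).1.
- by rewrite -ge0_fin_numE//; apply: leb_sub_cset => // x [].
rewrite (@setIidr _ _ (cset P `&` F m)); last first.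
  by rewrite -UF => x ?; exists m.
rewrite leeBlDr; last by apply: leb_sub_cset; [exact: (aF m).1|move=> x []].
by rewrite -leeBlDl.
Qed.

(** Within [P], the half-space is the countable union of the dyadic cells that it contains entirely:
    a point with [coord x i < t] has a cell of side below [t - coord x i]. *)
Lemma dapprox_coord_lt (i : 'I_n) (t : R) : dapprox [set x | coord x i < t]%R.
Proof.
pose U k := dunion k [set v | (coord P.1 i + (v i).+1%:R * (P.2 / 2 ^+ k) <= t)%R].
apply: (@dapprox_eq (\bigcup_k U k)); last first.
  by apply: dapprox_bigcup => k; exact: dapprox_dunion.
apply/seteqP; split => [x [Px [k _ Ux]]|x [Px xt]]; split => //.
  move: Ux; rewrite /U/dunion/= => kt; apply: lt_le_trans kt; have /(dcubeP k _ Px)/(_ i) := erefl (idx k x).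
  by rewrite coord_dcubeS => /andP[].
rewrite /= in xt; have [k kt] : exists k, (P.2 / 2 ^+ k < t - coord x i)%R.
  have tx : (0 < t - coord x i)%R by rewrite subr_gt0.
  have q0 : (0 <= P.2 / (t - coord x i))%R by rewrite divr_ge0// ltW.
  exists (Num.bound (P.2 / (t - coord x i))).
  have := archi_boundP q0; set k := Num.bound _ => kP.
  rewrite ltr_pdivrMr ?exprn_gt0// mulrC -ltr_pdivrMr//.
  by apply: lt_trans kP _; rewrite -natrX ltr_nat ltn_expl.
exists k => //=; have /(dcubeP k _ Px)/(_ i) := erefl (idx k x).
rewrite coord_dcube /= => /andP[+ _].
rewrite /U /dunion /= -[(idx k x i).+1]addn1 natrD mulrDl mul1r.
move: (P.2 / 2 ^+ k)%R kt => d.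
by move: (coord x i) (coord P.1 i) (_ * _)%R => a b c; lra.
Qed.

(** Sets with dyadic approximation form a sigma-algebra. It is compared with the generators in two
    stages: preimages under each coordinate, then open half-lines. *)
Lemma dapprox_borel (A : set (borel_row R n)) : measurable A -> dapprox A.
Proof.
move: A; apply: smallest_sub; first split.
- by apply: dapprox_eq (dapprox_dunion 0 set0); congr setI; apply/seteqP; split.
- by move=> A aA; rewrite setTD; exact: dapproxC.
- by move=> A aA; exact: dapprox_bigcup.
move=> A; rewrite -bigcup_seq => -[i _ [B mB <-]]; rewrite setTI.
move: B mB; rewrite RGenInftyO.measurableE; apply: smallest_sub; first split.
- by rewrite /= preimage_set0; apply: dapprox_eq (dapprox_dunion 0 set0); congr setI; apply/seteqP; split.
- by move=> B aB; rewrite /= setTD preimage_setC; exact: dapproxC.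
- by move=> B aB; rewrite /= preimage_bigcup; exact: dapprox_bigcup.
move=> _ [t ->] /=; apply: dapprox_eq (dapprox_coord_lt i t).
by congr setI; apply/seteqP; split => x /=; rewrite in_itv.
Qed.

(** By the definition of the outer measure, a Lebesgue measurable subset of [P] is covered by a
    Borel set with excess at most [e / 2]; that Borel set is then approximated. *)
Lemma dapprox_measurable (A : set E) : measurable A -> dapprox A.
Proof.
move=> mA; have mPA : measurable (cset P `&` A).
  by apply: measurableI => //; exact: measurable_cset.
split=> // e e0; have e20 : (0 < e / 2)%R by rewrite divr_gt0.
have fPA : mu (cset P `&` A) \is a fin_num by apply: leb_sub_cset => // x [].
have : ereal_inf [set \sum_(0 <= k <oo) borel_lebesgue R n (B k) | B in
   @measurable_cover _ (borel_row R n) (cset P `&` A)] < mu (cset P `&` A) + (e / 2)%:E.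
  by rewrite -[ltLHS]/(mu (cset P `&` A)) lteDl// lte_fin.
move=> /ereal_inf_lt[_ [B [mB AB] <-]] Be.
pose B' : set E := \bigcup_k B k.
have mB' : measurable (\bigcup_k B k : set (borel_row R n)).
  exact: bigcup_measurable.
have [mB'E B'E] := borel_rowE mB'.
have B'e : mu (B' `\` (cset P `&` A)) <= (e / 2)%:E.
  have muB : mu B' <= mu (cset P `&` A) + (e / 2)%:E.
    apply: le_trans (ltW Be); rewrite B'E.
    exact: measure_sigma_subadditive.
  rewrite measureD//; last by apply: le_lt_trans muB _; rewrite -ge0_fin_numE ?adde_ge0 ?fin_numD ?fPA// lee_fin ltW.
  by rewrite setIidr// leeBlDl.
have [k [D kD]] := (dapprox_borel mB').2 _ e20; exists k, D.
apply: (@le_trans _ _ (mu ((B' `\` (cset P `&` A)) `|`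
    (cset P `&` symdiff B' (dunion k D))))).
  apply: le_measure; rewrite ?inE.
  - exact: measurable_symdiff.
  - apply: measurableU; first exact: measurableD.
    by apply: measurable_symdiff; exact: (dapprox_borel mB').1.
  move=> x [Px [[Ax Ux]|[Ux Ax]]].
    by right; split => //; left; split => //; exact: AB.
  have [Bx|Bx] := pselect (B' x); first by left; split => // -[].
  by right; split => //; right.
rewrite [X in _ <= X%:E](splitr e) EFinD.
apply: leb_setU_le => //; first exact: measurableD.
by apply: measurable_symdiff; exact: (dapprox_borel mB').1.
Qed.

End dyadic_subcubes.

Section stopping.
Context {R : realType} {n : nat}.
Local Notation E := (Rn R n).
Local Notation mu := (leb R n).
Variables (P : @cube R n) (f : E -> \bar R) (lam : R).
Hypotheses (P0 : (0 < P.2)%R) (mf : Lmeas f) (f0 : forall x, 0 <= f x) (lam0 : (0 <= lam)%R).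

(** The Calderon-Zygmund cubes of [f] at height [lam]: maximal dyadic subcubes of [P] with large
    average. The point [x] certifies that the cube lies in [P] and names its ancestors; generation
    zero, that is [P] itself, is allowed. *)
Definition stop : set (@didx n) := [set q | exists x, [/\ cset P x, q.2 = idx P q.1 x,
  lam%:E < avg (cset (dcube P q)) f &
  forall j, (j < q.1)%N -> avg (cset (dcube P (j, idx P j x))) f <= lam%:E]].

Definition stopped : set E := \bigcup_(q in stop) cset (dcube P q).

Lemma countable_didx (S : set (@didx n)) : countable S.
Proof. exact: countableP. Qed.

Lemma measurable_stopped : measurable stopped.
Proof.
apply: countable_bigcup_measurable => [|q _]; first exact: countable_didx.
exact: measurable_cset.
Qed.

Lemma stop_sub q : stop q -> cset (dcube P q) `<=` cset P.
Proof. by case: q => k v [x [Px /= -> _ _]]; exact: dcube_sub. Qed.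

Lemma stopped_sub : stopped `<=` cset P.
Proof. by move=> x [q /stop_sub]; exact. Qed.

Lemma stop_triv : trivIset stop (fun q => cset (dcube P q)).
Proof.
have H q q' y : stop q -> stop q' -> cset (dcube P q) y -> cset (dcube P q') y ->
    (q.1 < q'.1)%N -> False.
  case: q q' => [k v] [k' v'] sq sq' qy qy' /= kk'.
  have Py := stop_sub sq qy.
  case: sq => /= x [Px vx vlam _]; case: sq' => /= x' [Px' vx' _] /(_ _ kk').
  have xy : idx P k' x' = idx P k' y by rewrite -vx'; apply/dcubeP.
  rewrite (idx_coarse P0 (ltnW kk') Px' Py xy).
  by move/dcubeP : qy => /(_ P0 Py) <-; rewrite leNgt vlam.
move=> q q' sq sq' [y [qy q'y]].
case: (ltngtP q.1 q'.1) => [/(H _ _ _ sq sq' qy q'y)//|/(H _ _ _ sq' sq q'y qy)//|].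
have Py := stop_sub sq qy.
case: q q' sq sq' qy q'y => [k v] [k' v'] /= sq sq' qy q'y kk'; subst k'.
by move/dcubeP : qy => /(_ P0 Py) ->; move/dcubeP : q'y => /(_ P0 Py) ->.
Qed.

Lemma not_stopped x k : cset P x -> ~ stopped x ->
  avg (cset (dcube P (k, idx P k x))) f <= lam%:E.
Proof.
move=> Px nx; rewrite leNgt; apply/negP => kx; apply: nx.
have ex : exists k, `[< lam%:E < avg (cset (dcube P (k, idx P k x))) f >].
  by exists k; apply/asboolP.
have := ex_minnP ex => -[j /asboolP jx jmin].
exists (j, idx P j x); last exact: idx_in.
exists x; split => // i ij; rewrite leNgt; apply/negP => ix.
by have := jmin i; move/asboolP : ix => /[swap] /[apply]; rewrite leqNgt ij.
Qed.

Lemma leb_stopped : lam%:E * mu stopped <= \int[mu]_(x in cset P) f x.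
Proof.
have mdc q : measurable (cset (dcube P q)) by exact: measurable_cset.
apply: (@le_trans _ _ (\esum_(q in stop) \int[mu]_(x in cset (dcube P q)) f x)); last first.
  apply: esum_int_le => //; [exact: measurable_cset|exact: stop_triv|exact: stop_sub].
have -> : lam%:E * mu stopped = \int[mu]_(x in stopped) (cst lam%:E x).
  by rewrite integral_cst//; exact: measurable_stopped.
apply: le_trans (int_bigcup_le mu (countable_didx stop) mdc (measurable_cst _) _) _ => //.
apply: le_esum => q [x [Px qx qlam _]].
rewrite integral_cst// int_cset; last exact: dcube_gt0.
rewrite leb_cset; last exact: dcube_gt0.
rewrite muleC; apply: lee_wpmul2l; last exact: ltW.
by rewrite lee_fin exprn_ge0// ltW// dcube_gt0.
Qed.

(** This replaces differentiation. Let [U] be the union of the chosen cells that meet [A], and [V]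
    the intersection of [A] and [U]. Each cell contains a point that is not stopped, so its average
    is at most [lam], whereas [f >= lam + d] on [A]. Hence [(lam + d) |V| <= lam |U| <= lam (|V| +
    e)], which gives [|V| <= lam e / d]; and [A] exceeds [V] by measure at most [e]. *)
Lemma density_le (A : set E) (k : nat) (D : set {ffun 'I_n -> nat}) (d e : R) :
    (0 < d)%R -> (0 < e)%R -> measurable A -> A `<=` cset P ->
    (forall x, A x -> ~ stopped x) ->
    (forall x, A x -> (lam + d)%:E <= f x) ->
    mu (cset P `&` symdiff A (dunion P k D)) <= e%:E ->
  mu A <= (e + lam * e / d)%:E.
Proof.
move=> d0 e0 mA AP As Af AD.
pose D' := [set v | D v /\ exists2 x, A x & v = idx P k x].
pose U := \bigcup_(v in D') cset (dcube P (k, v)).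
have cD' : countable D' by exact: countableP.
have mdc v : measurable (cset (dcube P (k, v))) by exact: measurable_cset.
have mU : measurable U by exact: countable_bigcup_measurable.
have UP : U `<=` cset P.
  by move=> y [v [Dv [x Ax ->]]]; apply: dcube_sub => //; exact: AP.
have tU : trivIset D' (fun v => cset (dcube P (k, v))).
  move=> v v' Dv Dv' [y [yv yv']].
  have Py : cset P y by apply: UP; exists v.
  by move/dcubeP : yv => /(_ P0 Py) ->; move/dcubeP : yv' => /(_ P0 Py) ->.
have mAU : measurable (A `&` U) by exact: measurableI.
have fAU : mu (A `&` U) \is a fin_num.
  by apply: (@leb_sub_cset _ _ P) => // x [/AP].
have mPD : measurable (cset P `&` symdiff A (dunion P k D)).
  by apply: measurable_symdiff => //; apply: measurableI => //; exact: measurable_cset.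
have UID (X Y : set E) : X = (X `&` Y) `|` (X `\` Y).
  by apply/seteqP; split => [x Xx|x [[]|[]]//]; have [?|?] := pselect (Y x); [left|right].
have h1 : mu A <= mu (A `&` U) + e%:E.
  rewrite {1}(UID A U); apply: leb_setU_le => //.
    exact: measurableD.
  apply: le_trans AD; apply: le_measure; rewrite ?inE//; first exact: measurableD.
  move=> x [Ax Ux]; split; first exact: AP.
  left; split => // Dx; apply: Ux; exists (idx P k x); first by split => //; exists x.
  by apply: idx_in => //; exact: AP.
have h2 : mu U <= mu (A `&` U) + e%:E.
  rewrite {1}(UID U A) [X in mu X + _]setIC; apply: leb_setU_le => //.
  - by rewrite setIC.
  - exact: measurableD.
  apply: le_trans AD; apply: le_measure; rewrite ?inE//; first exact: measurableD.
  move=> x [Ux Ax]; split; first exact: UP.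
  right; split => //; case: (Ux) => v [Dv _] xv; rewrite /dunion/=.
  by move/dcubeP : xv => /(_ P0 (UP _ Ux)) <-.
have h3 : (lam + d)%:E * mu (A `&` U) <= lam%:E * mu U.
  apply: (@le_trans _ _ (\int[mu]_(x in A `&` U) f x)).
    rewrite -integral_cst//; apply: int_le => //; first exact: Lmeas_cst.
      by move=> x; rewrite lee_fin addr_ge0// ltW.
    by move=> x [/Af].
  apply: (@le_trans _ _ (\int[mu]_(x in U) f x)).
    by apply: int_sub.
  apply: le_trans (int_bigcup_le mu cD' mdc mf f0) _.
  rewrite -integral_cst//; apply: le_trans (esum_int_le (F := fun v => cset (dcube P (k, v)))
     mu mU (fun v _ => mdc v) (measurable_cst _) _ tU _).
  - apply: le_esum => v [Dv [x Ax vx]]; rewrite integral_cst// int_cset; last exact: dcube_gt0.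
    rewrite leb_cset; last exact: dcube_gt0.
    rewrite muleC; apply: lee_wpmul2r; first by rewrite lee_fin exprn_ge0// ltW// dcube_gt0.
    by rewrite vx; apply: not_stopped; [exact: AP|exact: As].
  - by move=> x; rewrite lee_fin.
  - by move=> v Dv y yv; exists v.
have : (lam + d)%:E * mu (A `&` U) <= lam%:E * (mu (A `&` U) + e%:E).
  by apply: le_trans h3 _; apply: lee_wpmul2l.
move: h1; rewrite -(fineK fAU); move: (fine _) => a h1.
rewrite -EFinD -!EFinM lee_fin => h4; apply: le_trans h1 _.
rewrite -EFinD lee_fin [leRHS]addrC lerD2r ler_pdivlMr//.
by move: h4; rewrite mulrDl mulrDr lerD2l mulrC.
Qed.

Lemma ae_le_stopping : \forall x \ae mu, cset P x -> ~ stopped x -> f x <= lam%:E.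
Proof.
pose A j : set E := (cset P `\` stopped) `&` [set x | (lam + j.+1%:R^-1)%:E <= f x].
have mA j : measurable (A j).
  apply: measurableI; first by apply: measurableD; [exact: measurable_cset|exact: measurable_stopped].
  rewrite -[X in measurable X]setTI; exact: emeasurable_fun_c_infty.
have A0 j : mu (A j) = 0.
  have d0 : (0 < j.+1%:R^-1 :> R)%R by rewrite invr_gt0.
  apply/eqP; rewrite eq_le measure_ge0 andbT; apply/lee_addgt0Pr => e e0; rewrite add0e.
  (* Chosen so that the bound of [density_le], [e' + lam e' / d] with [d = 1 / (j + 1)], equals
     [e]. *)
  pose e' := (e / (1 + lam / j.+1%:R^-1))%R.
  have c0 : (0 < 1 + lam / j.+1%:R^-1)%R by rewrite ltr_wpDr// divr_ge0// ltW.
  have e'0 : (0 < e')%R by rewrite divr_gt0.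
  have [k [D kD]] := (dapprox_measurable P0 (mA j)).2 _ e'0.
  have := @density_le (A j) k D _ _ d0 e'0 (mA j).
  have -> : (e' + lam * e' / j.+1%:R^-1 = e)%R.
    by rewrite mulrAC -{1}(mul1r e') -mulrDl mulrC divfK// gt_eqF.
  by apply => // x [[]].
exists (\bigcup_j A j); split.
- exact: bigcup_measurable.
- apply/eqP; rewrite eq_le measure_ge0 andbT.
  apply: le_trans (measure_sigma_subadditive _ _ _ (subset_refl _)) _.
  + exact: mA.
  + exact: bigcup_measurable.
  + by [].
  by rewrite (eq_eseriesr (g := fun=> 0)) ?eseries0// => j _; exact: A0.
move=> x /= /not_implyP[Px /not_implyP[sx /negP]]; rewrite -ltNge => lx.
have [j jx] : exists j : nat, (lam + j.+1%:R^-1)%:E <= f x.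
  have [->|fx] := eqVneq (f x) +oo; first by exists 0%N; rewrite leey.
  have {}fx : f x \is a fin_num by rewrite ge0_fin_numE// lt_neqAle fx leey.
  move: lx; rewrite -(fineK fx) lte_fin -subr_gt0 => lx.
  have q0 : (0 <= (fine (f x) - lam)^-1)%R by rewrite invr_ge0 ltW.
  have := archi_boundP q0; set j := Num.bound _ => jP; exists j.
  rewrite lee_fin -lerBrDl invf_ple ?posrE//.
  by apply: ltW; apply: lt_trans jP _; rewrite ltr_nat.
by exists j.
Qed.

End stopping.

Section maximal_on_large_subset.
Context {R : realType} {n : nat}.
Local Notation E := (Rn R n).
Local Notation mu := (leb R n).

(** On the whole of [Q] the maximal function is at least the average of [h], so the mass of [h] on
    [Q] can be moved into any subset of proportion [t] at the price of [1 / t] and one [HLmax]. *)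
Lemma int_cube_HLmax (Q : @cube R n) (A : set E) (h : E -> \bar R) (t : R) :
    (0 < Q.2)%R -> measurable A -> A `<=` cset Q -> Lmeas h -> (forall x, 0 <= h x) ->
    (0 <= t)%R -> t%:E * mu (cset Q) <= mu A ->
  t%:E * \int[mu]_(x in cset Q) h x <= \int[mu]_(x in A) HLmax h x.
Proof.
move=> Q0 mA AQ mh h0 t0 tA; rewrite int_cset// -leb_cset//.
have habs : abse \o h = h by apply/funext => x /=; rewrite gee0_abs.
have a0 : 0 <= avg (cset Q) h by exact: avg_ge0.
apply: (@le_trans _ _ (\int[mu]_(x in A) (cst (avg (cset Q) h) x))).
  rewrite integral_cst// muleA [leRHS]muleC; exact: lee_wpmul2r.
apply: int_le => //; [exact: Lmeas_cst|exact: measurable_HLmax|].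
by move=> x /AQ Qx; rewrite /= -{1}habs; exact: avg_HLmax.
Qed.

Definition HLiter (k : nat) (g : E -> \bar R) : E -> \bar R := iter k (@HLmax R n) g.

Lemma HLiterS k g : HLiter k.+1 g = HLmax (HLiter k g).
Proof. by []. Qed.

Lemma measurable_HLiter k g : Lmeas g -> Lmeas (HLiter k g).
Proof. by move=> mg; elim: k => // k IH; exact: measurable_HLmax. Qed.

Lemma HLiter_ge0 k g : (forall x, 0 <= g x) -> forall x, 0 <= HLiter k g x.
Proof. by move=> g0; case: k => // k x; exact: HLmax_ge0. Qed.

(** An integrated form of [g <= HLmax g], free of differentiation: the average over [Q] is a lower
    bound for [HLmax] on [Q]. *)
Lemma int_cube_HLiter (Q : @cube R n) k g : (0 < Q.2)%R -> Lmeas g -> (forall x, 0 <= g x) ->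
  \int[mu]_(x in cset Q) g x <= \int[mu]_(x in cset Q) HLiter k g x.
Proof.
move=> Q0 mg g0; elim: k => // k IH; apply: le_trans IH _.
have := @int_cube_HLmax Q (cset Q) (HLiter k g) 1%R Q0.
rewrite !mul1e; apply => //; [exact: measurable_cset|exact: measurable_HLiter|exact: HLiter_ge0].
Qed.

End maximal_on_large_subset.

Lemma measurable_sum_dist d (T : measurableType d) (R : realType) l
    (f : 'I_l -> T -> R) (c w : 'I_l -> R) : (forall s, measurable_fun setT (f s)) ->
  measurable_fun setT (fun x => \sum_(s < l) `|f s x - c s| / w s)%R.
Proof.
move=> mf; apply: measurable_sum => s; apply: measurable_funM => //.
by apply: measurableT_comp => //; exact: measurable_funB.
Qed.

Lemma measurable_sub_cst d (T : measurableType d) (R : realType)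
    (f : T -> R) (c : R) : measurable_fun setT f ->
  measurable_fun setT (fun x => f x - c)%R.
Proof. by move=> mf; exact: measurable_funB. Qed.

Section oscillation.
Context {R : realType} {n l : nat}.
Local Notation E := (Rn R n).
Local Notation mu := (leb R n).
Variables (b : 'I_l -> E -> R) (beta : 'I_l -> R).
Hypotheses (bloc : forall s, locally_int (b s)).
Hypotheses (bbeta : forall s, bmo_norm (b s) <= (beta s)%:E) (beta0 : forall s, (0 < beta s)%R).

Lemma cset_compact (Q : @cube R n) : exists K : set 'rV[R]_n, [/\ compact K,
  measurable (K : set E) & (cset Q : set 'rV[R]_n) `<=` K].
Proof.
exists [set v : 'rV[R]_n | forall i, `[coord Q.1 i, (coord Q.1 i + Q.2)%R]%classic (v ord0 i)].
split.
- apply: (@rV_compact R n (fun i => `[coord Q.1 i, (coord Q.1 i + Q.2)%R]%classic)).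
  by move=> i; exact: segment_compact.
- exact: (leb_box (fun i => measurable_itv `[coord Q.1 i, (coord Q.1 i + Q.2)%R])).1.
- by move=> x Qx i; have /andP[? /ltW ?] := Qx i; rewrite /= in_itv/=; apply/andP; split.
Qed.

Lemma locally_int_cset (c : E -> R) (Q : @cube R n) : locally_int c ->
  mu.-integrable (cset Q) (EFin \o c).
Proof.
move=> [mc lc]; have [K [cK mK QK]] := cset_compact Q.
apply/integrableP; split; first by apply: measurable_funTS; exact: Lmeas_fin.
apply: le_lt_trans (lc _ cK).
exact: (int_sub (measurable_cset Q) mK (Lmeas_abse (Lmeas_fin mc)) (fun x => abse_ge0 _) QK).
Qed.

Lemma ravgP (c : E -> R) (Q : @cube R n) : (0 < Q.2)%R -> locally_int c ->
  (ravg Q c)%:E = avg (cset Q) (EFin \o c).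
Proof.
move=> Q0 lc; rewrite /ravg fineK// /avg fin_numM//.
exact: (integrable_fin_num (measurable_cset Q) (locally_int_cset Q lc)).
Qed.

Lemma ravg_dist (c : E -> R) (Q : @cube R n) (a : R) : (0 < Q.2)%R -> locally_int c ->
  `|(ravg Q c - a)%:E| <= avg (cset Q) (fun y => `|(c y - a)%:E|).
Proof.
move=> Q0 lc; have ic := locally_int_cset Q lc.
have mQ := measurable_cset Q.
have ia : mu.-integrable (cset Q) (EFin \o cst a).
  apply/integrableP; split; first exact: (measurable_funTS (Lmeas_cst a%:E)).
  rewrite (eq_integral (cst `|a|%:E))// integral_cst// leb_cset// -EFinM; exact: ltry.
have -> : (ravg Q c - a)%:E = avg (cset Q) (fun y => (c y - a)%:E).
  rewrite EFinB ravgP// !avg_cset//.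
  have -> : \int[mu]_(y in cset Q) (c y - a)%:E =
      \int[mu]_(y in cset Q) (EFin \o c) y - \int[mu]_(y in cset Q) (EFin \o cst a) y.
    rewrite -integralB//.
  have fi := integrable_fin_num mQ ic.
  have -> : \int[mu]_(y in cset Q) (EFin \o cst a) y = (a * Q.2 ^+ n)%:E.
    by rewrite -[LHS]/(\int[mu]_(y in cset Q) cst a%:E y) integral_cst// leb_cset// EFinM.
  case: (\int[mu]_(x in cset Q) (EFin \o c) x) fi => [r _| |]//.
  change ((Q.2 ^- n * r - a)%:E = (Q.2 ^- n * (r - a * Q.2 ^+ n))%:E)%R.
  congr (_%:E); rewrite mulrBr; congr (_ - _)%R.
  by rewrite mulrCA mulVf ?mulr1// gt_eqF// exprn_gt0.
rewrite !avg_cset// abseM gee0_abs; last by rewrite lee_fin invr_ge0 exprn_ge0// ltW.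
apply: lee_wpmul2l; first by rewrite lee_fin invr_ge0 exprn_ge0// ltW.
apply: le_abse_integral => //; apply: measurable_funTS; apply: Lmeas_fin.
exact: measurable_sub_cst lc.1.
Qed.

(** Summing the oscillations, each divided by a bound of its BMO norm, gives one scalar function
    whose powers dominate all products of oscillations; the stopping time is thus run once for all
    symbols. *)
Definition osc (P : @cube R n) (x : E) : R :=
  (\sum_(s < l) `|b s x - ravg P (b s)| / beta s)%R.

Lemma osc_ge0 P x : (0 <= osc P x)%R.
Proof. by apply: sumr_ge0 => s _; rewrite divr_ge0// ltW. Qed.

Lemma measurable_osc P : measurable_fun setT (osc P).
Proof.
exact: (measurable_sum_dist (fun s => ravg P (b s)) beta (fun s => (bloc s).1)).
Qed.

Lemma osc_term s P x : (`|b s x - ravg P (b s)| <= beta s * osc P x)%R.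
Proof.
rewrite mulrC -ler_pdivrMr// /osc (bigD1 s)//= lerDl.
by apply: sumr_ge0 => t _; rewrite divr_ge0// ltW.
Qed.

Lemma osc_sum (Q P : @cube R n) : avg (cset Q) (EFin \o osc P) =
  \sum_(s < l) (beta s)^-1%:E * avg (cset Q) (fun y => `|(b s y - ravg P (b s))%:E|).
Proof.
have mb s : Lmeas (fun y => `|(b s y - ravg P (b s))%:E|).
  apply: Lmeas_abse; apply: Lmeas_fin; exact: measurable_sub_cst (bloc s).1.
rewrite /avg (_ : \int[mu]_(x in _) _ = \int[mu]_(x in cset Q)
   \sum_(s < l) (beta s)^-1%:E * `|(b s x - ravg P (b s))%:E|); last first.
  apply: eq_integral => x _; rewrite /osc /= -sumEFin.
  by apply: eq_bigr => s _; rewrite mulrC EFinM.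
rewrite ge0_integral_sum; last 3 first.
- exact: measurable_cset.
- by move=> s; apply: measurable_funTS; apply: LmeasZ; exact: mb.
- by move=> s x _; rewrite mule_ge0// lee_fin invr_ge0 ltW.
rewrite ge0_sume_distrr; last first.
  move=> s _; apply: integral_ge0 => x _; by rewrite mule_ge0// lee_fin invr_ge0 ltW.
apply: eq_bigr => s _; rewrite ge0_integralZl.
- by rewrite muleCA.
- exact: measurable_cset.
- by apply: measurable_funTS; exact: mb.
- by move=> x _; exact: abse_ge0.
- by rewrite lee_fin invr_ge0 ltW.
Qed.

Lemma avg_osc (P : @cube R n) : (0 < P.2)%R -> avg (cset P) (EFin \o osc P) <= l%:R%:E.
Proof.
move=> P0; rewrite osc_sum.
apply: (@le_trans _ _ (\sum_(s < l) 1)); last first.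
  by rewrite sumEFin lee_fin sumr_const card_ord.
apply: lee_sum => s _; rewrite -lee_pdivlMl ?invr_gt0// invrK mule1.
by apply: le_trans (bbeta s); apply: ereal_sup_ubound; exists P.
Qed.

Lemma osc_sub (Q P : @cube R n) x (a : R) : (0 < Q.2)%R ->
  avg (cset Q) (EFin \o osc P) <= a%:E -> (osc P x <= osc Q x + a)%R.
Proof.
move=> Q0; rewrite osc_sum => Qa.
apply: (@le_trans _ _ (osc Q x + \sum_(s < l) `|ravg Q (b s) - ravg P (b s)| / beta s)%R).
  rewrite /osc -big_split /=; apply: ler_sum => s _; rewrite -mulrDl.
  rewrite ler_pM2r ?invr_gt0//; apply: le_trans (ler_normD _ _).
  by rewrite addrA subrK.
rewrite lerD2l -lee_fin -sumEFin; apply: le_trans Qa.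
apply: lee_sum => s _; rewrite mulrC EFinM; apply: lee_wpmul2l.
  by rewrite lee_fin invr_ge0 ltW.
exact: ravg_dist.
Qed.

(** The average of [osc P] over [P] is at most [l]; the threshold [2 l + 1] makes the stopped set
    fill at most half of [P] and excludes [P] as its own stopping cube. The factor [2^n] in [oc] is
    the volume ratio of a dyadic cube and its child. *)
Definition lam : R := (2 * l%:R + 1)%R.
Definition oc : R := (2 ^+ n * lam)%R.

Lemma lam_gt0 : (0 < lam)%R.
Proof. by rewrite /lam ltr_wpDl// mulr_ge0. Qed.

Lemma lam_oc : (lam <= oc)%R.
Proof. by rewrite /oc ler_peMl ?(ltW lam_gt0)// exprn_ege1// ler1n. Qed.

Lemma oc_gt0 : (0 < oc)%R.
Proof. exact: lt_le_trans lam_gt0 lam_oc. Qed.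

Definition ostop (P : @cube R n) := stop P (EFin \o osc P) lam.
Definition ostopped (P : @cube R n) := stopped P (EFin \o osc P) lam.

Lemma mosc P : Lmeas (EFin \o osc P).
Proof. by apply: Lmeas_fin; exact: measurable_osc. Qed.

Lemma osc0 P x : 0 <= (EFin \o osc P) x.
Proof. by rewrite lee_fin osc_ge0. Qed.

Lemma leb_ostopped (P : @cube R n) : (0 < P.2)%R ->
  mu (ostopped P) <= 2^-1%:E * mu (cset P).
Proof.
move=> P0; have := leb_stopped P0 (mosc P) (osc0 P) (ltW lam_gt0).
rewrite int_cset// -leb_cset// -/(ostopped P).
move=> /le_trans /(_ (lee_wpmul2l _ (avg_osc P0))) => /(_ (measure_ge0 _ _)).
have fS : mu (ostopped P) \is a fin_num.
  by apply: (@leb_sub_cset _ _ P) => //; [exact: measurable_stopped|exact: stopped_sub].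
rewrite leb_cset// -(fineK fS) -!EFinM !lee_fin => h.
rewrite -(ler_pM2l lam_gt0); apply: le_trans h _.
rewrite mulrA [leLHS]mulrC ler_pM2r ?exprn_gt0// /lam.
by have : (0 <= l%:R :> R)%R by []; lra.
Qed.

Lemma esum_ostop_le (P : @cube R n) h : (0 < P.2)%R -> Lmeas h -> (forall x, 0 <= h x) ->
  \esum_(q in ostop P) \int[mu]_(x in cset (dcube P q)) h x <=
  \int[mu]_(x in ostopped P) h x.
Proof.
move=> P0 mh h0.
apply: (esum_int_le (F := fun q => cset (dcube P q)) mu (measurable_stopped P _ _)
  (fun q _ => measurable_cset (dcube P q)) mh h0) => //.
  exact: stop_triv.
by move=> q sq x xq; exists q.
Qed.

(** The parent of a stopping cube has average at most [lam], and passing to a child multiplies the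
    average of a nonnegative function by at most [2^n]. Generation zero does not occur, because
    [l < lam]. *)
Lemma avg_ostop (P : @cube R n) q : (0 < P.2)%R -> ostop P q ->
  avg (cset (dcube P q)) (EFin \o osc P) <= oc%:E.
Proof.
move=> P0; case: q => k v [x [Px /= vx kl jl]].
case: k vx kl jl => [|k] vx kl jl.
  move: kl; rewrite vx dcube0// => /lt_le_trans /(_ (avg_osc P0)).
  rewrite lte_fin /lam => h; exfalso; have : (0 <= l%:R :> R)%R by [].
  by move: h; lra.
have := jl k (ltnSn _).
rewrite !avg_cset ?dcube_gt0//= => h.
have p2 : (0 < P.2 / 2 ^+ k :> R)%R by rewrite divr_gt0// exprn_gt0.
have -> : (P.2 / 2 ^+ k.+1 = (P.2 / 2 ^+ k) / 2)%R by rewrite exprSr invfM mulrA.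
rewrite exprMn exprVn invfM invrK [X in X%:E]mulrC EFinM -muleA /oc EFinM.
apply: lee_wpmul2l; first by rewrite lee_fin exprn_ge0.
apply: le_trans h; apply: lee_wpmul2l; first by rewrite lee_fin invr_ge0 exprn_ge0// ltW.
apply: int_sub; [exact: measurable_cset|exact: measurable_cset|exact: mosc|exact: osc0|].
have vP : cset (dcube P (k.+1, v)) `<=` cset P by rewrite vx; exact: dcube_sub.
move=> y yv; have Py := vP _ yv.
apply/dcubeP => //; apply: (@idx_coarse _ _ P P0 k k.+1) => //.
by rewrite -vx; apply/dcubeP.
Qed.

Lemma osc_ostop (P : @cube R n) q x : (0 < P.2)%R -> ostop P q ->
  (1 + osc P x / oc <= 1 + (1 + osc (dcube P q) x / oc))%R.
Proof.
move=> P0 sq; rewrite lerD2l.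
have := osc_sub x (dcube_gt0 P0 q) (avg_ostop P0 sq).
rewrite -(ler_pM2r (x := oc^-1%R)) ?invr_gt0 ?oc_gt0//.
by rewrite mulrDl divff ?gt_eqF ?oc_gt0// [leRHS]addrC.
Qed.

(* The points of [P] that lie in at most [J] nested generations of stopping cubes. *)
Fixpoint ogood (J : nat) (P : @cube R n) : set E :=
  if J is J'.+1 then
    (cset P `\` ostopped P) `|` \bigcup_(q in ostop P) ogood J' (dcube P q)
  else set0.

Lemma measurable_ogood J P : measurable (ogood J P).
Proof.
elim: J P => [|J IH] P; first exact: measurable0.
apply: measurableU; last by apply: countable_bigcup_measurable => //; exact: countable_didx.
by apply: measurableD; [exact: measurable_cset|exact: measurable_stopped].
Qed.

Lemma ogood_sub J P : (0 < P.2)%R -> ogood J P `<=` cset P.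
Proof.
elim: J P => [|J IH] P P0; first exact: sub0set.
move=> x [[]//|[q sq xq]]; apply: (stop_sub P0 sq); exact: (IH _ (dcube_gt0 P0 q)) xq.
Qed.

Lemma ogood_nd J P : ogood J P `<=` ogood J.+1 P.
Proof.
elim: J P => [|J IH] P; first exact: sub0set.
by move=> x [xP|[q sq /IH xq]]; [left|right; exists q].
Qed.

Lemma leb_ogood J P : (0 < P.2)%R ->
  mu (cset P `\` ogood J P) <= (2^-1 ^+ J)%:E * mu (cset P).
Proof.
elim: J P => [|J IH] P P0.
  by rewrite expr0 mul1e setD0.
have mdc q : measurable (cset (dcube P q)) by exact: measurable_cset.
have mdg q : measurable (cset (dcube P q) `\` ogood J (dcube P q)).
  by apply: measurableD => //; exact: measurable_ogood.
have c0 : (0 <= 2^-1 ^+ J :> R)%R by rewrite exprn_ge0// invr_ge0.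
apply: (@le_trans _ _ (mu (\bigcup_(q in ostop P) (cset (dcube P q) `\` ogood J (dcube P q))))).
  apply: le_measure; rewrite ?inE.
  - apply: measurableD; [exact: measurable_cset|exact: (measurable_ogood J.+1)].
  - by apply: countable_bigcup_measurable => //; exact: countable_didx.
  move=> x [Px /not_orP[/not_andP nx1 nx2]].
  have [q sq xq] : ostopped P x.
    by apply: contrapT => ?; case: nx1.
  by exists q => //; split => // xg; apply: nx2; exists q.
rewrite exprSr EFinM -muleA.
apply: le_trans (lee_wpmul2l _ (leb_ostopped P0)) => //.
have mU : measurable (\bigcup_(q in ostop P) (cset (dcube P q) `\` ogood J (dcube P q))).
  by apply: countable_bigcup_measurable => //; exact: countable_didx.
rewrite -[leLHS]mul1e -integral_cst//.
apply: le_trans (int_bigcup_le mu (countable_didx (ostop P)) mdg (Lmeas_cst 1) _) _ => //.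
rewrite -integral_cst; last exact: measurable_stopped.
apply: (@le_trans _ _ (\esum_(q in ostop P) \int[mu]_(x in cset (dcube P q)) (cst (2^-1 ^+ J)%:E x))).
  apply: le_esum => q sq; rewrite !integral_cst// mul1e; apply: IH; exact: dcube_gt0.
by apply: (esum_ostop_le P0 (Lmeas_cst (2^-1 ^+ J)%:E)) => x; rewrite lee_fin.
Qed.

(** The recursion is read off from [int_ogood]: [2^(k+1)] comes from the unstopped part, where
    [onum <= 2], and [(2^(k+1) - 1) Cosc k] from the lower-order term of [add1_expr]; an overall
    factor [2] pays for moving mass to the unstopped half. *)
Fixpoint Cosc (k : nat) : R :=
  if k is k'.+1 then (2 * ((2 ^+ k'.+1 - 1) * Cosc k') + 2 ^+ k'.+2)%R else 1%R.

Lemma Cosc_ge0 k : (0 <= Cosc k)%R.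
Proof.
elim: k => //= k IH; rewrite addr_ge0 ?exprn_ge0// mulr_ge0// mulr_ge0//.
by rewrite subr_ge0 exprn_ege1// ler1n.
Qed.

(** Apart from the leading one, the binomial coefficients sum to [2^(k+1) - 1], and for [y >= 1] the
    powers they multiply are at most [y^k]. The leading coefficient must stay exactly [1], or the
    induction over generations would not close. *)
Lemma add1_expr (k : nat) (y : R) : (1 <= y)%R ->
  ((1 + y) ^+ k.+1 <= y ^+ k.+1 + (2 ^+ k.+1 - 1) * y ^+ k)%R.
Proof.
move=> y1; have y0 : (0 <= y)%R by lra.
elim: k => [|k IH]; first by rewrite !expr1 expr0; lra.
rewrite exprS; apply: (@le_trans _ _ ((1 + y) * (y ^+ k.+1 + (2 ^+ k.+1 - 1) * y ^+ k))%R).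
  by rewrite ler_wpM2l// addr_ge0.
have p1 : (1 <= 2 ^+ k.+1 :> R)%R by rewrite exprn_ege1// ler1n.
have yk : (y ^+ k <= y ^+ k.+1)%R by rewrite exprS ler_peMl// exprn_ge0.
rewrite [(2 ^+ k.+2)%R]exprS [(y ^+ k.+2)%R]exprS.
move: (2 ^+ k.+1)%R p1 => c p1; move: yk; rewrite [(y ^+ k.+1)%R]exprS.
have : (0 <= y ^+ k)%R by rewrite exprn_ge0.
move: (y ^+ k)%R => z z0 zy; nra.
Qed.

Definition onum (P : @cube R n) (x : E) : R := (1 + osc P x / oc)%R.

Lemma onum_ge1 P x : (1 <= onum P x)%R.
Proof. by rewrite /onum lerDl divr_ge0 ?osc_ge0// ltW ?oc_gt0. Qed.

Lemma onum_ge0 P x k : (0 <= onum P x ^+ k)%R.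
Proof. by rewrite exprn_ge0// (le_trans ler01) ?onum_ge1. Qed.

Lemma measurable_affine d (T : measurableType d) (h : T -> R) (c : R) (k : nat) :
  measurable_fun setT h -> measurable_fun setT (fun x => (1 + h x / c) ^+ k)%R.
Proof.
move=> mh; apply: measurable_funX; apply: measurable_funD => //.
exact: measurable_funM.
Qed.

Lemma monum P k (g : E -> \bar R) : Lmeas g -> Lmeas (fun x => (onum P x ^+ k)%:E * g x).
Proof.
move=> mg; apply: LmeasM => //; apply: Lmeas_fin.
exact: (measurable_affine oc k (measurable_osc P)).
Qed.

Lemma onum_g0 P k (g : E -> \bar R) : (forall x, 0 <= g x) ->
  forall x, 0 <= (onum P x ^+ k)%:E * g x.
Proof. by move=> g0 x; rewrite mule_ge0// lee_fin onum_ge0. Qed.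

Lemma int_ostop (P : @cube R n) q J k (g : E -> \bar R) :
    (0 < P.2)%R -> ostop P q -> Lmeas g -> (forall x, 0 <= g x) ->
    (forall j, (j <= k.+1)%N -> \int[mu]_(x in ogood J (dcube P q)) ((onum (dcube P q) x ^+ j)%:E * g x) <=
      (Cosc j)%:E * \int[mu]_(x in cset (dcube P q)) HLiter j g x) ->
  \int[mu]_(x in ogood J (dcube P q)) ((onum P x ^+ k.+1)%:E * g x) <=
  \int[mu]_(x in cset (dcube P q)) ((Cosc k.+1)%:E * HLiter k.+1 g x +
     ((2 ^+ k.+1 - 1) * Cosc k)%:E * HLiter k g x).
Proof.
move=> P0 sq mg g0 H; set Q := dcube P q.
have mG := measurable_ogood J Q.
have p1 : (0 <= 2 ^+ k.+1 - 1 :> R)%R by rewrite subr_ge0 exprn_ege1// ler1n.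
have mQ := measurable_cset Q.
have C0 := Cosc_ge0.
apply: (@le_trans _ _ (\int[mu]_(x in ogood J Q) (1 * ((onum Q x ^+ k.+1)%:E * g x) +
    (2 ^+ k.+1 - 1)%:E * ((onum Q x ^+ k)%:E * g x)))).
  apply: (int_le mG (monum P k.+1 mg) _ (onum_g0 P k.+1 g0)).
    by apply: LmeasD; apply: LmeasZ; exact: monum.
  move=> x _; rewrite mul1e muleA -EFinM -ge0_muleDl; last 2 first.
  - by rewrite lee_fin onum_ge0.
  - by rewrite lee_fin mulr_ge0// onum_ge0.
  apply: lee_wpmul2r => //; rewrite lee_fin.
  apply: le_trans (add1_expr k (onum_ge1 Q x)).
  rewrite lerXn2r// ?nnegrE.
  - by apply: le_trans (onum_ge1 P x).
  - by rewrite addr_ge0//; apply: le_trans (onum_ge1 Q x).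
  exact: osc_ostop.
rewrite (int_lincomb mG (monum Q k.+1 mg) (onum_g0 Q k.+1 g0) (monum Q k mg) (onum_g0 Q k g0))//.
rewrite (int_lincomb mQ (measurable_HLiter k.+1 mg) (HLiter_ge0 k.+1 g0)
  (measurable_HLiter k mg) (HLiter_ge0 k g0)); last 2 first.
- by rewrite lee_fin (C0 k.+1).
- by rewrite lee_fin mulr_ge0.
rewrite mul1e; apply: leeD; first exact: H.
by rewrite EFinM -muleA; apply: lee_wpmul2l => //; exact: H.
Qed.

(* Passing to a stopping cube raises [onum] by at most one, and the stopping cubes
   fill at most half of [P]; moving the mass on them to the other half costs one
   maximal operator, so each power of [onum] is traded for one [HLmax]. *)
Lemma int_ogood k J (P : @cube R n) (g : E -> \bar R) : (0 < P.2)%R ->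
    Lmeas g -> (forall x, 0 <= g x) ->
  \int[mu]_(x in ogood J P) ((onum P x ^+ k)%:E * g x) <=
  (Cosc k)%:E * \int[mu]_(x in cset P) HLiter k g x.
Proof.
(* Strong induction on [k] outside, induction on [J] inside: on a stopping cube the power [k + 1] is
   handled with one generation less, the power [k] by the outer hypothesis, which holds for every
   number of generations. *)
move=> + mg g0; elim/ltn_ind: k J P => -[_|k IHk] J P P0.
  rewrite mul1e; under eq_integral do rewrite expr0 mul1e.
  exact: (int_sub (measurable_ogood J P) (measurable_cset P) mg g0 (ogood_sub P0)).
elim: J P P0 => [|J IHJ] P P0.
  rewrite /= integral_set0 mule_ge0//; first by rewrite lee_fin (Cosc_ge0 k.+1).
  by apply: integral_ge0 => x _; exact: HLmax_ge0.
have mP := measurable_cset P.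
have mS : measurable (ostopped P) by exact: measurable_stopped.
set A := cset P `\` ostopped P.
have mA : measurable A by exact: measurableD.
have mM j := measurable_HLiter j mg.
have M0 j := HLiter_ge0 j g0.
have p1 : (0 <= 2 ^+ k.+1 - 1 :> R)%R by rewrite subr_ge0 exprn_ege1// ler1n.
have SP : ostopped P `<=` cset P by exact: stopped_sub.
set h := fun x => (Cosc k.+1)%:E * HLiter k.+1 g x +
     ((2 ^+ k.+1 - 1) * Cosc k)%:E * HLiter k g x.
have mh : Lmeas h by apply: LmeasD; apply: LmeasZ; exact: mM.
have h0 x : 0 <= h x.
  by rewrite adde_ge0// mule_ge0 ?M0// lee_fin ?mulr_ge0// (Cosc_ge0 k.+1, Cosc_ge0 k).
have mG q : measurable (ogood J (dcube P q)) by exact: measurable_ogood.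
have mf := monum P k.+1 mg.
have f0 := onum_g0 P k.+1 g0.
have IA : \int[mu]_(x in A) ((onum P x ^+ k.+1)%:E * g x) <=
    (2 ^+ k.+1)%:E * \int[mu]_(x in cset P) HLiter k g x.
  apply: (@le_trans _ _ (\int[mu]_(x in A) ((2 ^+ k.+1)%:E * g x))).
    apply: (int_ae_le mA mf (LmeasZ _ mg) f0).
      by move=> x; rewrite mule_ge0// lee_fin exprn_ge0.
    have := ae_le_stopping P0 (mosc P) (osc0 P) (ltW lam_gt0).
    apply: filterS => x H [Px Sx]; have := H Px Sx; rewrite lee_fin /= => ol.
    apply: lee_wpmul2r => //; rewrite lee_fin lerXn2r// ?nnegrE//.
      by apply: le_trans (onum_ge1 P x).
    rewrite /onum (natrD _ 1 1) lerD2l ler_pdivrMr ?oc_gt0// mul1r.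
    exact: le_trans ol lam_oc.
  rewrite (intZ mA mg g0); last by rewrite lee_fin exprn_ge0.
  apply: lee_wpmul2l; first by rewrite lee_fin exprn_ge0.
  apply: le_trans (int_cube_HLiter k P0 mg g0).
  by apply: (int_sub mA mP mg g0) => x [].
set B := \bigcup_(q in ostop P) ogood J (dcube P q).
have mB : measurable B.
  by apply: countable_bigcup_measurable => //; exact: countable_didx.
have IB : \int[mu]_(x in B) ((onum P x ^+ k.+1)%:E * g x) <=
    \int[mu]_(x in ostopped P) h x.
  apply: le_trans (int_bigcup_le mu (countable_didx (ostop P)) mG mf f0) _.
  apply: le_trans (esum_ostop_le P0 mh h0).
  apply: le_esum => q sq; apply: int_ostop => // j; rewrite leq_eqVlt => /orP[/eqP ->|jk].
    by apply: IHJ; exact: dcube_gt0.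
  by apply: IHk => //; exact: dcube_gt0.
have AB0 : A `&` B = set0.
  apply/seteqP; split => // x [[_ nS] [q sq xq]]; apply: nS; exists q => //.
  by apply: ogood_sub xq; exact: dcube_gt0.
rewrite (_ : ogood J.+1 P = A `|` B)// (intU mA mB mf f0 AB0).
apply: le_trans (leeD IA IB) _.
have half : 2^-1%:E * \int[mu]_(x in cset P) HLiter k g x <=
    \int[mu]_(x in A) HLiter k.+1 g x.
  apply: (int_cube_HLmax P0 mA _ (mM k) (M0 k)); [by move=> x []|by rewrite invr_ge0|].
  have -> : mu A = mu (cset P) - mu (ostopped P).
    rewrite /A measureD//; last exact: leb_cset_fin.
    by rewrite setIidr.
  have fS : mu (ostopped P) \is a fin_num by apply: (@leb_sub_cset _ _ P).
  have := leb_ostopped P0; rewrite leb_cset// -(fineK fS) -!EFinM -EFinB !lee_fin; lra.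
have {}half : \int[mu]_(x in cset P) HLiter k g x <=
    2%:E * \int[mu]_(x in A) HLiter k.+1 g x.
  by rewrite -lee_pdivrMl.
have -> : \int[mu]_(x in ostopped P) h x = (Cosc k.+1)%:E * \int[mu]_(x in ostopped P) HLiter k.+1 g x +
    ((2 ^+ k.+1 - 1) * Cosc k)%:E * \int[mu]_(x in ostopped P) HLiter k g x.
  rewrite (int_lincomb mS (mM k.+1) (M0 k.+1) (mM k) (M0 k))//.
  - by rewrite lee_fin (Cosc_ge0 k.+1).
  - by rewrite lee_fin mulr_ge0// Cosc_ge0.
have SPk : \int[mu]_(x in ostopped P) HLiter k g x <= \int[mu]_(x in cset P) HLiter k g x.
  exact: (int_sub mS mP (mM k) (M0 k) SP).
have -> : \int[mu]_(x in cset P) HLiter k.+1 g x =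
   \int[mu]_(x in A) HLiter k.+1 g x + \int[mu]_(x in ostopped P) HLiter k.+1 g x.
  rewrite -(intU mA mS (mM k.+1) (M0 k.+1)); last by rewrite /A setDE -setIA [X in _ `&` X]setIC setICr setI0.
  congr (integral mu _ _); rewrite /A; apply/seteqP; split => [x Px|x [[]//|/SP//]].
  by have [?|?] := pselect (ostopped P x); [right|left].
have i0 (D : set E) j : 0 <= \int[mu]_(x in D) HLiter j g x by apply: integral_ge0 => x _; exact: M0.
rewrite [leRHS]ge0_muleDr ?i0// [leRHS]addeC addeCA; apply: leeD => //.
apply: (@le_trans _ _ ((2 ^+ k.+1)%:E * \int[mu]_(x in cset P) HLiter k g x +
   ((2 ^+ k.+1 - 1) * Cosc k)%:E * \int[mu]_(x in cset P) HLiter k g x)).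
  by apply: leeD => //; apply: lee_wpmul2l => //; rewrite lee_fin mulr_ge0// Cosc_ge0.
rewrite -ge0_muleDl; last 2 first.
- by rewrite lee_fin exprn_ge0.
- by rewrite lee_fin mulr_ge0// Cosc_ge0.
apply: le_trans (lee_wpmul2l _ half) _.
  by rewrite -EFinD lee_fin addr_ge0 ?exprn_ge0// mulr_ge0// Cosc_ge0.
rewrite muleA -EFinD -EFinM; apply: lee_wpmul2r => //.
rewrite lee_fin /= [(2 ^+ k.+2)%R]exprS; lra.
Qed.

(** A weighted counterpart of the John-Nirenberg inequality: the power [k] of the oscillation
    integrates against [g] at the cost of [k] maximal operators on [g]. The bound on [ogood J] does
    not depend on [J], and these sets exhaust [P] a.e. because their complements have measure at
    most [2^-J |P|]. *)
Lemma int_onum k (P : @cube R n) (g : E -> \bar R) : (0 < P.2)%R ->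
    Lmeas g -> (forall x, 0 <= g x) ->
  \int[mu]_(x in cset P) ((onum P x ^+ k)%:E * g x) <=
  (Cosc k)%:E * \int[mu]_(x in cset P) HLiter k g x.
Proof.
move=> P0 mg g0; have mf := monum P k mg; have f0 := onum_g0 P k g0.
have mP := measurable_cset P.
apply: (fatou_le mP mf (F := fun J x => (onum P x ^+ k)%:E * g x * chi (ogood J P) x)).
- by move=> J; exact: (Lmeas_chi (measurable_ogood J P) mf).
- exact: f0.
- by move=> J x; rewrite mule_ge0 ?chi_ge0.
- exists (\bigcap_J (cset P `\` ogood J P)); split.
  + apply: bigcap_measurable => // J _.
    by apply: measurableD => //; exact: measurable_ogood.
  + apply/eqP; rewrite eq_le measure_ge0 andbT; apply/lee_addgt0Pr => e e0; rewrite add0e.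
    have [J Je] : exists J, (2^-1 ^+ J * P.2 ^+ n < e)%R.
      have q0 : (0 <= P.2 ^+ n / e)%R by rewrite divr_ge0 ?exprn_ge0// ltW.
      have := archi_boundP q0; set J := Num.bound _ => JP; exists J.
      rewrite exprVn ltr_pdivrMl ?exprn_gt0// mulrC -ltr_pdivrMl// mulrC.
      by apply: lt_trans JP _; rewrite -natrX ltr_nat ltn_expl.
    apply: (@le_trans _ _ (mu (cset P `\` ogood J P))).
      apply: le_measure; rewrite ?inE.
      * by apply: bigcap_measurable => // i _; apply: measurableD => //; exact: measurable_ogood.
      * by apply: measurableD => //; exact: measurable_ogood.
      * exact: bigcap_inf.
    apply: le_trans (leb_ogood J P0) _.
    by rewrite leb_cset// -EFinM lee_fin ltW.
  move=> x /not_implyP[Px xc] J _; split => // xJ; apply: xc.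
  apply: cvg_near_cst; exists J => // i /= Ji; apply/eqP; rewrite chi1 ?mule1//.
  elim: i Ji => [|i IH]; first by rewrite leqn0 => /eqP J0; rewrite -J0.
  by rewrite leq_eqVlt => /orP[/eqP <-//|/IH]; exact: ogood_nd.
move=> J; apply: le_trans (int_ogood k J P0 mg g0).
have mJ := measurable_ogood J P.
rewrite [leRHS](int_chiE _ mJ); apply: (@le_trans _ _ (\int[mu]_(x in setT) ((onum P x ^+ k)%:E * g x * chi (ogood J P) x))) => //.
by apply: (int_sub mP measurableT (Lmeas_chi mJ mf)) => // x; rewrite mule_ge0 ?chi_ge0.
Qed.

End oscillation.

(** * Sparse sums *)

Lemma esum_scale (R : realType) (I : choiceType) (S : set I) (a : I -> \bar R) (c : R) :
  countable S -> (0 <= c)%R -> (forall i, 0 <= a i) ->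
  (\esum_(i in S) a i) * c%:E = \esum_(i in S) (a i * c%:E).
Proof.
move=> /esum_enum[->|[e [B eB]]] c0 a0; first by rewrite !esum_set0 mul0e.
have ac0 i : 0 <= a i * c%:E by rewrite mule_ge0.
rewrite !(esum_series eB)// muleC -nneseriesZl.
  by apply: eq_eseriesr => k _; case: ifP => _; rewrite ?mule0// muleC.
by move=> k _; case: ifP.
Qed.

Section dyadic_lattices.
Context {R : realType} {n : nat}.
Local Notation E := (Rn R n).
Local Notation mu := (leb R n).
Hypothesis n0 : (0 < n)%N.

Lemma dyadic_subE (Q Q' : @cube R n) : (0 < Q.2)%R -> dyadic_sub Q Q' ->
  exists k, forall x, cset Q' x -> cset Q x /\ Q' = dcube Q (k, idx Q k x).
Proof.
move=> Q0 [k [j [h' c']]]; pose v := [ffun i => (j i : nat)].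
have Q'E : Q' = dcube Q (k, v).
  rewrite [Q']surjective_pairing /dcube /= h'; congr pair.
  by apply/rowP => i; rewrite mxE ffunE -c'.
have xQ : cset Q Q'.1.
  move=> i; rewrite c'; have p2 : (0 < 2 ^+ k :> R)%R by rewrite exprn_gt0.
  apply/andP; split; first by rewrite lerDl mulr_ge0// divr_ge0 ?ltW.
  rewrite ltrD2l mulrA ltr_pdivrMr// mulrC ltr_pM2l// -natrX ltr_nat.
  exact: ltn_ord.
have Q'0 : (0 < Q'.2)%R by rewrite Q'E dcube_gt0.
have x' : cset (dcube Q (k, v)) Q'.1 by rewrite -Q'E; exact: cset_nonempty.
exists k => x; rewrite Q'E => xQ'.
have Qx : cset Q x.
  by move/dcubeP : x' => /(_ Q0 xQ) vE; rewrite vE in xQ'; exact: dcube_sub xQ'.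
by split => //; move/dcubeP : xQ' => /(_ Q0 Qx) ->.
Qed.

Lemma cset_inj_side (Q Q' : @cube R n) : (0 < Q.2)%R -> (0 < Q'.2)%R ->
  cset Q = cset Q' -> Q.2 = Q'.2.
Proof.
move=> Q0 Q'0 QQ'; have := leb_cset Q0; rewrite QQ' leb_cset// => -[] /eqP.
by rewrite eqrXn2 ?(ltW Q0) ?(ltW Q'0)// => /eqP.
Qed.

(** Both cubes are dyadic in a common ancestor, where each is the cell of [x] in its generation;
    comparing the generations decides which is larger. *)
Lemma dyadic_nested (D : set (@cube R n)) Q Q' x : dyadic_lattice D -> D Q -> D Q' ->
  cset Q x -> cset Q' x -> [\/ Q = Q', cset Q `<` cset Q' | cset Q' `<` cset Q].
Proof.
move=> [D0 _ DD _] DQ DQ' Qx Q'x; have [P [DP PQ PQ']] := DD _ _ DQ DQ'.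
have P0 := D0 _ DP.
have [k kQ] := dyadic_subE P0 PQ; have [k' k'Q'] := dyadic_subE P0 PQ'.
have [Px QE] := kQ x Qx; have [_ Q'E] := k'Q' x Q'x.
have H (a b : nat) : (a < b)%N -> cset (dcube P (b, idx P b x)) `<` cset (dcube P (a, idx P a x)).
  move=> ab.
  have sub : cset (dcube P (b, idx P b x)) `<=` cset (dcube P (a, idx P a x)).
    move=> y yb; have Py := dcube_sub P0 Px yb.
    apply/dcubeP => //; apply: (idx_coarse P0 (ltnW ab)) => //.
    by apply/dcubeP.
  split=> // ba; have ab' : cset (dcube P (b, idx P b x)) = cset (dcube P (a, idx P a x)).
    exact/seteqP.
  have /= /eqP := cset_inj_side (dcube_gt0 P0 _) (dcube_gt0 P0 _) ab'.
  rewrite -subr_eq0 -mulrBr mulf_eq0 (gt_eqF P0)/= subr_eq0 (inj_eq invr_inj).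
  by apply/negP; rewrite gt_eqF// ltr_eXn2l// ltr1n.
rewrite QE Q'E; case: (ltngtP k k') => [kk'|kk'|<-].
- by apply: Or33; exact: H.
- by apply: Or32; exact: H.
- exact: Or31.
Qed.

(** A cube of the lattice is determined by a rational point in it and its side, and a common
    ancestor with a fixed cube [Q0] shows that the side is [Q0.2 2^a / 2^b] for naturals [a] and
    [b]. Each set [F q] therefore has at most one element. *)
Lemma dyadic_countable (D : set (@cube R n)) : dyadic_lattice D -> countable D.
Proof.
move=> dD; have [D0 _ DD _] := dD.
have [->|/set0P[Q0 DQ0]] := eqVneq D set0; first exact: countable0.
pose pt (q : {ffun 'I_n -> rat}) : E := (\row_i ratr (q i) : 'rV[R]_n).
pose F (q : {ffun 'I_n -> rat} * nat * nat) : set (@cube R n) :=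
  [set Q | [/\ D Q, cset Q (pt q.1.1) & Q.2 * 2 ^+ q.2 = Q0.2 * 2 ^+ q.1.2]%R].
apply: (@sub_countable _ _ _ (\bigcup_q F q)).
  apply: subset_card_le => Q DQ.
  have Qgt0 := D0 _ DQ.
  have /choice[a ha] : forall i : 'I_n, exists q : rat,
      (coord Q.1 i < ratr q < coord Q.1 i + Q.2)%R.
    move=> i; have [|q] := @rat_in_itvoo R (coord Q.1 i) (coord Q.1 i + Q.2)%R.
      by rewrite ltrDl.
    by rewrite in_itv/= => ?; exists q.
  have [P [DP PQ PQ0]] := DD _ _ DQ DQ0.
  have [k [j [hk _]]] := PQ; have [k0 [j0 [hk0 _]]] := PQ0.
  exists ([ffun i => a i], k0, k) => //=; split => //=.
    move=> i; have := ha i; rewrite (_ : coord (pt _) i = ratr (a i)).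
      by move=> /andP[/ltW -> ->].
    by rewrite /coord mxE ffunE.
  by rewrite hk hk0 !divfK// gt_eqF// exprn_gt0.
apply: bigcup_countable => [|q _]; first exact: countableP.
have [->|/set0P[Q FQ]] := eqVneq (F q) set0; first exact: countable0.
apply: (@sub_countable _ _ _ [set Q]); last exact: countable1.
apply: subset_card_le => Q' [DQ' ptQ' sQ']; case: FQ => DQ ptQ sQ /=.
have s : Q.2 = Q'.2.
  by apply: (@mulIf _ (2 ^+ q.2)%R); rewrite ?sQ ?sQ'// gt_eqF// exprn_gt0.
have [P [DP PQ PQ']] := DD _ _ DQ DQ'; have P0 := D0 _ DP.
have [k kQ] := dyadic_subE P0 PQ; have [k' k'Q'] := dyadic_subE P0 PQ'.
have [Px QE] := kQ _ ptQ; have [_ Q'E] := k'Q' _ ptQ'.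
suff kk' : k = k' by rewrite QE Q'E kk'.
apply/eqP; have := s; rewrite QE Q'E /= => /eqP.
rewrite -subr_eq0 -mulrBr mulf_eq0 (gt_eqF P0)/= subr_eq0 (inj_eq invr_inj).
have H (a c : nat) : (a < c)%N -> ((2 ^+ a == 2 ^+ c :> R)%R = false) /\ ((2 ^+ c == 2 ^+ a :> R)%R = false).
  by move=> ac; rewrite lt_eqF 1?gt_eqF// ltr_eXn2l// ltr1n.
by case: (ltngtP k k') => // /H[e1 e2]; rewrite ?e1 ?e2.
Qed.

End dyadic_lattices.

Section sparse_sums.
Context {R : realType} {n : nat}.
Local Notation E := (Rn R n).
Local Notation mu := (leb R n).
Hypothesis n0 : (0 < n)%N.
Variables (eta : R) (S : set (@cube R n)).
Hypotheses (eta01 : (0 < eta < 1)%R) (spS : sparse eta S).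

(** These parts are pairwise disjoint by nestedness, and sparseness says that each carries at least
    the proportion [eta] of its cube. *)
Definition esub (Q : @cube R n) : set E :=
  cset Q `\` \bigcup_(Q' in [set Q' | S Q' /\ cset Q' `<` cset Q]) cset Q'.

Lemma sparse_countable : countable S.
Proof.
case: spS => D [dD SD _]; apply: (@sub_countable _ _ S D).
  exact: subset_card_le.
exact: (dyadic_countable dD).
Qed.

Lemma sparse_gt0 Q : S Q -> (0 < Q.2)%R.
Proof. by case: spS => D [[D0 _ _ _] SD _] /SD /D0. Qed.

Lemma measurable_strict Q :
  measurable (\bigcup_(Q' in [set Q' | S Q' /\ cset Q' `<` cset Q]) cset Q').
Proof.
apply: countable_bigcup_measurable => [|Q' _]; last exact: measurable_cset.
by apply: sub_countable sparse_countable; apply: subset_card_le => Q' [].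
Qed.

Lemma measurable_esub Q : measurable (esub Q).
Proof. by apply: measurableD; [exact: measurable_cset|exact: measurable_strict]. Qed.

Lemma leb_esub Q : S Q -> eta%:E * mu (cset Q) <= mu (esub Q).
Proof.
move=> SQ; case: spS => D [dD SD /(_ _ SQ) sQ]; have Q0 := sparse_gt0 SQ.
have sub : \bigcup_(Q' in [set Q' | S Q' /\ cset Q' `<` cset Q]) cset Q' `<=` cset Q.
  by move=> x [Q' [_ [Q'Q _]] /Q'Q].
have -> : mu (esub Q) = mu (cset Q) -
    mu (\bigcup_(Q' in [set Q' | S Q' /\ cset Q' `<` cset Q]) cset Q').
  rewrite /esub measureD; first by rewrite setIidr.
  - exact: measurable_cset.
  - exact: measurable_strict.
  - exact: leb_cset_fin.
have fS : mu (\bigcup_(Q' in [set Q' | S Q' /\ cset Q' `<` cset Q]) cset Q') \is a fin_num.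
  by apply: (@leb_sub_cset _ _ Q) => //; exact: measurable_strict.
move: sQ; rewrite leb_cset// -(fineK fS) -!EFinM -EFinB !lee_fin; lra.
Qed.

Lemma esub_triv : trivIset S esub.
Proof.
move=> Q Q' SQ SQ' [x [[Qx nx] [Q'x nx']]].
case: spS => D [dD SD _].
have [//|QQ'|Q'Q] := dyadic_nested n0 dD (SD _ SQ) (SD _ SQ') Qx Q'x.
- by exfalso; apply: nx'; exists Q.
- by exfalso; apply: nx; exists Q'.
Qed.

(** The mass of [h] on [Q] is moved into [esub Q] by [int_cube_HLmax]; there [a Q <= phi], and
    disjointness turns the sum into one integral. *)
Lemma sparse_sum_int (a : @cube R n -> \bar R) (phi h : E -> \bar R) :
    (forall Q, 0 <= a Q) -> Lmeas phi -> Lmeas h -> (forall x, 0 <= h x) ->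
    (forall x, 0 <= phi x) ->
    (forall Q x, S Q -> cset Q x -> a Q <= phi x) ->
  eta%:E * (\esum_(Q in S) (a Q * \int[mu]_(x in cset Q) h x)) <=
  \int[mu]_x (phi x * HLmax h x).
Proof.
move=> a0 mphi mh h0 phi0 aphi; have [eta0 _] := andP eta01.
have mM := measurable_HLmax mh.
have mpM : Lmeas (fun x => phi x * HLmax h x) by exact: LmeasM.
have pM0 x : 0 <= phi x * HLmax h x by rewrite mule_ge0// HLmax_ge0.
have i0 Q : 0 <= \int[mu]_(x in cset Q) h x by exact: integral_ge0.
apply: (@le_trans _ _ (\esum_(Q in S) \int[mu]_(x in esub Q) (phi x * HLmax h x))); last first.
  exact: (esum_int_le mu measurableT (fun Q _ => measurable_esub Q) mpM pM0 esub_triv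
    (fun Q _ => @subsetT _ _)).
rewrite muleC -lee_pdivlMr//.
rewrite (esum_scale sparse_countable) ?invr_ge0 ?(ltW eta0)//; last first.
  by move=> Q; apply: integral_ge0 => x _.
apply: le_esum => Q SQ; rewrite lee_pdivlMr// muleC.
have mQ := measurable_esub Q.
apply: (@le_trans _ _ (\int[mu]_(x in esub Q) (a Q * HLmax h x))); last first.
  apply: (int_le mQ (LmeasZ _ mM) mpM).
    by move=> x; rewrite mule_ge0// HLmax_ge0.
  move=> x [Qx _]; apply: lee_wpmul2r; [exact: HLmax_ge0|exact: aphi].
rewrite (intZ mQ mM (@HLmax_ge0 _ _ h) (a0 Q)) muleCA; apply: lee_wpmul2l => //.
apply: (int_cube_HLmax (sparse_gt0 SQ) mQ _ mh h0); [by move=> x []|exact: ltW|].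
exact: leb_esub.
Qed.

End sparse_sums.

Lemma sume_const (R : realType) (I : finType) (W : \bar R) :
  \sum_(i : I) W = (#|I|%:R)%:E * W.
Proof.
rewrite big_const mule_natl; elim: #|I| => [|k IH] //=.
rewrite IH.
by case: k {IH}; rewrite ?adde0.
Qed.

Lemma mule_fin3 (R : realType) (a b c : R) (J : \bar R) :
  a%:E * (b%:E * J) * c%:E = (c * (a * b))%:E * J.
Proof. by rewrite muleC !muleA !EFinM muleA. Qed.

Lemma prode_widen (R : realType) (l m : nat) (lm : (l <= m)%N) (A : 'I_m -> \bar R)
    (beta : 'I_l -> R) (K N : R) :
  (\prod_(s < l) ((beta s * K)%:E * N%:E * A (widen_ord lm s))) *
  (\prod_(s < m | (l <= s)%N) A s) =
  ((\prod_(s < l) beta s) * K ^+ l)%:E * (\prod_(i < m) A i) * (N ^+ l)%:E.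
Proof.
rewrite !big_split /= !prodEFin big_split /= !prodr_const card_ord.
rewrite (bigID (fun i : 'I_m => (i < l)%N) xpredT) /=.
rewrite (eq_bigl (fun i : 'I_m => ~~ (i < l)%N)) => [|i]; last by rewrite -leqNgt.
rewrite (big_ord_narrow lm) /= -!muleA; congr (_ * _).
by rewrite muleC -!muleA.
Qed.

Lemma HLmax_abse (R : realType) n (f : Rn R n -> \bar R) : HLmax (abse \o f) = HLmax f.
Proof.
by apply/funext => x; rewrite /HLmax (_ : abse \o (abse \o f) = abse \o f)//;
  apply/funext => y /=; rewrite abse_id.
Qed.

Section sparse_bound.
Context {R : realType} {n m l : nat}.
Local Notation E := (Rn R n).
Local Notation mu := (leb R n).
Variables (lm : (l <= m)%N) (b : 'I_l -> E -> R) (beta : 'I_l -> R).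
Hypotheses (n0 : (0 < n)%N) (bloc : forall s, locally_int (b s)).
Hypotheses (bbeta : forall s, bmo_norm (b s) <= (beta s)%:E) (beta0 : forall s, (0 < beta s)%R).
Variables (eta : R) (f : 'I_m -> E -> R) (G : E -> R).
Hypotheses (eta01 : (0 < eta < 1)%R) (mf : forall i, measurable_fun setT (f i)).
Hypotheses (mG : measurable_fun setT G) (G0 : forall x, (0 <= G x)%R).

Local Notation Mf := (fun i => HLmax (EFin \o f i)).
Local Notation N := (onum b beta).

Definition osc_const : R := (@oc R n l * @Cosc R 1)%R.

Lemma Cosc1 : (1 <= @Cosc R 1)%R.
Proof. by rewrite /= expr1 !exprS expr0; lra. Qed.

Lemma osc_const_ge0 : (0 <= osc_const)%R.
Proof. by rewrite /osc_const mulr_ge0 ?Cosc_ge0// ltW// oc_gt0. Qed.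

Lemma oc_le_osc_const : (@oc R n l <= osc_const)%R.
Proof. by rewrite /osc_const ler_peMr ?Cosc1// ltW// oc_gt0. Qed.

Lemma osc_onum s Q x : (`|b s x - ravg Q (b s)| <= beta s * @oc R n l * N Q x)%R.
Proof.
apply: le_trans (osc_term b beta0 s Q x) _; rewrite -mulrA ler_pM2l// /onum.
by rewrite mulrDr mulr1 mulrC divfK ?gt_eqF ?oc_gt0// lerDr ltW// oc_gt0.
Qed.

Lemma mfE i : Lmeas (EFin \o f i).
Proof. exact: Lmeas_fin. Qed.

Lemma avg_f_le i (Q : @cube R n) : (0 < Q.2)%R ->
  avg (cset Q) (fun y => `|(f i y)%:E|) <= avg (cset Q) (abse \o Mf i).
Proof.
move=> Q0; rewrite !avg_cset//; apply: lee_wpmul2l.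
  by rewrite lee_fin invr_ge0 exprn_ge0// ltW.
have := @int_cube_HLiter R n Q 1 (abse \o (EFin \o f i)) Q0 (Lmeas_abse (mfE i))
  (fun x => abse_ge0 _).
move=> /le_trans; apply; rewrite le_eqVlt; apply/orP; left; apply/eqP.
apply: eq_integral => x _; rewrite /HLiter /= gee0_abs ?HLmax_ge0//.
by rewrite HLmax_abse.
Qed.

(** Both kinds of factors receive a common bound. For index [1] the oscillation stays outside as
    [onum], and the average of [|f|] is at most that of its maximal function; for index [2] the case
    [k = 1] of [int_onum] converts the oscillation inside the average into [HLmax f], and
    [onum >= 1] is inserted for free. *)
Lemma sparse_factor_le s i (Q : @cube R n) gam x : (0 < Q.2)%R ->
  sparse_factor (b s) (f i) Q gam x <=
  (beta s * osc_const)%:E * (N Q x)%:E * avg (cset Q) (abse \o Mf i).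
Proof.
move=> Q0; have a0 : 0 <= avg (cset Q) (abse \o Mf i) by exact: avg_abs_ge0.
have N1 := onum_ge1 b beta0 Q x.
rewrite /sparse_factor; case: gam; last first.
  apply: lee_pmul => //; [exact: avg_abs_ge0| |exact: avg_f_le].
  rewrite /= lee_fin; apply: le_trans (osc_onum s Q x) _.
  rewrite ler_wpM2r ?(le_trans ler01 N1)// ler_pM2l//; exact: oc_le_osc_const.
apply: (@le_trans _ _ ((beta s * osc_const)%:E * avg (cset Q) (abse \o Mf i))); last first.
  apply: lee_wpmul2r => //; rewrite -EFinM lee_fin ler_peMr// mulr_ge0 ?osc_const_ge0// ltW//.
have g0 : forall y, 0 <= (abse \o (EFin \o f i)) y by move=> y; exact: abse_ge0.
have mg := Lmeas_abse (mfE i).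
have mQ := measurable_cset Q.
have moc := monum beta bloc Q 1 mg.
have oc0 : (0 <= beta s * @oc R n l)%R by apply: mulr_ge0; apply: ltW; [exact: beta0|exact: oc_gt0].
rewrite !avg_cset//.
apply: (@le_trans _ _ (((Q.2 ^+ n)^-1)%:E * \int[mu]_(y in cset Q)
    ((beta s * @oc R n l)%:E * ((N Q y ^+ 1)%:E * `|(f i y)%:E|)))).
  apply: lee_wpmul2l; first by rewrite lee_fin invr_ge0 exprn_ge0// ltW.
  apply: (int_le mQ _ (LmeasZ _ moc)).
  - apply: Lmeas_abse; apply: Lmeas_fin; apply: measurable_mulR; [exact: measurable_sub_cst (bloc s).1|exact: mf].
  - by move=> y; exact: abse_ge0.
  move=> y _; apply: (@le_trans _ _ (`|(b s y - ravg Q (b s))%:E| * `|(f i y)%:E|)); first by rewrite -abseM -EFinM.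
  have -> : (beta s * @oc R n l)%:E * ((N Q y ^+ 1)%:E * (abse \o (EFin \o f i)) y) =
      (beta s * @oc R n l * N Q y)%:E * `|(f i y)%:E| by rewrite expr1 muleA -EFinM.
  apply: lee_wpmul2r; first exact: abse_ge0.
  exact: osc_onum.
rewrite (intZ mQ moc (onum_g0 b beta0 Q 1 g0)); last by rewrite lee_fin.
rewrite muleCA /osc_const mulrA [X in _ <= X * _]EFinM -muleA; apply: lee_wpmul2l; first by rewrite lee_fin.
rewrite [leRHS]muleCA; apply: lee_wpmul2l; first by rewrite lee_fin invr_ge0 exprn_ge0// ltW.
apply: le_trans (int_onum bloc bbeta beta0 1 Q0 mg g0) _.
apply: lee_wpmul2l; first by rewrite lee_fin (Cosc_ge0 1).
rewrite le_eqVlt; apply/orP; left; apply/eqP.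
apply: eq_integral => y _; rewrite /HLiter /= [RHS]gee0_abs ?HLmax_ge0//.
by rewrite HLmax_abse.
Qed.

Definition sterm (gam : {ffun 'I_l -> bool}) (Q : @cube R n) (x : E) : \bar R :=
  (\prod_(s < l) sparse_factor (b s) (f (widen_ord lm s)) Q (gam s) x) *
  (\prod_(s < m | (l <= s)%N) avg (cset Q) (fun y => `|(f s y)%:E|)) *
  chi (cset Q) x.

Lemma sparse_factor_ge0 c h (Q : @cube R n) gam x : 0 <= sparse_factor c h Q gam x.
Proof.
rewrite /sparse_factor; case: gam; first by apply: avg_ge0 => y; exact: abse_ge0.
by rewrite mule_ge0// avg_ge0.
Qed.

Lemma sterm_ge0 gam Q x : 0 <= sterm gam Q x.
Proof.
rewrite /sterm mule_ge0 ?chi_ge0// mule_ge0//.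
  by apply: prode_ge0 => s _; exact: sparse_factor_ge0.
by apply: prode_ge0 => s _; apply: avg_ge0 => y; exact: abse_ge0.
Qed.

Lemma measurable_sterm gam Q : Lmeas (sterm gam Q).
Proof.
apply: Lmeas_chi; first exact: measurable_cset.
apply: LmeasM; last exact: Lmeas_cst.
apply: Lmeas_prod => s; rewrite /sparse_factor; case: (gam s); first exact: Lmeas_cst.
apply: LmeasM; last exact: Lmeas_cst.
apply: Lmeas_abse; apply: Lmeas_fin; exact: measurable_sub_cst (bloc s).1.
Qed.

Definition Pavg (Q : @cube R n) : \bar R := \prod_(i < m) avg (cset Q) (abse \o Mf i).

Lemma Pavg_ge0 Q : 0 <= Pavg Q.
Proof. by apply: prode_ge0 => i _; exact: avg_abs_ge0. Qed.

(** The factors produce [onum] to the power [l]; rounding up to [l + 1] is harmless since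
    [onum >= 1], and matches the number of iterates in the final estimate. *)
Lemma sterm_le gam (Q : @cube R n) x : (0 < Q.2)%R ->
  sterm gam Q x <= ((\prod_(s < l) beta s) * osc_const ^+ l)%:E * Pavg Q *
    ((N Q x ^+ l.+1)%:E * chi (cset Q) x).
Proof.
move=> Q0; rewrite /sterm muleA; apply: lee_wpmul2r; first exact: chi_ge0.
have N1 := onum_ge1 b beta0 Q x.
apply: (@le_trans _ _ ((\prod_(s < l) ((beta s * osc_const)%:E * (N Q x)%:E *
    avg (cset Q) (abse \o Mf (widen_ord lm s)))) *
    (\prod_(s < m | (l <= s)%N) avg (cset Q) (abse \o Mf s)))).
  apply: lee_pmul.
  - by apply: prode_ge0 => s _; exact: sparse_factor_ge0.
  - by apply: prode_ge0 => s _; apply: avg_ge0 => y; exact: abse_ge0.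
  - apply: lee_prode => s _; [exact: sparse_factor_ge0|exact: sparse_factor_le].
  - apply: lee_prode => s _; [by apply: avg_ge0 => y; exact: abse_ge0|exact: avg_f_le].
rewrite (prode_widen lm (fun s => avg (cset Q) (abse \o Mf s))).
apply: lee_wpmul2l; last by rewrite lee_fin ler_weXn2l.
rewrite mule_ge0 ?Pavg_ge0// lee_fin mulr_ge0 ?exprn_ge0 ?osc_const_ge0//.
by apply: prodr_ge0 => s _; exact: ltW.
Qed.

Definition sparse_sum_const : R := (eta^-1 * (osc_const ^+ l * @Cosc R l.+1 * ((2 * n%:R) ^+ n) ^+ m))%R.

(** First [int_onum] spends [l + 1] maximal operators on [G], giving [h]; then [sparse_sum_int]
    spends the last one, with [Pavg] dominated on each cube by the multilinear maximal function of
    the [HLmax f_i]. *)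
Lemma int_sterm gam S : sparse eta S ->
  \int[mu]_x ((\esum_(Q in S) sterm gam Q x) * (G x)%:E) <=
  ((\prod_(s < l) beta s) * sparse_sum_const)%:E *
    \int[mu]_x (multimax Mf x * HLiter (l + 2) (EFin \o G) x).
Proof.
move=> spS; have [eta0 _] := andP eta01.
have cS := sparse_countable spS.
have mGE : Lmeas (EFin \o G) by exact: Lmeas_fin.
have GE0 x : 0 <= (EFin \o G) x by rewrite lee_fin.
have B0 : (0 <= \prod_(s < l) beta s)%R by apply: prodr_ge0 => s _; exact: ltW.
have mM i : Lmeas (Mf i) by apply: measurable_HLmax; exact: mfE.
pose C : R := (((2 * n%:R) ^+ n) ^+ m)%R.
have C0 : (0 < C)%R by rewrite !exprn_gt0// mulr_gt0// ltr0n.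
pose h := HLiter l.+1 (EFin \o G).
have mh : Lmeas h by exact: measurable_HLiter.
have h0 x : 0 <= h x by exact: HLiter_ge0.
have i0 Q : 0 <= \int[mu]_(x in cset Q) h x by apply: integral_ge0 => x _.
have mtG Q : Lmeas (fun x => sterm gam Q x * (G x)%:E).
  exact: LmeasM (measurable_sterm gam Q) mGE.
have tG0 Q x : 0 <= sterm gam Q x * (G x)%:E by apply: mule_ge0; [exact: sterm_ge0|exact: GE0].
have -> : \int[mu]_x ((\esum_(Q in S) sterm gam Q x) * (G x)%:E) =
    \int[mu]_x (\esum_(Q in S) (sterm gam Q x * (G x)%:E)).
  by apply: eq_integral => x _; rewrite (esum_scale cS)// => Q; exact: sterm_ge0.
rewrite (int_esum mu cS measurableT mtG tG0).
pose B := ((\prod_(s < l) beta s) * osc_const ^+ l)%R.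
have BK0 : (0 <= B)%R by rewrite mulr_ge0 ?exprn_ge0 ?osc_const_ge0.
pose A := (B * @Cosc R l.+1)%R.
have A0 : (0 <= A)%R by rewrite mulr_ge0 ?Cosc_ge0.
have step Q : S Q -> \int[mu]_x (sterm gam Q x * (G x)%:E) <=
    (Pavg Q * \int[mu]_(x in cset Q) h x) * A%:E.
  move=> SQ; have Q0 := sparse_gt0 spS SQ; have mQ := measurable_cset Q.
  have mN := monum beta bloc Q l.+1 mGE.
  have N0 := onum_g0 b beta0 Q l.+1 GE0.
  apply: (@le_trans _ _ (\int[mu]_x ((B%:E * Pavg Q) *
     (((N Q x ^+ l.+1)%:E * (EFin \o G) x) * chi (cset Q) x)))).
    apply: (int_le measurableT (mtG Q) _ (tG0 Q)).
      by apply: LmeasZ; exact: Lmeas_chi.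
    move=> x _; apply: le_trans (lee_wpmul2r (GE0 x) (sterm_le gam x Q0)) _.
    by rewrite -/B -!muleA [(EFin \o G) x * chi _ _]muleC.
  rewrite (intZ measurableT (Lmeas_chi mQ mN)); last 2 first.
  - by move=> x; rewrite mule_ge0 ?chi_ge0.
  - by rewrite mule_ge0 ?Pavg_ge0// lee_fin.
  rewrite -(int_chiE _ mQ) (_ : A%:E = B%:E * (@Cosc R l.+1)%:E); last by rewrite -EFinM.
  have -> : Pavg Q * \int[mu]_(x in cset Q) h x * (B%:E * (@Cosc R l.+1)%:E) =
      B%:E * Pavg Q * ((@Cosc R l.+1)%:E * \int[mu]_(x in cset Q) h x).
    by rewrite muleACA [Pavg Q * _]muleC [_ * (@Cosc _ _)%:E]muleC.
  apply: lee_wpmul2l; first by rewrite mule_ge0 ?Pavg_ge0// lee_fin.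
  exact: (int_onum bloc bbeta beta0 l.+1 Q0 mGE GE0).
apply: le_trans (le_esum step) _.
rewrite -(esum_scale cS A0); last by move=> Q; rewrite mule_ge0 ?Pavg_ge0.
have := @sparse_sum_int R n n0 eta S eta01 spS Pavg (fun x => C%:E * multimax Mf x) h
  Pavg_ge0 (LmeasZ _ (measurable_multimax _)) mh h0.
have C0' : (0 <= C)%R by exact: ltW.
have mm0 x : 0 <= C%:E * multimax Mf x by rewrite mule_ge0 ?multimax_ge0// lee_fin.
move=> /(_ mm0) /(_ (fun Q x SQ Qx => cube_multimax n0 (sparse_gt0 spS SQ) Qx mM)).
under eq_integral do rewrite -muleA.
rewrite (intZ measurableT (LmeasM (measurable_multimax _) (measurable_HLmax mh))); last 2 first.
- by move=> x; rewrite mule_ge0 ?multimax_ge0// HLmax_ge0.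
- by rewrite lee_fin.
rewrite -lee_pdivlMl// => /(lee_wpmul2r _) => /(_ A%:E).
rewrite lee_fin => /(_ A0) /le_trans; apply.
rewrite /h -HLiterS addn2 mule_fin3.
apply: lee_wpmul2r.
  by apply: integral_ge0 => x _; rewrite mule_ge0 ?multimax_ge0//; exact: HLiter_ge0.
rewrite lee_fin /A /B /sparse_sum_const -/C le_eqVlt; apply/orP; left; apply/eqP; ring.
Qed.

Lemma int_sparse_bound S : (forall j : 'I_(3 ^ n), sparse eta (S j)) ->
  \int[mu]_x (sparse_bound lm b S f x * (G x)%:E) <=
  ((3 ^ n)%:R * (2 ^ l)%:R * sparse_sum_const)%:E * (\prod_(s < l) beta s)%:E *
    \int[mu]_x (multimax Mf x * HLiter (l + 2) (EFin \o G) x).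
Proof.
move=> spS; have mGE : Lmeas (EFin \o G) by exact: Lmeas_fin.
have me gam j : Lmeas (fun x => \esum_(Q in S j) sterm gam Q x).
  apply: measurable_esum; [exact: sparse_countable (spS j)|exact: measurable_sterm|].
  exact: sterm_ge0.
have e0 gam j x : 0 <= \esum_(Q in S j) sterm gam Q x.
  by apply: esum_ge0 => Q _; exact: sterm_ge0.
have mF gam j : Lmeas (fun x => (\esum_(Q in S j) sterm gam Q x) * (G x)%:E).
  exact: (LmeasM (me gam j) mGE).
have F0 gam j x : 0 <= (\esum_(Q in S j) sterm gam Q x) * (G x)%:E.
  by rewrite mule_ge0// lee_fin.
have mF' j : Lmeas (fun x => \sum_(gam : {ffun 'I_l -> bool})
    ((\esum_(Q in S j) sterm gam Q x) * (G x)%:E)).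
  by apply: Lmeas_sum => gam; exact: mF.
have F0' j x : 0 <= \sum_(gam : {ffun 'I_l -> bool})
    ((\esum_(Q in S j) sterm gam Q x) * (G x)%:E).
  by apply: sume_ge0 => gam _; exact: F0.
have -> : \int[mu]_x (sparse_bound lm b S f x * (G x)%:E) =
    \int[mu]_x (\sum_(j < 3 ^ n) \sum_(gam : {ffun 'I_l -> bool})
      ((\esum_(Q in S j) sterm gam Q x) * (G x)%:E)).
  apply: eq_integral => x _; rewrite /sparse_bound ge0_sume_distrl; last first.
    by move=> j _; apply: sume_ge0 => gam _; exact: e0.
  by apply: eq_bigr => j _; rewrite ge0_sume_distrl// => gam _; exact: e0.
rewrite (int_sum _ measurableT mF' F0').
set I := \int[mu]_x (multimax Mf x * HLiter (l + 2) (EFin \o G) x).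
apply: (@le_trans _ _ (\sum_(j < 3 ^ n) \sum_(gam : {ffun 'I_l -> bool})
    ((\prod_(s < l) beta s * sparse_sum_const)%:E * I))).
  apply: lee_sum => j _; rewrite (int_sum _ measurableT (fun gam => mF gam j) (fun gam => F0 gam j)).
  by apply: lee_sum => gam _; exact: int_sterm.
rewrite !sume_const card_ord card_ffun card_bool card_ord !muleA -!EFinM.
by rewrite le_eqVlt; apply/orP; left; apply/eqP; congr (_%:E * _); ring.
Qed.

End sparse_bound.

(** * The Lorentz-Luxemburg duality *)

Lemma limn_einf_bounds (R : realType) (u : nat -> \bar R) (a c : \bar R) :
  (forall k, a <= u k <= c) -> a <= limn_einf u <= c.
Proof.
move=> uac; rewrite limn_einf_lim (cvg_lim _ (@cvg_einfs_sup R u))//.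
apply/andP; split.
  apply: le_trans (ereal_sup_ubound _); last by exists 0%N.
  by apply: le_ereal_inf_tmp => _ [k _ <-]; have /andP[] := uac k.
apply: ub_ereal_sup => _ [k _ <-]; apply: (@le_trans _ _ (u k)).
  by apply: ereal_inf_lbound; exists k => /=.
by have /andP[] := uac k.
Qed.

(** * Projection in L^2 onto a set of functions between [0] and [F] *)

Section projection.
Context d (T : measurableType d) (R : realType) (mu : {measure set T -> \bar R}).
Variables (D : set T) (F : T -> R) (N : R).
Hypotheses (mD : measurable D) (Dfin : mu D < +oo) (mF : measurable_fun setT F).
Hypotheses (F0 : forall x, (0 <= F x <= N)%R) (FD : forall x, ~ D x -> F x = 0%R).

Lemma int_bounded (f : T -> R) (M : R) : measurable_fun setT f ->
  (forall x, (0 <= f x <= M)%R) -> \int[mu]_(x in D) (f x)%:E <= M%:E * mu D.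
Proof.
move=> mf fM; rewrite -integral_cst//; apply: le_int => //.
- exact/measurable_EFinP.
- by move=> x _; rewrite lee_fin; have /andP[] := fM x.
- by move=> x _; rewrite lee_fin; have /andP[] := fM x.
Qed.

Lemma int_bounded_fin (f : T -> R) (M : R) : measurable_fun setT f ->
  (forall x, (0 <= f x <= M)%R) -> \int[mu]_(x in D) (f x)%:E \is a fin_num.
Proof.
move=> mf fM; rewrite ge0_fin_numE; last first.
  by apply: integral_ge0 => x _; rewrite lee_fin; have /andP[] := fM x.
apply: le_lt_trans (int_bounded mf fM) _.
have [x|nD] := pselect (exists x, D x); last first.
  have -> : D = set0 by apply/seteqP; split => // x Dx; apply: nD; exists x.
  by rewrite measure0 mule0 ltry.
have M0 : (0 <= M)%R by case: x => x _; have /andP[] := fM x; exact: le_trans.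
by rewrite lte_mul_pinfty// lee_fin.
Qed.

Lemma summable_increments_cvg (h : nat -> T -> R) :
  (forall k, measurable_fun setT (h k)) ->
  \sum_(0 <= k <oo) \int[mu]_(x in D) (`|h k.+1 x - h k x|)%:E < +oo ->
  \forall x \ae mu, D x -> cvgn (h^~ x).
Proof.
move=> mh sfin; pose g k x : R := (`|h k.+1 x - h k x|)%R.
have mg k : measurable_fun setT (EFin \o g k).
  by apply/measurable_EFinP; apply: measurableT_comp => //; exact: measurable_funB.
have g0 k x : 0 <= (g k x)%:E by rewrite lee_fin normr_ge0.
have ms : measurable_fun setT (fun x => \sum_(0 <= k <oo) (g k x)%:E).
  by apply: ge0_emeasurable_sum => [k x _ _|k _]; [exact: g0|exact: mg].
have intg : mu.-integrable D (fun x => \sum_(0 <= k <oo) (g k x)%:E).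
  apply/integrableP; split; first exact: measurable_funTS.
  under eq_integral => x _ do rewrite gee0_abs ?nneseries_ge0//.
  by rewrite (integral_nneseries mu mD (fun k => measurable_funTS (mg k)) (fun k x _ => g0 k x)).
apply: filterS (integrable_ae mD intg) => x + Dx => /(_ Dx) sx.
have : cvgn (series (fun k => h k.+1 x - h k x)%R).
  apply: normed_cvg; rewrite (_ : [normed series _]%classic = series (g^~ x))//.
  apply: (@nondecreasing_is_cvgn R (series (g^~ x))).
    apply/nondecreasing_seqP => k; rewrite !seriesEnat/= big_nat_recr//= lerDl.
    exact: normr_ge0.
  exists (fine (\sum_(0 <= k <oo) (g k x)%:E)) => _ [k _ <-] /=.
  rewrite -lee_fin fineK// seriesEnat /= -sumEFin.
  exact: (nneseries_lim_ge k (fun i _ _ => g0 i x)).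
rewrite (_ : (fun k => h k.+1 x - h k x)%R = telescope (h^~ x))// telescopeK => ch.
rewrite (_ : h^~ x = [sequence (h n x - h 0%N x)%R]_n + cst (h 0%N x))%R.
  by apply: is_cvgD => //; exact: is_cvg_cst.
by apply/funext => k; rewrite /= /cst fctE subrK.
Qed.

Definition sqdist (h : T -> R) : \bar R := \int[mu]_(x in D) ((F x - h x) ^+ 2)%:E.

Definition below (h : T -> R) : Prop :=
  measurable_fun setT h /\ forall x, (0 <= h x <= F x)%R.

Lemma below_sq h x : below h -> (0 <= (F x - h x) ^+ 2 <= N ^+ 2)%R.
Proof.
move=> [_ /(_ x)/andP[h0 hF]]; have /andP[_ FN] := F0 x.
by rewrite sqr_ge0 lerXn2r ?nnegrE; lra.
Qed.

Lemma measurable_sq (f g : T -> R) : measurable_fun setT f -> measurable_fun setT g ->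
  measurable_fun setT (fun x => (f x - g x) ^+ 2)%R.
Proof. by move=> mf mg; apply: measurable_funX; exact: measurable_funB. Qed.

Lemma measurable_sqE (f g : T -> R) : measurable_fun setT f -> measurable_fun setT g ->
  measurable_fun D (fun x => ((f x - g x) ^+ 2)%:E).
Proof. by move=> mf mg; apply/measurable_EFinP; apply: measurable_funTS; exact: measurable_sq. Qed.

Lemma sqdist_fin h : below h -> sqdist h \is a fin_num.
Proof.
move=> bh; apply: (@int_bounded_fin _ (N ^+ 2)%R) => [|x]; last exact: below_sq.
exact: measurable_sq bh.1.
Qed.

Variable C : set (T -> R).
Hypotheses (C0 : C !=set0) (Cbelow : C `<=` below).
Hypothesis Cmid : forall g h, C g -> C h -> C (fun x => (g x + h x) / 2)%R.
Hypothesis Cclosed : forall h (H : nat -> T -> R), (forall k, C (H k)) -> below h ->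
  (\forall x \ae mu, H k x @[k --> \oo] --> h x) -> C h.

Lemma parallelogram g h : C g -> C h ->
  \int[mu]_(x in D) ((g x - h x) ^+ 2)%:E + 4%:E * sqdist (fun x => (g x + h x) / 2)%R =
  2%:E * sqdist g + 2%:E * sqdist h.
Proof.
move=> Cg Ch; have [[mg _] [mh _]] := (Cbelow Cg, Cbelow Ch).
have mm := (Cbelow (Cmid Cg Ch)).1.
have m1 := measurable_sqE mg mh.
have m2 := measurable_sqE mF mm.
have m3 := measurable_sqE mF mg.
have m4 := measurable_sqE mF mh.
have q0 (a : T -> R) x : D x -> 0 <= ((a x) ^+ 2)%:E by rewrite lee_fin sqr_ge0.
have qz (c : R) (a : T -> R) : (0 <= c)%R -> forall x, D x -> 0 <= c%:E * ((a x) ^+ 2)%:E.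
  by move=> c0 x _; rewrite -EFinM lee_fin mulr_ge0 ?sqr_ge0.
have mz (c : R) (f : T -> \bar R) : measurable_fun D f -> measurable_fun D (fun x => c%:E * f x).
  by move=> mf; exact: measurable_funeM.
have p4 : (0 : \bar R) <= 4%:E by rewrite lee_fin.
have p2 : (0 : \bar R) <= 2%:E by rewrite lee_fin.
have z4 := ge0_integralZl mu mD m2 (q0 _) p4.
have z3 := ge0_integralZl mu mD m3 (q0 _) p2.
have z2 := ge0_integralZl mu mD m4 (q0 _) p2.
rewrite /sqdist -z4 -z3 -z2.
rewrite -(ge0_integralD mu mD (q0 _) m1 (qz 4%R _ _) (mz _ _ m2))//.
rewrite -(ge0_integralD mu mD (qz 2%R _ _) (mz _ _ m3) (qz 2%R _ _) (mz _ _ m4))//.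
by apply: eq_integral => x _; rewrite -!EFinM -!EFinD; congr EFin; field.
Qed.

(** The Hilbert space proof carried out on functions: the parallelogram identity controls the
    increments of a minimizing sequence, and Fatou's lemma shows that its limit is minimal.
    Midpoints are all that the identity asks of convexity, and closedness under a.e. limits replaces
    closedness in norm. *)
Lemma exists_minimizer : exists h0, C h0 /\ forall h, C h -> sqdist h0 <= sqdist h.
Proof.
pose I h := fine (sqdist h); pose m := inf [set I h | h in C].
have I0 h : (0 <= I h)%R.
  by rewrite fine_ge0//; apply: integral_ge0 => x _; rewrite lee_fin sqr_ge0.
have IE h : C h -> sqdist h = (I h)%:E by move=> /Cbelow /sqdist_fin/fineK.
have hi : has_inf [set I h | h in C].
  by split; [case: C0 => h Ch; exists (I h), h|exists 0%R => _ [h _ <-]].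
have mI h : C h -> (m <= I h)%R by move=> Ch; apply: ge_inf; [exact: hi.2|exists h].
(* Defects [4^-k] give squared increments of order [4^-k], so that the increments themselves are
   summable in mean. *)
have /choice[H HC] : forall k : nat, exists h, C h /\ (I h <= m + 4 ^- k)%R.
  move=> k; have [|_ [h Ch <-] hk] := @inf_adherent _ _ (4 ^- k)%R _ hi.
    by rewrite invr_gt0 exprn_gt0.
  by exists h; split=> //; exact: ltW.
have mH k : measurable_fun setT (H k) := (Cbelow (HC k).1).1.
have D2 k : \int[mu]_(x in D) ((H k.+1 x - H k x) ^+ 2)%:E <= (4 * 4 ^- k)%:E.
  have := parallelogram (HC k.+1).1 (HC k).1.
  rewrite (IE _ (HC k.+1).1) (IE _ (HC k).1) (IE _ (Cmid (HC k.+1).1 (HC k).1)).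
  set J := integral _ _ _ => JE.
  have Jf : J \is a fin_num.
    apply: (@int_bounded_fin _ (N ^+ 2)%R) => [|x]; first exact: measurable_sq.
    have [_ /(_ x) /andP[a0 a1]] := Cbelow (HC k.+1).1.
    have [_ /(_ x) /andP[b0 b1]] := Cbelow (HC k).1.
    have /andP[_ FN] := F0 x; rewrite sqr_ge0 /= -real_normK ?num_real// lerXn2r ?nnegrE//.
      lra.
    by rewrite ler_norml; apply/andP; split; lra.
  have := mI _ (Cmid (HC k.+1).1 (HC k).1); have := (HC k.+1).2; have := (HC k).2.
  have : (4 ^- k.+1 <= 4 ^- k :> R)%R.
    by rewrite lef_pV2 ?posrE ?exprn_gt0// ler_weXn2l// ler1n.
  move: JE; rewrite -(fineK Jf) -!EFinM -!EFinD lee_fin => -[]; lra.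
(* From squares to first powers through [a <= 2^-k / 2 + 2^k a^2 / 2]; the constant term is
   integrable because [mu D] is finite. *)
have D1 k : \int[mu]_(x in D) (`|H k.+1 x - H k x|)%:E <=
    ((2 ^- k)%:E * (2^-1%:E * mu D + 2%:E)).
  have m2 := measurable_sq (mH k.+1) (mH k).
  have p2 : (0 < 2 ^+ k :> R)%R by rewrite exprn_gt0.
  apply: (@le_trans _ _ (\int[mu]_(x in D) ((2 ^- k / 2)%:E + (2 ^+ k / 2)%:E * ((H k.+1 x - H k x) ^+ 2)%:E))).
    apply: le_int => //.
    - apply/measurable_EFinP; apply: measurableT_comp => //; exact: measurable_funB.
    - apply: emeasurable_funD => //; apply: measurable_funeM; exact/measurable_EFinP.
    move=> x _; rewrite -EFinM -EFinD lee_fin -[in leRHS]real_normK ?num_real//.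
    set a := `|_|%R; have /= := sqr_ge0 (1 - 2 ^+ k * a)%R.
    rewrite -(ler_pM2l (_ : 0 < 2 * 2 ^+ k)%R) ?mulr_gt0//.
    have -> : (2 * 2 ^+ k * (2 ^- k / 2 + 2 ^+ k / 2 * a ^+ 2) = 1 + (2 ^+ k * a) ^+ 2)%R.
      by field; rewrite gt_eqF.
    nra.
  rewrite ge0_integralD//; first last.
  - apply: measurable_funeM; apply: measurable_funTS; exact/measurable_EFinP.
  - by move=> x _; rewrite -EFinM lee_fin mulr_ge0 ?sqr_ge0// divr_ge0// ltW.
  have p2' : (0 <= 2 ^+ k / 2 :> R)%R by rewrite divr_ge0// ltW.
  rewrite integral_cst// (ge0_integralZl mu mD (measurable_sqE (mH k.+1) (mH k)) _ _)//; last first.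
    by move=> x _; rewrite lee_fin sqr_ge0.
  have h0 : (0 : \bar R) <= 2^-1%:E * mu D by rewrite mule_ge0// lee_fin.
  rewrite (ge0_muleDr _ h0)// muleA -EFinM; apply: leeD2l.
  apply: (@le_trans _ _ ((2 ^+ k / 2)%:E * (4 * 4 ^- k)%:E)).
    by rewrite lee_wpmul2l// ?D2// lee_fin divr_ge0// ltW.
  rewrite -!EFinM lee_fin -[X in X ^- _](_ : 2 * 2 = 4)%R; last by ring.
  rewrite exprMn le_eqVlt; apply/orP; left; apply/eqP; field.
  by rewrite gt_eqF.
have Hcvg : \forall x \ae mu, D x -> cvgn (H^~ x).
  apply: summable_increments_cvg => //.
  apply: (@le_lt_trans _ _ (\sum_(0 <= k <oo) (2 ^- k)%:E * (2^-1%:E * mu D + 2%:E))).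
    apply: lee_nneseries => k _; last exact: D1.
    by move=> _; apply: integral_ge0.
  have cf : (2^-1%:E * mu D + 2%:E) \is a fin_num.
    by rewrite fin_numD fin_numM//= ge0_fin_numE.
  rewrite -(fineK cf); set c := fine _.
  have c0 : (0 <= c)%R by rewrite fine_ge0// adde_ge0// mule_ge0// lee_fin.
  have c20 : (0 <= c * 2)%R by rewrite mulr_ge0.
  apply: le_lt_trans (le_trans _ (@epsilon_trick0 R (c * 2)%R xpredT c20)) (ltry _).
  apply: lee_nneseries => k _; first by move=> _; rewrite -EFinM lee_fin mulr_ge0.
  rewrite -EFinM lee_fin natrX exprS invfM le_eqVlt; apply/orP; left; apply/eqP.
  by field; rewrite gt_eqF// exprn_gt0.
(* Taking the lower limit everywhere, instead of the limit where it exists, yields [0 <= h0 <= F] at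
   every point, as [below] demands. *)
pose h0 x := fine (limn_einf (fun k => (H k x)%:E)).
have HF k x : (0 <= H k x <= F x)%R := (Cbelow (HC k).1).2 x.
have ei x : limn_einf (fun k => (H k x)%:E) = (h0 x)%:E /\ (0 <= h0 x <= F x)%R.
  have /andP[l0 lF] : 0 <= limn_einf (fun k => (H k x)%:E) <= (F x)%:E.
    by apply: limn_einf_bounds => k; rewrite !lee_fin.
  have lE : limn_einf (fun k => (H k x)%:E) = (h0 x)%:E.
    by rewrite /h0 fineK// ge0_fin_numE// (le_lt_trans lF)// ltry.
  by split=> //; rewrite -!lee_fin -lE l0 lF.
have bh0 : below h0.
  split=> [|x]; last exact: (ei x).2.
  apply/measurable_EFinP; rewrite (_ : EFin \o h0 = fun x => limn_einf (fun k => (H k x)%:E)).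
    by apply: measurable_fun_limn_einf => k; exact/measurable_EFinP.
  by apply/funext => x; rewrite (ei x).1.
have Hh0 : \forall x \ae mu, H k x @[k --> \oo] --> h0 x.
  apply: filterS Hcvg => x cx.
  have {}cx : cvgn (H^~ x).
    have [/cx//|nDx] := pselect (D x).
    rewrite (_ : H^~ x = fun=> 0%R); first exact: is_cvg_cst.
    by apply/funext => k; apply/eqP; rewrite eq_le andbC; have := HF k x; rewrite (FD nDx).
  have cE : EFin \o H^~ x @ \oo --> (limn (H^~ x))%:E.
    by apply: cvg_EFin => //; exact: nearW.
  rewrite (_ : h0 x = limn (H^~ x)) //; apply: EFin_inj; rewrite -(ei x).1.
  rewrite is_cvg_limn_einfE; last by apply/cvg_ex; eexists; exact: cE.
  exact/cvg_lim.
have Ch0 : C h0 by exact: (Cclosed (fun k => (HC k).1) bh0 Hh0).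
exists h0; split=> // h Ch; rewrite (IE _ Ch).
apply: (@le_trans _ _ m%:E); last by rewrite lee_fin mI.
have sq0 (g : T -> R) x : 0 <= ((F x - g x) ^+ 2)%:E by rewrite lee_fin sqr_ge0.
have tail (j : nat) : sqdist h0 <= (m + 4 ^- j)%:E.
  apply: (fatou_le (F := fun k x => ((F x - H (k + j)%N x) ^+ 2)%:E)) => //.
  - by apply/measurable_EFinP; exact: measurable_sq bh0.1.
  - by move=> k; apply/measurable_EFinP; exact: measurable_sq.
  - apply: filterS Hh0 => x cx _; apply: cvg_EFin; first exact: nearW.
    apply: cvgM; apply: cvgB; (try exact: cvg_cst); by rewrite (cvg_shiftn j (H^~ x)).
  - move=> k; apply: (@le_trans _ _ (m + 4 ^- (k + j))%:E).
      by have := (HC (k + j)%N).2; rewrite -lee_fin -(IE _ (HC _).1).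
    rewrite lee_fin lerD2l lef_pV2 ?posrE ?exprn_gt0// ler_weXn2l// ?ler1n//.
    exact: leq_addl.
apply/lee_addgt0Pr => e e0.
have [j je] : exists j : nat, (4 ^- j <= e)%R.
  have : (fun j => 1 * 4^-1 ^+ j : R)%R @ \oo --> (0:R)%R.
    by apply: cvg_geometric; rewrite gtr0_norm ?invr_gt0// invf_lt1// ltr1n.
  move=> /cvgrPdist_le /(_ e e0)[j _ /(_ j (leqnn j))/=].
  rewrite sub0r normrN mul1r ger0_norm ?exprn_ge0 ?invr_ge0// exprVn => je.
  by exists j.
by rewrite -EFinD; apply: le_trans (tail j) _; rewrite lee_fin lerD2l.
Qed.

End projection.

Section truncation.
Context {R : realType}.

Definition etrunc (k : nat) (y : \bar R) : R := fine (mine y k%:R%:E).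

Lemma etruncE k y : 0 <= y -> (etrunc k y)%:E = mine y k%:R%:E.
Proof.
move=> y0; rewrite /etrunc fineK// ge0_fin_numE.
  by rewrite /mine; case: ifP => [/lt_trans ->|_]; rewrite ?ltry.
by rewrite le_min y0 lee_fin ler0n.
Qed.

Lemma etrunc_ge0 k y : 0 <= y -> (0 <= etrunc k y)%R.
Proof. by move=> y0; rewrite -lee_fin etruncE// le_min y0 lee_fin ler0n. Qed.

Lemma etrunc_le k y : 0 <= y -> (etrunc k y <= k%:R)%R.
Proof. by move=> y0; rewrite -lee_fin etruncE// ge_min lexx orbT. Qed.

Lemma etrunc_lel k y : 0 <= y -> (etrunc k y)%:E <= y.
Proof. by move=> y0; rewrite etruncE// ge_min lexx. Qed.

Lemma cvg_etrunc y : 0 <= y -> (etrunc k y)%:E @[k --> \oo] --> y.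
Proof.
move=> y0; under eq_fun do rewrite etruncE//.
case: y y0 => [r||//] r0.
- apply: cvg_near_cst; near=> k; apply/eqP; rewrite eq_le ge_min lexx/= le_min lexx/=.
  rewrite lee_fin; near: k; exact: nbhs_infty_ger.
- under eq_fun do rewrite min_r ?leey//.
  exact/cvgenyP.
Unshelve. all: by end_near. Qed.

Lemma measurable_etrunc d (T : measurableType d) (f : T -> \bar R) k :
  measurable_fun setT f -> measurable_fun setT (fun x => etrunc k (f x)).
Proof.
move=> mf; apply: (measurableT_comp (@fine_measurable R _ measurableT)).
by apply: measurable_mine.
Qed.

End truncation.

Section bfs.
Context {R : realType} {n : nat}.
Local Notation E := (Rn R n).
Local Notation mu := (leb R n).
Variable X : fnorm R n.
Hypothesis bX : banach_function_space X.

Lemma bfs_le f g : Lmeas f -> Lmeas g -> (forall x, `|g x| <= `|f x|) -> X g <= X f.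
Proof. by move=> mf mg gf; apply: (bfs_lattice bX) => //; exact: aeW. Qed.

Lemma bfs_ae f g : Lmeas f -> Lmeas g -> (\forall x \ae mu, f x = g x) -> X f = X g.
Proof.
move=> mf mg fg; apply/eqP; rewrite eq_le; apply/andP; split.
  by apply: (bfs_lattice bX) => //; apply: filterS fg => x ->.
by apply: (bfs_lattice bX) => //; apply: filterS fg => x ->.
Qed.

Lemma bfs_abse f : Lmeas f -> X (abse \o f) = X f.
Proof.
move=> mf; have ma := Lmeas_abse mf.
by apply/eqP; rewrite eq_le; apply/andP; split; apply: bfs_le => // x;
  rewrite /= abse_id.
Qed.

Lemma bfs_fin_num f : mem_space X f -> X f \is a fin_num.
Proof. by move=> [mf Xf]; rewrite ge0_fin_numE// (bfs_ge0 bX). Qed.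

Lemma bfs0 : X (fun=> 0) = 0.
Proof. by apply/(bfs_eq0 bX); [exact: Lmeas_cst|exact: aeW]. Qed.

(** The tail infima [einfs] increase to the limit and lie below the [F k], so the monotone axiom
    applies to them. *)
Lemma bfs_liminf (F : nat -> E -> \bar R) f (c : \bar R) :
  (forall k, Lmeas (F k)) -> Lmeas f -> (forall k x, 0 <= F k x) ->
  (\forall x \ae mu, F k x @[k --> \oo] --> f x) ->
  (forall k, X (F k) <= c) -> X f <= c.
Proof.
move=> mF mf F0 Ff Fc.
pose G k x := einfs (F^~ x) k.
have mG k : Lmeas (G k) by apply: measurable_fun_einfs => j; exact: mF.
have GF k x : 0 <= G k x <= F k x.
  apply/andP; split; last by apply: ereal_inf_lbound; exists k => /=.
  by apply: le_ereal_inf_tmp => _ [j _ <-].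
have [//|_ Xcvg] := bfs_fatou bX mG mf.
  apply: filterS Ff => x Fx; split=> [k|]; first by have /andP[] := GF k x.
  split; first exact: nondecreasing_einfs.
  exact: cvg_einfs.
apply: (@cvge_le _ _ _ _ _ _ _ _ Xcvg); apply: nearW => k /=.
apply: le_trans (Fc k); apply: bfs_le => // x; have /andP[G0 GFk] := GF k x.
by rewrite !gee0_abs.
Qed.

(** The associate norm has the absolute value outside the integral; the identity
    [g * sgnto f g = |f g|] brings it inside. *)
Definition sgnto (f g : E -> \bar R) (x : E) : \bar R :=
  if 0 <= g x then `|f x| else - `|f x|.

Lemma measurable_sgnto f g : Lmeas f -> Lmeas g -> Lmeas (sgnto f g).
Proof.
move=> mf mg; apply: measurable_fun_ifT.
- apply: (measurable_fun_bool true); rewrite setTI.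
  rewrite (_ : _ @^-1` _ = g @^-1` `[0, +oo[%classic); last first.
    by apply/seteqP; split => x /=; rewrite in_itv/= andbT.
  have := mg measurableT _ (emeasurable_itv `[0, +oo[); by rewrite setTI.
- exact: Lmeas_abse.
- exact: (measurableT_comp (@oppe_measurable R setT) (Lmeas_abse mf)).
Qed.

Lemma bfs_hoelder f g : mem_space X f -> Lmeas g ->
  \int[mu]_x `|f x * g x| <= X f * assoc X g.
Proof.
move=> [mf Xf] mg; have Xf0 := bfs_ge0 bX mf.
(* Treated apart because [assoc X g] may be infinite, so that the right-hand side can be
   [0 * oo = 0]; the left-hand side vanishes since [f = 0] a.e. *)
have [X0|Xn0] := eqVneq (X f) 0.
  rewrite X0 mul0e; have f0 : \forall x \ae mu, f x = 0 by exact/(bfs_eq0 bX).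
  have := @int_ae_le R n setT (fun x => `|f x * g x|) (fun=> 0) measurableT
    (Lmeas_abse (LmeasM mf mg)) (Lmeas_cst _) (fun x => abse_ge0 _) (fun=> lexx _).
  by rewrite integral0; apply; apply: filterS f0 => x -> _; rewrite mul0e abse0.
have Xfin : X f \is a fin_num by rewrite ge0_fin_numE.
pose c := fine (X f); have c0 : (0 < c)%R by rewrite fine_gt0// lt_neqAle eq_sym Xn0 Xf0.
have XE : X f = c%:E by rewrite fineK.
pose s x := (c^-1)%:E * sgnto f g x.
have ms0 := measurable_sgnto mf mg.
have ms : Lmeas s by exact: LmeasZ.
have Xs : X s <= 1.
  rewrite (bfs_scale bX)//; rewrite (_ : X (sgnto f g) = X f).
    by rewrite XE gtr0_norm ?invr_gt0// -EFinM mulVf// gt_eqF.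
  rewrite -(bfs_abse ms0) -(bfs_abse mf); congr X; apply/funext => x.
  by rewrite /= /sgnto; case: ifP => _; rewrite ?abseN abse_id.
have gs x : g x * s x = (c^-1)%:E * `|f x * g x|.
  rewrite /s muleCA abseM muleC [in RHS]muleC; congr (_ * _).
  rewrite /sgnto; case: ifPn => [g0|]; first by rewrite (gee0_abs g0) muleC.
  by rewrite -ltNge => g0; rewrite (lte0_abs g0) !muleN muleC.
have mfg : Lmeas (fun x => `|f x * g x|) by apply: Lmeas_abse; exact: LmeasM.
have : `|\int[mu]_x (g x * s x)| <= assoc X g by apply: ereal_sup_ubound; exists s.
under eq_integral do rewrite gs.
rewrite (intZ measurableT mfg (fun x => abse_ge0 _)); last by rewrite lee_fin invr_ge0 ltW.
rewrite gee0_abs; last by rewrite mule_ge0 ?integral_ge0// lee_fin invr_ge0 ltW.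
by rewrite -lee_pdivlMl ?invr_gt0// invrK XE.
Qed.

Section bounded_functions.
Variable D : set E.
Hypotheses (mD : measurable D) (Dfin : mu D < +oo).

(** On a set of finite measure such functions have finite integrals [bint], so the quadratic
    expansions of the variational argument take place in [R] rather than in [\bar R]. *)
Definition bddm (phi : E -> R) : Prop :=
  measurable_fun setT phi /\ exists M, forall x, (0 <= phi x <= M)%R.

Definition bint (phi : E -> R) : R := fine (\int[mu]_(x in D) (phi x)%:E).

Lemma bddm_ge0 phi x : bddm phi -> (0 <= phi x)%R.
Proof. by move=> [_ [M /(_ x)/andP[]]]. Qed.

Lemma bddmD f g : bddm f -> bddm g -> bddm (fun x => f x + g x)%R.
Proof.
move=> [mf [M fM]] [mg [N gN]]; split; first exact: measurable_funD.
exists (M + N)%R => x; have /andP[? ?] := fM x; have /andP[? ?] := gN x.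
by apply/andP; split; lra.
Qed.

Lemma bddmM f g : bddm f -> bddm g -> bddm (fun x => f x * g x)%R.
Proof.
move=> [mf [M fM]] [mg [N gN]]; split; first exact: measurable_mulR.
exists (M * N)%R => x; have /andP[? ?] := fM x; have /andP[? ?] := gN x.
by apply/andP; split; [exact: mulr_ge0|exact: ler_pM].
Qed.

Lemma bddm_cst (c : R) : (0 <= c)%R -> bddm (fun=> c).
Proof.
by move=> c0; split; [exact: measurable_cst|exists c => x; rewrite c0 lexx].
Qed.

Lemma bddm_sq f g : bddm f -> bddm g -> bddm (fun x => (f x - g x) ^+ 2)%R.
Proof.
move=> [mf [M fM]] [mg [N gN]]; split; first exact: measurable_sq.
exists ((M + N) ^+ 2)%R => x; have /andP[? ?] := fM x; have /andP[? ?] := gN x.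
rewrite sqr_ge0/= -real_normK ?num_real// lerXn2r ?nnegrE//; first lra.
by rewrite ler_norml; apply/andP; split; lra.
Qed.

Lemma bintE f : bddm f -> \int[mu]_(x in D) (f x)%:E = (bint f)%:E.
Proof. by move=> [mf [M fM]]; rewrite fineK// (int_bounded_fin mD Dfin mf fM). Qed.

Lemma bint_ge0 f : bddm f -> (0 <= bint f)%R.
Proof.
by move=> bf; apply: fine_ge0; apply: integral_ge0 => x _; rewrite lee_fin bddm_ge0.
Qed.

Lemma bintD f g : bddm f -> bddm g -> bint (fun x => f x + g x)%R = (bint f + bint g)%R.
Proof.
move=> bf bg; apply: EFin_inj; rewrite EFinD -(bintE (bddmD bf bg)) -!bintE//.
apply: (intD mD (Lmeas_fin bf.1) _ (Lmeas_fin bg.1)) => x; rewrite lee_fin; exact: bddm_ge0.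
Qed.

Lemma bintZ (c : R) f : (0 <= c)%R -> bddm f -> bint (fun x => c * f x)%R = (c * bint f)%R.
Proof.
move=> c0 bf; apply: EFin_inj; rewrite EFinM -(bintE (bddmM (bddm_cst c0) bf)) -bintE//.
have f0 x : 0 <= (EFin \o f) x by rewrite lee_fin; exact: bddm_ge0.
by rewrite -(intZ mD (Lmeas_fin bf.1) f0) ?lee_fin.
Qed.

Lemma bint_le f g : bddm f -> bddm g -> (forall x, (f x <= g x)%R) -> (bint f <= bint g)%R.
Proof.
move=> bf bg fg; rewrite -lee_fin -!bintE//.
apply: (int_le mD (Lmeas_fin bf.1) (Lmeas_fin bg.1)) => x; rewrite lee_fin//; exact: bddm_ge0.
Qed.

End bounded_functions.

Section separation.
Variables (D : set E) (F : E -> R) (N : R).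
Hypotheses (mD : measurable D) (Dfin : mu D < +oo) (mF : measurable_fun setT F).
Hypotheses (F0 : forall x, (0 <= F x <= N)%R) (FD : forall x, ~ D x -> F x = 0%R).
Hypothesis XF : 1 < X (EFin \o F).

Local Notation C := [set h : E -> R | below F h /\ X (EFin \o h) <= 1].

Lemma bfs_proj : exists h0, C h0 /\
  forall h, C h -> sqdist mu D F h0 <= sqdist mu D F h.
Proof.
apply: (exists_minimizer mD Dfin mF F0 FD).
- exists (cst 0%R); split; last by rewrite (_ : EFin \o _ = fun=> 0) ?bfs0.
  by split=> [|x]; [exact: measurable_cst|have := F0 x; rewrite lexx => /andP[->]].
- by move=> h [].
- move=> g h [[mg bg] Xg] [[mh bh] Xh]; split.
    split=> [|x]; last first.
      by have /andP[? ?] := bg x; have /andP[? ?] := bh x; apply/andP; split; lra.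
    apply: measurable_mulR; last exact: measurable_cst.
    exact: measurable_funD.
  have -> : EFin \o (fun x => (g x + h x) / 2)%R =
      fun x => (2^-1)%:E * (EFin \o g) x + (2^-1)%:E * (EFin \o h) x.
    by apply/funext => x /=; rewrite -!EFinM -EFinD; congr EFin; ring.
  have mgE := Lmeas_fin mg; have mhE := Lmeas_fin mh.
  apply: le_trans (bfs_triangle bX (LmeasZ _ mgE) (LmeasZ _ mhE)) _.
  rewrite !(bfs_scale bX)// gtr0_norm// (_ : 1 = (2^-1)%:E * 1 + (2^-1)%:E * 1).
    by apply: leeD; apply: lee_wpmul2l => //; rewrite lee_fin.
  by rewrite !mule1 -EFinD; congr EFin; field.
- move=> h H CH bh Hh; split=> //.
  apply: (bfs_liminf (F := fun k => EFin \o H k)) => //.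
  + by move=> k; apply: Lmeas_fin; exact: (CH k).1.1.
  + by apply: Lmeas_fin; exact: bh.1.
  + by move=> k x; rewrite lee_fin; have /andP[] := (CH k).1.2 x.
  + by apply: filterS Hh => x cx; apply: cvg_EFin => //; exact: nearW.
  + by move=> k; exact: (CH k).2.
Qed.

(* The separating functional is the residual of the L^2 projection of [F] onto the
   functions between [0] and [F] of norm at most one, suitably normalized. *)
Lemma bfs_separation : exists g : E -> R, [/\ measurable_fun setT g,
  exists M, forall x, (0 <= g x <= M)%R, assoc X (EFin \o g) <= 1 &
  1 < \int[mu]_x (F x * g x)%:E].
Proof.
have [h0 [[[mh0 bh0] Xh0] hmin]] := bfs_proj.
have bF : bddm F by split=> //; exists N.
have bh : bddm h0.
  split=> //; exists N => x; have /andP[-> /le_trans] := bh0 x; apply.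
  by have /andP[] := F0 x.
pose g x := (F x - h0 x)%R.
have bg : bddm g.
  split; first exact: measurable_funB.
  exists N => x; have /andP[? ?] := bh0 x; have /andP[? ?] := F0 x.
  by apply/andP; split; rewrite /g; lra.
have gD x : ~ D x -> g x = 0%R.
  move=> nD; have := bh0 x; rewrite /g (FD nD) => /andP[a b].
  have -> : h0 x = 0%R by apply/eqP; rewrite eq_le b a.
  by rewrite subr0.
pose I := bint D.
pose c := I (fun x => g x * h0 x)%R.
have c0 : (0 <= c)%R by apply: bint_ge0; exact: bddmM.
have var h : bddm h -> X (EFin \o h) <= 1 -> (I (fun x => g x * h x) <= c)%R.
  move=> bdh Xh; pose K := I (fun x => (h x - h0 x) ^+ 2)%R.
  have K0 : (0 <= K)%R by apply: bint_ge0; exact: bddm_sq.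
  (* First variation of the distance at [h0] in the direction [h - h0]. The point [a] of the segment
     may exceed [F]; cutting it at [F] keeps the norm at most one and does not increase the distance
     to [F], so minimality applies to [k]. *)
  have step (t : R) : (0 < t)%R -> (t <= 1)%R -> (I (fun x => g x * h x) <= c + t * K)%R.
    move=> t0 t1; pose a x : R := ((1 - t) * h0 x + t * h x)%R.
    have t1' : (0 <= 1 - t)%R by rewrite subr_ge0.
    have ba : bddm a by apply: bddmD; apply: bddmM => //; apply: bddm_cst => //; exact: ltW.
    have Xa : X (EFin \o a) <= 1.
      have -> : EFin \o a = fun x => (1 - t)%:E * (EFin \o h0) x + t%:E * (EFin \o h) x.
        by apply/funext => x.
      have mhE := Lmeas_fin bdh.1; have mh0E := Lmeas_fin bh.1.
      apply: le_trans (bfs_triangle bX (LmeasZ _ mh0E) (LmeasZ _ mhE)) _.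
      rewrite !(bfs_scale bX)// ger0_norm// gtr0_norm// (_ : 1 = (1 - t)%:E * 1 + t%:E * 1).
        by apply: leeD; apply: lee_wpmul2l => //; rewrite lee_fin ?ltW.
      by rewrite !mule1 -EFinD subrK.
    pose k x : R := Num.min (a x) (F x).
    have bk x : (0 <= k x <= F x)%R.
      by rewrite le_min ge_min lexx orbT (bddm_ge0 _ ba) (bddm_ge0 _ bF).
    have mk : measurable_fun setT k by exact: (measurable_minr ba.1 mF).
    have Ck : C k.
      split; first by split.
      apply: le_trans Xa; apply: bfs_le; [exact: Lmeas_fin ba.1|exact: Lmeas_fin|].
      move=> x; rewrite /= !ger0_norm ?(bddm_ge0 _ ba)//; last by have /andP[] := bk x.
      by rewrite lee_fin ge_min lexx.
    have bFa : bddm (fun x => (F x - a x) ^+ 2)%R by exact: bddm_sq.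
    have bFk : bddm (fun x => (F x - k x) ^+ 2)%R.
      apply: bddm_sq => //; split=> //; exists N => x.
      by have /andP[-> /le_trans] := bk x; apply; have /andP[] := F0 x.
    have bFh : bddm (fun x => (F x - h0 x) ^+ 2)%R by exact: bddm_sq.
    have h1 : (I (fun x => (F x - h0 x) ^+ 2) <= I (fun x => (F x - k x) ^+ 2))%R.
      have := hmin _ Ck; rewrite /sqdist (bintE mD Dfin bFh) (bintE mD Dfin bFk).
      by rewrite lee_fin.
    have h2 : (I (fun x => (F x - k x) ^+ 2) <= I (fun x => (F x - a x) ^+ 2))%R.
      apply: bint_le => // x; rewrite /k; case: (leP (a x) (F x)) => // _.
      by rewrite subrr expr0n /= sqr_ge0.
    have bgh : bddm (fun x => g x * h x)%R by exact: bddmM.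
    have bgh0 : bddm (fun x => g x * h0 x)%R by exact: bddmM.
    have bd : bddm (fun x => (h x - h0 x) ^+ 2)%R by exact: bddm_sq.
    have t20 : (0 <= 2 * t)%R by rewrite mulr_ge0// ltW.
    have tt0 : (0 <= t ^+ 2)%R by exact: sqr_ge0.
    have bz (s : R) f : (0 <= s)%R -> bddm f -> bddm (fun x => s * f x)%R.
      by move=> s0 bf; apply: bddmM => //; exact: bddm_cst.
    have h3 : (I (fun x => (F x - a x) ^+ 2) + 2 * t * I (fun x => g x * h x) =
        I (fun x => (F x - h0 x) ^+ 2) + 2 * t * c + t ^+ 2 * K)%R.
      have b1 := bz _ _ t20 bgh; have b2 := bz _ _ t20 bgh0; have b3 := bz _ _ tt0 bd.
      have e1 := bintZ mD Dfin t20 bgh; have e2 := bintZ mD Dfin t20 bgh0.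
      have e3 := bintZ mD Dfin tt0 bd; have e4 := bintD mD Dfin bFa b1.
      have e5 := bintD mD Dfin bFh b2; have e6 := bintD mD Dfin (bddmD bFh b2) b3.
      rewrite /c /K /I -e1 -e4 -e2 -e5 -e3 -e6.
      by congr bint; apply/funext => x; rewrite /a /g; ring.
    have h4 := le_trans h1 h2; move: h3 h4; set J := I (fun x => g x * h x)%R.
    move=> h3 h4; have h5 : (t * (2 * J) <= t * (2 * c + t * K))%R by nra.
    by move: h5; rewrite ler_pM2l// => h5; nra.
  apply/ler_addgt0Pr => e e0; have eK : (0 < e + K)%R by rewrite ltr_wpDr.
  have := step (e / (e + K))%R; rewrite divr_gt0// ler_pdivrMr// mul1r lerDl K0.
  move=> /(_ isT isT) /le_trans; apply; rewrite lerD2l mulrAC ler_pdivrMr// ler_pM2l//.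
  by rewrite lerDr ltW.
have bFg : bddm (fun x => F x * g x)%R by exact: bddmM.
have bgg : bddm (fun x => (F x - h0 x) ^+ 2)%R by exact: bddm_sq.
have Fg : I (fun x => F x * g x)%R = (c + I (fun x => (F x - h0 x) ^+ 2))%R.
  rewrite /c /I -(bintD mD Dfin (bddmM bg bh) bgg).
  by congr bint; apply/funext => x; rewrite /g; ring.
have I0 : (0 < I (fun x => (F x - h0 x) ^+ 2))%R.
  rewrite lt_neqAle bint_ge0// andbT eq_sym; apply/eqP => I0.
  have : \int[mu]_(x in D) ((F x - h0 x) ^+ 2)%:E = 0 by rewrite bintE// -/I I0.
  move=> /(ae_zero_int mD (Lmeas_fin bgg.1) (fun x => _)).
  have sq0 (x : E) : 0 <= ((F x - h0 x) ^+ 2)%:E by rewrite lee_fin sqr_ge0.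
  move=> /(_ sq0) ae0; move: XF; rewrite (@bfs_ae (EFin \o F) (EFin \o h0)).
  - by move=> /lt_le_trans /(_ Xh0); rewrite ltxx.
  - exact: Lmeas_fin.
  - exact: Lmeas_fin.
  apply: filterS ae0 => x ae0; have [/ae0 /eqP|/gD] := pselect (D x).
    by rewrite eqe sqrf_eq0 subr_eq0 /= => /eqP ->.
  by rewrite /g /= => /eqP; rewrite subr_eq0 => /eqP ->.
have Fgc : (c < I (fun x => F x * g x))%R by rewrite Fg ltrDl.
have XFoo : X (EFin \o F) < +oo.
  apply: (@le_lt_trans _ _ (X (fun x => `|N|%:E * chi D x))).
    apply: bfs_le; [exact: (LmeasZ _ (measurable_chi mD))|exact: Lmeas_fin|].
    move=> x; have [Dx|nD] := pselect (D x); last by rewrite (chi0 nD) mule0 abse0 /= FD// normr0.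
    rewrite chi1// mule1 /= lee_fin normr_id; have /andP[a0 aN] := F0 x.
    by rewrite ger0_norm// (le_trans aN)// ler_norm.
  rewrite (bfs_scale bX _ (measurable_chi mD)) lte_mul_pinfty//.
  exact: bfs_chi.
(* [c] is the normalizing factor of the functional. If it were zero, [var] applied to the multiple
   of [F] of norm one would force the integral of [F g] to be at most [0], against [Fgc]. *)
have cpos : (0 < c)%R.
  rewrite lt_neqAle eq_sym c0 andbT; apply/eqP => c00.
  pose xi := fine (X (EFin \o F)).
  have XE : X (EFin \o F) = xi%:E by rewrite fineK// ge0_fin_numE// (bfs_ge0 bX)//; exact: Lmeas_fin.
  have xi0 : (0 < xi)%R by move: XF; rewrite XE lte_fin; exact: lt_trans.
  have xi0' : (0 <= xi^-1)%R by rewrite invr_ge0 ltW.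
  have := var (fun x => xi^-1 * F x)%R; rewrite c00.
  have -> : I (fun x => g x * (xi^-1 * F x))%R = (xi^-1 * I (fun x => F x * g x))%R.
    by rewrite -(bintZ mD Dfin xi0' bFg); congr bint; apply/funext => x; ring.
  rewrite pmulr_rle0 ?invr_gt0// => /(_ (bddmM (bddm_cst xi0') bF)).
  move: Fgc; rewrite c00 => /lt_geF -> h; suff : false by []; apply: h.
  have -> : EFin \o (fun x => xi^-1 * F x)%R = fun x => (xi^-1)%:E * (EFin \o F) x.
    by apply/funext => x.
  rewrite (bfs_scale bX _ (Lmeas_fin mF)) XE ger0_norm// -EFinM mulVf//.
  by rewrite gt_eqF.
have ci0 : (0 <= c^-1)%R by rewrite invr_ge0 ltW.
have bg' : bddm (fun x => c^-1 * g x)%R by exact: (bddmM (bddm_cst ci0) bg).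
exists (fun x => c^-1 * g x)%R; split; [exact: bg'.1|exact: bg'.2| |].
(* [var] concerns bounded nonnegative functions; a general [phi] is reached by truncating [|phi|]
   and applying Fatou's lemma. *)
- apply: ub_ereal_sup => _ [phi [mphi Xphi] <-].
  have mgE := Lmeas_fin bg.1; have ma := Lmeas_abse mphi.
  apply: (@le_trans _ _ (\int[mu]_x ((c^-1)%:E * ((g x)%:E * `|phi x|)))).
    apply: le_trans (le_abse_integral mu measurableT (LmeasM (Lmeas_fin bg'.1) mphi)) _.
    rewrite le_eqVlt; apply/orP; left; apply/eqP; apply: eq_integral => x _.
    by rewrite abseM (gee0_abs (_ : 0 <= _)) ?lee_fin ?(bddm_ge0 _ bg')// muleA -EFinM.
  have ga0 x : 0 <= (g x)%:E * `|phi x| by rewrite mule_ge0// lee_fin (bddm_ge0 _ bg).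
  rewrite (intZ measurableT (LmeasM mgE ma) ga0) ?lee_fin//.
  rewrite -lee_pdivlMl ?invr_gt0// invrK mule1.
  have -> : \int[mu]_x ((g x)%:E * `|phi x|) = \int[mu]_(x in D) ((g x)%:E * `|phi x|).
    rewrite (int_chiE _ mD); apply: eq_integral => x _.
    have [Dx|nD] := pselect (D x); first by rewrite chi1// mule1.
    by rewrite gD// mul0e chi0// mul0e.
  pose phik k x := etrunc k `|phi x|.
  have bphi k : bddm (phik k).
    split; first exact: measurable_etrunc.
    by exists k%:R => x; rewrite etrunc_ge0 ?etrunc_le.
  have p0 k x : 0 <= (EFin \o (fun x => g x * phik k x)%R) x.
    by rewrite lee_fin (bddm_ge0 _ (bddmM bg (bphi k))).
  apply: (fatou_le mD (LmeasM mgE ma) (fun k => Lmeas_fin (bddmM bg (bphi k)).1) ga0 p0).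
  + apply: aeW => x _; rewrite (_ : (fun k => _) = fun k => (g x)%:E * (phik k x)%:E)//.
    by apply: cvgeZl => //; exact: cvg_etrunc.
  + move=> k; rewrite (bintE mD Dfin (bddmM bg (bphi k))) lee_fin; apply: var => //.
    apply: le_trans Xphi; apply: bfs_le => //; first exact: Lmeas_fin (bphi k).1.
    move=> x; rewrite /= ger0_norm ?(bddm_ge0 _ (bphi k))//.
    exact: etrunc_lel.
- have -> : \int[mu]_x (F x * (c^-1 * g x))%:E = \int[mu]_(x in D) (c^-1 * (F x * g x))%:E.
    rewrite (int_chiE _ mD); apply: eq_integral => x _.
    have [Dx|nD] := pselect (D x); first by rewrite chi1// mule1 mulrCA.
    by rewrite gD// !mulr0 mul0e.
  rewrite (bintE mD Dfin (bddmM (bddm_cst ci0) bFg)) (bintZ mD Dfin ci0 bFg) lte_fin.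
  by rewrite -/I mulrC ltr_pdivlMr// mul1r.
Qed.

End separation.

Definition truncf k (f : E -> \bar R) (x : E) : R :=
  (etrunc k `|f x| * \1_(eball (0%R : 'rV[R]_n) k%:R) x)%R.

Lemma truncf_bddm k f : Lmeas f -> bddm (truncf k f).
Proof.
move=> mf; apply: bddmM.
  split; first exact: measurable_etrunc (Lmeas_abse mf).
  by exists k%:R => x; rewrite etrunc_ge0 ?etrunc_le.
split; first by apply: measurable_indic; exact: measurable_eball.
by exists 1%R => x; rewrite indicE; case: (_ \in _); rewrite lexx ?ler01.
Qed.

Lemma truncf_le k f x : (truncf k f x)%:E <= `|f x|.
Proof.
apply: le_trans (etrunc_lel k (abse_ge0 (f x))); rewrite lee_fin.
by rewrite ler_piMr ?etrunc_ge0// indicE; case: (_ \in _).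
Qed.

Lemma cvg_truncf f x : (truncf k f x)%:E @[k --> \oo] --> `|f x|.
Proof.
apply: cvg_trans (cvg_etrunc (abse_ge0 (f x))); apply: near_eq_cvg.
near=> k; rewrite /truncf indicE mem_set ?mulr1//=.
near: k; exact: nbhs_infty_gtr.
Unshelve. all: by end_near. Qed.

Lemma bfs_truncf f (c : \bar R) : Lmeas f ->
  (forall k, X (EFin \o truncf k f) <= c) -> X f <= c.
Proof.
move=> mf Xc; rewrite -(bfs_abse mf).
apply: (bfs_liminf (F := fun k => EFin \o truncf k f)) => //.
- by move=> k; apply: Lmeas_fin; exact: (truncf_bddm k mf).1.
- exact: Lmeas_abse.
- by move=> k x; rewrite lee_fin (bddm_ge0 _ (truncf_bddm k mf)).
- by apply: aeW => x; exact: cvg_truncf.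
Qed.

(** If a truncation of [f] had norm above [c + e], dividing by [c + e] would give norm above one;
    the separating [g] would pair with it to more than one, while the assumption allows at most
    [c / (c + e)]. Testing bounded [g] is enough, because the separating function is bounded. *)
Lemma lorentz_luxemburg f (c : R) : Lmeas f ->
  (forall g, bddm g -> assoc X (EFin \o g) <= 1 ->
     \int[mu]_x (`|f x| * (g x)%:E) <= c%:E) ->
  X f <= c%:E.
Proof.
move=> mf fc; apply/lee_addgt0Pr => e e0; rewrite -EFinD.
have c0 : (0 <= c)%R.
  have b0 : bddm (fun=> 0 : R)%R by exact: bddm_cst.
  rewrite -lee_fin; apply: le_trans (fc _ b0 _).
    by apply: integral_ge0 => x _; rewrite mule_ge0.
  apply: ub_ereal_sup => _ [phi _ <-]; rewrite (_ : integral _ _ _ = 0) ?abse0//.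
  by rewrite -[RHS](integral0 mu setT); apply: eq_integral => x _; rewrite /= mul0e.
have ce0 : (0 < c + e)%R by rewrite ltr_wpDl.
have ci0 : (0 <= (c + e)^-1)%R by rewrite invr_ge0 ltW.
apply: bfs_truncf => // k; rewrite leNgt; apply/negP => Xk.
have bk := truncf_bddm k mf; have [mk [M Mk]] := bk.
pose F x := ((c + e)^-1 * truncf k f x)%R.
have bF : bddm F by exact: (bddmM (bddm_cst ci0) bk).
have k0 : (0 < k)%N.
  rewrite lt0n; apply/eqP => k0; move: Xk; rewrite (_ : EFin \o _ = fun=> 0).
    by rewrite bfs0 lte_fin => /(lt_trans ce0); rewrite ltxx.
  apply/funext => x /=; rewrite /truncf; apply/eqP; rewrite eqe mulf_eq0; apply/orP; left.
  by rewrite eq_le etrunc_ge0// andbT; have := etrunc_le k (abse_ge0 (f x)); rewrite k0.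
have mD := @measurable_eball R n (0%R : 'rV[R]_n) k%:R.
have Dfin : mu (eball (0%R : 'rV[R]_n) k%:R) < +oo by apply: leb_eball_fin; rewrite ltr0n.
have [mF [M' FM]] := bF.
have FD x : ~ eball (0%R : 'rV[R]_n) k%:R x -> F x = 0%R.
  by move=> nx; rewrite /F /truncf indicE memNset// !mulr0.
have XF : 1 < X (EFin \o F).
  have -> : EFin \o F = fun x => ((c + e)^-1)%:E * (EFin \o truncf k f) x.
    by apply/funext => x.
  rewrite (bfs_scale bX _ (Lmeas_fin mk)) gtr0_norm ?invr_gt0//.
  by rewrite lte_pdivlMl// mule1.
have [g [mg [Mg gM] ag]] := bfs_separation mD Dfin mF FM FD XF.
have bg : bddm g by split=> //; exists Mg.
apply/negP; rewrite -leNgt.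
have := fc _ bg ag; move=> fgc.
have mfg : Lmeas (fun x => `|f x| * (g x)%:E).
  exact: (LmeasM (Lmeas_abse mf) (Lmeas_fin mg)).
have fg0 x : 0 <= `|f x| * (g x)%:E by rewrite mule_ge0// lee_fin (bddm_ge0 _ bg).
apply: (@le_trans _ _ (\int[mu]_x (((c + e)^-1)%:E * (`|f x| * (g x)%:E)))).
  apply: (int_le measurableT (Lmeas_fin (bddmM bF bg).1) (LmeasZ _ mfg)).
    by move=> x; rewrite lee_fin (bddm_ge0 _ (bddmM bF bg)).
  move=> x _; rewrite (_ : _ x = ((c + e)^-1)%:E * ((truncf k f x)%:E * (g x)%:E)).
    apply: lee_wpmul2l; first by rewrite lee_fin.
    by apply: lee_wpmul2r (truncf_le k f x); rewrite lee_fin (bddm_ge0 _ bg).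
  by rewrite -!EFinM mulrA.
rewrite (intZ measurableT mfg fg0) ?lee_fin// lee_pdivrMl// mule1.
by apply: le_trans fgc _; rewrite lee_fin lerDl ltW.
Qed.

End bfs.

(** * Blocks and Morrey spaces *)

Section operator_norms.
Context {R : realType} {n : nat}.
Local Notation E := (Rn R n).

Lemma opnorm_le (X Y : fnorm R n) S f : Lmeas f -> X f <= 1 -> Y (S f) <= opnorm X Y S.
Proof. by move=> mf Xf; apply: ereal_sup_ubound; exists f. Qed.

Lemma mopnorm_le m (X : 'I_m -> fnorm R n) (Y : fnorm R n) S f :
  (forall i, Lmeas (f i)) -> (forall i, X i (f i) <= 1) -> Y (S f) <= mopnorm X Y S.
Proof. by move=> mf Xf; apply: ereal_sup_ubound; exists f. Qed.

End operator_norms.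

Lemma muleDr_pos (R : realType) (s : R) (x y : \bar R) : (0 < s)%R ->
  s%:E * (x + y) = s%:E * x + s%:E * y.
Proof.
move=> s0; case: x y => [x||] [y||]; rewrite ?gt0_muley ?gt0_muleNy ?lte_fin//=.
- by rewrite -!EFinD -!EFinM mulrDr.
Qed.

(** An inequality, so as to include [c = +oo]: a single positive term then makes the right-hand side
    infinite. It is applied with [c] the value at a point of a function that may be infinite. *)
Lemma mule_nneseries_le (R : realType) (c : \bar R) (f : nat -> \bar R) : 0 <= c ->
  (forall k, 0 <= f k) ->
  c * (\sum_(0 <= k <oo) f k) <= \sum_(0 <= k <oo) c * f k.
Proof.
case: c => [c||//] c0 f0; first by rewrite nneseriesZl.
have [[k fk]|nf] := pselect (exists k, 0 < f k); last first.
  rewrite eseries0 ?mule0; first by apply: nneseries_ge0 => k _ _; rewrite mule_ge0.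
  move=> k _ _; apply/eqP; rewrite eq_le f0 andbT leNgt; apply/negP => fk.
  by apply: nf; exists k.
apply: (@le_trans _ _ +oo); first exact: leey.
have cf0 j : 0 <= +oo * f j by rewrite mule_ge0.
apply: le_trans (nneseries_lim_ge k.+1 (fun j _ _ => cf0 j)).
rewrite big_nat_recr//= gt0_mulye// addey//.
by rewrite -ltNye (lt_le_trans ltNy0)// sume_ge0.
Qed.

Section blocks.
Context {R : realType} {n : nat}.
Local Notation E := (Rn R n).
Local Notation mu := (leb R n).
Variables (X : fnorm R n) (u : E -> R -> R).
Hypothesis u0 : forall x r, (0 < r)%R -> (0 < u x r)%R.
Local Notation B := (block_norm X u).

Lemma morrey_ball f x r : (0 < r)%R ->
  X (fun y => f y * chi (eball x r) y) <= (u x r)%:E * morrey X u f.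
Proof.
move=> r0; rewrite -lee_pdivrMl ?u0//.
by apply: ereal_sup_ubound; exists (x, r).
Qed.

Lemma block_norm_ge0 f : 0 <= B f.
Proof.
by apply: le_ereal_inf_tmp => _ [lam [b [_ ->]]]; exact: nneseries_ge0.
Qed.

(** The block norm is an infimum that need not be attained; the strict bound [c] supplies an actual
    representation, which is scaled term by term. *)
Lemma block_norm_scale s f (c : \bar R) : (0 < s)%R -> B f < c ->
  B (fun x => s%:E * f x) <= s%:E * c.
Proof.
move=> s0 /ereal_inf_lt[_ [lam [b [[blk slam cvg] ->]]] lamc].
apply: (@le_trans _ _ (\sum_(0 <= k <oo) (`|s * lam k|)%:E)).
  apply: ereal_inf_lbound; exists (fun k => s * lam k)%R, b; split=> //; split=> //.
    under eq_eseriesr do rewrite normrM EFinM.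
    by rewrite nneseriesZl// lte_mul_pinfty// lee_fin.
  apply: filterS cvg => x [fx cfx]; split; first by rewrite fin_numM.
  rewrite (_ : (fun N => _) = fun N => s%:E * \sum_(0 <= k < N) (lam k)%:E * b k x).
    exact: cvgeZl.
  apply/funext => N; elim: N => [|N IH]; first by rewrite !big_nil mule0.
  by rewrite !big_nat_recr//= IH muleDr_pos// muleA -EFinM.
under eq_eseriesr do rewrite normrM EFinM gtr0_norm//.
by rewrite nneseriesZl//; apply: lee_wpmul2l; rewrite ?lee_fin; exact: ltW.
Qed.

Lemma block_norm_block f : block X u f -> (forall x, f x \is a fin_num) -> B f <= 1.
Proof.
move=> bf ff.
pose lam (k : nat) : R := if k is 0%N then 1%R else 0%R.
have sE N : (0 < N)%N -> forall x, \sum_(0 <= k < N) (lam k)%:E * f x = f x.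
  case: N => // N _ x; rewrite big_nat_recl//= mul1e big1 ?adde0// => k _.
  by rewrite mul0e.
have s1 : \sum_(0 <= k <oo) (`|lam k|)%:E = 1.
  rewrite (nneseries_split 0 1)// big_nat1 /lam normr1 eseries0 ?adde0//.
  by case=> //= k _ _; rewrite normr0.
apply: ereal_inf_lbound; exists lam, (fun=> f); split; last by rewrite s1.
split=> //; first by rewrite s1 ltry.
apply: aeW => x; split=> //; apply: cvg_near_cst; near=> N.
by apply: sE; near: N; exact: nbhs_infty_gt.
Unshelve. all: by end_near. Qed.

Hypothesis X00 : X (fun=> 0) = 0.

Lemma opnorm_block_ge0 : 0 <= opnorm B B (@HLmax R n).
Proof.
have B0 : B (fun=> 0) <= 1.
  apply: block_norm_block => //; exists (0%R : 'rV[R]_n), 1%R; split=> //.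
    exact: Lmeas_cst.
  by rewrite X00 lee_fin invr_ge0 ltW// u0.
by apply: le_trans (@opnorm_le _ _ B B (@HLmax R n) _ (Lmeas_cst 0) B0); exact: block_norm_ge0.
Qed.

Variable a : R.
Hypothesis aM : opnorm B B (@HLmax R n) = a%:E.

Let opnorm_fin_ge0 : (0 <= a)%R. Proof. by rewrite -lee_fin -aM opnorm_block_ge0. Qed.

Lemma block_norm_HLmax f c : Lmeas f -> B f <= c%:E -> B (HLmax f) <= (a * c)%:E.
Proof.
move=> mf fc; have a0 := opnorm_fin_ge0.
have c0 : (0 <= c)%R by rewrite -lee_fin; apply: le_trans fc; exact: block_norm_ge0.
apply/lee_addgt0Pr => e e0; rewrite -EFinD.
(* Normalizing by [c + d] instead of [c] keeps the bounds strict and covers [c = 0]. The total error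
   is [d (a + 1)], which is [e / 2]. *)
pose d := (e / (2 * (a + 1)))%R.
have d0 : (0 < d)%R by rewrite divr_gt0// mulr_gt0// ltr_wpDl.
have cd0 : (0 < c + d)%R by rewrite ltr_wpDl.
pose h x := ((c + d)^-1)%:E * f x.
have mh : Lmeas h by exact: LmeasZ.
have Bh : B h <= 1.
  have -> : 1 = ((c + d)^-1)%:E * (c + d)%:E :> \bar R.
    by rewrite -EFinM mulVf// gt_eqF.
  apply: block_norm_scale; rewrite ?invr_gt0//.
  by apply: le_lt_trans fc _; rewrite lte_fin ltrDl.
have := @opnorm_le _ _ B B (@HLmax R n) _ mh Bh; rewrite aM => Ba.
have -> : HLmax f = fun x => (c + d)%:E * HLmax h x.
  apply/funext => x; rewrite HLmaxZ// gtr0_norm ?invr_gt0// muleA -EFinM mulfV ?mul1e//.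
  by rewrite gt_eqF.
apply: (@le_trans _ _ ((c + d)%:E * (a + d / (c + d))%:E)).
  apply: block_norm_scale => //; apply: le_lt_trans Ba _.
  by rewrite lte_fin ltrDl divr_gt0.
rewrite -EFinM lee_fin mulrDr [(_ + _ * (d / _))%R](_ : _ = (c + d) * a + d)%R; last first.
  by field; rewrite gt_eqF.
rewrite mulrDl mulrC -addrA lerD2l.
have : (d * (2 * (a + 1)) = e)%R by rewrite /d divfK// gt_eqF// mulr_gt0// ltr_wpDl.
nra.
Qed.

Lemma block_norm_HLiter k f : Lmeas f -> B f <= 1 -> B (HLiter k f) <= (a ^+ k)%:E.
Proof.
move=> mf Bf; elim: k => [|k IH]; first by rewrite expr0.
by rewrite exprS HLiterS; apply: block_norm_HLmax => //; exact: measurable_HLiter.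
Qed.

End blocks.

Section block_duality.
Context {R : realType} {n : nat}.
Local Notation E := (Rn R n).
Local Notation mu := (leb R n).
Variables (X : fnorm R n) (u : E -> R -> R).
Hypothesis bX : banach_function_space X.
Hypothesis u0 : forall x r, (0 < r)%R -> (0 < u x r)%R.
Local Notation B := (block_norm (assoc X) u).

Lemma assoc_ge0 f : 0 <= assoc X f.
Proof.
apply: (@le_trans _ _ `|\int[mu]_x (f x * (fun=> 0) x)|); first exact: abse_ge0.
apply: ereal_sup_ubound; exists (fun=> 0) => //.
by split; [exact: Lmeas_cst|rewrite (bfs0 bX)].
Qed.

Lemma assoc0 : assoc X (fun=> 0) = 0.
Proof.
apply/eqP; rewrite eq_le assoc_ge0 andbT; apply: ge_ereal_sup => _ [g _ <-].
by under eq_integral do rewrite mul0e; rewrite integral0 abse0.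
Qed.

Lemma morrey_ge0 f : Lmeas f -> 0 <= morrey X u f.
Proof.
move=> mf; pose x0 : E := (0%R : 'rV[R]_n).
apply: (@le_trans _ _ (((u x0 1)^-1)%:E * X (fun y => f y * chi (eball x0 1) y))).
  apply: mule_ge0; first by rewrite lee_fin invr_ge0 ltW// u0.
  by apply: (bfs_ge0 bX); apply: Lmeas_chi => //; exact: measurable_eball.
by apply: ereal_sup_ubound; exists (x0, 1%R) => //=; exact: ltr01.
Qed.

(** The block lives on one ball, so the Hoelder inequality is applied to the restriction of [phi] to
    it; the factor [u] from the Morrey norm cancels the [1 / u] in the size of the block. *)
Lemma int_morrey_block phi b : Lmeas phi -> morrey X u phi < +oo ->
  block (assoc X) u b -> \int[mu]_x `|phi x * b x| <= morrey X u phi.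
Proof.
move=> mphi phioo [x [r [r0 mb b0 Xb]]]; have ur0 := u0 x r0.
have mB := measurable_eball x r.
have mpB : Lmeas (fun y => phi y * chi (eball x r) y) by exact: Lmeas_chi.
have pball := morrey_ball X u0 phi x r0.
have -> : \int[mu]_y `|phi y * b y| =
    \int[mu]_y `|phi y * chi (eball x r) y * b y|.
  apply: eq_integral => y _; have [yB|nB] := pselect (eball x r y).
    by rewrite chi1// mule1.
  by rewrite (b0 _ nB) !mule0.
have XpB : mem_space X (fun y => phi y * chi (eball x r) y).
  split=> //; apply: le_lt_trans pball _; rewrite lte_mul_pinfty// lee_fin; exact: ltW.
apply: le_trans (bfs_hoelder bX XpB mb) _.
apply: (@le_trans _ _ (((u x r)%:E * morrey X u phi) * ((u x r)^-1)%:E)).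
  apply: lee_pmul => //; first exact: (bfs_ge0 bX).
  by apply: assoc_ge0.
by rewrite muleAC -EFinM mulfV ?mul1e// gt_eqF.
Qed.

(** Term by term for a representation of [h] with coefficient sum below [c + e], then [e] tends to
    zero. Block series are only required to converge as sequences of partial sums, hence [phi h] is
    first bounded by the possibly infinite series of absolute values. *)
Lemma morrey_block_hoelder phi h (c : R) : Lmeas phi -> (forall x, 0 <= phi x) ->
  Lmeas h -> (forall x, 0 <= h x) -> morrey X u phi < +oo -> B h <= c%:E ->
  \int[mu]_x (phi x * h x) <= morrey X u phi * c%:E.
Proof.
move=> mphi phi0 mh h0 poo Bh; set P := morrey X u phi in poo *.
have P0 : 0 <= P by exact: morrey_ge0.
have Pf : P \is a fin_num by rewrite ge0_fin_numE.
have key e : (0 < e)%R -> \int[mu]_x (phi x * h x) <= P * (c + e)%:E.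
  move=> e0; have : B h < (c + e)%:E by apply: le_lt_trans Bh _; rewrite lte_fin ltrDl.
  move=> /ereal_inf_lt[_ [lam [b [[blk slam cvg] ->]]] lamc].
  have mb k : Lmeas (b k) by have [? [? []]] := blk k.
  pose F k x := (`|lam k|)%:E * `|phi x * b k x|.
  have mpb k : Lmeas (fun x => `|phi x * b k x|) by apply: Lmeas_abse; exact: LmeasM.
  have mF k : Lmeas (F k) by exact: LmeasZ.
  have F0 k x : 0 <= F k x by rewrite mule_ge0// lee_fin.
  apply: (@le_trans _ _ (\int[mu]_x (\sum_(0 <= k <oo) F k x))).
    apply: (int_ae_le measurableT (LmeasM mphi mh) (Lmeas_series mF F0)).
    - by move=> x; rewrite mule_ge0.
    - by move=> x; exact: nneseries_ge0.
    apply: filterS cvg => x [fx cfx] _.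
    have sx : h x <= \sum_(0 <= k <oo) (`|lam k|)%:E * `|b k x|.
      have t0 k : 0 <= (`|lam k|)%:E * `|b k x| by rewrite mule_ge0// lee_fin.
      rewrite -(gee0_abs (h0 x)).
      have caf : `|\sum_(0 <= k < N) (lam k)%:E * b k x| @[N --> \oo] --> `|h x| by exact: cvg_abse.
      rewrite -(cvg_lim _ caf)//; apply: lime_le.
        by apply/cvg_ex; eexists; exact: caf.
      apply: nearW => N; apply: le_trans (nneseries_lim_ge N (fun k _ _ => t0 k)).
      apply: le_trans (lee_abs_sum _ _ _) _; rewrite le_eqVlt; apply/orP; left; apply/eqP.
      by apply: eq_bigr => k _; rewrite abseM.
    apply: le_trans (lee_wpmul2l (phi0 x) sx) _.
    have t0 k : 0 <= (`|lam k|)%:E * `|b k x| by rewrite mule_ge0// lee_fin.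
    apply: le_trans (mule_nneseries_le (phi0 x) t0) _.
    apply: lee_nneseries => k _; first by rewrite mule_ge0.
    by rewrite /F abseM (gee0_abs (phi0 x)) muleCA.
  rewrite (integral_nneseries mu measurableT (fun k => mF k) (fun k x _ => F0 k x)).
  apply: (@le_trans _ _ (\sum_(0 <= k <oo) (`|lam k|)%:E * (fine P)%:E)).
    apply: lee_nneseries => k _; first by move=> _; apply: integral_ge0 => x _; exact: F0.
    rewrite (intZ measurableT (mpb k) (fun x => abse_ge0 _)) ?lee_fin// fineK//.
    by apply: lee_wpmul2l; [rewrite lee_fin|exact: int_morrey_block].
  under eq_eseriesr do rewrite muleC.
  rewrite nneseriesZl// fineK//; apply: lee_wpmul2l => //; exact: ltW.
have [P00|Pn0] := eqVneq P 0.
  by have := key 1%R ltr01; rewrite P00 !mul0e.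
have Pp : (0 < fine P)%R by rewrite fine_gt0// lt_neqAle eq_sym Pn0 P0.
apply/lee_addgt0Pr => e e0.
apply: le_trans (key (e / fine P)%R _) _; first by rewrite divr_gt0.
rewrite -(fineK Pf) -!EFinM -EFinD lee_fin mulrDr mulrCA mulfV ?mulr1//.
by rewrite gt_eqF.
Qed.

Variable a : R.
Hypothesis aM : opnorm B B (@HLmax R n) = a%:E.

(** The argument of [HLiter] is a block for the associate space because [assoc X g <= 1], and each
    [HLmax] multiplies its block norm by at most [a]. *)
Lemma morrey_duality phi (g : E -> R) x r k : Lmeas phi -> (forall x, 0 <= phi x) ->
  morrey X u phi < +oo -> bddm g -> assoc X (EFin \o g) <= 1 -> (0 < r)%R ->
  \int[mu]_y (phi y * HLiter k (fun y => ((u x r)^-1 * g y * \1_(eball x r) y)%:E) y) <=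
  morrey X u phi * (a ^+ k)%:E.
Proof.
move=> mphi phi0 poo bg ag r0; set h := fun y => ((u x r)^-1 * g y * \1_(eball x r) y)%:E.
have mB := measurable_eball x r; have ur0 := u0 x r0.
have ui0 : (0 <= (u x r)^-1)%R by rewrite invr_ge0 ltW.
have b1 : bddm (\1_(eball x r) : E -> R).
  split; first exact: measurable_indic.
  by exists 1%R => y; rewrite indicE; case: (_ \in _); rewrite lexx ?ler01.
have bh := bddmM (bddmM (bddm_cst ui0) bg) b1.
have mh : Lmeas h := Lmeas_fin bh.1.
have h0 y : 0 <= h y by rewrite lee_fin (bddm_ge0 _ bh).
apply: morrey_block_hoelder => //; [exact: measurable_HLiter|exact: HLiter_ge0|].
apply: (block_norm_HLiter u0 assoc0 aM) => //.
apply: block_norm_block => //; exists x, r; split=> //.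
  by move=> y ny; rewrite /h indicE memNset// mulr0.
apply: ge_ereal_sup => _ [phi' [mp Xp] <-].
have -> : \int[mu]_y (h y * phi' y) =
    \int[mu]_y (((u x r)^-1)%:E * ((g y)%:E * (phi' y * chi (eball x r) y))).
  apply: eq_integral => y _; rewrite /h /chi !EFinM -!muleA; congr (_ * (_ * _)).
  by rewrite muleC.
have mgp : Lmeas (fun y => (g y)%:E * (phi' y * chi (eball x r) y)).
  exact: (LmeasM (Lmeas_fin bg.1) (Lmeas_chi mB mp)).
have XpB : X (fun y => phi' y * chi (eball x r) y) <= 1.
  apply: le_trans Xp; apply: bfs_le => //; first exact: Lmeas_chi.
  move=> y; rewrite abseM; have [yB|nB] := pselect (eball x r y).
    by rewrite chi1// abse1 mule1.
  by rewrite chi0// abse0 mule0 abse_ge0.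
apply: le_trans (le_abse_integral mu measurableT (LmeasZ _ mgp)) _.
under eq_integral do rewrite abseM.
rewrite (intZ measurableT (Lmeas_abse mgp) (fun x => abse_ge0 _)) ?abse_ge0//.
rewrite /= ger0_norm//.
rewrite -[leRHS]mule1; apply: lee_wpmul2l; first by rewrite lee_fin.
have mpB : mem_space X (fun y => phi' y * chi (eball x r) y).
  by split; [exact: Lmeas_chi|exact: le_lt_trans XpB (ltry _)].
have := bfs_hoelder bX mpB (Lmeas_fin bg.1).
under eq_integral do rewrite muleC.
move=> /le_trans; apply; rewrite -(mule1 1); apply: lee_pmul => //.
- by apply: (bfs_ge0 bX); exact: Lmeas_chi.
- exact: assoc_ge0.
Qed.

End block_duality.

(** * Weighted inequalities and extrapolation *)

Section vitali.
Context {R : realType} {n : nat}.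
Local Notation E := (Rn R n).
Local Notation mu := (leb R n).

Definition cube3 (Q : @cube R n) : @cube R n :=
  (\row_i (coord Q.1 i - Q.2), 3 * Q.2)%R.

Lemma coord_cube3 (Q : @cube R n) i : coord (cube3 Q).1 i = (coord Q.1 i - Q.2)%R.
Proof. by rewrite /coord mxE. Qed.

Lemma cube3_sub (Q Q' : @cube R n) x : (0 < Q.2)%R -> (Q'.2 <= Q.2)%R ->
  cset Q x -> cset Q' x -> cset Q' `<=` cset (cube3 Q).
Proof.
move=> Q0 QQ' Qx Q'x y Q'y i; rewrite coord_cube3 /=.
have /andP[? ?] := Qx i; have /andP[? ?] := Q'x i; have /andP[? ?] := Q'y i.
by apply/andP; split; lra.
Qed.

Lemma sub_cube3 (Q : @cube R n) : (0 < Q.2)%R -> cset Q `<=` cset (cube3 Q).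
Proof. by move=> Q0 x Qx; exact: (cube3_sub Q0 (lexx _) Qx Qx Qx). Qed.

(** Greedy selection: take a cube of largest side, discard the cubes meeting it, which lie in its
    triple, and recurse on the rest. Disjointness of the selection is recorded in the form in which
    it is used, as a comparison of integrals. *)
Lemma vitali_finite (I : choiceType) (Q : I -> @cube R n) (s : seq I) :
  (forall i, i \in s -> (0 < (Q i).2)%R) ->
  exists s' : seq I, [/\ {subset s' <= s},
    (forall x i, i \in s -> cset (Q i) x -> exists2 j, j \in s' & cset (cube3 (Q j)) x) &
    forall f : E -> \bar R, Lmeas f -> (forall x, 0 <= f x) ->
      \sum_(i <- s') \int[mu]_(x in cset (Q i)) f x <=
      \int[mu]_(x in \big[setU/set0]_(i <- s') cset (Q i)) f x].
Proof.
have [k] := ubnP (size s); elim: k s => // k IH s sk Q0.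
have [->|s0] := eqVneq s [::].
  exists [::]; split=> // f mf f0; by rewrite !big_nil integral_set0.
have [i0 [i0s imax]] : exists i0, i0 \in s /\ forall i, i \in s -> ((Q i).2 <= (Q i0).2)%R.
  elim: s s0 {IH sk Q0} => // a [|b s] IHs _.
    by exists a; split=> [|i]; rewrite inE// => /eqP ->.
  have [//|j [js jmax]] := IHs.
  have [aj|ja] := leP (Q a).2 (Q j).2.
    exists j; split=> [|i]; first by rewrite inE js orbT.
    by rewrite inE => /orP[/eqP ->//|/jmax].
  exists a; split=> [|i]; first by rewrite inE eqxx.
  by rewrite inE => /orP[/eqP ->//|/jmax /le_trans]; apply; exact: ltW.
pose s1 := [seq i <- s | `[< cset (Q i0) `&` cset (Q i) = set0 >]].
have i0n : i0 \notin s1.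
  rewrite mem_filter; apply/negP => /andP[/asboolP QQ _].
  have := cset_nonempty (Q0 _ i0s) => Qx.
  by have : set0 (Q i0).1 by rewrite -QQ.
have s1s i : i \in s1 -> i \in s by rewrite mem_filter => /andP[].
have sz : (size s1 < k)%N.
  apply: (@leq_trans (size s)); last by rewrite -ltnS.
  rewrite size_filter ltn_neqAle count_size andbT -all_count; apply/negP => /allP /(_ _ i0s) h.
  by move: i0n; rewrite mem_filter h i0s.
have [s' [ss' cov disj]] := IH s1 sz (fun i is1 => Q0 _ (s1s _ is1)).
exists (i0 :: s'); split.
- by move=> i; rewrite inE => /orP[/eqP ->//|/ss' /s1s].
- move=> x i is_ Qx.
  have [QQ|] := pselect (cset (Q i0) `&` cset (Q i) = set0).
    have is1 : i \in s1 by rewrite mem_filter is_ andbT; exact/asboolP.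
    have [j js' jx] := cov x i is1 Qx; by exists j => //; rewrite inE js' orbT.
  move=> /eqP/set0P[y [Q0y Qy]]; exists i0; first by rewrite inE eqxx.
  exact: (cube3_sub (Q0 _ i0s) (imax _ is_) Q0y Qy Qx).
- move=> f mf f0; rewrite !big_cons.
  have mU : measurable (\big[setU/set0]_(i <- s') cset (Q i)).
    by apply: bigsetU_measurable => i _; exact: measurable_cset.
  rewrite (intU (measurable_cset _) mU mf f0).
    by apply: leeD => //; exact: disj.
  apply/seteqP; split => // x [Q0x]; rewrite -bigcup_seq => -[j /= js' Qjx].
  have := ss' _ js'; rewrite mem_filter => /andP[/asboolP QQ _].
  by have : set0 x by rewrite -QQ.
Qed.

End vitali.

Lemma int_setU_le (R : realType) n (A B : set (Rn R n)) f : measurable A -> measurable B ->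
  Lmeas f -> (forall x, 0 <= f x) ->
  \int[leb R n]_(x in A `|` B) f x <=
  \int[leb R n]_(x in A) f x + \int[leb R n]_(x in B) f x.
Proof.
move=> mA mB mf f0; have -> : A `|` B = A `|` (B `\` A).
  apply/seteqP; split => x [Ax|Bx]; try by left.
    by have [Ax|nA] := pselect (A x); [left|right].
  by right; case: Bx.
have mBA := measurableD mB mA.
rewrite (intU mA mBA mf f0); last by apply/seteqP; split => // x [Ax [_]].
by apply: leeD => //; apply: (int_sub mBA mB mf f0) => x [].
Qed.

(** The sum up to the last index in [P] is at most [r / (r - 1)] times its last term, and that term
    is at most [y]; skipping indices outside [P] only helps. *)
Lemma thin_geometric_sum (R : realFieldType) (P : pred nat) (beta r y : R) J :
  (0 <= beta)%R -> (1 < r)%R -> (0 <= y)%R -> (forall j, P j -> (beta * r ^+ j <= y)%R) ->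
  (\sum_(j < J) (if P j then beta * r ^+ j else 0) <= r / (r - 1) * y)%R.
Proof.
move=> b0 r1 y0 Py; have r10 : (0 < r - 1)%R by rewrite subr_gt0.
have C0 : (0 <= r / (r - 1))%R by rewrite divr_ge0 ?ltW// (lt_trans _ r1).
have br0 j : (0 <= beta * r ^+ j)%R by rewrite mulr_ge0// exprn_ge0// ltW// (lt_trans _ r1).
have full k : (\sum_(j < k.+1) beta * r ^+ j <= r / (r - 1) * (beta * r ^+ k))%R.
  elim: k => [|k IH].
    by rewrite big_ord1 expr0 mulr1 ler_peMl// ler_pdivlMr// mul1r gerBl ler01.
  rewrite big_ord_recr /=; apply: le_trans (lerD IH (lexx _)) _.
  rewrite -[X in (_ + X <= _)%R]mul1r exprS le_eqVlt; apply/orP; left; apply/eqP.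
  by field; rewrite gt_eqF.
elim: J => [|J IH]; first by rewrite big_ord0 mulr_ge0.
rewrite big_ord_recr /=; case: ifPn => [PJ|_]; last by rewrite addr0.
apply: (@le_trans _ _ (\sum_(j < J.+1) beta * r ^+ j)%R).
  rewrite big_ord_recr /= lerD2r; apply: ler_sum => j _; case: ifP => // _; exact: br0.
by apply: le_trans (full J) _; rewrite ler_wpM2l// Py.
Qed.

Lemma powR2_gt1 (R : realType) (s : R) : (0 < s)%R -> (1 < 2 `^ s)%R.
Proof.
move=> s0; rewrite -[X in (X < _)%R](_ : 1 `^ s = 1)%R; last by rewrite powR1.
by apply: gt0_ltr_powR; rewrite ?nnegrE// ltr1n.
Qed.

Lemma powR_exprn (R : realType) (x s : R) (j : nat) : (0 <= x)%R ->
  ((x ^+ j) `^ s = (x `^ s) ^+ j)%R.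
Proof.
move=> x0; elim: j => [|j IH]; first by rewrite !expr0 powR1.
by rewrite !exprS powRM ?exprn_ge0// IH.
Qed.

Lemma powR_predM (R : realType) (x q : R) : (0 < x)%R -> (x `^ q = x `^ (q - 1) * x)%R.
Proof.
move=> x0; rewrite -[X in (_ = _ * X)%R]powRr1 ?ltW// -powRD ?subrK//.
by rewrite (gt_eqF x0) implybT.
Qed.

(** * Weak and strong type bounds for abstract averages over countably many cubes *)

Section strong_type.
Context {R : realType} {n : nat}.
Local Notation E := (Rn R n).
Local Notation mu := (leb R n).
Variables (I : countType) (i0 : I) (Q : I -> @cube R n).
Variables (A : I -> (E -> \bar R) -> \bar R) (v rho : E -> \bar R) (c : R).
Hypotheses (vfin : forall x, v x \is a fin_num) (mv : Lmeas v) (v0 : forall x, 0 <= v x) (mrho : Lmeas rho)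
  (rho0 : forall x, 0 <= rho x) (c0 : (0 < c)%R).
Hypothesis A0 : forall i h, (0 < (Q i).2)%R -> (forall x, 0 <= h x) -> 0 <= A i h.

Definition above (h : E -> \bar R) (t : R) (x : E) : \bar R :=
  if t%:E < h x then h x else 0.

Hypothesis Asub : forall i h t, (0 < (Q i).2)%R -> Lmeas h -> (forall x, 0 <= h x) ->
  (0 < t)%R -> A i h <= t%:E + A i (above h t).
Hypothesis Acov : forall i h, (0 < (Q i).2)%R -> Lmeas h -> (forall x, 0 <= h x) ->
  A i h * \int[mu]_(x in cset (cube3 (Q i))) v x <=
  c%:E * \int[mu]_(x in cset (Q i)) (h x * rho x).

(** One abstract maximal operator serves twice: with Lebesgue averages, [v] a weight and [rho] its
    maximal function, it gives the Fefferman-Stein inequality; with weighted averages and [v = rho]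
    it bounds [wmax]. [Asub] discards the part of [h] below [t], and [Acov] is what the Vitali
    selection requires of the triples. *)
Definition supavg (h : E -> \bar R) (x : E) : \bar R :=
  ereal_sup [set (if (0 < (Q i).2)%R then A i h * chi (cset (Q i)) x else 0) | i in setT].

Lemma above_ge0 h t x : (forall x, 0 <= h x) -> 0 <= above h t x.
Proof. by move=> h0; rewrite /above; case: ifP. Qed.

Lemma measurable_lt h t : Lmeas h -> measurable [set x : E | t%:E < h x].
Proof.
move=> mh; have := mh measurableT _ (emeasurable_itv `]t%:E, +oo[); rewrite setTI.
by congr measurable; apply/seteqP; split => x /=; rewrite in_itv/= andbT.
Qed.

Lemma aboveE h t x : above h t x = h x * chi [set x : E | t%:E < h x] x.
Proof.
rewrite /above; case: ifPn => hx; first by rewrite chi1 ?mule1.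
by rewrite chi0 ?mule0//; exact/negP.
Qed.

Lemma measurable_above h t : Lmeas h -> Lmeas (above h t).
Proof.
move=> mh; rewrite (_ : above h t = fun x => h x * chi [set x : E | t%:E < h x] x).
  by apply: Lmeas_chi => //; exact: measurable_lt.
by apply/funext => x; exact: aboveE.
Qed.

Lemma weak_finite h t (s : seq I) : Lmeas h -> (forall x, 0 <= h x) -> (0 < t)%R ->
  (forall i, i \in s -> (0 < (Q i).2)%R /\ t%:E < A i h) ->
  \int[mu]_(x in \big[setU/set0]_(i <- s) cset (Q i)) v x <=
  (c / t)%:E * \int[mu]_x (h x * rho x).
Proof.
move=> mh h0 t0 sA.
have [s' [ss' cov disj]] := vitali_finite (fun i is_ => (sA i is_).1).
have mhr : Lmeas (fun x => h x * rho x) by exact: LmeasM.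
have hr0 x : 0 <= h x * rho x by rewrite mule_ge0.
have mU (J : seq I) (F : I -> @cube R n) : measurable (\big[setU/set0]_(i <- J) cset (F i)).
  by apply: bigsetU_measurable => i _; exact: measurable_cset.
apply: (@le_trans _ _ (\int[mu]_(x in \big[setU/set0]_(i <- s') cset (cube3 (Q i))) v x)).
  apply: (int_sub (mU _ _) (mU _ _) mv v0) => x.
  rewrite -!bigcup_seq => -[i /= is_ Qx]; have [j js' jx] := cov x i is_ Qx.
  by exists j.
apply: (@le_trans _ _ (\sum_(i <- s') \int[mu]_(x in cset (cube3 (Q i))) v x)).
  elim: s' {ss' cov disj} => [|a s' IH]; first by rewrite !big_nil integral_set0.
  rewrite !big_cons; apply: (@le_trans _ _ (\int[mu]_(x in cset (cube3 (Q a))) v x +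
      \int[mu]_(x in \big[setU/set0]_(i <- s') cset (cube3 (Q i))) v x)).
    exact: (int_setU_le (measurable_cset _) (mU s' (cube3 \o Q)) mv v0).
  by apply: leeD.
apply: (@le_trans _ _ (\sum_(i <- s') (c / t)%:E * \int[mu]_(x in cset (Q i)) (h x * rho x))).
  rewrite !big_seq; apply: lee_sum => i /ss' /sA [Qi Ai].
  rewrite (_ : (c / t)%:E = (t^-1)%:E * c%:E); last by rewrite -EFinM mulrC.
  rewrite -muleA lee_pdivlMl//; apply: le_trans (Acov Qi mh h0).
  apply: lee_wpmul2r; last exact: ltW.
  exact: integral_ge0.
rewrite -ge0_sume_distrr => [|i _]; last exact: integral_ge0.
apply: lee_wpmul2l; first by rewrite lee_fin divr_ge0// ltW.
apply: le_trans (disj _ mhr hr0) _.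
exact: (int_sub (mU _ _) measurableT mhr hr0).
Qed.

Lemma measurable_supavg h : Lmeas (supavg h).
Proof.
apply: measurable_ereal_sup => i; case: (_ < _)%R; last exact: Lmeas_cst.
exact: (LmeasZ _ (measurable_chi (measurable_cset _))).
Qed.

Lemma supavg_ge h i x : (0 < (Q i).2)%R -> cset (Q i) x -> A i h <= supavg h x.
Proof.
by move=> Q0 Qx; apply: ereal_sup_ubound; exists i => //; rewrite Q0 chi1// mule1.
Qed.

Lemma supavg_ge0 h : (forall x, 0 <= h x) -> forall x, 0 <= supavg h x.
Proof.
move=> h0 x; apply: le_trans (ereal_sup_ubound _); last by exists i0.
by case: (boolP (0 < (Q i0).2)%R) => [Q0|//]; apply: mule_ge0; [exact: A0|exact: chi_ge0].
Qed.

(** Where [A i h > 2 t], [Asub] gives [A i (above h t) > t]. The covering argument needs finitely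
    many cubes, so it is applied to the indices with code below [K], and [K] tends to infinity. *)
Lemma weak_type h t : Lmeas h -> (forall x, 0 <= h x) -> (0 < t)%R ->
  \int[mu]_(x in [set x | (2 * t)%:E < supavg h x]) v x <=
  (c / t)%:E * \int[mu]_x (above h t x * rho x).
Proof.
move=> mh h0 t0; have mht := measurable_above t mh.
have ht0 := fun x => above_ge0 t x h0.
pose good : pred I := fun i => (0 < (Q i).2)%R && (t%:E < A i (above h t)).
pose s K := [seq i <- pmap unpickle (iota 0 K) | good i].
pose U K := \big[setU/set0]_(i <- s K) cset (Q i).
have mUK K : measurable (U K) by apply: bigsetU_measurable => i _; exact: measurable_cset.
have UB K : \int[mu]_(x in U K) v x <= (c / t)%:E * \int[mu]_x (above h t x * rho x).
  apply: weak_finite => // i; rewrite mem_filter => /andP[/andP[? ?] _]; by split.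
pose W := [set x | (2 * t)%:E < supavg h x].
have mW : measurable W := measurable_lt _ (measurable_supavg h).
rewrite (int_chiE _ mW).
apply: (fatou_le (F := fun K x => v x * chi (U K `&` W) x) measurableT (Lmeas_chi mW mv)).
- by move=> K; apply: Lmeas_chi => //; exact: measurableI.
- by move=> x; rewrite mule_ge0// chi_ge0.
- by move=> K x; rewrite mule_ge0// chi_ge0.
- apply: aeW => x _; have [Wx|nW] := pselect (W x); last first.
    apply: cvg_near_cst; apply: nearW => K; rewrite !chi0// => -[_ //].
  have [_ [i _ <-]] := ereal_sup_gt Wx.
  case: ifPn => [Q0|_]; last by rewrite ltNge lee_fin mulr_ge0// ltW.
  have [Qx|nQ] := pselect (cset (Q i) x); last first.
    by rewrite chi0// mule0 ltNge lee_fin mulr_ge0// ltW.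
  rewrite chi1// mule1 => tA.
  have gi : good i.
    rewrite /good Q0 /=; have := lt_le_trans tA (Asub Q0 mh h0 t0).
    by rewrite mulrDl mul1r EFinD lteD2lE.
  apply: cvg_near_cst; near=> K; rewrite !chi1//; split=> //.
  rewrite /U -bigcup_seq; exists i => //=; rewrite mem_filter gi mem_pmap /=.
  apply/mapP; exists (pickle i); last by rewrite pickleK.
  rewrite mem_iota /= add0n; near: K; exact: nbhs_infty_gt.
- move=> K; have mK := measurableI _ _ (mUK K) mW.
  rewrite -(int_chiE _ mK); apply: le_trans (UB K).
  exact: (int_sub mK (mUK K) mv v0).
Unshelve. all: by end_near. Qed.

Variable q : R.
Hypothesis q1 : (1 < q)%R.

(* The strong type inequality is obtained from finitely many dyadic levels,
   without the layer cake formula. *)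
Definition cutoff (b : R) (J : nat) (y : \bar R) : \bar R :=
  if (2 * b)%:E < y then mine y (2 * b * 2 ^+ J)%:E else 0.

(** Only the highest level below [y] matters: if [y] lies between [2 b 2^j] and twice that, then
    [y <= 4 b 2^j]. The cap in [cutoff] takes care of values beyond the top level. *)
Lemma cutoff_le b J y : (0 < b)%R -> (0 < J)%N ->
  cutoff b J y `^ q <= \sum_(j < J) (if (2 * (b * 2 ^+ j))%:E < y then (((4 * (b * 2 ^+ j)) `^ q)%R)%:E else 0).
Proof.
move=> b0; case: J => // J _.
have q0 : (0 <= q)%R by rewrite ltW// (lt_trans _ q1).
have t0 j (z : \bar R) : 0 <= if (2 * (b * 2 ^+ j))%:E < z then (((4 * (b * 2 ^+ j)) `^ q)%R)%:E else 0.
  by case: ifP => //; rewrite lee_fin powR_ge0.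
rewrite /cutoff; case: ifPn => by_; last by rewrite poweR0r ?gt_eqF ?(lt_trans _ q1)//; apply: sume_ge0.
have y0 : 0 <= y by apply: le_trans (ltW by_); rewrite lee_fin mulr_ge0// ltW.
have bJ J' : (0 <= 2 * b * 2 ^+ J')%R by rewrite !mulr_ge0// ?exprn_ge0// ltW.
have main J' (z : \bar R) : 0 <= z -> z <= (2 * b * 2 ^+ J'.+1)%:E ->
    z `^ q <= (((4 * (b * 2 ^+ J')) `^ q)%R)%:E.
  move=> z0 zb; rewrite -poweR_EFin; apply: gt0_ler_poweR => //.
    - by rewrite in_itv /= z0 leey.
    - by rewrite in_itv /= leey andbT lee_fin; have := bJ J'; lra.
  by apply: le_trans zb _; rewrite lee_fin exprS; lra.
elim: J => [|J IH].
  rewrite big_ord1 expr0 mulr1 by_.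
  have := @main 0%N (mine y (2 * b * 2 ^+ 1)%:E); rewrite expr0 mulr1; apply.
    by rewrite le_min y0 lee_fin (bJ 1%N).
  by rewrite ge_min lexx orbT.
rewrite big_ord_recr /=; case: (ltP (2 * (b * 2 ^+ J.+1))%:E y) => yJ.
  rewrite -[leLHS]add0e; apply: leeD; first by apply: sume_ge0.
  by apply: main; [rewrite le_min y0 lee_fin (bJ J.+2)|rewrite ge_min lexx orbT].
rewrite adde0; apply: le_trans IH; rewrite !min_l// ?(le_trans yJ)// lee_fin; first lra.
by rewrite [X in (_ <= _ * X)%R]exprS; have := bJ J.+1; lra.
Qed.

Lemma measurable_cutoff b J (g : E -> \bar R) : Lmeas g -> Lmeas (fun x => cutoff b J (g x)).
Proof.
move=> mg; rewrite (_ : (fun _ => _) =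
    fun x => mine (g x) (2 * b * 2 ^+ J)%:E * chi [set x : E | (2 * b)%:E < g x] x).
  apply: Lmeas_chi; first exact: measurable_lt.
  exact: (measurable_mine mg (Lmeas_cst _)).
apply/funext => x; rewrite /cutoff; case: ifPn => gx; first by rewrite chi1 ?mule1.
by rewrite chi0 ?mule0//; exact/negP.
Qed.

(** The factor [4^q] comes from [cutoff_le], [c] from the weak type bound, and the last factor is
    [r / (r - 1)] for the ratio [r = 2^(q - 1)] of the geometric sum over levels. *)
Definition strong_const : R := (c * 4 `^ q * (2 `^ (q - 1) / (2 `^ (q - 1) - 1)))%R.

Lemma strong_const_ge0 : (0 <= strong_const)%R.
Proof.
rewrite /strong_const !mulr_ge0 ?powR_ge0 ?ltW// invr_gt0 subr_gt0.
by apply: powR2_gt1; rewrite subr_gt0.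
Qed.

Lemma layer_sum b J h x : (0 < b)%R -> (forall x, 0 <= h x) ->
  \sum_(j < J) (((4 * (b * 2 ^+ j)) `^ q * (c / (b * 2 ^+ j)))%R)%:E * above h (b * 2 ^+ j) x <=
  strong_const%:E * h x `^ q.
Proof.
move=> b0 h0; have q10 : (0 < q - 1)%R by rewrite subr_gt0.
have q0 : (0 < q)%R by rewrite (lt_trans _ q1).
have r1 : (1 < 2 `^ (q - 1) :> R)%R.
  exact: powR2_gt1.
have C0 : (0 < strong_const)%R.
  rewrite /strong_const !mulr_gt0 ?powR_gt0// invr_gt0 subr_gt0//.
have tau0 j : (0 < b * 2 ^+ j)%R by rewrite mulr_gt0// exprn_gt0.
case hx : (h x) => [y||]; last 2 first.
- by rewrite poweRyr ?gt_eqF// gt0_muley ?lte_fin// leey.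
- by have := h0 x; rewrite hx.
have y0 : (0 <= y)%R by have := h0 x; rewrite hx lee_fin.
under eq_bigr => j _ do rewrite /above hx lte_fin.
have coefE j : ((4 * (b * 2 ^+ j)) `^ q * (c / (b * 2 ^+ j)) =
    c * 4 `^ q * (b `^ (q - 1) * (2 `^ (q - 1)) ^+ j))%R.
  have b2 : (b * 2 ^+ j != 0)%R by rewrite gt_eqF.
  rewrite powRM//; last exact: ltW.
  rewrite [((b * 2 ^+ j) `^ q)%R]powR_predM//.
  rewrite powRM ?exprn_ge0 ?ltW// powR_exprn//.
  by move: b2; set z := (b * 2 ^+ j)%R => z0; field.
apply: (@le_trans _ _ ((c * 4 `^ q * (\sum_(j < J) (if (b * 2 ^+ j < y)%R then
    (b `^ (q - 1) * (2 `^ (q - 1)) ^+ j) else 0)) * y)%R)%:E).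
  rewrite mulr_sumr mulr_suml -sumEFin; apply: lee_sum => j _; rewrite coefE.
  by case: ifP => _; rewrite ?mule0 ?mulr0 ?mul0r// -EFinM.
rewrite poweR_EFin -EFinM lee_fin /strong_const.
have [y00|yn0] := eqVneq y 0%R; first by rewrite y00 powR0 ?gt_eqF// !mulr0.
have ypos : (0 < y)%R by rewrite lt_neqAle eq_sym yn0 y0.
rewrite (powR_predM q ypos) [leRHS]mulrA ler_wpM2r//.
rewrite -[leRHS]mulrA; apply: ler_wpM2l; first by rewrite mulr_ge0 ?powR_ge0// ltW.
apply: (thin_geometric_sum (P := fun j => (b * 2 ^+ j < y)%R)); rewrite ?powR_ge0// => j jy.
rewrite -powR_exprn// -powRM ?exprn_ge0 ?(ltW b0)//.
by apply: ge0_ler_powR; rewrite ?nnegrE ?(ltW q10) ?(ltW (tau0 _)) ?(ltW jy).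
Qed.

Lemma strong_cutoff h b J : Lmeas h -> (forall x, 0 <= h x) -> (0 < b)%R -> (0 < J)%N ->
  \int[mu]_x (cutoff b J (supavg h x) `^ q * v x) <=
  strong_const%:E * \int[mu]_x (h x `^ q * rho x).
Proof.
move=> mh h0 b0 J0; have mS := measurable_supavg h.
have S0 := supavg_ge0 h0.
pose L j := [set x : E | (2 * (b * 2 ^+ j))%:E < supavg h x].
have mL j : measurable (L j) by exact: measurable_lt.
pose F (j : 'I_J) x := (((4 * (b * 2 ^+ j)) `^ q)%R)%:E * (v x * chi (L j) x).
have mF j : Lmeas (F j) by apply: LmeasZ; exact: Lmeas_chi.
have F0 j x : 0 <= F j x by rewrite mule_ge0 ?lee_fin ?powR_ge0// mule_ge0// chi_ge0.
apply: (@le_trans _ _ (\int[mu]_x (\sum_(j < J) F j x))).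
  apply: (int_le measurableT _ (Lmeas_sum _ _ mF)).
  - by apply: LmeasM => //; apply: Lmeas_poweR; exact: measurable_cutoff.
  - by move=> x; rewrite mule_ge0// poweR_ge0.
  move=> x _; apply: le_trans (lee_wpmul2r (v0 x) (cutoff_le (supavg h x) b0 J0)) _.
  rewrite ge0_sume_distrl; last first.
    by move=> j _; case: ifP => // _; rewrite lee_fin powR_ge0.
  apply: lee_sum => j _; rewrite /F; case: ifPn => jS.
    by rewrite chi1// mule1.
  by rewrite mul0e mule_ge0 ?lee_fin ?powR_ge0// mule_ge0// chi_ge0.
rewrite (int_sum _ measurableT mF F0).
pose G (j : 'I_J) x := (((4 * (b * 2 ^+ j)) `^ q * (c / (b * 2 ^+ j)))%R)%:E *
  (above h (b * 2 ^+ j) x * rho x).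
have tau0 j : (0 < b * 2 ^+ j)%R by rewrite mulr_gt0// exprn_gt0.
have a0 t x : 0 <= above h t x * rho x by rewrite mule_ge0// above_ge0.
have ma t : Lmeas (fun x => above h t x * rho x) by apply: LmeasM => //; exact: measurable_above.
have k0 (j : nat) : (0 <= (4 * (b * 2 ^+ j)) `^ q * (c / (b * 2 ^+ j)))%R.
  by rewrite mulr_ge0 ?powR_ge0// divr_ge0// ltW.
have mG j : Lmeas (G j) by exact: LmeasZ.
have G0 j x : 0 <= G j x by rewrite mule_ge0// lee_fin.
apply: (@le_trans _ _ (\sum_(j < J) \int[mu]_x G j x)).
  apply: lee_sum => j _.
  rewrite (intZ measurableT (Lmeas_chi (mL j) mv)); last 2 first.
  - by move=> x; rewrite mule_ge0// chi_ge0.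
  - by rewrite lee_fin powR_ge0.
  rewrite (intZ measurableT (ma _) (a0 _)) ?lee_fin//.
  rewrite -(int_chiE _ (mL j)) EFinM -muleA; apply: lee_wpmul2l; first by rewrite lee_fin powR_ge0.
  exact: weak_type.
rewrite -(int_sum _ measurableT mG G0).
have mhq : Lmeas (fun x => h x `^ q * rho x) by apply: LmeasM => //; exact: Lmeas_poweR.
have hq0 x : 0 <= h x `^ q * rho x by rewrite mule_ge0// poweR_ge0.
have C0 := strong_const_ge0.
rewrite -(intZ measurableT mhq hq0) ?lee_fin//.
apply: (int_le measurableT (Lmeas_sum _ _ mG) (LmeasZ _ mhq)).
  by move=> x; apply: sume_ge0 => j _.
move=> x _; rewrite muleA; apply: le_trans (lee_wpmul2r (rho0 x) (layer_sum J x b0 h0)).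
rewrite ge0_sume_distrl; last first.
  by move=> j _; rewrite mule_ge0 ?lee_fin// above_ge0.
by apply: lee_sum => j _; rewrite /G muleA.
Qed.

(** With bottom [2^-k] and [2 k + 1] levels, the floor [2 2^-k] tends to zero and the cap [4 2^k] to
    infinity, so each finite value is eventually untouched. *)
Lemma cvg_cutoff (y : \bar R) : 0 <= y ->
  cutoff (2 ^- k) (k + k).+1 y `^ q @[k --> \oo] --> y `^ q.
Proof.
move=> y0; have q0 : (0 < q)%R by rewrite (lt_trans _ q1).
have [->|yn0] := eqVneq y 0.
  apply: cvg_near_cst; apply: nearW => k.
  by rewrite /cutoff ltNge lee_fin mulr_ge0 ?invr_ge0 ?exprn_ge0.
have ypos : 0 < y by rewrite lt_neqAle eq_sym yn0 y0.
have topE k : (2 * 2 ^- k * 2 ^+ (k + k).+1 = 4 * 2 ^+ k :> R)%R.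
  by rewrite exprS exprD; field; rewrite gt_eqF// exprn_gt0.
have pow_ge k : (k%:R <= 2 ^+ k :> R)%R by rewrite -natrX ler_nat ltnW// ltn_expl.
case: y y0 ypos {yn0} => [y||//] y0 ypos.
  apply: cvg_near_cst; near=> k.
  rewrite /cutoff topE ifT; last first.
    rewrite lte_fin ltr_pdivrMr ?exprn_gt0// -ltr_pdivrMl//.
    apply: lt_le_trans (pow_ge k); near: k; exact: nbhs_infty_gtr.
  rewrite min_l// lee_fin; apply: (@le_trans _ _ k%:R)%R.
    near: k; exact: nbhs_infty_ger.
  by apply: le_trans (pow_ge k) _; rewrite ler_peMl ?exprn_ge0// ler1n.
rewrite [X in _ --> X]poweRyr ?gt_eqF//; apply/cvgeyPge => M; near=> k; rewrite /cutoff topE ltry min_r ?leey//.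
rewrite poweR_EFin lee_fin; apply: (@le_trans _ _ k%:R)%R.
  near: k; exact: nbhs_infty_ger.
have p1 : (1 <= 4 * 2 ^+ k :> R)%R.
  by rewrite -[leLHS]mulr1 ler_pM ?ler1n// exprn_ege1// ler1n.
apply: (@le_trans _ _ (4 * 2 ^+ k)%R).
  by apply: le_trans (pow_ge k) _; rewrite ler_peMl ?exprn_ge0// ler1n.
by rewrite -[leLHS]powRr1 ?(le_trans ler01 p1)// ler_powR// ltW.
Unshelve. all: by end_near. Qed.

Lemma strong_type h : Lmeas h -> (forall x, 0 <= h x) ->
  \int[mu]_x (supavg h x `^ q * v x) <= strong_const%:E * \int[mu]_x (h x `^ q * rho x).
Proof.
move=> mh h0; have mS := measurable_supavg h; have S0 := supavg_ge0 h0.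
apply: (fatou_le (F := fun k x => cutoff (2 ^- k) (k + k).+1 (supavg h x) `^ q * v x) measurableT).
- exact: (LmeasM (Lmeas_poweR q mS) mv).
- by move=> k; exact: (LmeasM (Lmeas_poweR q (measurable_cutoff _ _ mS)) mv).
- by move=> x; rewrite mule_ge0// poweR_ge0.
- by move=> k x; rewrite mule_ge0// poweR_ge0.
- by apply: aeW => x _; apply: cvgeZr => //; exact: cvg_cutoff.
- by move=> k; apply: strong_cutoff => //; rewrite invr_gt0 exprn_gt0.
Qed.

End strong_type.

Section fefferman_stein.
Context {R : realType} {n : nat}.
Local Notation E := (Rn R n).
Local Notation mu := (leb R n).

Lemma le_above (h : E -> \bar R) (t : R) x : (0 <= t)%R -> (forall x, 0 <= h x) -> h x <= t%:E + above h t x.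
Proof.
move=> t0 h0; rewrite /above; case: ifPn => [_|]; first by rewrite leeDr// lee_fin.
by rewrite -leNgt adde0.
Qed.

Lemma int_le_above (v h : E -> \bar R) (t : R) D : measurable D -> Lmeas v -> (forall x, 0 <= v x) ->
  Lmeas h -> (forall x, 0 <= h x) -> (0 < t)%R ->
  \int[mu]_(x in D) (h x * v x) <=
  t%:E * \int[mu]_(x in D) v x + \int[mu]_(x in D) (above h t x * v x).
Proof.
move=> mD mv v0 mh h0 t0; have ma := measurable_above t mh.
have a0 x : 0 <= above h t x * v x by rewrite mule_ge0// above_ge0.
have mav := LmeasM ma mv; have tv0 x : 0 <= t%:E * v x by rewrite mule_ge0// lee_fin ltW.
have t0' : 0 <= t%:E by rewrite lee_fin ltW.
rewrite -(intZ mD mv v0 t0') -(intD mD (LmeasZ _ mv) tv0 mav a0).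
apply: (int_le mD (LmeasM mh mv) (LmeasD (LmeasZ _ mv) mav)).
  by move=> x; rewrite mule_ge0.
move=> x _; rewrite -ge0_muleDl ?above_ge0//.
by apply: lee_wpmul2r => //; exact: (le_above x (ltW t0)).
Qed.

Lemma supavg_HLmax (f : E -> \bar R) x : Lmeas f ->
  supavg (@rcube R n) (fun q h => avg (cset (rcube q)) h) (abse \o f) x = HLmax f x.
Proof. by move=> mf; rewrite HLmaxE. Qed.

Lemma HLmax_ge_avg (f : E -> \bar R) (Q : @cube R n) x : (0 < Q.2)%R -> cset Q x ->
  (forall x, 0 <= f x) -> avg (cset Q) f <= HLmax f x.
Proof.
move=> Q0 Qx f0; apply: le_trans (avg_HLmax f Q0 Qx).
by rewrite (_ : abse \o f = f)//; apply/funext => y /=; rewrite gee0_abs.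
Qed.

Lemma int_cube3_HLmax (v h : E -> \bar R) (Q : @cube R n) : (0 < Q.2)%R ->
  Lmeas v -> (forall x, 0 <= v x) -> Lmeas h -> (forall x, 0 <= h x) ->
  avg (cset Q) h * \int[mu]_(x in cset (cube3 Q)) v x <=
  (3 ^+ n)%:E * \int[mu]_(x in cset Q) (h x * HLmax v x).
Proof.
move=> Q0 mv v0 mh h0; have Q30 : (0 < (cube3 Q).2)%R by rewrite /= mulr_gt0.
have mQ := measurable_cset Q.
have A0 : 0 <= avg (cset (cube3 Q)) v by exact: avg_ge0.
have mhM := LmeasM mh (measurable_HLmax mv).
apply: (@le_trans _ _ ((3 ^+ n)%:E * (avg (cset (cube3 Q)) v * \int[mu]_(x in cset Q) h x))).
  rewrite (int_cset _ Q30) (avg_cset _ Q0) /= exprMn le_eqVlt; apply/orP; left; apply/eqP.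
  rewrite muleACA -EFinM [_ * avg _ v]muleC; congr (_%:E * _).
  by rewrite mulrCA mulVf ?mulr1// gt_eqF// exprn_gt0.
apply: lee_wpmul2l; first by rewrite lee_fin exprn_ge0.
rewrite -(intZ mQ mh h0 A0); apply: (int_le mQ (LmeasZ _ mh) mhM).
  by move=> x; rewrite mule_ge0.
move=> x Qx; rewrite muleC; apply: lee_wpmul2l => //.
by apply: HLmax_ge_avg => //; exact: sub_cube3.
Qed.

Lemma fefferman_stein (q : R) (f : E -> \bar R) (g : E -> R) : (1 < q)%R ->
  Lmeas f -> measurable_fun setT g -> (forall x, (0 <= g x)%R) ->
  \int[mu]_x (HLmax f x `^ q * (g x)%:E) <=
  (strong_const (3 ^+ n) q)%:E * \int[mu]_x (`|f x| `^ q * HLmax (EFin \o g) x).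
Proof.
move=> q1 mf mg g0; have mgE := Lmeas_fin mg.
have g0' x : 0 <= (EFin \o g) x by rewrite lee_fin.
under eq_integral do rewrite -supavg_HLmax//.
apply: (strong_type (([ffun=> 0%R], 0%R) : @ratcube n) (rho := HLmax (EFin \o g)) _ mgE g0'
  (measurable_HLmax mgE) (@HLmax_ge0 _ _ _)).
- by [].
- by rewrite exprn_gt0.
- by move=> i h _ h0; exact: avg_ge0.
- move=> i h t Q0 mh h0 t0; have mQ := measurable_cset (rcube i : @cube R n).
  rewrite -(avg_cst t mQ (leb_cset_gt0 Q0) (leb_cset_fin Q0)).
  have ma := measurable_above t mh; have a0 := fun x => above_ge0 t x h0.
  have t0' (x : E) : 0 <= t%:E by rewrite lee_fin ltW.
  rewrite -(avgD mQ (Lmeas_cst _) t0' ma a0).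
  apply: (avg_le mQ mh (LmeasD (Lmeas_cst _) ma) h0).
    by move=> x; apply: adde_ge0; [exact: (t0' x)|exact: a0].
  by apply: aeW => x _; exact: (le_above x (ltW t0)).
- by move=> i h Q0 mh h0; exact: int_cube3_HLmax.
- by [].
- exact: Lmeas_abse.
- by move=> x; exact: abse_ge0.
Qed.

End fefferman_stein.

(** * A_1 weights and the maximal operator with respect to [w] *)

Section muckenhoupt.
Context {R : realType} {n : nat}.
Local Notation E := (Rn R n).
Local Notation mu := (leb R n).
Variables (w : E -> R) (a : R).
Hypotheses (mw : measurable_fun setT w) (w0 : forall x, (0 <= w x)%R) (a0 : (0 < a)%R).
Local Notation W Q := (\int[mu]_(x in cset Q) (w x)%:E).
Hypothesis Wpos : forall Q : @cube R n, (0 < Q.2)%R -> 0 < W Q < +oo.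
Hypothesis A1 : \forall x \ae mu, HLmax (EFin \o w) x <= (a * w x)%:E.

Let mwE : Lmeas (EFin \o w) := Lmeas_fin mw.
Let wE0 x : 0 <= (EFin \o w) x. Proof. by rewrite lee_fin. Qed.
Let wE1 x : 0 <= (w x)%:E. Proof. by rewrite lee_fin. Qed.
Definition wavg (Q : @cube R n) (h : E -> \bar R) : \bar R :=
  (fine (W Q))^-1%:E * \int[mu]_(x in cset Q) (h x * (w x)%:E).

Definition wmax : (E -> \bar R) -> E -> \bar R :=
  supavg (@rcube R n) (fun q h => wavg (rcube q) h).

Lemma wmassE (Q : @cube R n) : (0 < Q.2)%R -> W Q = (fine (W Q))%:E /\ (0 < fine (W Q))%R.
Proof.
move=> /Wpos/andP[W0 Woo]; have Wf : W Q \is a fin_num by rewrite ge0_fin_numE// ltW.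
by rewrite fineK// fine_gt0// W0.
Qed.

Lemma wavg_ge0 Q h : (0 < Q.2)%R -> (forall x, 0 <= h x) -> 0 <= wavg Q h.
Proof.
move=> Q0 h0; have [_ W0] := wmassE Q0; rewrite /wavg.
apply: mule_ge0; first by rewrite lee_fin invr_ge0 ltW.
by apply: integral_ge0 => x _; rewrite mule_ge0// lee_fin.
Qed.

(** At almost every point of [Q] the average of [w] over the triple is at most [HLmax w <= a w];
    integrating over [Q] gives doubling, with [3^n] the volume ratio. *)
Lemma wmass_doubling (Q : @cube R n) : (0 < Q.2)%R -> W (cube3 Q) <= (3 ^+ n * a)%:E * W Q.
Proof.
move=> Q0; have Q30 : (0 < (cube3 Q).2)%R by rewrite /= mulr_gt0.
have mQ := measurable_cset Q.
have av0 : 0 <= avg (cset (cube3 Q)) (EFin \o w) by exact: avg_ge0.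
have S0 : (0 < Q.2 ^+ n)%R by rewrite exprn_gt0.
rewrite (int_cset _ Q30) /= exprMn EFinM EFinM -!muleA.
apply: lee_wpmul2l; first by rewrite lee_fin exprn_ge0.
have a0' : 0 <= a%:E by rewrite lee_fin ltW.
rewrite -(intZ mQ mwE wE0 a0') -leb_cset// muleC -integral_cst//.
apply: (int_ae_le mQ (Lmeas_cst _) (LmeasZ _ mwE)) => //.
  by move=> x; rewrite mule_ge0.
apply: filterS A1 => x Mx Qx; rewrite -EFinM; apply: le_trans Mx.
by apply: HLmax_ge_avg => //; exact: sub_cube3.
Qed.

Lemma wmax_ge0 h : (forall x, 0 <= h x) -> forall x, 0 <= wmax h x.
Proof.
apply: (supavg_ge0 (([ffun=> 0%R], 0%R) : @ratcube n)) => q g Q0; exact: wavg_ge0.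
Qed.

Lemma measurable_wmax h : Lmeas (wmax h).
Proof. exact: measurable_supavg. Qed.

Lemma wmax_strong q h : (1 < q)%R -> Lmeas h -> (forall x, 0 <= h x) ->
  \int[mu]_x (wmax h x `^ q * (w x)%:E) <=
  (strong_const (3 ^+ n * a) q)%:E * \int[mu]_x (h x `^ q * (w x)%:E).
Proof.
move=> q1; apply: (strong_type (([ffun=> 0%R], 0%R) : @ratcube n) (rho := EFin \o w) _ mwE wE0 mwE wE0) => //.
- by rewrite mulr_gt0// exprn_gt0.
- by move=> i g Q0; exact: wavg_ge0.
- move=> i g t Q0 mg g0 t0; have mQ := measurable_cset (rcube i : @cube R n).
  have [WE W0] := wmassE Q0.
  have Wi0 : 0 <= (fine (W (rcube i)))^-1%:E by rewrite lee_fin invr_ge0 ltW.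
  apply: le_trans (lee_wpmul2l Wi0 (int_le_above mQ mwE wE0 mg g0 t0)) _.
  rewrite ge0_muleDr; last 2 first.
  - by rewrite mule_ge0 ?lee_fin ?(ltW t0)// integral_ge0.
  - by apply: integral_ge0 => x _; rewrite mule_ge0// above_ge0.
  by rewrite [\int[mu]_(x in _) (EFin \o w) x]WE -EFinM mulrCA mulVf ?mulr1// gt_eqF.
- move=> i g Q0 mg g0; have [WE W0] := wmassE Q0.
  apply: le_trans (lee_wpmul2l (wavg_ge0 Q0 g0) (wmass_doubling Q0)) _.
  by rewrite WE /wavg [_ * (_ * _%:E)]muleCA [_ * (fine _)%:E]muleAC -EFinM mulVf ?mul1e// gt_eqF.
Qed.

(** The average of [h w] over a cube factors as the average of [w] times the weighted average of
    [h], and the A_1 condition bounds the first factor by [a w(x)]. This trades [HLmax] on [h w] for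
    [wmax] on [h]. *)
Lemma HLmax_wmax h : Lmeas h -> (forall x, 0 <= h x) ->
  \forall x \ae mu, HLmax (fun y => h y * (w y)%:E) x <= a%:E * ((w x)%:E * wmax h x).
Proof.
move=> mh h0; apply: filterS A1 => x Mx.
rewrite HLmaxE; last exact: LmeasM.
apply: ge_ereal_sup => _ [q _ <-]; rewrite /ravgc.
have r0 : 0 <= a%:E * ((w x)%:E * wmax h x).
  by rewrite mule_ge0 ?lee_fin ?(ltW a0)// mule_ge0 ?lee_fin// wmax_ge0.
case: ifPn => [Q0|_//].
have [Qx|nQ] := pselect (cset (rcube q) x); last by rewrite chi0// mule0.
rewrite chi1// mule1; have [WE W0] := wmassE Q0.
have -> : avg (cset (rcube q)) (abse \o (fun y => h y * (w y)%:E)) =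
    avg (cset (rcube q)) (EFin \o w) * wavg (rcube q) h.
  rewrite !avg_cset// /wavg [\int[mu]_(x in _) (EFin \o w) x]WE muleA -[_ * _ * (fine _)^-1%:E]muleA.
  rewrite -[_ * (fine _)^-1%:E]EFinM mulfV ?gt_eqF// mule1; congr (_ * _).
  by apply: eq_integral => y _; rewrite /= gee0_abs// mule_ge0// lee_fin.
have -> : a%:E * ((w x)%:E * wmax h x) = (a * w x)%:E * wmax h x by rewrite muleA.
apply: lee_pmul.
- exact: avg_ge0.
- exact: wavg_ge0.
- by apply: le_trans (HLmax_ge_avg _ Qx wE0) Mx.
- exact: (@supavg_ge _ _ _ _ (fun q h => wavg (rcube q) h)).
Qed.

Definition witer (k : nat) (h : E -> \bar R) : E -> \bar R := iter k wmax h.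

Lemma measurable_witer k h : Lmeas h -> Lmeas (witer k h).
Proof. by move=> mh; case: k => // k; exact: measurable_wmax. Qed.

Lemma witer_ge0 k h : (forall x, 0 <= h x) -> forall x, 0 <= witer k h x.
Proof. by move=> h0; elim: k => // k IH; exact: wmax_ge0. Qed.

Lemma witer_strong k q h : (1 < q)%R -> Lmeas h -> (forall x, 0 <= h x) ->
  \int[mu]_x (witer k h x `^ q * (w x)%:E) <=
  (strong_const (3 ^+ n * a) q ^+ k)%:E * \int[mu]_x (h x `^ q * (w x)%:E).
Proof.
move=> q1 mh h0; elim: k => [|k IH]; first by rewrite expr0 mul1e.
apply: le_trans (wmax_strong q1 (measurable_witer k mh) (witer_ge0 k h0)) _.
set C := strong_const _ _ in IH *.
have -> : (C ^+ k.+1)%:E = C%:E * (C ^+ k)%:E by rewrite exprS.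
rewrite -muleA; apply: lee_wpmul2l; last exact: IH.
by rewrite lee_fin strong_const_ge0// mulr_gt0// exprn_gt0.
Qed.

Lemma HLiter_witer k h : Lmeas h -> (forall x, 0 <= h x) ->
  \forall x \ae mu, HLiter k (fun y => h y * (w y)%:E) x <=
    (a ^+ k)%:E * ((w x)%:E * witer k h x).
Proof.
move=> mh h0; elim: k => [|k IH].
  by apply: aeW => x; rewrite expr0 mul1e /= muleC.
have mk := measurable_witer k mh; have k0 := witer_ge0 k h0.
have mhw : Lmeas (fun y => h y * (w y)%:E) by exact: LmeasM.
have mkw : Lmeas (fun y => witer k h y * (w y)%:E) by exact: LmeasM.
apply: filterS (HLmax_wmax mk k0) => x Mx; rewrite HLiterS.
apply: (@le_trans _ _ (HLmax (fun y => (a ^+ k)%:E * (witer k h y * (w y)%:E)) x)).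
  apply: HLmax_le; [exact: measurable_HLiter|exact: LmeasZ|].
  apply: filterS IH => y My; rewrite !gee0_abs.
  - by rewrite [_ * (w y)%:E]muleC.
  - by rewrite mule_ge0 ?lee_fin ?exprn_ge0 ?(ltW a0)// mule_ge0// lee_fin.
  - by apply: HLiter_ge0 => z; rewrite mule_ge0// lee_fin.
have ak0 : (0 <= a ^+ k)%R by rewrite exprn_ge0// ltW.
rewrite HLmaxZ// ger0_norm// exprSr EFinM -muleA.
by apply: lee_wpmul2l; first rewrite lee_fin.
Qed.

(* The [G]-inequality is tested on [F ^ (p - 1) w]; Young's inequality moves
   [(witer k (F ^ (p - 1))) ^ p'] back to [F ^ p], with a small constant. *)
Section duality_to_weighted.
Variables (p : R) (k : nat).
Hypothesis p1 : (1 < p)%R.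
Let p' : R := (p / (p - 1))%R.
Let p0 : (0 < p)%R. Proof. exact: lt_trans p1. Qed.
Let pm0 : (0 < p - 1)%R. Proof. by rewrite subr_gt0. Qed.
Let p'1 : (1 < p')%R. Proof. by rewrite /p' ltr_pdivlMr// mul1r gtrBl. Qed.

(** With [y = z^(p - 1)], compare [x] with [e z]: if [x <= e z] then [x y <= e z^p], otherwise
    [y <= (x / e)^(p - 1)]. The constants are not optimal, but [e] is free and no convexity is
    used. *)
Lemma young (e : R) (x y : \bar R) : (0 < e)%R -> 0 <= x -> 0 <= y ->
  x * y <= (e `^ (1 - p))%:E * x `^ p + e%:E * y `^ p'.
Proof.
move=> e0; case: x => [x||//]; last first.
  move=> _ y0; rewrite poweRyr ?gt_eqF// gt0_muley ?lte_fin ?powR_gt0//.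
  by rewrite addye ?leey// -ltNye (lt_le_trans ltNy0)// mule_ge0 ?poweR_ge0// lee_fin ltW.
have p'0 : (0 < p')%R := lt_trans ltr01 p'1.
case: y => [y||//] x0 y0; last first.
  have -> : e%:E * +oo `^ p' = +oo by rewrite poweRyr ?gt0_muley ?lte_fin ?gt_eqF.
  rewrite addey ?leey// -ltNye (lt_le_trans ltNy0)// mule_ge0 ?poweR_ge0// lee_fin powR_ge0//.
rewrite !poweR_EFin -!EFinM -EFinD lee_fin; rewrite !lee_fin in x0 y0.
have e1 : (0 <= e `^ (1 - p) * x `^ p)%R by rewrite mulr_ge0 ?powR_ge0.
have e2 : (0 <= e * y `^ p')%R by rewrite mulr_ge0 ?powR_ge0// ltW.
have [->|xn0] := eqVneq x 0%R; first by rewrite mul0r; apply: addr_ge0 => //; rewrite mulr_ge0 ?powR_ge0.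
have [->|yn0] := eqVneq y 0%R; first by rewrite mulr0; apply: addr_ge0 => //; rewrite mulr_ge0 ?powR_ge0// ltW.
have {}x0 : (0 < x)%R by rewrite lt_neqAle eq_sym xn0.
have {}y0 : (0 < y)%R by rewrite lt_neqAle eq_sym yn0.
pose z := (y `^ (p - 1)^-1)%R; have z0 : (0 < z)%R by exact: powR_gt0.
have yE : y = (z `^ (p - 1))%R by rewrite -powRrM mulVf ?powRr1 ?gt_eqF// ltW.
have y'E : (y `^ p' = z `^ p)%R by rewrite /z -powRrM /p' mulrC.
rewrite y'E in e2 *; have [xz|zx] := leP x (e * z)%R.
  apply: (@le_trans _ _ (e * z `^ p)%R); last by rewrite lerDr.
  by rewrite (powR_predM p z0) -yE [leRHS]mulrCA mulrC ler_pM2l// mulrC.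
apply: (@le_trans _ _ (e `^ (1 - p) * x `^ p)%R); last by rewrite lerDl.
rewrite (powR_predM p x0) mulrA [leLHS]mulrC ler_pM2r// yE.
have -> : (e `^ (1 - p) * x `^ (p - 1) = (x / e) `^ (p - 1))%R.
  rewrite powRM ?invr_ge0 ?ltW// mulrC; congr (_ * _)%R.
  by rewrite -(powR_inv1 (ltW e0)) -powRrM mulN1r opprB.
by apply: ge0_ler_powR; rewrite ?nnegrE ?divr_ge0 ?(ltW x0) ?(ltW e0) ?(ltW z0) ?(ltW pm0)//; rewrite ler_pdivlMr// mulrC ltW.
Qed.

(** Here [b] is the cost of [k] iterates under the A_1 condition, [D] the constant of [witer k] in
    the dual Lebesgue space, and [e = 1 / (2 (b D + 1))] the parameter of [young], small enough that
    [b e D <= 1 / 2]; the leading [2] comes from absorbing that half. *)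
Definition transfer_const : R :=
  (let b := a ^+ k in let D := strong_const (3 ^+ n * a) p' ^+ k in
  2 * (b * (2 * (b * D + 1))^-1 `^ (1 - p)))%R.

Lemma weighted_of_dual (F : E -> R) (phi : E -> \bar R) :
  measurable_fun setT F -> (forall x, (0 <= F x)%R) -> Lmeas phi -> (forall x, 0 <= phi x) ->
  (forall G : E -> R, measurable_fun setT G -> (forall x, (0 <= G x)%R) ->
     \int[mu]_x (F x * G x)%:E <= \int[mu]_x (phi x * HLiter k (EFin \o G) x)) ->
  \int[mu]_x (F x `^ p * w x)%:E <= transfer_const%:E * \int[mu]_x (phi x `^ p * (w x)%:E).
Proof.
move=> mF F0 mphi phi0 dual.
have mFE := Lmeas_fin mF; have FE x : `|(EFin \o F) x| = (F x)%:E by rewrite gee0_abs// lee_fin.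
set Phi := \int[mu]_x (phi x `^ p * (w x)%:E).
have mPhi : Lmeas (fun x => phi x `^ p * (w x)%:E) by exact: (LmeasM (Lmeas_poweR p mphi) mwE).
have Phi0' x : 0 <= phi x `^ p * (w x)%:E by rewrite mule_ge0 ?poweR_ge0.
have Phi0 : 0 <= Phi by exact: integral_ge0.
pose b := (a ^+ k)%R; pose D := (strong_const (3 ^+ n * a) p' ^+ k)%R.
pose e := ((2 * (b * D + 1))^-1)%R.
have b0 : (0 < b)%R by rewrite exprn_gt0.
have D0 : (0 <= D)%R.
  by rewrite exprn_ge0// strong_const_ge0// mulr_gt0// exprn_gt0.
have bD0 : (0 <= b * D)%R by rewrite mulr_ge0// ltW.
have e0 : (0 < e)%R by rewrite invr_gt0 mulr_gt0// ltr_wpDl.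
have tcE : transfer_const = (2 * (b * e `^ (1 - p)))%R by [].
have be0 : (0 < b * e `^ (1 - p))%R by rewrite mulr_gt0// powR_gt0.
(* Absorption subtracts a multiple of the left-hand side, which must be finite; hence [F] is
   replaced by a truncation that is bounded with bounded support, where the weight is integrable. *)
have main N : \int[mu]_x (truncf N (EFin \o F) x `^ p * w x)%:E <= transfer_const%:E * Phi.
  set H := truncf N (EFin \o F); have [mH [M HM]] : bddm H by exact: truncf_bddm.
  have H0 x : (0 <= H x)%R by have /andP[] := HM x.
  pose h x := (H x `^ (p - 1))%R.
  have h0 x : (0 <= h x)%R by exact: powR_ge0.
  have mh : measurable_fun setT h := measurableT_comp (measurable_powR (p - 1)) mH.
  have mhE := Lmeas_fin mh; have h0E x : 0 <= (EFin \o h) x by rewrite lee_fin.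
  have mHp : measurable_fun setT (fun x => H x `^ p)%R := measurableT_comp (measurable_powR p) mH.
  have mS : measurable_fun setT (fun x => H x `^ p * w x)%R by exact: measurable_mulR.
  have S0 x : (0 <= H x `^ p * w x)%R by rewrite mulr_ge0 ?powR_ge0.
  set S := \int[mu]_x (H x `^ p * w x)%:E.
  have hp' x : (EFin \o h) x `^ p' = (H x `^ p)%:E.
    by rewrite poweR_EFin /h -powRrM /p' mulrCA mulfV ?mulr1// gt_eqF.
  have Sfin : S < +oo.
    have [N0|N0] := posnP N.
      rewrite /S (_ : integral _ _ _ = 0)//; rewrite -[RHS](integral0 mu setT).
      apply: eq_integral => x _; rewrite (_ : H x = 0%R) ?powR0 ?mul0r// ?gt_eqF//.
      apply/eqP; rewrite eq_le H0 andbT /H /truncf; rewrite -[leRHS](mul0r (\1_(eball 0%R N%:R) x)).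
      apply: ler_wpM2r; first by rewrite indicE.
      by have := etrunc_le N (abse_ge0 ((EFin \o F) x)); rewrite N0.
    pose Q := @ccube R n 0%R N%:R; have Q0 : (0 < Q.2)%R by rewrite /= mulr_gt0// ltr0n.
    have mQ := measurable_cset Q.
    have M0 : 0 <= (M `^ p)%:E by rewrite lee_fin powR_ge0.
    apply: (@le_lt_trans _ _ (\int[mu]_x ((M `^ p)%:E * ((w x)%:E * chi (cset Q) x)))).
      apply: (int_le measurableT (Lmeas_fin mS) (LmeasZ _ (Lmeas_chi mQ mwE))).
        by move=> x; rewrite lee_fin.
      move=> x _; have [Qx|nQ] := pselect (cset Q x).
        rewrite chi1// mule1 -EFinM lee_fin ler_wpM2r//.
        have /andP[_ HxM] := HM x.
        by apply: ge0_ler_powR; rewrite ?nnegrE ?(ltW p0)// (le_trans (H0 x)).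
      have Hx : H x = 0%R.
        rewrite /H /truncf indicE memNset ?mulr0// => /eball_box /box_ccube; exact: nQ.
      rewrite (_ : (EFin \o _) x = 0); last by rewrite /= Hx powR0 ?mul0r// gt_eqF.
      by apply: mule_ge0 => //; rewrite mule_ge0 ?chi_ge0.
    rewrite (intZ measurableT (Lmeas_chi mQ mwE)) => //; last first.
      by move=> x; rewrite mule_ge0 ?chi_ge0.
    by rewrite -(int_chiE _ mQ) lte_mul_pinfty//; have /andP[] := Wpos Q0.
  have Sge0 : 0 <= S by apply: integral_ge0 => x _; rewrite lee_fin.
  pose G x := (h x * w x)%R.
  have mG : measurable_fun setT G by exact: measurable_mulR.
  have G0 x : (0 <= G x)%R by rewrite mulr_ge0.
  have GE : EFin \o G = fun y => (EFin \o h) y * (w y)%:E by apply/funext => y.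
  have mwi := measurable_witer k mhE; have wi0 := witer_ge0 k h0E.
  have b0' : 0 <= b%:E by rewrite lee_fin ltW.
  have mT1 : Lmeas (fun x => witer k (EFin \o h) x `^ p' * (w x)%:E).
    exact: (LmeasM (Lmeas_poweR p' mwi) mwE).
  have T10 x : 0 <= witer k (EFin \o h) x `^ p' * (w x)%:E by rewrite mule_ge0 ?poweR_ge0.
  have step : S <= (b * e `^ (1 - p))%:E * Phi + (b * e * D)%:E * S.
    apply: (@le_trans _ _ (\int[mu]_x (F x * G x)%:E)).
      apply: (int_le measurableT (Lmeas_fin mS) (Lmeas_fin (measurable_mulR mF mG))).
        by move=> x; rewrite lee_fin.
      move=> x _; rewrite /= lee_fin /G mulrA ler_wpM2r//.
      have [Hx|Hn] := eqVneq (H x) 0%R; first by rewrite Hx powR0 ?gt_eqF// mulr_ge0.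
      rewrite (powR_predM p _) ?lt_neqAle 1?eq_sym ?Hn//= mulrC ler_wpM2r//; first exact: powR_ge0.
      by rewrite -lee_fin -(FE x); exact: truncf_le.
    apply: le_trans (dual G mG G0) _.
    have c1 : 0 <= (b * e `^ (1 - p))%:E by rewrite lee_fin ltW.
    have c2 : 0 <= (b * e)%:E by rewrite lee_fin mulr_ge0// ltW.
    apply: (@le_trans _ _ (\int[mu]_x ((b * e `^ (1 - p))%:E * (phi x `^ p * (w x)%:E) +
        (b * e)%:E * (witer k (EFin \o h) x `^ p' * (w x)%:E)))).
      apply: (int_ae_le measurableT).
      - by apply: LmeasM => //; apply: measurable_HLiter; exact: Lmeas_fin.
      - exact: LmeasD (LmeasZ _ mPhi) (LmeasZ _ mT1).
      - by move=> x; rewrite mule_ge0//; apply: HLiter_ge0 => y; rewrite lee_fin.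
      - by move=> x; rewrite adde_ge0// mule_ge0.
      apply: filterS (HLiter_witer k mhE h0E) => x Mx _; rewrite GE.
      apply: le_trans (lee_wpmul2l (phi0 x) Mx) _.
      rewrite muleCA -/b !EFinM -!muleA -ge0_muleDr; last 2 first.
      - by rewrite mule_ge0// lee_fin powR_ge0.
      - by rewrite mule_ge0// lee_fin ltW.
      apply: lee_wpmul2l => //; rewrite muleCA [leRHS](_ : _ = (w x)%:E *
          ((e `^ (1 - p))%:E * phi x `^ p + e%:E * witer k (EFin \o h) x `^ p')).
        by apply: lee_wpmul2l; [rewrite lee_fin|exact: young].
      rewrite ge0_muleDr; last 2 first.
      - by rewrite mule_ge0 ?poweR_ge0// lee_fin powR_ge0.
      - by rewrite mule_ge0 ?poweR_ge0// lee_fin ltW.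
      by rewrite !(muleC (w x)%:E) !muleA.
    rewrite (int_lincomb measurableT mPhi Phi0' mT1 T10 c1 c2); apply: leeD2l.
    rewrite [(b * e * D)%:E](_ : _ = (b * e)%:E * D%:E); last by rewrite -EFinM.
    rewrite -muleA; apply: lee_wpmul2l; first exact: c2.
    apply: le_trans (witer_strong k p'1 mhE h0E) _; rewrite -/D le_eqVlt; apply/orP; left; apply/eqP.
    by congr (_ * _); apply: eq_integral => x _; rewrite hp' -EFinM.
  have [Phioo|Phin] := eqVneq Phi +oo.
    by rewrite Phioo gt0_muley ?leey// lte_fin tcE mulr_gt0.
  have Pf : Phi \is a fin_num by rewrite ge0_fin_numE// lt_neqAle Phin leey.
  have Sf : S \is a fin_num by rewrite ge0_fin_numE.
  move: step; rewrite -(fineK Pf) -(fineK Sf) -!EFinM -EFinD !lee_fin tcE.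
  have beD : (b * e * D <= 2^-1)%R.
    have bD10 : (0 < b * D + 1)%R by rewrite ltr_wpDl.
    rewrite mulrAC /e invfM mulrCA ler_piMr ?invr_ge0//.
    by rewrite ler_pdivrMr// mul1r lerDl.
  have : (0 <= fine S)%R by rewrite fine_ge0.
  nra.
apply: (fatou_le (F := fun N x => (truncf N (EFin \o F) x `^ p * w x)%:E) measurableT).
- apply: Lmeas_fin; apply: measurable_mulR mw; exact: measurableT_comp (measurable_powR p) mF.
- move=> N; apply: Lmeas_fin; apply: measurable_mulR mw.
  exact: measurableT_comp (measurable_powR p) (truncf_bddm N mFE).1.
- by move=> x; rewrite lee_fin mulr_ge0 ?powR_ge0.
- by move=> N x; rewrite lee_fin mulr_ge0 ?powR_ge0.
- apply: aeW => x _; apply: cvg_near_cst; near=> N; congr (_ `^ _ * _)%:E.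
  rewrite /truncf indicE mem_set ?mulr1; last by near: N; exact: nbhs_infty_gtr.
  apply: EFin_inj; rewrite etruncE// FE min_l// lee_fin; near: N; exact: nbhs_infty_ger.
- exact: main.
Unshelve. all: by end_near. Qed.

End duality_to_weighted.

End muckenhoupt.

(** * The Rubio de Francia algorithm *)

Section rubio_de_francia.
Context {R : realType} {n : nat}.
Local Notation E := (Rn R n).
Local Notation mu := (leb R n).
Variables (G0 : E -> \bar R) (a : R).
Hypotheses (mG0 : Lmeas G0) (G00 : forall x, 0 <= G0 x) (a0 : (0 < a)%R).

Let r : R := ((2 * a)^-1)%R.
Let r0 : (0 < r)%R. Proof. by rewrite invr_gt0 mulr_gt0. Qed.

Definition rdf_term (k : nat) (x : E) : \bar R := (r ^+ k)%:E * HLiter k G0 x.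

Definition rdf (x : E) : \bar R := \sum_(0 <= k <oo) rdf_term k x.

Lemma rdf_term_ge0 k x : 0 <= rdf_term k x.
Proof. by rewrite mule_ge0 ?HLiter_ge0// lee_fin exprn_ge0// ltW. Qed.

Lemma measurable_rdf_term k : Lmeas (rdf_term k).
Proof. by apply: LmeasZ; exact: measurable_HLiter. Qed.

Lemma measurable_rdf : Lmeas rdf.
Proof. by apply: Lmeas_series; [exact: measurable_rdf_term|exact: rdf_term_ge0]. Qed.

Lemma rdf_ge0 x : 0 <= rdf x.
Proof. by apply: nneseries_ge0 => k _ _; exact: rdf_term_ge0. Qed.

Lemma rdf_term_le k x : rdf_term k x <= rdf x.
Proof.
apply: le_trans (nneseries_lim_ge k.+1 (fun k _ _ => rdf_term_ge0 k x)).
by rewrite big_nat_recr//= leeDr// sume_ge0// => j _; exact: rdf_term_ge0.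
Qed.

Lemma rdf_ge x : G0 x <= rdf x.
Proof. by apply: le_trans (rdf_term_le 0 x); rewrite /rdf_term expr0 mul1e. Qed.

(** Sublinearity of [HLmax] shifts the series by one term, and the ratio [1 / (2 a)] restores the
    coefficients: this is the A_1 condition with constant [2 a]. *)
Lemma HLmax_rdf x : HLmax rdf x <= (2 * a)%:E * rdf x.
Proof.
apply: le_trans (HLmax_series x measurable_rdf_term rdf_term_ge0) _.
have S k : HLmax (rdf_term k) x = (2 * a)%:E * rdf_term k.+1 x.
  rewrite /rdf_term HLmaxZ; last exact: measurable_HLiter.
  rewrite ger0_norm ?exprn_ge0 ?(ltW r0)// muleA -EFinM exprS mulrA mulfV ?mul1r//.
  by rewrite gt_eqF// mulr_gt0.
under eq_eseriesr do rewrite S.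
rewrite nneseriesZl; last by move=> k _; exact: rdf_term_ge0.
apply: lee_wpmul2l; first by rewrite lee_fin mulr_ge0// ltW.
apply: lime_le; first by apply: is_cvg_nneseries => k _ _; exact: rdf_term_ge0.
apply: nearW => N.
apply: le_trans (nneseries_lim_ge N.+1 (fun k _ _ => rdf_term_ge0 k x)).
by rewrite big_nat_recl//= leeDr// rdf_term_ge0.
Qed.

Lemma int_rdf (psi : E -> \bar R) (D : R) : Lmeas psi -> (forall x, 0 <= psi x) -> (0 <= D)%R ->
  (forall k, \int[mu]_x (psi x * HLiter k G0 x) <= (D * a ^+ k)%:E) ->
  \int[mu]_x (psi x * rdf x) <= (2 * D)%:E.
Proof.
move=> mpsi psi0 D0 Dk.
have mF k : Lmeas (fun x => psi x * rdf_term k x) by exact: (LmeasM mpsi (measurable_rdf_term k)).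
have F0 k x : 0 <= psi x * rdf_term k x by rewrite mule_ge0// rdf_term_ge0.
apply: (@le_trans _ _ (\int[mu]_x (\sum_(0 <= k <oo) psi x * rdf_term k x))).
  apply: (int_le measurableT (LmeasM mpsi measurable_rdf) (Lmeas_series mF F0)).
    by move=> x; rewrite mule_ge0// rdf_ge0.
  by move=> x _; apply: mule_nneseries_le => // k; exact: rdf_term_ge0.
rewrite (integral_nneseries mu measurableT (fun k => mF k) (fun k x _ => F0 k x)).
apply: le_trans (@epsilon_trick0 R (2 * D)%R xpredT _); last by rewrite mulr_ge0.
apply: lee_nneseries => k _; first by move=> _; apply: integral_ge0 => x _; exact: F0.
have mH := measurable_HLiter k mG0; have H0 := HLiter_ge0 k G00.
rewrite /rdf_term; under eq_integral do rewrite muleCA.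
have rk0 : 0 <= (r ^+ k)%:E by rewrite lee_fin exprn_ge0// ltW.
have pH0 x : 0 <= psi x * HLiter k G0 x by rewrite mule_ge0.
rewrite (intZ measurableT (LmeasM mpsi mH) pH0 rk0).
apply: le_trans (lee_wpmul2l rk0 (Dk k)) _.
rewrite -EFinM lee_fin /r exprVn exprMn natrX exprS le_eqVlt; apply/orP; left; apply/eqP.
by field; rewrite !expf_neq0// gt_eqF.
Qed.

Variables (p : R) (k : nat) (F : E -> R) (phi : E -> \bar R) (D : R).
Hypotheses (p1 : (1 < p)%R) (mF : measurable_fun setT F) (F0 : forall x, (0 <= F x)%R).
Hypotheses (mphi : Lmeas phi) (phi0 : forall x, 0 <= phi x) (D0 : (0 <= D)%R).
Hypothesis dual : forall G : E -> R, measurable_fun setT G -> (forall x, (0 <= G x)%R) ->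
  \int[mu]_x (F x * G x)%:E <= \int[mu]_x (phi x * HLiter k (EFin \o G) x).
Hypothesis phiD : forall j, \int[mu]_x (phi x `^ p * HLiter j G0 x) <= (D * a ^+ j)%:E.
Hypothesis locD : forall Q : @cube R n, (0 < Q.2)%R -> exists2 D' : R, (0 <= D')%R &
  forall j, \int[mu]_x (chi (cset Q) x * HLiter j G0 x) <= (D' * a ^+ j)%:E.

(** The weight majorizes [G0], so the integral of [F^p G0] is at most the weighted one; after the
    weighted inequality, the pairing of [phi^p] with the weight is bounded by [int_rdf]. The
    assumption [locD] makes the weight locally integrable, hence finite a.e. *)
Lemma rdf_transfer :
  \int[mu]_x ((F x `^ p)%:E * G0 x) <= (2 * @transfer_const R n (2 * a) p k * D)%:E.
Proof.
have a20 : (0 < 2 * a)%R by rewrite mulr_gt0.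
have T0 : (0 <= @transfer_const R n (2 * a) p k)%R.
  by rewrite /transfer_const !mulr_ge0 ?exprn_ge0 ?powR_ge0// ltW.
have mFp : measurable_fun setT (fun x => F x `^ p)%R := measurableT_comp (measurable_powR p) mF.
have Fp0 x : 0 <= (F x `^ p)%:E by rewrite lee_fin powR_ge0.
have mFG := LmeasM (Lmeas_fin mFp) mG0.
have FG0 x : 0 <= (F x `^ p)%:E * G0 x by rewrite mule_ge0.
(* If [G0] vanishes a.e., the weight would have no mass on cubes, but then the left-hand side is
   zero. Otherwise [HLmax G0 > 0] everywhere, and the term of index [1] makes the weight
   positive. *)
have [Gz|Gnz] := pselect (\forall x \ae mu, G0 x = 0).
  apply: (@le_trans _ _ (\int[mu]_(x in [set: E]) 0)); last by rewrite integral0 lee_fin mulr_ge0 ?(mulr_ge0 _ T0).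
  apply: (int_ae_le measurableT mFG (Lmeas_cst _) FG0) => //.
  by apply: filterS Gz => x /= -> _; rewrite mule0.
have W1 (Q : @cube R n) : (0 < Q.2)%R -> \int[mu]_(x in cset Q) rdf x < +oo.
  move=> Q0; have [D' D'0 /int_rdf h] := locD Q0.
  rewrite (int_chiE _ (measurable_cset Q)); under eq_integral do rewrite muleC.
  apply: le_lt_trans (h _ _ D'0) (ltry _); first exact: measurable_chi (measurable_cset _).
  exact: chi_ge0.
have fin : \forall x \ae mu, rdf x \is a fin_num.
  apply: ae_qcube => j; have Q0 := @qcube_gt0 R n j.
  have mQ := measurable_cset (@qcube R n j).
  apply: (integrable_ae mQ); apply/integrableP.
  split; first exact: measurable_funTS measurable_rdf.
  under eq_integral => x _ do rewrite gee0_abs ?rdf_ge0//.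
  exact: W1.
pose w x := fine (rdf x).
have mw : measurable_fun setT w := measurableT_comp (@fine_measurable R _ measurableT) measurable_rdf.
have w0 x : (0 <= w x)%R by rewrite fine_ge0// rdf_ge0.
have mwE := Lmeas_fin mw; have w0E x : 0 <= (EFin \o w) x by rewrite lee_fin.
have wE : \forall x \ae mu, rdf x = (w x)%:E by apply: filterS fin => x /fineK.
have intw D1 (psi : E -> \bar R) : measurable D1 -> Lmeas psi -> (forall x, 0 <= psi x) ->
    \int[mu]_(x in D1) (psi x * (w x)%:E) = \int[mu]_(x in D1) (psi x * rdf x).
  move=> mD1 mpsi psi0; apply/eqP; rewrite eq_le.
  have m1 := LmeasM mpsi mwE; have m2 := LmeasM mpsi measurable_rdf.
  have p10 x : 0 <= psi x * (EFin \o w) x by exact: mule_ge0.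
  have p20 x : 0 <= psi x * rdf x by rewrite mule_ge0// rdf_ge0.
  by apply/andP; split; apply: int_ae_le => //; apply: filterS wE => x ->.
have Wpos (Q : @cube R n) : (0 < Q.2)%R -> 0 < \int[mu]_(x in cset Q) (w x)%:E < +oo.
  move=> Q0; have mQ := measurable_cset Q.
  have WE : \int[mu]_(x in cset Q) (w x)%:E = \int[mu]_(x in cset Q) rdf x.
    have := intw (cset Q) (fun=> 1) mQ (Lmeas_cst _) (fun=> lee01).
    by under eq_integral do rewrite mul1e; under [RHS]eq_integral do rewrite mul1e.
  rewrite WE W1// andbT lt_neqAle integral_ge0 ?andbT => [|x _]; last exact: rdf_ge0.
  apply/eqP => /esym /(ae_zero_int mQ measurable_rdf rdf_ge0) Qz.
  have [x Qx /(_ Qx) rx] := ae_ex mQ (leb_cset_gt0 Q0) Qz.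
  have := rdf_term_le 1 x; rewrite rx leNgt => /negP; apply.
  by rewrite /rdf_term expr1 mule_gt0 ?lte_fin// HLmax_gt0.
have A1 : \forall x \ae mu, HLmax (EFin \o w) x <= (2 * a * w x)%:E.
  have wE' := wE; apply: filterS wE' => x wx; rewrite EFinM -wx; apply: le_trans (HLmax_rdf x).
  by apply: HLmax_le => //; [exact: measurable_rdf|apply: filterS wE => y ->].
apply: (@le_trans _ _ (\int[mu]_x (F x `^ p * w x)%:E)).
  apply: (int_ae_le measurableT mFG (Lmeas_fin (measurable_mulR mFp mw)) FG0).
  - by move=> x; rewrite lee_fin mulr_ge0 ?powR_ge0.
  apply: filterS wE => x wx _; rewrite /= EFinM -wx; apply: lee_wpmul2l; last exact: rdf_ge.
  by rewrite lee_fin powR_ge0.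
apply: le_trans (weighted_of_dual mw w0 a20 Wpos A1 p1 mF F0 mphi phi0 dual) _.
have mphip := Lmeas_poweR p mphi.
rewrite (intw _ (fun x => phi x `^ p) measurableT mphip (fun x => poweR_ge0 _ _)).
have T0' : 0 <= (@transfer_const R n (2 * a) p k)%:E by rewrite lee_fin.
apply: le_trans (lee_wpmul2l T0' (int_rdf mphip (fun x => poweR_ge0 _ _) D0 phiD)) _.
by rewrite -EFinM mulrCA mulrA.
Qed.

End rubio_de_francia.

(** * The maximal operator on Morrey spaces *)

Lemma poweRK (R : realType) (x : \bar R) (p : R) : (0 < p)%R -> 0 <= x -> (x `^ p) `^ p^-1 = x.
Proof. by move=> p0 x0; rewrite -poweRrM mulfV ?gt_eqF// poweRe1. Qed.

Lemma poweRVK (R : realType) (x : \bar R) (p : R) : (0 < p)%R -> 0 <= x -> (x `^ p^-1) `^ p = x.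
Proof. by move=> p0 x0; rewrite -poweRrM mulVf ?gt_eqF// poweRe1. Qed.

Lemma lee_poweR (R : realType) (x y : \bar R) (p : R) : (0 <= p)%R -> 0 <= x -> x <= y -> x `^ p <= y `^ p.
Proof.
move=> p0 x0 xy; apply: gt0_ler_poweR => //; rewrite in_itv/= leey ?x0//.
by rewrite (le_trans x0).
Qed.

Lemma poweRD_le (R : realType) (x y : \bar R) (p : R) : (0 <= p)%R -> 0 <= x -> 0 <= y ->
  (x + y) `^ p <= (2 `^ p)%:E * (x `^ p + y `^ p).
Proof.
move=> p0; wlog xy : x y / x <= y => [H x0 y0|x0 y0].
  have [xy|yx] := leP x y; first exact: H.
  by rewrite addeC [x `^ p + _]addeC; apply: H => //; exact: ltW.
have c0 : 0 <= (2 `^ p)%:E by rewrite lee_fin powR_ge0.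
apply: (@le_trans _ _ ((2%:E * y) `^ p)).
  apply: lee_poweR => //; first exact: adde_ge0.
  by rewrite mule_natl mule2n leeD2r.
rewrite poweRM// poweR_EFin; apply: lee_wpmul2l => //.
by rewrite leeDr// poweR_ge0.
Qed.

Lemma le_1addpoweR (R : realType) (x : \bar R) (p : R) : (1 <= p)%R -> 0 <= x ->
  x <= 1 + x `^ p.
Proof.
move=> p1; have p0 : (0 < p)%R by exact: lt_le_trans p1.
case: x => [x||//] x0; last by rewrite poweRyr ?gt_eqF// addey.
rewrite poweR_EFin -EFinD lee_fin; rewrite lee_fin in x0.
have [x1|/ltW x1] := leP x 1%R; first by rewrite (le_trans x1)// lerDl powR_ge0.
apply: (@le_trans _ _ (x `^ p)%R); last by rewrite lerDr.
by rewrite -[leLHS]powRr1// ler_powR.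
Qed.

Section fpow_maximal.
Context {R : realType} {n : nat}.
Local Notation E := (Rn R n).
Local Notation mu := (leb R n).
Variables (Y : fnorm R n) (p : R).
Hypotheses (bY : banach_function_space Y) (p1 : (1 < p)%R) (MY : HLbounded (assoc Y)).

Let p0 : (0 < p)%R. Proof. exact: lt_trans p1. Qed.

Definition pnorm (f : E -> \bar R) : \bar R := Y (fun x => `|f x| `^ p).

Lemma measurable_ppow (f : E -> \bar R) : Lmeas f -> Lmeas (fun x => `|f x| `^ p).
Proof. by move=> mf; apply: Lmeas_poweR; exact: Lmeas_abse. Qed.

Lemma pnorm_ge0 (f : E -> \bar R) : Lmeas f -> 0 <= pnorm f.
Proof. by move=> mf; apply: (bfs_ge0 bY); exact: measurable_ppow. Qed.

(** Testing the norm of [(HLmax f)^p] against [g] in the unit ball of the associate space, the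
    Fefferman-Stein inequality moves the maximal operator onto [g], where it is bounded by [MY]. The
    summand [1] makes the constant positive. *)
Lemma HLmax_pnorm : exists2 A : R, (0 < A)%R &
  forall f, Lmeas f -> pnorm f < +oo -> pnorm (HLmax f) <= A%:E * pnorm f.
Proof.
have [C HC] := MY; pose S := @strong_const R (3 ^+ n) p.
have S0 : (0 <= S)%R by apply: strong_const_ge0; rewrite // exprn_gt0.
exists (S * `|C| + 1)%R; first by rewrite ltr_wpDl// mulr_ge0.
move=> f mf foo; have Pf : pnorm f \is a fin_num by rewrite ge0_fin_numE// pnorm_ge0.
have mM := measurable_HLmax mf.
rewrite -(fineK Pf) -EFinM; apply: (lorentz_luxemburg bY (measurable_ppow mM)) => g bg ag.
have [mg _] := bg; have mgE := Lmeas_fin mg.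
have g0 x : (0 <= g x)%R by exact: bddm_ge0.
under eq_integral => x _.
  rewrite gee0_abs ?poweR_ge0// gee0_abs ?HLmax_ge0//. over.
apply: le_trans (fefferman_stein p1 mf mg g0) _; rewrite -/S.
have fp : mem_space Y (fun x => `|f x| `^ p) by split=> //; exact: measurable_ppow.
have := bfs_hoelder bY fp (measurable_HLmax mgE).
under eq_integral => x _.
  rewrite gee0_abs; last by rewrite mule_ge0 ?poweR_ge0// HLmax_ge0.
  over.
move=> h; apply: le_trans (lee_wpmul2l _ h) _; first by rewrite lee_fin.
have gm : mem_space (assoc Y) (EFin \o g) by split=> //; exact: le_lt_trans ag (ltry _).
have aM : assoc Y (HLmax (EFin \o g)) <= `|C|%:E.
  apply: le_trans (HC _ gm) _; apply: (@le_trans _ _ (`|C|%:E * assoc Y (EFin \o g))).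
    by apply: lee_wpmul2r; [exact: assoc_ge0|rewrite lee_fin ler_norm].
  by rewrite -[leRHS]mule1; apply: lee_wpmul2l.
apply: (@le_trans _ _ (S%:E * (pnorm f * `|C|%:E))).
  by apply: lee_wpmul2l; [rewrite lee_fin|apply: lee_wpmul2l => //; exact: pnorm_ge0].
rewrite -(fineK Pf) -!EFinM lee_fin mulrCA [leRHS]mulrC ler_wpM2l ?fine_ge0 ?pnorm_ge0//.
by rewrite lerDl.
Qed.

End fpow_maximal.

Section characteristic_norms.
Context {R : realType} {n : nat}.
Local Notation E := (Rn R n).
Local Notation mu := (leb R n).
Variables (Y : fnorm R n) (p : R).
Hypotheses (n0 : (0 < n)%N) (bY : banach_function_space Y) (p0 : (0 < p)%R).

Lemma bfs_ball_gt0 x r : (0 < r)%R -> 0 < Y (chi (eball x r)) < +oo.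
Proof.
move=> r0; have mB := measurable_eball x r.
rewrite (bfs_chi bY mB (leb_eball_fin x r0)) andbT lt_neqAle (bfs_ge0 bY (measurable_chi mB)) andbT.
apply/eqP => /esym /(bfs_eq0 bY (measurable_chi mB)) z.
have [y By] := ae_ex mB (leb_eball_gt0 x n0 r0) z.
by rewrite chi1// => /eqP; rewrite onee_eq0.
Qed.

Lemma chinormP x r : (0 < r)%R -> Y (chi (eball x r)) = (chinorm Y x r)%:E /\ (0 < chinorm Y x r)%R.
Proof.
move=> r0; have /andP[b1 b2] := bfs_ball_gt0 x r0.
have bf : Y (chi (eball x r)) \is a fin_num by rewrite ge0_fin_numE// ltW.
by rewrite /chinorm fineK// fine_gt0// b1.
Qed.

Lemma poweR_chi (B : set E) x : `|chi B x| `^ p = chi B x.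
Proof.
have [Bx|nB] := pselect (B x); first by rewrite chi1// abse1 poweR1r.
by rewrite chi0// abse0 poweR0r// gt_eqF.
Qed.

Lemma chinorm_fpow x r : chinorm (fpow Y p) x r = (chinorm Y x r `^ p^-1)%R.
Proof.
rewrite /chinorm /fpow fine_poweR; congr (fine _ `^ _)%R.
by congr Y; apply/funext => y; exact: poweR_chi.
Qed.

End characteristic_norms.

Section morrey_maximal.
Context {R : realType} {n : nat}.
Local Notation E := (Rn R n).
Local Notation mu := (leb R n).
Variables (Y : fnorm R n) (p : R) (u : E -> R -> R).
Hypotheses (n0 : (0 < n)%N) (bY : banach_function_space Y) (p1 : (1 < p)%R).
Hypothesis u0 : forall x r, (0 < r)%R -> (0 < u x r)%R.
Local Notation v := (fun x r => powR (u x r) p^-1).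
Local Notation Yp := (pnorm Y p).
Hypothesis hw : weight0 (fpow Y p) v.
Variable A : R.
Hypotheses (A0 : (0 < A)%R) (HA : forall f, Lmeas f -> Yp f < +oo -> Yp (HLmax f) <= A%:E * Yp f).

Let p0 : (0 < p)%R. Proof. exact: lt_trans p1. Qed.

Local Notation yb := (chinorm Y).
Let ybE := @chinormP R n Y n0 bY.
Let chi_pow := @poweR_chi R n p p0.
Let chinormE := @chinorm_fpow R n Y p p0.

(** A single term of the series in the second weight condition, raised to the power [p]. It controls
    the ratio of [u] to the norm of the indicator under dilation. *)
Lemma weight_dilate : exists2 C : R, (0 < C)%R & forall x r i, (0 < r)%R ->
  (u x (2 ^+ i.+1 * r) / yb x (2 ^+ i.+1 * r) <= C * (u x r / yb x r))%R.
Proof.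
have [_ _ [C [C0 _ C2]]] := hw; exists (C `^ p)%R; first exact: powR_gt0.
move=> x r i r0; have ri0 : (0 < 2 ^+ i.+1 * r)%R by rewrite mulr_gt0// exprn_gt0.
have [_ y0] := ybE x r0; have [_ yi0] := ybE x ri0.
have ur := u0 x r0; have uri := u0 x ri0.
pose t j := (chinorm (fpow Y p) x r / chinorm (fpow Y p) x (2 ^+ j.+1 * r) *
   (u x (2 ^+ j.+1 * r) `^ p^-1))%R.
have t0 j : (0 <= t j)%R by rewrite /t !chinormE !mulr_ge0 ?invr_ge0 ?powR_ge0.
have : ((t i)%:E <= (C * u x r `^ p^-1)%:E).
  apply: le_trans (C2 x r r0).
  have T0 j : 0 <= (t j)%:E by rewrite lee_fin.
  apply: le_trans (nneseries_lim_ge i.+1 (fun j _ _ => T0 j)).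
  by rewrite big_nat_recr//= leeDr// sume_ge0// => j _; rewrite lee_fin.
rewrite lee_fin /t !chinormE.
set d := (u x r `^ p^-1)%R; set c := (u x (2 ^+ i.+1 * r) `^ p^-1)%R.
set b := (yb x (2 ^+ i.+1 * r) `^ p^-1)%R; set a := (yb x r `^ p^-1)%R => h.
have b0 : (0 < b)%R by exact: powR_gt0.
have a0 : (0 < a)%R by exact: powR_gt0.
have V (z : R) : (0 < z)%R -> ((z `^ p^-1) `^ p = z)%R.
  by move=> z0; rewrite -powRrM mulVf ?powRr1 ?gt_eqF// ltW.
have {}h : (a * c <= C * d * b)%R by move: h; rewrite mulrAC ler_pdivrMr.
have := @ge0_ler_powR R p (ltW p0) (a * c)%R (C * d * b)%R.
rewrite !nnegrE !mulr_ge0 ?powR_ge0 ?(ltW C0)// => /(_ isT isT h).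
rewrite !powRM ?mulr_ge0 ?powR_ge0 ?(ltW C0)// !V// => h'.
rewrite ler_pdivrMr// [leRHS](_ : _ = (C `^ p * u x r * yb x (2 ^+ i.+1 * r)) / yb x r)%R; last by ring.
by rewrite ler_pdivlMr// mulrC.
Qed.

Lemma morrey_pow_ge (f : E -> \bar R) x r : (0 < r)%R ->
  Yp (fun y => f y * chi (eball x r) y) <= (u x r)%:E * morrey Y u (fun y => `|f y| `^ p).
Proof.
move=> r0; apply: le_trans (morrey_ball Y u0 (fun y => `|f y| `^ p) x r0).
rewrite le_eqVlt; apply/orP; left; apply/eqP; congr Y; apply/funext => y.
by rewrite abseM poweRM// chi_pow.
Qed.

(** On [B] the maximal function dominates the constant average, so the bound for [HLmax] applies.
    With [f] an indicator this yields doubling of indicator norms; in general it bounds averages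
    over large cubes. *)
Lemma cube_avg_le f (Q : @cube R n) (B : set E) : (0 < Q.2)%R -> measurable B -> Lmeas f ->
  B `<=` cset Q -> Yp f < +oo ->
  avg (cset Q) (abse \o f) `^ p * Y (chi B) <= A%:E * Yp f.
Proof.
move=> Q0 mB mf BQ Yf; set a := avg _ _; have a0 : 0 <= a by exact: avg_abs_ge0.
apply: le_trans (HA mf Yf).
have mQ := measurable_cset Q; have mp := measurable_ppow p mf.
have af : a \is a fin_num.
  rewrite ge0_fin_numE// /a avg_cset// lte_mul_pinfty ?lee_fin ?invr_ge0 ?exprn_ge0 ?(ltW Q0)//.
  apply: (@le_lt_trans _ _ (\int[mu]_(x in cset Q) (1 + `|f x| `^ p))).
    apply: (int_le mQ (Lmeas_abse mf) (LmeasD (Lmeas_cst _) mp) (fun x => abse_ge0 _)) => x _.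
    by apply: le_1addpoweR; [exact: ltW|exact: abse_ge0].
  rewrite (intD mQ (Lmeas_cst _) (fun=> lee01) mp (fun x => poweR_ge0 _ _)).
  rewrite integral_cst// mul1e lte_add_pinfty ?leb_cset_fin//.
  have [C HC] := bfs_int bY mQ (leb_cset_fin Q0).
  have fm : mem_space Y (fun x => `|f x| `^ p) by [].
  have := HC _ fm; under eq_integral do rewrite gee0_abs ?poweR_ge0//.
  move=> /le_lt_trans; apply; have Yf' := bfs_fin_num bY fm.
  by rewrite -(fineK Yf') -EFinM ltry.
rewrite -(fineK af) poweR_EFin -(ger0_norm (powR_ge0 _ p)) -(bfs_scale bY _ (measurable_chi mB)).
apply: (bfs_le bY); [exact: measurable_ppow (measurable_HLmax mf)|exact: LmeasZ _ (measurable_chi mB)|].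
move=> x; have [Bx|nB] := pselect (B x); last by rewrite chi0// mule0 abse0 abse_ge0.
rewrite chi1// mule1 -poweR_EFin fineK// !(gee0_abs (poweR_ge0 _ _)) (gee0_abs (HLmax_ge0 _ _)).
apply: lee_poweR => //; first exact: ltW.
by apply: avg_HLmax => //; exact: BQ.
Qed.

Variable k0 : nat.
Hypothesis k0n : (2 * n%:R <= 2 ^+ k0 :> R)%R.

Let star (r : R) : R := (2 ^+ k0.+1 * r)%R.

Lemma eball_sub_ccube (x : E) (r : R) : eball x r `<=` cset (ccube x r).
Proof. by apply: subset_trans (@box_ccube _ _ x r); exact: eball_box. Qed.

Lemma eball_mono (x : E) (r s : R) : (r <= s)%R -> eball x r `<=` eball x s.
Proof. by move=> rs y /= /lt_le_trans; apply. Qed.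

(** The cube stays within sup-distance [2 s] of [x], hence within Euclidean distance [2 n s], and
    [2^k0] is at least [2 n]. A power of two is taken because the weight condition concerns radii
    [2^j r]. *)
Lemma cset_sub_dilate (x y : E) (r s : R) (Q : @cube R n) : (0 < Q.2)%R -> (Q.2 <= s)%R -> (r <= s)%R ->
  eball x r y -> cset Q y -> cset Q `<=` eball x (2 ^+ k0 * s).
Proof.
move=> Q0 Qs rs /eball_box yx Qy z Qz; have s0 : (0 < s)%R := lt_le_trans Q0 Qs.
apply: (@eball_mono x (n%:R * (2 * s))).
  by rewrite mulrCA mulrA ler_pM2r.
apply: box_eball => // i; have := yx i; have /andP[? ?] := Qy i; have /andP[? ?] := Qz i.
by rewrite !ltr_distl => /andP[? ?]; apply/andP; split; lra.
Qed.

Lemma between_dyadic (h r : R) : (0 < r)%R -> (r < h)%R ->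
  exists j, (2 ^+ j * r < h <= 2 ^+ j.+1 * r)%R.
Proof.
move=> r0 rh; have [j jh] : exists j, (h <= 2 ^+ j * r)%R.
  exists (Num.truncn (h / r)).+1; rewrite -ler_pdivrMr//.
  apply: (@le_trans _ _ (Num.truncn (h / r)).+1%:R); first exact/ltW/truncnS_gt.
  by rewrite -natrX ler_nat ltnW// ltn_expl.
elim: j jh => [|j IH] jh; first by rewrite expr0 mul1r leNgt rh in jh.
have [hj|jh'] := leP h (2 ^+ j * r)%R; first exact: IH.
by exists j; rewrite jh' jh.
Qed.

(** Local and far cubes are separated. For [y] in [B(x, r)], a cube of side at most [r] sees only
    the restriction of [f] to the ball dilated by [2^(k0+1)]; a larger cube lies in a ball of
    comparable dyadic radius, where [cube_avg_le], the Morrey bound and [weight_dilate] give a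
    constant [t] that does not depend on that radius. *)
Lemma HLmax_morrey : exists2 K : R, (0 < K)%R & forall f : E -> \bar R, Lmeas f ->
  morrey Y u (fun x => `|f x| `^ p) < +oo ->
  morrey Y u (fun x => HLmax f x `^ p) <= K%:E * morrey Y u (fun x => `|f x| `^ p).
Proof.
have [C C0 HC] := weight_dilate.
pose c0 := ((2 ^+ k0.+2 : R) ^+ n)%R.
pose c1 := ((n%:R * 2 ^+ k0.+2 : R) ^+ n)%R.
have c00 : (0 < c0)%R by rewrite !exprn_gt0.
have c10 : (0 < c1)%R by rewrite exprn_gt0// mulr_gt0 ?ltr0n// exprn_gt0.
(* Doubling of indicator norms: the average of the indicator of the small ball over the cube around
   the dilated one is at least [1 / c1], so [cube_avg_le] compares the two indicators. *)
have dbl x r : (0 < r)%R -> (yb x (star r) <= (c1 `^ p * A) * yb x r)%R.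
  move=> r0; have rs0 : (0 < star r)%R by rewrite mulr_gt0// exprn_gt0.
  have mb := measurable_eball x r; have [yE y0] := ybE x r0; have [ysE ys0] := ybE x rs0.
  pose Q := ccube x (star r); have Q0 : (0 < Q.2)%R by rewrite mulr_gt0.
  have YpE : Yp (chi (eball x r)) = (yb x r)%:E.
    by rewrite -yE; congr Y; apply/funext => y; exact: chi_pow.
  have := @cube_avg_le (chi (eball x r)) Q (eball x (star r)) Q0 (measurable_eball _ _)
    (measurable_chi mb) (@eball_sub_ccube _ _).
  rewrite YpE ltry ysE => /(_ isT).
  have -> : avg (cset Q) (abse \o chi (eball x r)) =
      (((2 * star r) ^+ n)^-1)%:E * mu (eball x r).
    rewrite avg_cset//; congr (_ * _).
    rewrite (int_chiE _ (measurable_cset Q)) -[RHS]mul1e -integral_cst// (int_chiE _ mb).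
    apply: eq_integral => y _; rewrite mul1e.
    have -> : (abse \o chi (eball x r)) y = chi (eball x r) y by rewrite [LHS]gee0_abs ?chi_ge0.
    have [By|nB] := pselect (eball x r y); last by rewrite (chi0 nB) mul0e.
    have Qy : cset Q y.
      apply: eball_sub_ccube; apply: eball_mono By.
      by rewrite ler_peMl ?(ltW r0)// exprn_ege1// ler1n.
    by rewrite (chi1 Qy) mule1.
  have h1 : (c1^-1)%:E <= (((2 * star r) ^+ n)^-1)%:E * mu (eball x r).
    apply: (@le_trans _ _ ((((2 * star r) ^+ n)^-1)%:E * ((r / n%:R) ^+ n)%:E)).
      rewrite -EFinM lee_fin /c1 -!exprVn -exprMn le_eqVlt; apply/orP; left; apply/eqP; congr (_ ^+ n)%R.
      rewrite /star !exprS; field; rewrite !(gt_eqF r0) !gt_eqF ?exprn_gt0 ?ltr0n//.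
    by apply: lee_wpmul2l; [rewrite lee_fin invr_ge0 exprn_ge0// mulr_ge0// ltW|exact: leb_eball_ge].
  have c1i : 0 <= (c1^-1)%:E by rewrite lee_fin invr_ge0 ltW.
  move=> /(le_trans (lee_wpmul2r (ltW _) (lee_poweR (ltW p0) c1i h1))).
  rewrite lte_fin poweR_EFin -!EFinM lee_fin => /(_ ys0).
  have cp0 : (0 < c1 `^ p)%R by exact: powR_gt0.
  have -> : ((c1^-1) `^ p = (c1 `^ p)^-1)%R.
    by rewrite -(powR_inv1 (ltW c10)) -powRrM mulN1r powRN.
  by rewrite ler_pdivrMl// mulrA.
pose K := (2 `^ p * (A * (C * (c1 `^ p * A)) + c0 `^ p * A * C))%R.
have K0 : (0 < K)%R.
  by rewrite !mulr_gt0 ?powR_gt0// addr_gt0// !mulr_gt0 ?powR_gt0.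
exists K => // f mf; set P := morrey _ _ _ => Poo.
have mp := measurable_ppow p mf.
have P0 : 0 <= P by exact: morrey_ge0.
have Pf : P \is a fin_num by rewrite ge0_fin_numE.
have mM := measurable_HLmax mf.
apply: ge_ereal_sup => _ [[x r] /= r0 <-]; rewrite lee_pdivrMl ?u0//.
have mB s := measurable_eball x s.
pose Fb s y := f y * chi (eball x s) y.
have mF s : Lmeas (Fb s) by exact: Lmeas_chi.
have Fb_le s : (0 < s)%R -> Yp (Fb s) <= (u x s)%:E * P by exact: morrey_pow_ge.
have Fboo s : (0 < s)%R -> Yp (Fb s) < +oo.
  by move=> s0; apply: le_lt_trans (Fb_le s s0) _; rewrite lte_mul_pinfty// lee_fin ltW// u0.
have rs0 : (0 < star r)%R by rewrite mulr_gt0// exprn_gt0.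
have [yE y0] := ybE x r0.
(* [c0] bounds the volume ratio between the enclosing cube, of side [2 s], and a cube of side above
   [2^j r]; the second factor bounds the average over the enclosing cube. *)
pose t := (c0 * ((A * C * fine P * u x r / yb x r) `^ p^-1))%R.
have t0 : (0 <= t)%R by rewrite mulr_ge0 ?powR_ge0// ltW.
have cmp s i : s = (2 ^+ i.+1 * r)%R -> (u x s <= C * (u x r / yb x r) * yb x s)%R.
  move=> ->; have si0 : (0 < 2 ^+ i.+1 * r)%R by rewrite mulr_gt0// exprn_gt0.
  by have [_ ys0] := ybE x si0; rewrite -ler_pdivrMr//; exact: HC.
have point y : eball x r y -> HLmax f y <= HLmax (Fb (star r)) y + t%:E.
  move=> By; apply: ge_ereal_sup => _ [Q [Q0 Qy] <-]; have mQ := measurable_cset Q.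
  have [Qr|rQ] := leP Q.2 r.
    have Qs : cset Q `<=` eball x (star r).
      apply: subset_trans (cset_sub_dilate Q0 Qr (lexx _) By Qy) _; apply: eball_mono.
      by rewrite ler_pM2r// ler_weXn2l// ler1n.
    apply: (@le_trans _ _ (HLmax (Fb (star r)) y)); last by rewrite leeDl// lee_fin.
    apply: le_trans (avg_HLmax _ Q0 Qy); rewrite le_eqVlt; apply/orP; left; apply/eqP.
    rewrite /avg; congr (_ * _); apply: eq_integral => z /set_mem Qz.
    by rewrite /= /Fb chi1 ?mule1//; exact: Qs.
  apply: (@le_trans _ _ t%:E); last by rewrite leeDr// HLmax_ge0.
  have [j /andP[jQ Qj]] := between_dyadic r0 rQ.
  pose s := (2 ^+ (k0 + j).+1 * r)%R; have s0 : (0 < s)%R by rewrite mulr_gt0// exprn_gt0.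
  have sE : s = (2 ^+ k0 * (2 ^+ j.+1 * r))%R by rewrite /s -addnS exprD mulrA.
  have Qs : cset Q `<=` eball x s.
    rewrite sE; apply: cset_sub_dilate Q0 Qj _ By Qy.
    by rewrite ler_peMl ?(ltW r0)// exprn_ege1// ler1n.
  pose S := ccube x s; have S0 : (0 < S.2)%R by rewrite mulr_gt0.
  have [ysE ys0] := ybE x s0.
  have aC : avg (cset S) (abse \o Fb s) `^ p * (yb x s)%:E <= (A * (u x s * fine P))%:E.
    rewrite -ysE; apply: le_trans (cube_avg_le S0 (mB s) (mF s) (@eball_sub_ccube _ _) (Fboo s s0)) _.
    rewrite EFinM EFinM fineK//; apply: lee_wpmul2l; first by rewrite lee_fin ltW.
    exact: Fb_le.
  have a0 : 0 <= avg (cset S) (abse \o Fb s) by exact: avg_abs_ge0.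
  have aC' : avg (cset S) (abse \o Fb s) <= ((A * C * fine P * u x r / yb x r) `^ p^-1)%:E.
    rewrite -(poweRK p0 a0) -poweR_EFin; apply: lee_poweR; [by rewrite invr_ge0 ltW|exact: poweR_ge0|].
    move: aC; rewrite -lee_pdivlMr// => /le_trans; apply; rewrite -EFinM lee_fin.
    rewrite ler_pdivrMr//; have := cmp s (k0 + j)%N erefl => us.
    have AP0 : (0 <= A * fine P)%R by rewrite mulr_ge0 ?fine_ge0// ltW.
    have := ler_wpM2l AP0 us; nra.
  apply: (@le_trans _ _ (c0%:E * avg (cset S) (abse \o Fb s))); last first.
    by rewrite /t EFinM; apply: lee_wpmul2l => //; rewrite lee_fin ltW.
  rewrite !avg_cset// muleA -EFinM; apply: lee_pmul.
  - by rewrite lee_fin invr_ge0 exprn_ge0// ltW.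
  - by apply: integral_ge0 => z _; exact: abse_ge0.
  - rewrite lee_fin /c0 -exprVn -[X in (_ <= _ * X)%R]exprVn -exprMn lerXn2r ?nnegrE ?invr_ge0 ?(ltW Q0)//.
      by rewrite divr_ge0 ?exprn_ge0// ltW.
    rewrite /= ler_pdivlMr ?mulr_gt0// ler_pdivrMl//.
    apply: (@le_trans _ _ (2 ^+ k0.+2 * (2 ^+ j * r)))%R; last first.
      by rewrite mulrC ler_pM2r ?exprn_gt0// ltW.
    by rewrite /s !exprS exprD le_eqVlt; apply/orP; left; apply/eqP; ring.
  - have mS := measurable_cset S.
    apply: (@le_trans _ _ (\int[mu]_(z in cset Q) (abse \o Fb s) z)).
      rewrite le_eqVlt; apply/orP; left; apply/eqP; apply: eq_integral => z /set_mem Qz.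
      by rewrite /= /Fb chi1 ?mule1//; exact: Qs.
    apply: (int_sub mQ mS (Lmeas_abse (mF s)) (fun z => abse_ge0 _)).
    by apply: subset_trans Qs _; exact: eball_sub_ccube.
have mMs := measurable_HLmax (mF (star r)).
have tp0 : (0 <= t `^ p)%R by exact: powR_ge0.
have m1 : Lmeas (fun y => HLmax (Fb (star r)) y `^ p) by exact: Lmeas_poweR.
have m2 : Lmeas (fun y => (t `^ p)%:E * chi (eball x r) y) by exact: LmeasZ (measurable_chi (mB r)).
have m3 := LmeasD m1 m2.
have q1 y : 0 <= HLmax (Fb (star r)) y `^ p by exact: poweR_ge0.
have q2 y : 0 <= (t `^ p)%:E * chi (eball x r) y by rewrite mule_ge0 ?chi_ge0.
have two0 : (0 <= 2 `^ p :> R)%R by exact: powR_ge0.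
apply: (@le_trans _ _ (Y (fun y => (2 `^ p)%:E *
    (HLmax (Fb (star r)) y `^ p + (t `^ p)%:E * chi (eball x r) y)))).
  apply: (bfs_le bY (LmeasZ _ m3)).
    exact: Lmeas_chi (mB r) (Lmeas_poweR p mM).
  move=> y; have [By|nB] := pselect (eball x r y); last first.
    by rewrite (chi0 nB) mule0 abse0 abse_ge0.
  rewrite (chi1 By) !mule1 (gee0_abs (poweR_ge0 _ _)) gee0_abs; last first.
    by rewrite mule_ge0// adde_ge0.
  have te : 0 <= t%:E by rewrite lee_fin.
  have h := poweRD_le (ltW p0) (HLmax_ge0 (Fb (star r)) y) te.
  rewrite poweR_EFin in h; apply: le_trans h.
  by apply: lee_poweR (ltW p0) (HLmax_ge0 _ _) (point y By).
rewrite (bfs_scale bY _ m3) ger0_norm//.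
apply: (@le_trans _ _ ((2 `^ p)%:E * (A%:E * Yp (Fb (star r)) + (t `^ p)%:E * (yb x r)%:E))).
  apply: lee_wpmul2l => //; apply: le_trans (bfs_triangle bY m1 m2) _; apply: leeD.
    apply: le_trans (HA (mF _) (Fboo _ rs0)); rewrite le_eqVlt; apply/orP; left; apply/eqP.
    by congr Y; apply/funext => y; rewrite gee0_abs// HLmax_ge0.
  by rewrite (bfs_scale bY _ (measurable_chi (mB r))) ger0_norm// yE.
have tpE : (t `^ p = c0 `^ p * (A * C * fine P * u x r / yb x r))%R.
  rewrite /t powRM ?powR_ge0 ?(ltW c00)//; congr (_ * _)%R.
  rewrite -powRrM mulVf ?powRr1// ?gt_eqF//.
  by rewrite divr_ge0 ?(ltW y0)// !mulr_ge0 ?fine_ge0// ?(ltW A0) ?(ltW C0) ?(ltW (u0 x r0)).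
apply: (@le_trans _ _ ((2 `^ p)%:E * (A%:E * ((u x (star r))%:E * P) + (t `^ p)%:E * (yb x r)%:E))).
  apply: lee_wpmul2l => //; apply: leeD2r; apply: lee_wpmul2l; first by rewrite lee_fin ltW.
  exact: Fb_le.
rewrite -(fineK Pf) (_ : (2 `^ p)%:E * _ =
    (2 `^ p * (A * (u x (star r) * fine P) + t `^ p * yb x r))%:E)// -!EFinM lee_fin tpE.
have us : (u x (star r) <= C * (c1 `^ p * A) * u x r)%R.
  apply: le_trans (cmp (star r) k0 erefl) _.
  apply: (@le_trans _ _ (C * (u x r / yb x r) * ((c1 `^ p * A) * yb x r)))%R.
    by apply: ler_wpM2l (dbl x r r0); rewrite mulr_ge0 ?(ltW C0)// divr_ge0 ?(ltW y0)// ltW// u0.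
  by rewrite le_eqVlt; apply/orP; left; apply/eqP; field; rewrite gt_eqF.
have -> : (c0 `^ p * (A * C * fine P * u x r / yb x r) * yb x r = c0 `^ p * A * C * u x r * fine P)%R.
  by field; rewrite gt_eqF.
have AP0 : (0 <= A * fine P)%R by rewrite mulr_ge0 ?fine_ge0// ltW.
have := ler_wpM2l AP0 us => h.
apply: (@le_trans _ _ (2 `^ p * (A * fine P * (C * (c1 `^ p * A) * u x r) + c0 `^ p * A * C * u x r * fine P)))%R.
  by apply: ler_wpM2l => //; rewrite lerD2r; apply: le_trans h; rewrite le_eqVlt; apply/orP; left; apply/eqP; ring.
by rewrite le_eqVlt; apply/orP; left; apply/eqP; rewrite /K; ring.
Qed.

End morrey_maximal.

(** * Commutators *)

Section commutators.
Context {R : realType} {n m l : nat}.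
Local Notation E := (Rn R n).
Local Notation mu := (leb R n).
Variables (n0 : (0 < n)%N) (lm : (l <= m)%N) (b : 'I_l -> E -> R) (dom : 'I_m -> set (E -> R)) (T : mop R n m).
Hypothesis hT : multilinear_operator dom T.

(** Generalized from all slots to a duplicate-free list: the outer commutator multiplies slot [s] by
    [b s], and since [s] does not recur in the tail, the domain conditions on the remaining slots
    survive the substitution. *)
Lemma measurable_foldr_commutator (mb : forall s, measurable_fun setT (b s)) (r : seq 'I_l) f : uniq r ->
  (forall i, dom i (f i)) ->
  (forall s, s \in r -> dom (widen_ord lm s) (fun y => b s y * f (widen_ord lm s) y)%R) ->
  measurable_fun setT (foldr (fun s U => commutator (widen_ord lm s) (b s) U) T r f).
Proof.
elim: r f => [|s r IH] f /=; first by move=> _ df _; exact: (mlin_measurable hT).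
move=> /andP[sr ur] df dbf; rewrite /commutator.
have dr t : t \in r -> dom (widen_ord lm t) (fun y => b t y * f (widen_ord lm t) y)%R.
  by move=> tr; apply: dbf; rewrite inE tr orbT.
have m1 := IH f ur df dr.
set g := subst f (widen_ord lm s) _.
have dg i : dom i (g i).
  by rewrite /g /subst; case: eqP => [->|_]; [apply: dbf; rewrite inE eqxx|exact: df].
have m2 : measurable_fun setT (foldr (fun s U => commutator (widen_ord lm s) (b s) U) T r g).
  apply: IH => // t tr; rewrite /g /subst; case: eqP => [ts|_]; last exact: dr.
  have {}ts : t = s by apply: val_inj; have := congr1 val ts.
  by move: sr; rewrite -ts tr.
exact: (measurable_funB (measurable_mulR (mb s) m1) m2).
Qed.

Lemma measurable_iter_commutator f : (forall s, measurable_fun setT (b s)) ->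
  iter_commutator_dom lm b dom f -> measurable_fun setT (iter_commutator lm b T f).
Proof.
by move=> mb [df dbf]; apply: measurable_foldr_commutator => //; exact: enum_uniq.
Qed.

Lemma sparse_bound_eq0 (S : 'I_(3 ^ n) -> set (@cube R n)) f x :
  (forall j gam Q, S j Q -> sterm lm b f gam Q x = 0) -> sparse_bound lm b S f x = 0.
Proof.
move=> t0; rewrite /sparse_bound; apply: big1 => j _; apply: big1 => gam _.
have := @esum1 _ _ (S j) (sterm lm b f gam ^~ x) (t0 j gam).
by rewrite /sterm.
Qed.

Lemma sparse_sum_const_ge0 (eta : R) : (0 < eta < 1)%R -> (0 <= @sparse_sum_const R n m l eta)%R.
Proof.
move=> /andP[e0 _]; rewrite /sparse_sum_const mulr_ge0 ?invr_ge0 ?(ltW e0)// !mulr_ge0 ?exprn_ge0 ?osc_const_ge0 ?Cosc_ge0//.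
Qed.

Lemma avg_ae0 (h : E -> \bar R) (Q : @cube R n) : (0 < Q.2)%R -> Lmeas h -> (forall x, 0 <= h x) ->
  (\forall x \ae mu, cset Q x -> h x = 0) -> avg (cset Q) h = 0.
Proof.
move=> Q0 mh h0 ae0; rewrite avg_cset// [X in _ * X](_ : _ = 0) ?mule0//.
apply: le_anti; rewrite integral_ge0 ?andbT; last by move=> x _; exact: h0.
rewrite -[leRHS](integral0 mu (cset Q)).
apply: (int_ae_le (measurable_cset Q) mh (Lmeas_cst _) h0 (fun=> lexx _)).
by apply: filterS ae0 => x H Qx; rewrite H.
Qed.

Lemma bmo_eq0 (c : E -> R) (Q : @cube R n) : measurable_fun setT c -> bmo_norm c = 0 -> (0 < Q.2)%R ->
  \forall x \ae mu, cset Q x -> c x = ravg Q c.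
Proof.
move=> mc c0 Q0; have mQ := measurable_cset Q.
have md : Lmeas (fun y => `|(c y - ravg Q c)%:E|).
  by apply: Lmeas_abse; apply: Lmeas_fin; exact: measurable_sub_cst.
have a0 : avg (cset Q) (fun y => `|(c y - ravg Q c)%:E|) = 0.
  apply/eqP; rewrite eq_le avg_ge0 ?andbT//; rewrite -c0.
  by apply: ereal_sup_ubound; exists Q.
have := int_cset (fun y => `|(c y - ravg Q c)%:E|) Q0; rewrite a0 mule0 => i0.
have := ae_zero_int mQ md (fun x => abse_ge0 _) i0.
apply: filterS => x /[apply] /eqP; rewrite abse_eq0 eqe subr_eq0 => /eqP //.
Qed.

(** A symbol of BMO norm zero is a.e. equal to its average on each cube, so its factor vanishes for
    both indices. The null set depends on the cube; countability of the sparse families allows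
    uniting these null sets. *)
Lemma sparse_bound_bmo0 (eta : R) (S : 'I_(3 ^ n) -> set (@cube R n)) f s :
  (forall t, measurable_fun setT (b t)) -> (forall i, measurable_fun setT (f i)) ->
  (forall j, sparse eta (S j)) -> bmo_norm (b s) = 0 ->
  \forall x \ae mu, sparse_bound lm b S f x = 0.
Proof.
move=> mb mf spS bs0.
have H j Q : S j Q -> \forall x \ae mu, forall gam, sterm lm b f gam Q x = 0.
  move=> SQ; have Q0 := sparse_gt0 (spS j) SQ; have mQ := measurable_cset Q.
  have bQ := bmo_eq0 (mb s) bs0 Q0; have bQ' := bQ.
  have a0 : avg (cset Q) (fun y => `|((b s y - ravg Q (b s)) * f (widen_ord lm s) y)%:E|) = 0.
    apply: (avg_ae0 Q0 _ (fun=> abse_ge0 _)).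
      exact: (Lmeas_abse (Lmeas_fin (measurable_mulR (measurable_sub_cst _ (mb s)) (mf _)))).
    by apply: filterS bQ' => x bx /bx ->; rewrite subrr mul0r abse0.
  apply: filterS bQ => x bx gam; rewrite /sterm.
  have [Qx|nQ] := pselect (cset Q x); last by rewrite chi0// mule0.
  rewrite (bigD1 s)//= /sparse_factor; case: (gam s); first by rewrite a0 !mul0e.
  by rewrite (bx Qx) subrr abse0 !mul0e.
have cS : countable (\bigcup_(j in [set: 'I_(3 ^ n)]) S j).
  apply: bigcup_countable => [|j _]; first exact: countableP.
  by apply: sparse_countable (spS j).
have [S0|[e [B eB]]] := esum_enum cS.
  apply: aeW => x; apply: sparse_bound_eq0 => j gam Q SQ; exfalso.
  by have : set0 Q by rewrite -S0; exists j.
have : \forall x \ae mu, forall k, B k -> forall j gam, S j (e k) -> sterm lm b f gam (e k) x = 0.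
  apply: ae_foralln => k; have [Bk|nB] := pselect (B k); last by apply: aeW => x /nB.
  (* The family index is recast as a natural number, so that the countable union of null sets
     applies; the equation [i = j] recovers the ordinal. *)
  have : \forall x \ae mu, forall i : nat, forall j : 'I_(3 ^ n), i = j :> nat -> forall gam, S j (e k) -> sterm lm b f gam (e k) x = 0.
    apply: ae_foralln => i; have [i3|ni] := ltnP i (3 ^ n); last first.
      by apply: aeW => x j ij; move: (ltn_ord j); rewrite -ij ltnNge ni.
    have [Sj|nS] := pselect (S (Ordinal i3) (e k)).
      apply: filterS (H _ _ Sj) => x Hx j ij gam _; exact: Hx.
    by apply: aeW => x j ij gam; rewrite (_ : j = Ordinal i3) => [/nS|]; first by []; exact: val_inj.
  by apply: filterS => x Hx _ j gam; exact: (Hx j j erefl).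
apply: filterS => x Hx; apply: sparse_bound_eq0 => j gam Q SQ.
have [_ _ sB] := eB; have [|k Bk kQ] := sB Q; first by exists j.
by rewrite -kQ; apply: (Hx k Bk j gam); rewrite kQ.
Qed.

Lemma sparse_bound_f0 (eta : R) (S : 'I_(3 ^ n) -> set (@cube R n)) (f : 'I_m -> E -> R) (i : 'I_m) :
  (forall t, measurable_fun setT (b t)) -> (forall i, measurable_fun setT (f i)) ->
  (forall j, sparse eta (S j)) -> (\forall x \ae mu, f i x = 0%R) ->
  forall x, sparse_bound lm b S f x = 0.
Proof.
move=> mb mf spS fi0 x; apply: sparse_bound_eq0 => j gam Q SQ.
have Q0 := sparse_gt0 (spS j) SQ; have mQ := measurable_cset Q.
have a0 (c : E -> R) : measurable_fun setT c -> avg (cset Q) (fun y => `|(c y * f i y)%:E|) = 0.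
  move=> mc; apply: (avg_ae0 Q0 _ (fun=> abse_ge0 _)).
    exact: (Lmeas_abse (Lmeas_fin (measurable_mulR mc (mf i)))).
  by apply: filterS fi0 => y fy _; rewrite fy mulr0 abse0.
have a1 : avg (cset Q) (fun y => `|(f i y)%:E|) = 0.
  by rewrite -[RHS](a0 (cst 1%R) (measurable_cst _)); congr avg; apply/funext => y; rewrite mul1r.
rewrite /sterm; have [il|li] := ltnP i l; last by rewrite (bigD1 i (P := fun s : 'I_m => (l <= s)%N))//= a1 mul0e mule0 mul0e.
rewrite (bigD1 (Ordinal il))//= /sparse_factor.
have -> : widen_ord lm (Ordinal il) = i by exact: val_inj.
case: (gam _); last by rewrite a1 mule0 !mul0e.
by rewrite (a0 _ (measurable_sub_cst _ (mb _))) !mul0e.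
Qed.

(** The approximants inherit [f i = 0] from [|F k| <= |f|]; their sparse bounds vanish a.e., hence
    so do their commutators, and so does the limit. *)
Lemma iter_commutator_eq0 (C eta : R) f : (forall s, measurable_fun setT (b s)) ->
  sparse_domination lm b dom T C eta -> approximable lm b T f ->
  (exists s, bmo_norm (b s) = 0) \/ (exists i, \forall x \ae mu, f i x = 0%R) ->
  \forall x \ae mu, iter_commutator lm b T f x = 0%R.
Proof.
move=> mb sd [F [cF Ff cvF]] z.
have F0 : \forall x \ae mu, forall k, iter_commutator lm b T (F k) x = 0%R.
  apply: ae_foralln => k; have [_ [S [spS dS]]] := sd (F k) (cF k).
  have mF i : measurable_fun setT (F k i) by case: (cF k i).
  have s0 : \forall x \ae mu, sparse_bound lm b S (F k) x = 0.
    case: z => [[s bs]|[i fi]]; first exact: (sparse_bound_bmo0 mb mF spS bs).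
    apply: aeW; apply: (@sparse_bound_f0 eta S (F k) i mb mF spS).
    have H := Ff k i; apply: filterS2 H fi => x + fx.
    by rewrite fx normr0 normr_le0 => /eqP.
  apply: filterS2 s0 dS => x -> ; rewrite mule0 => H.
  by apply/eqP; rewrite -normr_eq0 eq_le normr_ge0 andbT -lee_fin.
apply: filterS2 F0 cvF => x Fx cx.
have : 0%:E @[k --> \oo] --> (iter_commutator lm b T f x)%:E.
  have -> // : (fun=> 0%:E) = (fun k => (iter_commutator lm b T (F k) x)%:E).
  by apply/funext => k; rewrite Fx.
by move=> /(cvg_unique _ (cvg_cst _)) => /(_ (@ereal_hausdorff _)) [<-].
Qed.

Lemma measurable_sparse_bound (eta : R) (S : 'I_(3 ^ n) -> set (@cube R n)) f :
  (forall t, locally_int (b t)) -> (forall j, sparse eta (S j)) -> Lmeas (sparse_bound lm b S f).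
Proof.
move=> bloc spS; apply: Lmeas_sum => j; apply: Lmeas_sum => gam.
apply: (measurable_esum (sparse_countable (spS j)) (f := sterm lm b f gam)).
  by move=> Q; apply: measurable_sterm.
by move=> Q x; exact: sterm_ge0.
Qed.

Lemma sparse_bound_ge0 (S : 'I_(3 ^ n) -> set (@cube R n)) f x : 0 <= sparse_bound lm b S f x.
Proof.
apply: sume_ge0 => j _; apply: sume_ge0 => gam _; apply: esum_ge0 => Q _; exact: (sterm_ge0 lm b f gam Q x).
Qed.

(** Sparse domination is available for the approximants. Since [|F k| <= |f|], their dual bounds are
    dominated by the one with maximal functions of [f], uniformly in [k], and Fatou's lemma passes
    to the limit. [|C|] replaces [C], whose sign is not prescribed. *)
Lemma iter_commutator_dual (beta : 'I_l -> R) (C eta : R) f (G : E -> R) : (0 < eta < 1)%R ->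
  (forall s, locally_int (b s)) -> (forall s, bmo_norm (b s) <= (beta s)%:E) -> (forall s, (0 < beta s)%R) ->
  sparse_domination lm b dom T C eta -> iter_commutator_dom lm b dom f -> approximable lm b T f ->
  measurable_fun setT G -> (forall x, (0 <= G x)%R) ->
  \int[mu]_x (`|iter_commutator lm b T f x| * G x)%:E <=
  `|C|%:E * (((3 ^ n)%:R * (2 ^ l)%:R * @sparse_sum_const R n m l eta)%:E * (\prod_(s < l) beta s)%:E *
    \int[mu]_x (multimax (fun i => HLmax (EFin \o f i)) x * HLiter (l + 2) (EFin \o G) x)).
Proof.
move=> eta01 bloc bbeta beta0 sd fd [F [cF Ff cvF]] mG G0.
have mb s : measurable_fun setT (b s) by case: (bloc s).
have mf i : measurable_fun setT (f i) by apply: (mlin_dom_measurable hT); case: fd.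
have mF k i : measurable_fun setT (F k i) by case: (cF k i).
have mprod (h : E -> R) : measurable_fun setT h -> Lmeas (fun x => (`|h x| * G x)%:E).
  move=> mh; apply: Lmeas_fin; apply: measurable_mulR mG.
  exact: (measurableT_comp (@normr_measurable R setT) mh).
have mT (h : 'I_m -> E -> R) : iter_commutator_dom lm b dom h -> measurable_fun setT (iter_commutator lm b T h).
  exact: (measurable_iter_commutator mb).
apply: (@fatou_le _ _ R mu setT (fun x => (`|iter_commutator lm b T f x| * G x)%:E)
  (fun k x => (`|iter_commutator lm b T (F k) x| * G x)%:E) _ measurableT (mprod _ (mT _ fd))).
- by move=> k; apply/mprod/mT; case: (sd (F k) (cF k)).
- by move=> x; rewrite lee_fin mulr_ge0.
- by move=> k x; rewrite lee_fin mulr_ge0.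
- apply: filterS cvF => x cx _; have := cvgeZr (isT : (G x)%:E \is a fin_num) (cvg_abse cx).
  exact.
move=> k; have [Fd [S [spS dS]]] := sd (F k) (cF k).
have mS := measurable_sparse_bound (F k) bloc spS.
have mSG : Lmeas (fun x => sparse_bound lm b S (F k) x * (G x)%:E) by exact: (LmeasM mS (Lmeas_fin mG)).
have SG0 x : 0 <= sparse_bound lm b S (F k) x * (G x)%:E by rewrite mule_ge0 ?sparse_bound_ge0 ?lee_fin.
apply: (@le_trans _ _ (\int[mu]_x (`|C|%:E * (sparse_bound lm b S (F k) x * (G x)%:E)))).
  apply: (int_ae_le measurableT (mprod _ (mT _ Fd)) (LmeasZ _ mSG)).
  - by move=> x; rewrite lee_fin mulr_ge0.
  - by move=> x; rewrite mule_ge0 ?lee_fin.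
  apply: filterS dS => x dx _; rewrite EFinM muleA lee_wpmul2r ?lee_fin//.
  apply: le_trans dx _; rewrite lee_wpmul2r ?sparse_bound_ge0// lee_fin ler_norm//.
rewrite (intZ measurableT mSG SG0) ?lee_fin// lee_wpmul2l ?lee_fin//.
apply: le_trans (int_sparse_bound lm n0 bloc bbeta beta0 eta01 (mF k) mG G0 spS) _.
have mE (h : 'I_m -> E -> R) : (forall i, measurable_fun setT (h i)) -> forall i, Lmeas (HLmax (EFin \o h i)).
  by move=> mh i; apply: measurable_HLmax; exact: Lmeas_fin.
have HG0 x : 0 <= HLiter (l + 2) (EFin \o G) x by apply: HLiter_ge0 => y; rewrite lee_fin.
have mHG : Lmeas (HLiter (l + 2) (EFin \o G)) by apply: measurable_HLiter; exact: Lmeas_fin.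
apply: lee_wpmul2l.
  rewrite mule_ge0 ?lee_fin ?prodr_ge0 => // [|s _]; last exact: ltW.
  by apply: mulr_ge0; [exact: mulr_ge0|exact: (sparse_sum_const_ge0 eta01)].
apply: (int_le measurableT (LmeasM (measurable_multimax _) mHG) (LmeasM (measurable_multimax _) mHG)).
  by move=> x; rewrite mule_ge0// multimax_ge0.
move=> x _; apply: (lee_wpmul2r (HG0 x)); apply: multimax_le; [exact: mE|exact: mE|].
move=> i; apply: aeW => y; rewrite !gee0_abs ?HLmax_ge0//.
apply: HLmax_le; [exact: Lmeas_fin|exact: Lmeas_fin|].
by apply: filterS (Ff k i) => z; rewrite /= lee_fin.
Qed.

End commutators.

(** * Operator norms and scaling *)

Section operator_bounds.
Context {R : realType} {n : nat}.
Local Notation E := (Rn R n).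

(** What rescaling to the unit ball of an operator norm requires. No triangle inequality is listed,
    so Morrey norms over [fpow] qualify without Minkowski's inequality; an inequality for scaling
    suffices, because the inverse factor is also allowed. *)
Definition homog_norm (X : fnorm R n) : Prop :=
  [/\ X (fun=> 0) = 0, forall f, Lmeas f -> 0 <= X f,
    forall f g, Lmeas f -> Lmeas g -> (forall x, 0 <= g x <= f x) -> X g <= X f &
    forall (c : R) f, (0 < c)%R -> Lmeas f -> X (fun x => c%:E * f x) <= c%:E * X f].

Lemma opnorm_HLmax_ge0 X Y : homog_norm X -> homog_norm Y -> 0 <= opnorm X Y (@HLmax R n).
Proof.
move=> [X0 _ _ _] [_ Y0 _ _]; have X1 : X (fun=> 0) <= 1 by rewrite X0.
apply: le_trans (@opnorm_le R n X Y (@HLmax R n) _ (Lmeas_cst _) X1).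
exact: (Y0 _ (measurable_HLmax (Lmeas_cst _))).
Qed.

Lemma mopnorm_multimax_ge0 m (X : 'I_m -> fnorm R n) Y : (forall i, homog_norm (X i)) -> homog_norm Y ->
  0 <= mopnorm X Y (@multimax R n m).
Proof.
move=> hX [_ Y0 _ _].
apply: le_trans (@mopnorm_le R n m X Y (@multimax R n m) (fun _ => fun=> 0) (fun=> Lmeas_cst _) _).
  exact: (Y0 _ (measurable_multimax _)).
by move=> i; have [-> _ _ _] := hX i.
Qed.

Lemma homog_normalize X f (N : R) : homog_norm X -> (0 < N)%R -> Lmeas f -> X f <= N%:E ->
  X (fun x => (N^-1)%:E * f x) <= 1.
Proof.
move=> [_ _ _ XZ] N0 mf fN; have Ni : (0 < N^-1)%R by rewrite invr_gt0.
apply: le_trans (XZ _ _ Ni mf) _.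
have -> : 1 = (N^-1)%:E * N%:E :> \bar R by rewrite -EFinM mulVf ?gt_eqF.
by rewrite lee_wpmul2l// lee_fin ltW.
Qed.

(** A positive real bound [N] stands in for the norm of [f], so that normalization never divides by
    zero or infinity. *)
Lemma opnorm_HLmax (X Y : fnorm R n) f (N : R) : homog_norm X -> homog_norm Y -> (0 < N)%R -> Lmeas f ->
  X f <= N%:E -> Y (HLmax f) <= opnorm X Y (@HLmax R n) * N%:E.
Proof.
move=> hX [_ _ _ YZ] N0 mf fN.
have mg : Lmeas (fun x => (N^-1)%:E * f x) := LmeasZ _ mf.
have H := @opnorm_le R n X Y (@HLmax R n) _ mg (homog_normalize hX N0 mf fN).
have -> : HLmax f = fun x => N%:E * HLmax (fun x => (N^-1)%:E * f x) x.
  apply/funext => x; rewrite HLmaxZ// gtr0_norm ?invr_gt0// muleA -EFinM mulfV ?gt_eqF// mul1e//.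
apply: le_trans (YZ _ _ N0 (measurable_HLmax mg)) _.
by rewrite muleC lee_wpmul2r// lee_fin ltW.
Qed.

Lemma mopnorm_multimax m (X : 'I_m -> fnorm R n) (Y : fnorm R n) F (N : 'I_m -> R) :
  (forall i, homog_norm (X i)) -> homog_norm Y -> (forall i, (0 < N i)%R) -> (forall i, Lmeas (F i)) ->
  (forall i, X i (F i) <= (N i)%:E) ->
  Y (multimax F) <= mopnorm X Y (@multimax R n m) * (\prod_(i < m) N i)%:E.
Proof.
move=> hX [_ _ Yle YZ] N0 mF FN; pose G i x := ((N i)^-1)%:E * F i x.
have mG i : Lmeas (G i) := LmeasZ _ (mF i).
have P0 : (0 < \prod_(i < m) N i)%R by apply: prodr_gt0 => i _.
have H := @mopnorm_le R n m X Y (@multimax R n m) G mG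
  (fun i => homog_normalize (hX i) (N0 i) (mF i) (FN i)).
have E1 x : multimax F x <= (\prod_(i < m) N i)%:E * multimax G x.
  rewrite -prodEFin; apply: le_trans (multimaxZ x mG (fun i => ltW (N0 i))).
  apply: multimax_le => // i; first exact: (LmeasZ _ (mG i)).
  by apply: aeW => y; rewrite /G muleA -EFinM mulfV ?gt_eqF// mul1e.
have mG' := LmeasZ (\prod_(i < m) N i)%:E (measurable_multimax G).
apply: le_trans (Yle _ _ mG' (measurable_multimax F) _) _; first by move=> x; rewrite multimax_ge0 E1.
apply: le_trans (YZ _ _ P0 (measurable_multimax G)) _.
by rewrite muleC lee_wpmul2r// lee_fin ltW.
Qed.

End operator_bounds.

Section morrey_spaces.
Context {R : realType} {n : nat}.
Local Notation E := (Rn R n).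
Local Notation mu := (leb R n).
Variables (X : fnorm R n) (u : E -> R -> R).
Hypotheses (n0 : (0 < n)%N) (bX : banach_function_space X).
Hypothesis u0 : forall x r, (0 < r)%R -> (0 < u x r)%R.

Lemma morrey_le f g : Lmeas f -> Lmeas g -> (forall x, `|g x| <= `|f x|) -> morrey X u g <= morrey X u f.
Proof.
move=> mf mg gf; apply: ge_ereal_sup => _ [[x r] /= r0 <-].
apply: (@le_trans _ _ (((u x r)^-1)%:E * X (fun y => f y * chi (eball x r) y))).
  rewrite lee_wpmul2l ?lee_fin ?invr_ge0 ?(ltW (u0 x r0))//.
  have mB := measurable_eball x r.
  apply: (bfs_le bX (Lmeas_chi mB mf) (Lmeas_chi mB mg)) => y; rewrite !abseM; apply: lee_wpmul2r => //.
by apply: ereal_sup_ubound; exists (x, r).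
Qed.

Lemma morrey_ae_eq0 f : Lmeas f -> (\forall x \ae mu, f x = 0) -> morrey X u f <= 0.
Proof.
move=> mf f0; apply: ge_ereal_sup => _ [[x r] /= r0 <-].
rewrite [X in _ * X](_ : _ = 0) ?mule0//; apply/(bfs_eq0 bX (Lmeas_chi (measurable_eball x r) mf)).
by apply: filterS f0 => y ->; rewrite mul0e.
Qed.

Lemma homog_morrey : homog_norm (morrey X u).
Proof.
split=> [|f|f g mf mg gf|c f c0 mf].
- by apply/le_anti; rewrite (morrey_ge0 bX u0 (Lmeas_cst _)) andbT; apply: (morrey_ae_eq0 (Lmeas_cst _)); exact: aeW.
- exact: (morrey_ge0 bX u0).
- apply: morrey_le => // x; have /andP[g0 gfx] := gf x.
  by rewrite (gee0_abs g0) (gee0_abs (le_trans g0 gfx)).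
apply: ge_ereal_sup => _ [[x r] /= r0 <-].
have -> : (fun y => c%:E * f y * chi (eball x r) y) = (fun y => c%:E * (f y * chi (eball x r) y)).
  by apply/funext => y; rewrite muleA.
rewrite (bfs_scale bX c (Lmeas_chi (measurable_eball x r) mf)) gtr0_norm// muleCA lee_wpmul2l ?lee_fin ?(ltW c0)//.
by apply: ereal_sup_ubound; exists (x, r).
Qed.

Lemma eball_exhaust (y : E) : exists k : nat, eball (0%R : 'rV[R]_n) k.+1%:R y.
Proof.
pose d := Num.sqrt (\sum_(i < n) (coord y i - coord (0%R : 'rV[R]_n) i) ^+ 2)%R.
by exists (Num.truncn d); rewrite /eball /=; exact: truncnS_gt.
Qed.

Lemma morrey_gt0 f : Lmeas f -> ~ (\forall x \ae mu, f x = 0) -> 0 < morrey X u f.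
Proof.
move=> mf f0; rewrite lt_neqAle (morrey_ge0 bX u0 mf) andbT; apply/eqP => /esym z; apply: f0.
have H (k : nat) : \forall x \ae mu, f x * chi (eball (0%R : 'rV[R]_n) k.+1%:R) x = 0.
  have mB := measurable_eball (0%R : 'rV[R]_n) (k.+1%:R : R); have mfB := Lmeas_chi mB mf.
  apply/(bfs_eq0 bX mfB)/le_anti; rewrite (bfs_ge0 bX mfB) andbT.
  by have := morrey_ball X u0 f (0%R : 'rV[R]_n) (ltr0Sn R k); rewrite z mule0.
apply: filterS (ae_foralln H) => x Hx; have [k kx] := eball_exhaust x.
by have := Hx k; rewrite (chi1 kx) mule1.
Qed.

(** Lorentz-Luxemburg on each ball: the factor [1 / u] and the indicator are moved onto the test
    function, which thereby becomes a block. *)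
Lemma morrey_le_dual (F : E -> R) (c : R) : measurable_fun setT F ->
  (forall x r (g : E -> R), (0 < r)%R -> bddm g -> assoc X (EFin \o g) <= 1 ->
    \int[mu]_y ((`|F y| * ((u x r)^-1 * g y * \1_(eball x r) y))%:E) <= c%:E) ->
  morrey X u (EFin \o F) <= c%:E.
Proof.
move=> mF H; apply: ge_ereal_sup => _ [[x r] /= r0 <-].
have ui : (0 < (u x r)^-1)%R by rewrite invr_gt0 u0.
have mh : Lmeas (fun y => (F y)%:E * chi (eball x r) y) := Lmeas_chi (measurable_eball x r) (Lmeas_fin mF).
rewrite -[X in X%:E * _](gtr0_norm ui) -(bfs_scale bX _ mh).
apply: (lorentz_luxemburg bX (LmeasZ _ mh)) => g bg ag.
apply: le_trans (H x r g r0 bg ag); rewrite le_eqVlt; apply/orP; left; apply/eqP.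
apply: eq_integral => y _; rewrite /chi -!EFinM /= !normrM (gtr0_norm ui).
by rewrite [X in (_ * (_ * X))%R]ger0_norm ?indicE ?ler0n//; congr (_%:E); ring.
Qed.

Lemma assoc_chi_fin x r : (0 < r)%R -> exists2 c : R, (0 < c)%R & assoc X (chi (eball x r)) <= c%:E.
Proof.
move=> r0; have mB := measurable_eball x r.
have [C HC] := bfs_int bX mB (leb_eball_fin x r0).
exists (`|C| + 1)%R; first by rewrite ltr_wpDl.
apply: ge_ereal_sup => _ [g [mg Xg] <-].
apply: le_trans (le_abse_integral mu measurableT _) _; first exact: (LmeasM (measurable_chi mB) mg).
have -> : \int[mu]_y `|chi (eball x r) y * g y| = \int[mu]_(y in eball x r) `|g y|.
  rewrite (int_chiE _ mB); apply: eq_integral => y _.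
  by rewrite abseM muleC (gee0_abs (chi_ge0 _ _)).
have Xg0 := bfs_ge0 bX mg.
apply: le_trans (HC g _) _; first by split=> //; apply: le_lt_trans Xg _; exact: ltry.
apply: (@le_trans _ _ (`|C|%:E * X g)); first by rewrite lee_wpmul2r// lee_fin ler_norm.
apply: (@le_trans _ _ (`|C|%:E * 1)); first by rewrite lee_wpmul2l// lee_fin.
by rewrite mule1 lee_fin lerDl.
Qed.

End morrey_spaces.

Section block_operator_norm.
Context {R : realType} {n : nat}.
Local Notation E := (Rn R n).
Local Notation mu := (leb R n).
Variables (X : fnorm R n) (u : E -> R -> R).
Hypotheses (n0 : (0 < n)%N) (bX : banach_function_space X).
Hypothesis u0 : forall x r, (0 < r)%R -> (0 < u x r)%R.
Local Notation B := (block_norm (assoc X) u).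
Local Notation o := (0%R : 'rV[R]_n).

(** If the norm were zero, [morrey_duality] with [a = 0] would make the integral of [HLmax h] over
    the unit ball vanish for a nonzero multiple [h] of the indicator of that ball, although
    [HLmax h] is positive everywhere. *)
Lemma opnorm_blocks_gt0 : morrey X u (chi (eball o 1)) < +oo -> 0 < opnorm B B (@HLmax R n).
Proof.
move=> mfin; have mB := measurable_eball o (1 : R); have mc := measurable_chi mB.
rewrite lt_neqAle (opnorm_block_ge0 u0 (assoc0 bX)) andbT; apply/eqP => /esym z.
have [c c0 cB] := assoc_chi_fin bX o (@ltr01 R).
have ci : (0 < c^-1)%R by rewrite invr_gt0.
have b1 : bddm (\1_(eball o 1) : E -> R).
  split; first exact: measurable_indic.
  by exists 1%R => y; rewrite indicE; case: (_ \in _); rewrite lexx ?ler01.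
pose g (y : E) := (c^-1 * \1_(eball o 1) y)%R.
have bg : bddm g := bddmM (bddm_cst (ltW ci)) b1.
have ag : assoc X (EFin \o g) <= 1.
  apply: ge_ereal_sup => _ [h [mh Xh] <-].
  have mch : Lmeas (fun x => chi (eball o 1) x * h x) := LmeasM mc mh.
  have H : `|\int[mu]_x `|chi (eball o 1) x * h x| | <= c%:E.
    apply: le_trans cB; apply: ereal_sup_ubound; exists (abse \o h).
      by split; [exact: Lmeas_abse|rewrite (bfs_abse bX mh)].
    congr (`|_|); apply: eq_integral => x _; by rewrite abseM (gee0_abs (chi_ge0 _ _)).
  have mgh : Lmeas (fun x => (EFin \o g) x * h x) := LmeasM (Lmeas_fin bg.1) mh.
  apply: le_trans (le_abse_integral mu measurableT mgh) _.
  have -> : \int[mu]_x `|(EFin \o g) x * h x| = (c^-1)%:E * \int[mu]_x `|chi (eball o 1) x * h x|.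
    rewrite -(intZ measurableT (Lmeas_abse mch) (fun=> abse_ge0 _)) ?lee_fin ?(ltW ci)//.
    apply: eq_integral => x _.
    change (`|(c^-1 * \1_(eball o 1) x)%:E * h x| = (c^-1)%:E * `|(\1_(eball o 1) x)%:E * h x|).
    by rewrite EFinM -muleA abseM abse_EFin (gtr0_norm ci).
  rewrite (gee0_abs (integral_ge0 _ (fun x _ => abse_ge0 _))) in H.
  by rewrite lee_pdivrMl// mule1.
have := @morrey_duality R n X u bX u0 0%R z (chi (eball o 1)) g o 1%R 1%N mc (chi_ge0 _) mfin bg ag (@ltr01 R).
have -> : morrey X u (chi (eball o 1)) * (0 ^+ 1)%:E = 0 by rewrite expr1 mule0.
set h := fun y : E => _%:E => i0.
have mh : Lmeas h.
  apply: (Lmeas_fin (measurable_mulR (measurable_mulR (measurable_cst _) bg.1) b1.1)).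
have h0 y : 0 <= h y.
  by rewrite lee_fin mulr_ge0 ?(bddm_ge0 _ b1)// mulr_ge0 ?(bddm_ge0 _ bg)// invr_ge0 ltW// u0.
have hne : ~ (\forall y \ae mu, h y = 0).
  move=> /(ae_ex mB (leb_eball_gt0 o n0 (@ltr01 R)))[y By] /eqP; rewrite /h /g indicE mem_set// !mulr1 eqe mulf_eq0.
  by rewrite (gt_eqF ci) invr_eq0 (gt_eqF (u0 _ ltr01)).
have mHh : Lmeas (fun y => chi (eball o 1) y * HLiter 1 h y) := LmeasM mc (measurable_HLiter 1 mh).
have Hh0 y : 0 <= chi (eball o 1) y * HLiter 1 h y by rewrite mule_ge0 ?chi_ge0// HLiter_ge0.
have /(ae_zero_int measurableT mHh Hh0) ae0 : \int[mu]_y (chi (eball o 1) y * HLiter 1 h y) = 0.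
  by apply/le_anti; rewrite i0 integral_ge0.
have [y By /(_ I)] := ae_ex mB (leb_eball_gt0 o n0 (@ltr01 R)) ae0; rewrite (chi1 By) mul1e => Hy.
by have := HLmax_gt0 y mh hne; rewrite -[HLmax h y]/(HLiter 1 h y) Hy ltxx.
Qed.

End block_operator_norm.

Section morrey_powers.
Context {R : realType} {n : nat}.
Local Notation E := (Rn R n).
Local Notation mu := (leb R n).
Local Notation o := (0%R : 'rV[R]_n).
Variables (X : fnorm R n) (p : R) (u : E -> R -> R).
Hypotheses (n0 : (0 < n)%N) (bX : banach_function_space X) (p0 : (0 < p)%R).
Hypothesis u0 : forall x r, (0 < r)%R -> (0 < u x r)%R.
Local Notation v := (fun x r => powR (u x r) p^-1).

Let pi0 : (0 <= p^-1)%R. Proof. by rewrite invr_ge0 ltW. Qed.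

(** Powers commute with the supremum over balls, and the weight [u^(1/p)] turns back into [u]. Both
    kinds of Morrey norm in the estimate for [p > 1] are thereby reduced to the one over [X]. *)
Lemma poweR_morrey f : Lmeas f ->
  (morrey (fpow X p) v f) `^ p = morrey X u (fun x => `|f x| `^ p).
Proof.
move=> mf; have mfp : Lmeas (fun x => `|f x| `^ p) := Lmeas_poweR p (Lmeas_abse mf).
have el x r : (0 < r)%R -> ((v x r)^-1)%:E * fpow X p (fun y => f y * chi (eball x r) y) =
    (((u x r)^-1)%:E * X (fun y => `|f y| `^ p * chi (eball x r) y)) `^ p^-1.
  move=> r0; have ui : (0 <= (u x r)^-1)%R by rewrite invr_ge0 ltW// u0.
  rewrite poweRM ?lee_fin//; last exact: (bfs_ge0 bX (Lmeas_chi (measurable_eball x r) mfp)).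
  rewrite poweR_EFin -(powR_inv1 (ltW (u0 x r0))) -powRrM mulN1r powRN.
  congr (_ * (X _) `^ _); apply/funext => y; rewrite /= abseM poweRM//.
  by rewrite (poweR_chi p0).
have e0 x r : (0 < r)%R -> 0 <= ((u x r)^-1)%:E * X (fun y => `|f y| `^ p * chi (eball x r) y).
  move=> r0; rewrite mule_ge0 ?lee_fin ?invr_ge0 ?(ltW (u0 x r0))//.
  exact: (bfs_ge0 bX (Lmeas_chi (measurable_eball x r) mfp)).
apply/le_anti/andP; split.
  have -> : morrey X u (fun x => `|f x| `^ p) = ((morrey X u (fun x => `|f x| `^ p)) `^ p^-1) `^ p.
    by rewrite poweRVK// (morrey_ge0 bX u0 mfp).
  apply: lee_poweR (ltW p0) _ _.
    apply: (@le_trans _ _ (((v o 1)^-1)%:E * fpow X p (fun y => f y * chi (eball o 1) y))).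
      by rewrite el// poweR_ge0.
    by apply: ereal_sup_ubound; exists (o, 1%R) => //; exact: ltr01.
  apply: ge_ereal_sup => _ [[x r] /= r0 <-]; rewrite el//; apply: (lee_poweR pi0 (e0 x r r0)).
  by apply: ereal_sup_ubound; exists (x, r).
apply: ge_ereal_sup => _ [[x r] /= r0 <-]; rewrite -[leLHS](poweRVK p0 (e0 x r r0)).
apply: (lee_poweR (ltW p0) (poweR_ge0 _ _)); rewrite -el//.
by apply: ereal_sup_ubound; exists (x, r).
Qed.

Lemma morrey_fpow_ge0 f : Lmeas f -> 0 <= morrey (fpow X p) v f.
Proof.
move=> mf; apply: (@le_trans _ _ (((v o 1)^-1)%:E * fpow X p (fun y => f y * chi (eball o 1) y))).
  by rewrite mule_ge0 ?poweR_ge0// lee_fin invr_ge0 powR_ge0.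
by apply: ereal_sup_ubound; exists (o, 1%R) => //; exact: ltr01.
Qed.

Lemma morrey_fpowE f : Lmeas f ->
  morrey (fpow X p) v f = (morrey X u (fun x => `|f x| `^ p)) `^ p^-1.
Proof. by move=> mf; rewrite -poweR_morrey// poweRK// morrey_fpow_ge0. Qed.

Lemma homog_morrey_fpow : homog_norm (morrey (fpow X p) v).
Proof.
have mp (f : E -> \bar R) : Lmeas f -> Lmeas (fun x => `|f x| `^ p) by move=> mf; exact: (Lmeas_poweR p (Lmeas_abse mf)).
have [z _ mono scal] := homog_morrey bX u0.
split=> [|f mf|f g mf mg gf|c f c0 mf].
- rewrite (morrey_fpowE (Lmeas_cst 0)) (_ : (fun x => _) = fun=> 0) ?z ?poweR0r ?invr_eq0 ?gt_eqF//.
  by apply/funext => x; rewrite abse0 poweR0r ?gt_eqF.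
- exact: morrey_fpow_ge0.
  rewrite (morrey_fpowE mf) (morrey_fpowE mg); apply: (lee_poweR pi0 (morrey_ge0 bX u0 (mp _ mg))).
  apply: (mono _ _ (mp _ mf) (mp _ mg)) => x; have /andP[g0 gfx] := gf x.
  rewrite poweR_ge0 (gee0_abs g0) (gee0_abs (le_trans g0 gfx)); exact: lee_poweR (ltW p0) _ _.
have mcf : Lmeas (fun x => c%:E * f x) := LmeasZ _ mf.
rewrite (morrey_fpowE mcf) (morrey_fpowE mf).
have -> : (fun x => `|c%:E * f x| `^ p) = (fun x => (c `^ p)%:E * `|f x| `^ p).
  by apply/funext => x; rewrite abseM abse_EFin gtr0_norm// poweRM ?lee_fin ?(ltW c0)//.
apply: le_trans (lee_poweR pi0 _ (scal _ _ (powR_gt0 p c0) (mp _ mf))) _.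
  exact: (morrey_ge0 bX u0 (LmeasZ _ (mp _ mf))).
rewrite poweRM ?lee_fin ?powR_ge0 ?(morrey_ge0 bX u0 (mp _ mf))// poweR_EFin -powRrM mulfV ?gt_eqF//.
by rewrite (powRr1 (ltW c0)).
Qed.

Hypothesis hw : weight0 (fpow X p) v.

(** For balls with [u] at most [u(x0, r0)], the first weight condition bounds the ratio of indicator
    norm to [u]; for the others, the norm of the fixed indicator is divided by a larger weight. The
    sum of the two bounds serves both cases. *)
Lemma morrey_chi_fin x0 r0 : (0 < r0)%R -> morrey X u (chi (eball x0 r0)) < +oo.
Proof.
move=> r00; have [_ _ [C [C0 HC _]]] := hw.
have mB (x : E) (r : R) := measurable_chi (measurable_eball x r).
have [N0E N0] := chinormP n0 bX x0 r00.
pose b1 := (chinorm X x0 r0 / u x0 r0)%R.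
have b10 : (0 <= b1)%R by rewrite divr_ge0 ?ltW// u0.
apply: (@le_lt_trans _ _ (b1 + C `^ p * b1)%:E); last exact: ltry.
apply: ge_ereal_sup => _ [[x r] /= r1 <-].
have [NE N1] := chinormP n0 bX x r1.
have mBB : Lmeas (fun y => chi (eball x0 r0) y * chi (eball x r) y) := LmeasM (mB _ _) (mB _ _).
have chi1le A (y : E) : chi A y <= 1.
  by rewrite /chi lee_fin indicE lern1 leq_b1.
have l1 : X (fun y => chi (eball x0 r0) y * chi (eball x r) y) <= (chinorm X x0 r0)%:E.
  rewrite -N0E; apply: (bfs_le bX (mB _ _) mBB) => y; rewrite abseM !(gee0_abs (chi_ge0 _ _)).
  by rewrite -[leRHS]mule1 lee_wpmul2l ?chi1le ?chi_ge0.
have l2 : X (fun y => chi (eball x0 r0) y * chi (eball x r) y) <= (chinorm X x r)%:E.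
  rewrite -NE; apply: (bfs_le bX (mB _ _) mBB) => y; rewrite abseM !(gee0_abs (chi_ge0 _ _)).
  by rewrite -[leRHS]mul1e lee_wpmul2r ?chi1le ?chi_ge0.
have ui : (0 <= (u x r)^-1)%R by rewrite invr_ge0 ltW// u0.
have [le|lt] := leP (u x r) (u x0 r0).
  apply: (@le_trans _ _ (chinorm X x r / u x r)%:E).
    by rewrite [in leRHS]mulrC EFinM lee_wpmul2l// lee_fin.
  have vle : (v x r <= v x0 r0)%R by apply: ge0_ler_powR; rewrite ?nnegrE ?(ltW (u0 _ _)).
  have := HC x x0 r r0 r1 r00 vle; rewrite !(chinorm_fpow _ p0).
  have dv (a d : R) : (0 < a)%R -> (0 < d)%R -> (a `^ p^-1 / d `^ p^-1 = (a / d) `^ p^-1)%R.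
    move=> a0 d0; rewrite powRM ?invr_ge0 ?ltW// -(powR_inv1 (ltW d0)) -powRrM mulN1r powRN//.
  rewrite !dv ?u0// -/b1 => H.
  have := ge0_ler_powR (ltW p0) (powR_ge0 _ _ : _ \in Num.nneg) (mulr_ge0 (ltW C0) (powR_ge0 _ _) : _ \in Num.nneg) H.
  rewrite -powRrM mulVf ?gt_eqF// powRr1 ?divr_ge0 ?(ltW N1) ?(ltW (u0 _ _))//.
  rewrite powRM ?powR_ge0 ?(ltW C0)// -powRrM mulVf ?gt_eqF// powRr1// => H'.
  by rewrite lee_fin; apply: le_trans H' _; rewrite lerDr.
apply: (@le_trans _ _ b1%:E); last by rewrite lee_fin lerDl mulr_ge0// powR_ge0.
rewrite /b1 mulrC EFinM; apply: lee_pmul => //; first exact: (bfs_ge0 bX mBB).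
by rewrite lee_fin lef_pV2 ?posrE ?u0// ltW.
Qed.

Lemma morrey_cset_fin (Q : @cube R n) : (0 < Q.2)%R -> morrey X u (chi (cset Q)) < +oo.
Proof.
move=> Q0; have r0 : (0 < n%:R * Q.2)%R by rewrite mulr_gt0 ?ltr0n.
apply: le_lt_trans (morrey_chi_fin Q.1 r0).
apply: (morrey_le bX u0 (measurable_chi (measurable_eball _ _)) (measurable_chi (measurable_cset Q))) => y.
rewrite !(gee0_abs (chi_ge0 _ _)); have [Qy|nQ] := pselect (cset Q y); last by rewrite (chi0 nQ) chi_ge0.
by rewrite (chi1 Qy) (chi1 (cset_sub_eball n0 Q0 (cset_nonempty Q0) Qy)).
Qed.

End morrey_powers.

Lemma prode_pinfty (R : realType) m (F : 'I_m -> \bar R) i : (forall j, 0 < F j) -> F i = +oo ->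
  \prod_(j < m) F j = +oo.
Proof.
by move=> F0 Fi; rewrite (bigD1 i)//= Fi gt0_mulye// prode_gt0// => j _; exact: F0.
Qed.

(** * Morrey bounds for the commutator with real constants *)

Section morrey_bounds.
Context {R : realType} {n m l : nat}.
Local Notation E := (Rn R n).
Local Notation mu := (leb R n).
Variables (n0 : (0 < n)%N) (lm : (l <= m)%N) (X : fnorm R n) (u : E -> R -> R) (p : R).
Hypotheses (bX : banach_function_space X) (u0 : forall x r, (0 < r)%R -> (0 < u x r)%R).
Hypotheses (p0 : (0 < p)%R) (hw : weight0 (fpow X p) (fun x r => powR (u x r) p^-1)).
Variables (dom : 'I_m -> set (E -> R)) (T : mop R n m) (C eta : R) (b : 'I_l -> E -> R) (f : 'I_m -> E -> R).
Hypotheses (hT : multilinear_operator dom T) (eta01 : (0 < eta < 1)%R).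
Hypotheses (sd : sparse_domination lm b dom T C eta) (fd : iter_commutator_dom lm b dom f).
Hypotheses (fa : approximable lm b T f).
Variables (beta : 'I_l -> R) (a W : R).
Hypotheses (bloc : forall s, locally_int (b s)).
Hypotheses (bbeta : forall s, bmo_norm (b s) <= (beta s)%:E) (beta0 : forall s, (0 < beta s)%R).
Hypothesis aM : opnorm (block_norm (assoc X) u) (block_norm (assoc X) u) (@HLmax R n) = a%:E.
Local Notation MM := (multimax (fun i => HLmax (EFin \o f i))).
Local Notation Tf := (iter_commutator lm b T f).

Definition sparse_const : R := (`|C| * ((3 ^ n)%:R * (2 ^ l)%:R * @sparse_sum_const R n m l eta))%R.

Lemma sparse_const_ge0 : (0 <= sparse_const)%R.
Proof. by apply: mulr_ge0 => //; apply: mulr_ge0; [exact: mulr_ge0|exact: (sparse_sum_const_ge0 eta01)]. Qed.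

Let c : R := (sparse_const * \prod_(s < l) beta s)%R.

Let c0 : (0 <= c)%R.
Proof. by rewrite mulr_ge0 ?sparse_const_ge0// prodr_ge0// => s _; exact: ltW. Qed.

Let mTf : measurable_fun setT Tf.
Proof. by apply: (measurable_iter_commutator hT _ fd) => s; case: (bloc s). Qed.

Let dual (G : E -> R) : measurable_fun setT G -> (forall x, (0 <= G x)%R) ->
  \int[mu]_x (`|Tf x| * G x)%:E <= c%:E * \int[mu]_x (MM x * HLiter (l + 2) (EFin \o G) x).
Proof.
move=> mG G0; apply: le_trans (iter_commutator_dual n0 hT eta01 bloc bbeta beta0 sd fd fa mG G0) _.
by rewrite !muleA -!EFinM.
Qed.

Let testG x r (g : E -> R) : (0 < r)%R -> bddm g ->
  measurable_fun setT (fun y => (u x r)^-1 * g y * \1_(eball x r) y)%R /\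
  forall y, (0 <= (u x r)^-1 * g y * \1_(eball x r) y)%R.
Proof.
move=> r0 bg; split.
  apply: (measurable_mulR (measurable_mulR (measurable_cst _) bg.1)).
  by apply: measurable_indic; exact: measurable_eball.
by move=> y; rewrite mulr_ge0 ?indicE ?ler0n// mulr_ge0 ?(bddm_ge0 _ bg)// invr_ge0 ltW// u0.
Qed.

Let duality (phi : E -> \bar R) (D : R) x r (g : E -> R) j : Lmeas phi -> (forall y, 0 <= phi y) ->
  morrey X u phi <= D%:E -> (0 < r)%R -> bddm g -> assoc X (EFin \o g) <= 1 ->
  \int[mu]_y (phi y * HLiter j (EFin \o (fun y => (u x r)^-1 * g y * \1_(eball x r) y)%R) y) <=
  (D * a ^+ j)%:E.
Proof.
move=> mphi phi0 MD r0 bg ag; have fin : morrey X u phi < +oo by apply: le_lt_trans MD _; exact: ltry.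
apply: (@le_trans _ _ (morrey X u phi * (a ^+ j)%:E)).
  exact: (@morrey_duality R n X u bX u0 a aM phi g x r j mphi phi0 fin bg ag r0).
rewrite EFinM lee_wpmul2r// lee_fin exprn_ge0//.
by rewrite -lee_fin -aM (opnorm_block_ge0 u0 (assoc0 bX)).
Qed.

Lemma commutator_morrey_le : (0 <= W)%R -> morrey X u MM <= W%:E ->
  morrey X u (EFin \o Tf) <= (c * W * a ^+ (l + 2))%:E.
Proof.
move=> W0 MW; apply: (morrey_le_dual bX u0 mTf) => x r g r0 bg ag.
have [mG G0] := testG x r0 bg.
apply: le_trans (dual mG G0) _.
rewrite -mulrA [leRHS]EFinM; apply: lee_wpmul2l; first by rewrite lee_fin.
exact: (@duality _ _ _ _ _ (l + 2)%N (measurable_multimax _) (multimax_ge0 _) MW r0 bg ag).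
Qed.

(** [rdf_transfer] with the test block as seed of the weight: [phi = c MM] satisfies the dual
    inequality, its power [p] pairs with the iterates by block duality, and the local bound holds
    because indicators of cubes have finite Morrey norm. *)
Lemma commutator_morrey_power_le : (1 < p)%R -> (0 < a)%R -> (0 <= W)%R ->
  morrey X u (fun x => MM x `^ p) <= W%:E ->
  morrey X u (fun x => (powR `|Tf x| p)%:E) <=
  (2 * @transfer_const R n (2 * a) p (l + 2) * (c `^ p * W))%:E.
Proof.
move=> p1 a0 W0 MW.
have mTp : measurable_fun setT (fun x => powR `|Tf x| p).
  by apply: (measurableT_comp (measurable_powR p)); exact: (measurableT_comp (@normr_measurable R setT) mTf).
apply: (morrey_le_dual bX u0 mTp) => x r g r0 bg ag.
have [mG G0] := testG x r0 bg.
set G := fun y => (_ * _ * _)%R in mG G0.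
have mM : Lmeas (fun x => c%:E * MM x) := LmeasZ _ (measurable_multimax _).
have ai j : (0 <= a ^+ j)%R by rewrite exprn_ge0// ltW.
have := @rdf_transfer R n (EFin \o G) a (Lmeas_fin mG) _ a0 p (l + 2) (fun x => `|Tf x|%R)
  (fun x => c%:E * MM x) (c `^ p * W) p1 (measurableT_comp (@normr_measurable R setT) mTf) _ mM.
have -> : \int[mu]_y (`|powR `|Tf y| p| * G y)%:E = \int[mu]_y ((powR `|Tf y| p)%:E * (EFin \o G) y).
  by apply: eq_integral => y _; rewrite ger0_norm ?powR_ge0// EFinM.
apply.
- by move=> y; have := G0 y; rewrite -lee_fin.
- by [].
- by move=> y; rewrite mule_ge0 ?lee_fin// multimax_ge0.
- by rewrite mulr_ge0 ?powR_ge0.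
- move=> H mH H0; apply: le_trans (dual mH H0) _.
  have mMH : Lmeas (fun y => MM y * HLiter (l + 2) (EFin \o H) y).
    exact: (LmeasM (measurable_multimax _) (measurable_HLiter _ (Lmeas_fin mH))).
  have MH0 y : 0 <= MM y * HLiter (l + 2) (EFin \o H) y.
    by rewrite mule_ge0 ?multimax_ge0// HLiter_ge0// => z; rewrite lee_fin.
  rewrite -(intZ measurableT mMH MH0) ?lee_fin// le_eqVlt; apply/orP; left; apply/eqP.
  by apply: eq_integral => y _; rewrite muleA.
- move=> j.
  have mMp : Lmeas (fun y => MM y `^ p) := Lmeas_poweR p (measurable_multimax _).
  have mMH : Lmeas (fun y => MM y `^ p * HLiter j (EFin \o G) y).
    exact: (LmeasM mMp (measurable_HLiter _ (Lmeas_fin mG))).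
  have MH0 y : 0 <= MM y `^ p * HLiter j (EFin \o G) y.
    by rewrite mule_ge0 ?poweR_ge0// HLiter_ge0// => z; rewrite lee_fin.
  apply: (@le_trans _ _ ((c `^ p)%:E * \int[mu]_y (MM y `^ p * HLiter j (EFin \o G) y))).
    rewrite -(intZ measurableT mMH MH0) ?lee_fin ?powR_ge0// le_eqVlt; apply/orP; left; apply/eqP.
    by apply: eq_integral => y _; rewrite poweRM ?lee_fin ?multimax_ge0// poweR_EFin muleA.
  rewrite -mulrA [leRHS]EFinM; apply: lee_wpmul2l; first by rewrite lee_fin powR_ge0.
  exact: (@duality _ _ _ _ _ j mMp (fun y => poweR_ge0 _ _) MW r0 bg ag).
move=> Q Q0; have Qfin := morrey_cset_fin n0 bX p0 u0 hw Q0.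
have mQ := measurable_chi (measurable_cset Q); have Mge0 := morrey_ge0 bX u0 mQ.
exists (fine (morrey X u (chi (cset Q)))); first exact: fine_ge0.
move=> j; apply: (@duality _ _ _ _ _ j mQ (chi_ge0 _) _ r0 bg ag).
by rewrite fineK ?ge0_fin_numE.
Qed.

End morrey_bounds.

Lemma mule_lty_fin (R : realType) (x y : \bar R) : 0 < x -> 0 < y -> x * y < +oo ->
  x \is a fin_num /\ y \is a fin_num.
Proof.
move=> x0 y0 xy; split; rewrite ge0_fin_numE ?ltW// ltey; apply/eqP => xo; move: xy; rewrite xo.
  by rewrite gt0_mulye// ltxx.
by rewrite gt0_muley// ltxx.
Qed.

Lemma prode_lty_fin (R : realType) m (F : 'I_m -> \bar R) i : (forall j, 0 < F j) ->
  \prod_(j < m) F j \is a fin_num -> F i \is a fin_num.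
Proof.
move=> F0 Ffin; rewrite ge0_fin_numE ?ltW// ltey; apply/eqP => Fi.
by move: Ffin; rewrite (prode_pinfty F0 Fi).
Qed.

Lemma powR_prod (R : realType) m (F : 'I_m -> R) (p : R) : (forall i, (0 <= F i)%R) ->
  ((\prod_(i < m) F i) `^ p = \prod_(i < m) (F i `^ p))%R.
Proof.
move=> F0; have : (0 <= \prod_(i < m) F i /\ (\prod_(i < m) F i) `^ p = \prod_(i < m) (F i `^ p))%R.
  elim/big_ind2: _ => [|x y z t [x0 <-] [z0 <-]|i _]; first by rewrite powR1.
  - by rewrite mulr_ge0// powRM.
  - by [].
by case.
Qed.

Lemma transfer_const_ge0 (R : realType) n (a p : R) k : (0 <= a)%R -> (0 <= @transfer_const R n a p k)%R.
Proof. by move=> a0; rewrite /transfer_const !mulr_ge0 ?exprn_ge0 ?powR_ge0. Qed.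

Section nondegenerate.
Context {R : realType} {n : nat}.
Local Notation E := (Rn R n).
Local Notation mu := (leb R n).
Hypothesis n0 : (0 < n)%N.

Lemma pos_not_ae0 (f : E -> \bar R) : (forall x, 0 < f x) -> ~ (\forall x \ae mu, f x = 0).
Proof.
move=> f0; have mB := measurable_eball (0%R : 'rV[R]_n) (1 : R).
move=> /(ae_ex mB (leb_eball_gt0 _ n0 (@ltr01 R)))[x _ fx].
by have := f0 x; rewrite fx ltxx.
Qed.

Lemma bmo_norm_ge0 (c : E -> R) : 0 <= bmo_norm c.
Proof.
apply: (@le_trans _ _ (avg (cset ((0%R : 'rV[R]_n), 1%R)) (fun y => `|(c y - ravg ((0%R : 'rV[R]_n), 1%R) c)%:E|))).
  by apply: avg_ge0 => y; exact: abse_ge0.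
by apply: ereal_sup_ubound; exists ((0%R : 'rV[R]_n), 1%R) => //; exact: ltr01.
Qed.

End nondegenerate.

(** * The two estimates with operator norms, including degenerate and infinite cases *)

Section commutator_estimates.
Context {R : realType} {n m l : nat}.
Local Notation E := (Rn R n).
Local Notation mu := (leb R n).
Variables (n0 : (0 < n)%N) (lm : (l <= m)%N) (X : fnorm R n) (Xs : 'I_m -> fnorm R n).
Variables (u : E -> R -> R) (us : 'I_m -> E -> R -> R) (p : R).
Hypotheses (bX : banach_function_space X) (bXs : forall i, banach_function_space (Xs i)).
Hypotheses (u0 : forall x r, (0 < r)%R -> (0 < u x r)%R) (us0 : forall i x r, (0 < r)%R -> (0 < us i x r)%R).
Hypotheses (p0 : (0 < p)%R) (hw : weight0 (fpow X p) (fun x r => powR (u x r) p^-1)).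
Variables (dom : 'I_m -> set (E -> R)) (T : mop R n m) (C eta : R) (b : 'I_l -> E -> R) (f : 'I_m -> E -> R).
Hypotheses (hT : multilinear_operator dom T) (eta01 : (0 < eta < 1)%R).
Hypotheses (hb : forall s, BMO (b s)) (sd : sparse_domination lm b dom T C eta).
Hypotheses (fd : iter_commutator_dom lm b dom f) (fa : approximable lm b T f).
Local Notation opB := (opnorm (block_norm (assoc X) u) (block_norm (assoc X) u) (@HLmax R n)).
Local Notation Tf := (iter_commutator lm b T f).
Local Notation sc := (@sparse_const R n m l C eta).

Let mb s : measurable_fun setT (b s). Proof. by case: (hb s) => -[]. Qed.
Let mf i : Lmeas (EFin \o f i).
Proof. by apply: Lmeas_fin; apply: (mlin_dom_measurable hT); case: fd. Qed.
Let mT : measurable_fun setT Tf := measurable_iter_commutator hT mb fd.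
Let mM i : Lmeas (HLmax (EFin \o f i)) := measurable_HLmax (mf i).
Let bloc s : locally_int (b s). Proof. by case: (hb s). Qed.
Let beta s := fine (bmo_norm (b s)).
Let bE s : bmo_norm (b s) = (beta s)%:E.
Proof. by rewrite /beta fineK// ge0_fin_numE ?bmo_norm_ge0//; case: (hb s). Qed.
Let hM := homog_morrey bX u0.
Let hMs i := homog_morrey (bXs i) (us0 i).
Let sc0 : (0 <= sc)%R := @sparse_const_ge0 R n m l C eta eta01.

Let opB0 : 0 < opB.
Proof. exact: (opnorm_blocks_gt0 n0 bX u0 (morrey_chi_fin n0 bX p0 u0 hw _ (@ltr01 R))). Qed.

Let degenerate := (exists s, bmo_norm (b s) = 0) \/ (exists i, \forall x \ae mu, f i x = 0%R).

Let Tf0 : degenerate -> \forall x \ae mu, (EFin \o Tf) x = 0.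
Proof. by move=> /(iter_commutator_eq0 mb sd fa); apply: filterS => x /= ->. Qed.

Let beta0 : ~ degenerate -> forall s, (0 < beta s)%R.
Proof.
move=> nz s; rewrite -lte_fin -bE lt_neqAle bmo_norm_ge0 andbT.
by apply/eqP => /esym bs; apply: nz; left; exists s.
Qed.

Let fn0 : ~ degenerate -> forall i, ~ (\forall x \ae mu, (EFin \o f i) x = 0).
Proof. by move=> nz i fi; apply: nz; right; exists i; apply: filterS fi => x /= []. Qed.

Let HLmax_ne0 : ~ degenerate -> forall i, ~ (\forall x \ae mu, HLmax (EFin \o f i) x = 0).
Proof. by move=> nz i; apply: (pos_not_ae0 n0) => x; apply: (HLmax_gt0 x (mf i)); exact: fn0. Qed.

Let multimax_ne0 : ~ degenerate -> ~ (\forall x \ae mu, multimax (fun i => EFin \o f i) x = 0).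
Proof. by move=> nz; apply: (pos_not_ae0 n0) => x; apply: (multimax_gt0 x n0 mf); exact: fn0. Qed.

(** In the degenerate case the left-hand side is zero, and an infinite right-hand side needs no
    proof. Otherwise all factors are positive, so finiteness of the product forces finiteness of
    each one, and the bound with real constants applies. *)
Lemma commutator_estimate1 : (forall i, morrey (Xs i) (us i) (EFin \o f i) < +oo) ->
  morrey X u (EFin \o Tf) <=
  (sc + 1)%:E * (\prod_(s < l) bmo_norm (b s)) * opB ^+ (l + 2) *
  mopnorm (fun i => morrey (Xs i) (us i)) (morrey X u) (@multimax R n m) *
  \prod_(i < m) (opnorm (morrey (Xs i) (us i)) (morrey (Xs i) (us i)) (@HLmax R n) *
                  morrey (Xs i) (us i) (EFin \o f i)).
Proof.
(* The summand [1] keeps the constant positive, so that an infinite operator norm makes the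
   right-hand side infinite instead of [0 * oo = 0]. *)
move=> fM; have K0 : (0 < sc + 1)%R by rewrite ltr_wpDl.
pose N i := morrey (Xs i) (us i) (EFin \o f i).
pose op i := opnorm (morrey (Xs i) (us i)) (morrey (Xs i) (us i)) (@HLmax R n).
have op0 i : 0 <= op i := opnorm_HLmax_ge0 (hMs i) (hMs i).
have N0 i : 0 <= N i := morrey_ge0 (bXs i) (us0 i) (mf i).
set mop := mopnorm _ _ _.
have mop0 : 0 <= mop := mopnorm_multimax_ge0 hMs hM.
have [z|nz] := pselect degenerate.
  apply: (@le_trans _ _ 0); first exact: (morrey_ae_eq0 u bX (Lmeas_fin mT) (Tf0 z)).
  apply: mule_ge0; last by apply: prode_ge0 => i _; exact: (mule_ge0 (op0 i) (N0 i)).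
  rewrite !mule_ge0 ?expe_ge0 ?(ltW opB0) ?lee_fin ?(ltW K0)//.
  by apply: prode_ge0 => s _; exact: bmo_norm_ge0.
have Npos i : 0 < N i := morrey_gt0 (bXs i) (us0 i) (mf i) (@fn0 nz i).
pose nu i := fine (N i).
have NE i : N i = (nu i)%:E by rewrite /nu fineK// ge0_fin_numE ?N0//; exact: fM.
have nu0 i : (0 < nu i)%R by rewrite -lte_fin -NE.
have Nle i : N i <= (nu i)%:E by rewrite NE.
have Hle i : morrey (Xs i) (us i) (HLmax (EFin \o f i)) <= op i * N i.
  by rewrite NE; exact: (opnorm_HLmax (hMs i) (hMs i) (nu0 i) (mf i) (Nle i)).
have oppos i : 0 < op i.
  rewrite lt_neqAle op0 andbT; apply/eqP => /esym op00; have := Hle i; rewrite op00 mul0e leNgt => /negP; apply.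
  exact: (morrey_gt0 (bXs i) (us0 i) (mM i) (@HLmax_ne0 nz i)).
have moppos : 0 < mop.
  rewrite lt_neqAle mop0 andbT; apply/eqP => /esym mop00.
  have := mopnorm_multimax hMs hM nu0 mf Nle; rewrite -/mop mop00 mul0e leNgt => /negP; apply.
  exact: (morrey_gt0 bX u0 (measurable_multimax _) (multimax_ne0 nz)).
have Ppos i : 0 < op i * N i by rewrite mule_gt0.
have B0 : (0 < \prod_(s < l) beta s)%R by rewrite prodr_gt0// => s _; exact: beta0.
rewrite (eq_bigr (fun s => (beta s)%:E))// prodEFin -EFinM.
set RHS := (X in _ <= X); have [Rfin|] := ltP RHS +oo; last by apply: le_trans; exact: leey.
have KB0 : 0 < ((sc + 1) * \prod_(s < l) beta s)%:E by rewrite lte_fin mulr_gt0.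
have opBk k : 0 < opB ^+ k by elim: k => [|k IH]; rewrite ?expe0 ?lte01// expeS mule_gt0.
have PP : 0 < \prod_(i < m) (op i * N i) by apply: prode_gt0 => i _.
have KBo := mule_gt0 KB0 (opBk (l + 2)%N).
have [Lfin Pfin] := mule_lty_fin (mule_gt0 KBo moppos) PP Rfin.
rewrite ge0_fin_numE ?mule_ge0 ?ltW// in Lfin.
have [opBfin mopfin] := mule_lty_fin KBo moppos Lfin.
rewrite ge0_fin_numE ?mule_ge0 ?ltW// in opBfin.
have [_] := mule_lty_fin KB0 (opBk _) opBfin.
rewrite addnS expeS => H; rewrite ge0_fin_numE ?mule_ge0 ?ltW// in H.
have [afin _] := mule_lty_fin opB0 (opBk _) H.
pose a := fine opB; have aM : opB = a%:E by rewrite fineK.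
pose mu' := fine mop; have mE : mop = mu'%:E by rewrite fineK.
have mu0 : (0 < mu')%R by rewrite -lte_fin -mE.
pose q i := fine (op i * N i).
have qE i : op i * N i = (q i)%:E by rewrite fineK//; exact: (prode_lty_fin i Ppos Pfin).
have q0 i : (0 < q i)%R by rewrite -lte_fin -qE.
have Q0 : (0 < \prod_(i < m) q i)%R by apply: prodr_gt0 => i _; exact: q0.
have MMle : morrey X u (multimax (fun i => HLmax (EFin \o f i))) <= (mu' * \prod_(i < m) q i)%:E.
  rewrite EFinM -mE; apply: (mopnorm_multimax hMs hM q0 mM) => i; rewrite -qE; exact: Hle.
have W0 : (0 <= mu' * \prod_(i < m) q i)%R by rewrite ltW// mulr_gt0.
have ble s : bmo_norm (b s) <= (beta s)%:E by rewrite bE.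
apply: le_trans (commutator_morrey_le n0 bX u0 hT eta01 sd fd fa bloc ble (beta0 nz) aM W0 MMle) _.
have PE : \prod_(i < m) (op i * N i) = (\prod_(i < m) q i)%:E.
  by rewrite -prodEFin; apply: eq_bigr => i _; exact: qE.
rewrite [RHS](_ : _ = ((sc + 1) * (\prod_(s < l) beta s) * a ^+ (l + 2) * mu' * \prod_(i < m) q i)%:E); last first.
  by rewrite /RHS [X in _ * X]PE aM mE -EFin_expe -!EFinM.
rewrite lee_fin.
have a0 : (0 <= a ^+ (l + 2))%R by rewrite exprn_ge0// -lee_fin -aM ltW.
have le1 (c B M Q A : R) : (0 <= B -> 0 <= M -> 0 <= Q -> 0 <= A ->
    c * B * (M * Q) * A <= (c + 1) * B * A * M * Q)%R.
  move=> ? ? ? ?; have -> : ((c + 1) * B * A * M * Q = c * B * (M * Q) * A + B * A * M * Q)%R by ring.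
  by rewrite lerDl !mulr_ge0.
by apply: le1 => //; exact: ltW.
Qed.

Variable Kc : 'I_m -> R.
Hypotheses (Kc0 : forall i, (0 < Kc i)%R) (p1 : (1 < p)%R).
Hypothesis HKc : forall i (h : E -> \bar R), Lmeas h ->
  morrey (Xs i) (us i) (fun x => `|h x| `^ p) < +oo ->
  morrey (Xs i) (us i) (fun x => HLmax h x `^ p) <= (Kc i)%:E * morrey (Xs i) (us i) (fun x => `|h x| `^ p).
Hypothesis hws : forall i, weight0 (fpow (Xs i) p) (fun x r => powR (us i x r) p^-1).
Local Notation e := (p * l%:R + Num.max 2 p)%R.

(* The constant may depend on [X] and [u], hence on the operator norm of the maximal
   operator on blocks: Rubio de Francia extrapolation with an A_1 weight of constant
   [2 opB] gives the bound [2 transfer_const (2 opB) ...], from which the power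
   of [opB] in the theorem is divided out. The summand [1] matters only when the
   right-hand side is infinite. *)
Definition power_const : R :=
  (2 * @transfer_const R n (2 * fine opB) p (l + 2) * (sc `^ p * \prod_(i < m) Kc i) / (fine opB) `^ e + 1)%R.

(** The maximal functions of the [f_i] are measured in the Morrey spaces over [X_i^p] through [HKc];
    the constants [Kc] are collected in [power_const], and the rest follows the pattern of the first
    estimate. *)
Lemma commutator_estimate2 : (forall i, morrey (Xs i) (us i) (fun x => (powR `|f i x| p)%:E) < +oo) ->
  morrey X u (fun x => (powR `|Tf x| p)%:E) <=
  power_const%:E * poweR (\prod_(s < l) bmo_norm (b s)) p * poweR opB e *
  poweR (mopnorm (fun i => morrey (fpow (Xs i) p) (fun x r => powR (us i x r) p^-1))
           (morrey (fpow X p) (fun x r => powR (u x r) p^-1)) (@multimax R n m)) p *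
  \prod_(i < m) morrey (Xs i) (us i) (fun x => (powR `|f i x| p)%:E).
Proof.
move=> fM.
pose Y i := morrey (fpow (Xs i) p) (fun x r => powR (us i x r) p^-1).
pose Z := morrey (fpow X p) (fun x r => powR (u x r) p^-1).
have hY i : homog_norm (Y i) := homog_morrey_fpow (bXs i) p0 (us0 i).
have hZ : homog_norm Z := homog_morrey_fpow bX p0 u0.
pose P i := morrey (Xs i) (us i) (fun x => (powR `|f i x| p)%:E).
have mfp i : Lmeas (fun x => (powR `|f i x| p)%:E) := Lmeas_poweR p (Lmeas_abse (mf i)).
have mTp : Lmeas (fun x => (powR `|Tf x| p)%:E) := Lmeas_poweR p (Lmeas_abse (Lmeas_fin mT)).
have P0 i : 0 <= P i := morrey_ge0 (bXs i) (us0 i) (mfp i).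
set mop := mopnorm _ _ _.
have mop0 : 0 <= mop := mopnorm_multimax_ge0 hY hZ.
have e0 : (0 < e)%R by rewrite ltr_wpDl ?mulr_ge0 ?(ltW p0)// lt_max ltr0n.
have Kp0 : (0 <= \prod_(i < m) Kc i)%R by rewrite prodr_ge0// => i _; exact: ltW.
have tc0 : (0 <= 2 * @transfer_const R n (2 * fine opB) p (l + 2) * (sc `^ p * \prod_(i < m) Kc i))%R.
  by apply: mulr_ge0; [rewrite mulr_ge0// transfer_const_ge0// mulr_ge0// fine_ge0// ltW|rewrite mulr_ge0 ?powR_ge0].
have K0 : (0 < power_const)%R by rewrite ltr_wpDl// divr_ge0 ?powR_ge0.
have [z|nz] := pselect degenerate.
  apply: (@le_trans _ _ 0).
    apply: (morrey_ae_eq0 u bX mTp); apply: filterS (Tf0 z) => x /= [] ->.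
    by rewrite normr0 powR0 ?gt_eqF.
  apply: mule_ge0; last by apply: prode_ge0 => i _; exact: P0.
  by rewrite !mule_ge0 ?poweR_ge0 ?lee_fin ?(ltW K0).
have Ppos i : 0 < P i.
  apply: (morrey_gt0 (bXs i) (us0 i) (mfp i)) => z; apply: (@fn0 nz i).
  by apply: filterS z => x /= [] /powR_eq0_eq0 /normr0_eq0 ->.
pose pi' i := fine (P i).
have PE i : P i = (pi' i)%:E by rewrite /pi' fineK// ge0_fin_numE ?P0//; exact: fM.
have pi0 i : (0 < pi' i)%R by rewrite -lte_fin -PE.
have pV0 : (0 <= p^-1)%R by rewrite invr_ge0 ltW.
have Nle i : Y i (EFin \o f i) <= (pi' i `^ p^-1)%:E.
  rewrite /Y (morrey_fpowE (bXs i) p0 (us0 i) (mf i)) -poweR_EFin; apply: lee_poweR => //; first exact: P0.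
  by rewrite -PE.
have nu0 i : (0 < pi' i `^ p^-1)%R by rewrite powR_gt0.
(* A bound for [HLmax f_i] in the Morrey space over [X_i^p]; its power [p] is [Kc i] times the
   Morrey norm of [|f_i|^p], and the product of these powers enters [W]. *)
pose q i := ((Kc i * pi' i) `^ p^-1)%R.
have q0 i : (0 < q i)%R by rewrite powR_gt0// mulr_gt0.
have Hle i : Y i (HLmax (EFin \o f i)) <= (q i)%:E.
  rewrite /Y (morrey_fpowE (bXs i) p0 (us0 i) (mM i)) -poweR_EFin.
  have -> : (fun x => `|HLmax (EFin \o f i) x| `^ p) = (fun x => HLmax (EFin \o f i) x `^ p).
    by apply/funext => x; rewrite gee0_abs// HLmax_ge0.
  apply: lee_poweR => //; first exact: (morrey_ge0 (bXs i) (us0 i) (Lmeas_poweR p (mM i))).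
  by rewrite EFinM -PE; apply: (HKc (mf i)); exact: fM.
have moppos : 0 < mop.
  rewrite lt_neqAle mop0 andbT; apply/eqP => /esym mop00.
  have := mopnorm_multimax hY hZ nu0 mf Nle; rewrite -/mop mop00 mul0e leNgt => /negP; apply.
  rewrite /Z (morrey_fpowE bX p0 u0 (measurable_multimax _)) poweR_gt0//.
  apply: (morrey_gt0 bX u0 (Lmeas_poweR p (Lmeas_abse (measurable_multimax _)))); apply: (pos_not_ae0 n0) => x.
  have mmx : 0 < multimax (fun i => EFin \o f i) x by apply: (multimax_gt0 x n0 mf) => i; exact: fn0.
  by rewrite [X in X `^ p](gee0_abs (ltW mmx)) poweR_gt0.
have B0 : (0 < \prod_(s < l) beta s)%R by rewrite prodr_gt0// => s _; exact: beta0.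
rewrite (eq_bigr (fun s => (beta s)%:E))// prodEFin poweR_EFin -EFinM.
set RHS := (X in _ <= X); have [Rfin|] := ltP RHS +oo; last by apply: le_trans; exact: leey.
have KB0 : 0 < (power_const * (\prod_(s < l) beta s) `^ p)%:E by rewrite lte_fin mulr_gt0 ?powR_gt0.
have opBe : 0 < opB `^ e by rewrite poweR_gt0.
have mope : 0 < mop `^ p by rewrite poweR_gt0.
have PP : 0 < \prod_(i < m) P i by apply: prode_gt0 => i _.
have KBo := mule_gt0 KB0 opBe.
have [Lfin _] := mule_lty_fin (mule_gt0 KBo mope) PP Rfin.
rewrite ge0_fin_numE ?mule_ge0 ?ltW// in Lfin.
have [opBfin mopfin] := mule_lty_fin KBo mope Lfin.
rewrite ge0_fin_numE ?mule_ge0 ?ltW// in opBfin.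
have [_ efin] := mule_lty_fin KB0 opBe opBfin.
have pfin (x : \bar R) r : (0 < r)%R -> 0 < x -> x `^ r \is a fin_num -> x \is a fin_num.
  move=> r0 x0; rewrite [_ \is a fin_num -> x \is a fin_num](_ : _ = (x `^ r \is a fin_num -> x < +oo)); last first.
    by rewrite -ge0_fin_numE// ltW.
  by case: x x0 => // [x _ _|_]; rewrite ?ltry// poweRyr ?gt_eqF.
pose a := fine opB; have aM : opB = a%:E by rewrite fineK//; exact: pfin efin.
have a0 : (0 < a)%R by rewrite -lte_fin -aM.
pose mu' := fine mop; have mE : mop = mu'%:E by rewrite fineK//; exact: pfin mopfin.
have mu0 : (0 < mu')%R by rewrite -lte_fin -mE.
have Q0 : (0 < \prod_(i < m) q i)%R by apply: prodr_gt0 => i _; exact: q0.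
pose W := (mu' `^ p * (\prod_(i < m) Kc i * \prod_(i < m) pi' i))%R.
have WE : W = ((mu' * \prod_(i < m) q i) `^ p)%R.
  rewrite powRM ?(ltW mu0) ?(ltW Q0)// powR_prod => [|i]; last exact: ltW.
  rewrite /W -big_split/=; congr (_ * _)%R; apply: eq_bigr => i _.
  by rewrite /q -powRrM mulVf ?gt_eqF// powRr1// ltW// mulr_gt0.
have W0 : (0 <= W)%R by rewrite WE powR_ge0.
have MMle : morrey X u (fun x => multimax (fun i => HLmax (EFin \o f i)) x `^ p) <= W%:E.
  have -> : (fun x => multimax (fun i => HLmax (EFin \o f i)) x `^ p) =
      (fun x => `|multimax (fun i => HLmax (EFin \o f i)) x| `^ p).
    by apply/funext => x; rewrite gee0_abs// multimax_ge0.
  rewrite -(poweR_morrey bX p0 u0 (measurable_multimax _)) WE -poweR_EFin.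
  have [_ Z0 _ _] := hZ.
  apply: lee_poweR; [exact: ltW|exact: (Z0 _ (measurable_multimax _))|].
  by rewrite EFinM -mE; exact: (mopnorm_multimax hY hZ q0 mM Hle).
have ble s : bmo_norm (b s) <= (beta s)%:E by rewrite bE.
apply: le_trans (commutator_morrey_power_le n0 bX u0 p0 hw hT eta01 sd fd fa bloc ble (beta0 nz) aM p1 a0 W0 MMle) _.
have PPE : \prod_(i < m) P i = (\prod_(i < m) pi' i)%:E.
  by rewrite -prodEFin; apply: eq_bigr => i _; exact: PE.
rewrite [RHS](_ : _ = (power_const * (\prod_(s < l) beta s) `^ p * a `^ e * mu' `^ p * \prod_(i < m) pi' i)%:E); last first.
  by rewrite /RHS [X in _ * X]PPE aM mE !poweR_EFin -!EFinM.
rewrite lee_fin powRM ?sc0 ?(ltW B0)// /power_const -/a /W.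
have ae0 : (0 < a `^ e)%R by rewrite powR_gt0.
have le1 (t c K B M Q A : R) : (0 <= B -> 0 <= M -> 0 <= Q -> 0 < A ->
    2 * t * (c * B * (M * (K * Q))) <= (2 * t * (c * K) / A + 1) * B * A * M * Q)%R.
  move=> ? ? ? A0; have A1 : (A != 0)%R by rewrite gt_eqF.
  have -> : ((2 * t * (c * K) / A + 1) * B * A * M * Q =
      2 * t * (c * B * (M * (K * Q))) + B * A * M * Q)%R by field.
  by rewrite lerDl !mulr_ge0// ltW.
by apply: le1 => //; rewrite ?powR_ge0// prodr_ge0// => i _; exact: ltW.
Qed.

End commutator_estimates.

Theorem theorem1p2 (R : realType) (n m l : nat) (hn : (0 < n)%N)
    (hl : (1 <= l)%N) (lm : (l <= m)%N)
    (X : fnorm R n) (Xs : 'I_m -> fnorm R n)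
    (hX : banach_function_space X)
    (hXs : forall i, banach_function_space (Xs i))
    (hchi : exists C : R, forall (x : Rn R n) (r : R), (0 < r)%R ->
      X (chi (eball x r)) <= C%:E * \prod_(i < m) Xs i (chi (eball x r)))
    (p : R) (hp : (1 <= p)%R)
    (hX' : HLbounded (assoc X))
    (hXp' : forall i, HLbounded (assoc (fpow (Xs i) p)))
    (hmax : multimax_bounded (fun i => fpow (Xs i) p) (fpow X p))
    (us : 'I_m -> Rn R n -> R -> R) (u : Rn R n -> R -> R)
    (hu_def : forall x r, u x r = (\prod_(i < m) us i x r)%R)
    (hus_gt0 : forall i x r, (0 < r)%R -> (0 < us i x r)%R)
    (hus : forall i,
      weight0 (fpow (Xs i) p) (fun x r => powR (us i x r) p^-1))
    (hu : weight0 (fpow X p) (fun x r => powR (u x r) p^-1))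
    (dom : 'I_m -> set (Rn R n -> R)) (T : mop R n m)
    (hT : multilinear_operator dom T)
    (C eta : R) (heta : (0 < eta < 1)%R) :
  (p = 1%R -> (forall i, HLbounded (Xs i)) ->
    exists K : R, forall b : 'I_l -> Rn R n -> R,
      (forall s, BMO (b s)) ->
      sparse_domination lm b dom T C eta ->
      forall f : 'I_m -> Rn R n -> R,
        iter_commutator_dom lm b dom f ->
        approximable lm b T f ->
        (forall i, mem_space (morrey (Xs i) (us i)) (EFin \o f i)) ->
        morrey X u (EFin \o iter_commutator lm b T f) <=
          K%:E * (\prod_(s < l) bmo_norm (b s)) *
          opnorm (block_norm (assoc X) u) (block_norm (assoc X) u) (@HLmax R n)
            ^+ (l + 2) *
          mopnorm (fun i => morrey (Xs i) (us i)) (morrey X u)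
            (@multimax R n m) *
          \prod_(i < m)
            (opnorm (morrey (Xs i) (us i)) (morrey (Xs i) (us i)) (@HLmax R n) *
             morrey (Xs i) (us i) (EFin \o f i))) /\
  ((1 < p)%R -> (forall i, HLbounded (assoc (Xs i))) ->
    exists K : R, forall b : 'I_l -> Rn R n -> R,
      (forall s, BMO (b s)) ->
      sparse_domination lm b dom T C eta ->
      forall f : 'I_m -> Rn R n -> R,
        iter_commutator_dom lm b dom f ->
        approximable lm b T f ->
        (forall i, mem_space (morrey (Xs i) (us i))
                     (fun x => (powR `|f i x| p)%:E)) ->
        morrey X u (fun x => (powR `|iter_commutator lm b T f x| p)%:E) <=
          K%:E * poweR (\prod_(s < l) bmo_norm (b s)) p *
          poweR (opnorm (block_norm (assoc X) u) (block_norm (assoc X) u)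
                   (@HLmax R n))
            (p * l%:R + Num.max 2 p)%R *
          poweR (mopnorm
                   (fun i => morrey (fpow (Xs i) p)
                               (fun x r => powR (us i x r) p^-1))
                   (morrey (fpow X p) (fun x r => powR (u x r) p^-1))
                   (@multimax R n m)) p *
          \prod_(i < m)
            morrey (Xs i) (us i) (fun x => (powR `|f i x| p)%:E)).
Proof.
have us0 i x r : (0 < r)%R -> (0 < us i x r)%R := hus_gt0 i x r.
have u0 x r : (0 < r)%R -> (0 < u x r)%R.
  by move=> r0; rewrite hu_def; apply: prodr_gt0 => i _; exact: us0.
have p0 : (0 < p)%R by exact: lt_le_trans hp.
split=> [p1 _|p1 MX'].
  exists (@sparse_const R n m l C eta + 1)%R => b hb sd f fd fa fM.
  by apply: (commutator_estimate1 hn hX hXs u0 us0 p0 hu hT heta hb sd fd fa) => i; case: (fM i).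
(* The dilation exponent for the splitting in [HLmax_morrey]; [2 n < 2^(2 n)] supplies it. *)
have [k kn] : exists k, (2 * n%:R <= 2 ^+ k :> R)%R.
  by exists (2 * n)%N; rewrite -natrM -natrX ler_nat ltnW// ltn_expl.
(* The bounds for [HLmax] on the Morrey spaces are fixed before [b] and [f], so that the final
   constant is independent of them. *)
have /choice[Kc HKc] : forall i, exists K : R, (0 < K)%R /\ forall h : Rn R n -> \bar R, Lmeas h ->
    morrey (Xs i) (us i) (fun x => `|h x| `^ p) < +oo ->
    morrey (Xs i) (us i) (fun x => HLmax h x `^ p) <= K%:E * morrey (Xs i) (us i) (fun x => `|h x| `^ p).
  move=> i; have [A A0 HA] := HLmax_pnorm (hXs i) p1 (MX' i).
  by have [K K0 HK] := HLmax_morrey hn (hXs i) p1 (us0 i) (hus i) A0 HA kn; exists K.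
exists (@power_const R n m l X u p C eta Kc) => b hb sd f fd fa fM.
apply: (commutator_estimate2 hn hX hXs u0 us0 p0 hu hT heta hb sd fd fa (fun i => (HKc i).1) p1 (fun i => (HKc i).2)) => i.
by case: (fM i).
Qed.
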